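(* Let $\alpha>-1$, let $g\in\mathcal{B}_0$, and consider $I_g$ acting on $\mathcal{A}^2_\alpha$. If $\eta=(\eta(n))_{n\geq1}$ is a nonincreasing sequence of positive numbers such that $\eta(2n)\asymp\eta(n)$, then $$s_n^2(I_g)\asymp\eta(n)\iff a_n(m_g)\asymp\eta(n).$$
   Context: For sequences, $A_n\asymp B_n$ means that there are constants $c,C>0$ independent of $n$ with $cB_n\leq A_n\leq CB_n$ for all $n\geq 1$. $\mathbb{D}$ is the open unit disc, $\mathbb{T}$ the unit circle, and $m$ is normalized Lebesgue (area) measure on $\mathbb{D}$. For $\alpha>-1$, the weighted Bergman space $\mathcal{A}^2_\alpha$ is the space of analytic functions $f$ on $\mathbb{D}$ with $\|f\|_\alpha^2=(\alpha+1)\int_{\mathbb{D}}|f(z)|^2(1-|z|^2)^\alpha\,dm(z)<\infty$. For $g$ analytic on $\mathbb{D}$, the integration operator is $I_gf(z)=\int_0^z f(\zeta)g'(\zeta)\,d\zeta$. The little Bloch space $\mathcal{B}_0$ is the set of analytic $g$ on $\mathbb{D}$ with $\lim_{|z|\to1}(1-|z|^2)|g'(z)|=0$; for such $g$ the operator $I_g$ is compact on $\mathcal{A}^2_\alpha$. The singular values of a compact operator $T$ are $s_n(T)=\inf\{\|T-R\|:\operatorname{rank}R<n\}$, $n\geq1$. For an arc $I\subset\mathbb{T}$ of length $|I|$, $R(I)=\{z\in\mathbb{D}:|I|/4\pi<1-|z|\leq|I|/2\pi,\ z/|z|\in I\}$. The dyadic arcs are $I_{n,k}=\{e^{i\theta}:2\pi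 k/2^n\leq\theta<2\pi(k+1)/2^n\}$, $n\geq1$, $1\leq k\leq2^n$. For $g$ analytic on $\mathbb{D}$ let $dm_g(z)=|g'(z)|^2(1-|z|^2)^2dm(z)$. For $g\in\mathcal{B}_0$ one has $\sup_{1\leq k\leq 2^n}m_g(R(I_{n,k}))/m(R(I_{n,k}))\to0$ as $n\to\infty$, and $(a_n(m_g))_{n\geq1}$ denotes the nonincreasing rearrangement of the family $\left(m_g(R(I_{n,k}))/m(R(I_{n,k}))\right)_{n,k}$, i.e. $a_n(m_g)=m_g(R(I_n))/m(R(I_n))$ where $(I_n)_{n\geq1}$ is an enumeration of the dyadic arcs making this sequence nonincreasing. *)

(* Defs.v *)
From HB Require Import structures.
From mathcomp Require Import all_boot all_order all_algebra.
From mathcomp Require Export complex.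
From mathcomp Require Import all_classical all_reals all_analysis.
Import Order.TTheory GRing.Theory Num.Theory.
Import numFieldNormedType.Exports.

Set Implicit Arguments.
Unset Strict Implicit.
Unset Printing Implicit Defensive.

Local Open Scope classical_set_scope.
Local Open Scope ring_scope.
Local Open Scope complex_scope.

(* Real-valued modulus (`|z| would be an element of R[i]). *)
Notation modulus := ComplexField.Normc.normc.

(* The topology of R[i] induced by its norm. *)
HB.instance Definition _ (R : rcfType) := GRing.ComAlgebra.copy R[i] (R[i])^o.
HB.instance Definition _ (R : rcfType) := Vector.copy R[i] (R[i])^o.
HB.instance Definition _ (R : rcfType) := NormedModule.copy R[i] (R[i])^o.

Section Disc.
Context {R : realType}.
Local Notation C := R[i].

Definition disc : set C := [set z | modulus z < 1].

Definition analytic_on_disc (f : C -> C) : Prop :=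
  forall z0, disc z0 -> exists (r : R) (c : nat -> C), 0 < r /\
    forall z : C, modulus (z - z0) < r ->
      [series c k * (z - z0) ^+ k]_k @ \oo --> f z.

Definition little_bloch (g : C -> C) : Prop :=
  analytic_on_disc g /\
  forall eps : R, 0 < eps -> \forall r \near (1 : R)^'-, forall z : C,
    modulus z = r -> (1 - modulus z ^+ 2) * modulus (derive1 g z) < eps.

(* R[i] carries no measurable structure: subsets of the plane are measured
   through the identification of (x, y) with x + iy. *)
Definition to_complex (p : measurableTypeR R * measurableTypeR R) : C :=
  (p.1 : R) +i* (p.2 : R).

Lemma invpi_ge0 : 0 <= (pi : R)^-1.
Proof. by rewrite invr_ge0 pi_ge0. Qed.

(* Lebesgue measure on the plane, normalized so that the disc has mass 1. *)
Definition plane_measure :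
    {measure set (measurableTypeR R * measurableTypeR R) -> \bar R} :=
  mscale (NngNum invpi_ge0)
    ((@lebesgue_measure R) \x (@lebesgue_measure R))%E.

Definition area (A : set C) : \bar R := plane_measure (to_complex @^-1` A).

Definition area_integral (A : set C) (F : C -> R) : \bar R :=
  (\int[plane_measure]_(p in to_complex @^-1` A) (F (to_complex p))%:E)%E.

End Disc.

Section Bergman.
Context {R : realType}.
Local Notation C := R[i].

Definition bergman_norm (alpha : R) (f : C -> C) : \bar R :=
  sqrte ((alpha + 1)%:E *
    area_integral disc
      (fun z => modulus (f z) ^+ 2 * (1 - modulus z ^+ 2) `^ alpha)%R)%E.

(* Functions on the disc are represented by their extension by 0 to C, so that
   equality in the Bergman space is equality of functions C -> C. *)
Definition bergman (alpha : R) : set (C -> C) :=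
  [set f | [/\ analytic_on_disc f, (bergman_norm alpha f < +oo)%E
             & forall z, ~ disc z -> f z = 0]].

Definition complex_Rintegral (a b : R) (h : R -> C) : C :=
  (\int[lebesgue_measure]_(t in `[a, b]) complex.Re (h t))
  +i* (\int[lebesgue_measure]_(t in `[a, b]) complex.Im (h t)).

(* Line integral along the segment from 0 to z, parametrized by t |-> t z. *)
Definition segment_integral (h : C -> C) (z : C) : C :=
  complex_Rintegral 0 1 (fun t => h (t%:C * z) * z).

Definition integration_operator (g f : C -> C) : C -> C := fun z =>
  if modulus z < 1
  then segment_integral (fun zeta => f zeta * derive1 g zeta) z
  else 0.

Definition operator_norm (alpha : R) (T : (C -> C) -> (C -> C)) : \bar R :=
  ereal_sup [set bergman_norm alpha (T f) |
    f in [set f | bergman alpha f /\ (bergman_norm alpha f <= 1)%E]].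

Definition bounded_operator (alpha : R) (T : (C -> C) -> (C -> C)) : Prop :=
  [/\ forall f, bergman alpha f -> bergman alpha (T f),
      forall (c : C) f h, bergman alpha f -> bergman alpha h ->
        T (fun z => c * f z + h z) = (fun z => c * T f z + T h z)
    & (operator_norm alpha T < +oo)%E].

(* The range of T has a basis with k elements. *)
Definition has_rank (alpha : R) (T : (C -> C) -> (C -> C)) (k : nat) : Prop :=
  exists e : 'I_k -> (C -> C),
    [/\ forall i, (T @` bergman alpha) (e i),
        forall c : 'I_k -> C,
          (forall z, \sum_(i < k) c i * e i z = 0) -> forall i, c i = 0
      & forall f, bergman alpha f -> exists c : 'I_k -> C,
          forall z, T f z = \sum_(i < k) c i * e i z].

(* For n >= 1. *)
Definition singular_value (alpha : R) (T : (C -> C) -> (C -> C)) (n : nat) :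
    \bar R :=
  ereal_inf [set operator_norm alpha (fun f z => T f z - S f z) |
    S in [set S | bounded_operator alpha S /\
                  exists2 k, (k < n)%N & has_rank alpha S k]].

End Bergman.

Section Dyadic.
Context {R : realType}.
Local Notation C := R[i].

Definition arc (a b : R) : set C :=
  [set cos t +i* sin t | t in [set t | a <= t < b]].

(* R(I) for I = arc a b, whose length is b - a (0 < b - a <= 2 pi). *)
Definition arc_box (a b : R) : set C :=
  [set z | [/\ disc z,
               (b - a) / (4 * pi) < 1 - modulus z <= (b - a) / (2 * pi)
             & arc a b (z / (modulus z)%:C)]].

Definition dyadic_indices : set (nat * nat) :=
  [set p | (1 <= p.1)%N /\ (1 <= p.2 <= 2 ^ p.1)%N].

Definition dyadic_box (p : nat * nat) : set C :=
  arc_box (2 * pi * p.2%:R / 2 ^+ p.1) (2 * pi * p.2.+1%:R / 2 ^+ p.1).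

Definition bloch_measure (g : C -> C) (A : set C) : \bar R :=
  area_integral A
    (fun z => modulus (derive1 g z) ^+ 2 * (1 - modulus z ^+ 2) ^+ 2).

Definition dyadic_mean (g : C -> C) (p : nat * nat) : \bar R :=
  (bloch_measure g (dyadic_box p) / area (dyadic_box p))%E.

End Dyadic.

Section Sequences.
Context {R : realType}.

(* Sequences are indexed by n >= 1; the value at 0 is irrelevant. *)
Definition asymp (A B : nat -> \bar R) : Prop :=
  exists c d : R, [/\ 0 < c, 0 < d & forall n, (1 <= n)%N ->
    (c%:E * B n <= A n)%E /\ (A n <= d%:E * B n)%E].

Definition nonincreasing_rearrangement (T : Type) (D : set T)
    (u : T -> \bar R) (a : nat -> \bar R) : Prop :=
  exists e : nat -> T,
    [/\ set_bij [set n | (1 <= n)%N] D e,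
        forall n, (1 <= n)%N -> a n = u (e n)
      & forall m n, (1 <= m <= n)%N -> (a n <= a m)%E].

End Sequences.

(* Main.v *)
(* The Littlewood-Paley identity makes [||I_g f||^2] comparable to the integral of
   [|f|^2] against [|g'|^2 (1-|z|^2)^(alpha+2) dm], whose mass on a dyadic box [R(I)]
   is, for [f] of constant modulus there, [m_g(R(I)) / m(R(I))] times that of [|f|^2].

   Upper bound.  If [f] vanishes to order [o I] at the points of a fixed grid in every
   box, Cauchy estimates on discs around these points gain a factor [2 ^ (- o I)].  The
   vanishing is imposed by [O(sum_I (o I))] linear conditions, so a bound
   [a(I) <= B 2 ^ (o I)] on the means gives [s_n^2 <= C0 B] with [n = 1 + M sum_I (o I)].

   Lower bound.  If [c0 m] boxes have means [>= A], the normalized reproducing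
   kernels at suitable points of these boxes satisfy a Bessel inequality, dual to the local
   estimate of [|f|^2] by its mean, and [||I_g f||^2] is at least a multiple of [A] on each
   of them; hence it cannot be small on the whole complement of a subspace of dimension
   [< m], and [s_m^2 >= A / C1].

   Since [eta(2n)] is comparable to [eta(n)], the orders [o(I_j) ~ q log2(N/j) + t],
   whose sum is [O((1 + t) N)], turn the upper bound into
   [s_n^2 <= C0 (D 2^(-t) eta(N) + a_N)] with [n ~ (1 + t) N].  For [t = 0] this bounds
   the singular values by the means; for [t] large it bounds [a_N] below by [eta(N)],
   because [eta(n)] decreases only like [(1 + t)^(-q)]. *)

(* Analytic functions enter only through Taylor series. Angular integration is replaced by averages
   over [N]-th roots of unity: they leave integrals unchanged, since area is rotation invariant, and
   they separate the powers of a polynomial of degree below [N] exactly. Radial integration is the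
   push-forward of area under [|z|^2]. So Parseval and Littlewood-Paley become statements on
   coefficients.

   The linear algebra takes place on polynomials of degree below [N], written as row vectors in the
   orthonormal monomials; the Taylor remainder costs a multiple of [B] because [g] is in the little
   Bloch space, and [N] does not enter the constants.

   Two obstacles shape the estimates. The boxes of scale [n >= 1] miss [0 < |z| < 1/2], so the mass
   there is recovered from the first annulus through the coefficients of [g']. And [m_g] may
   concentrate anywhere inside a box, so the kernel point of the lower bound cannot be fixed
   beforehand: it is found by pigeonhole on a grid. There each box is also divided by its own mean,
   since a multiple of [A] need not bound the means from above. *)
From HB Require Import structures.
Require Import Defs.
From mathcomp Require Import all_boot all_order all_algebra.
From mathcomp Require Import all_classical all_reals all_analysis.
From mathcomp Require Import measurable_realfun ring lra zify.
Import Order.TTheory GRing.Theory Num.Theory.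
Import numFieldNormedType.Exports.
Import complex.ComplexField.
Set Implicit Arguments.
Unset Strict Implicit.
Unset Printing Implicit Defensive.
Local Open Scope classical_set_scope.
Local Open Scope ring_scope.
Local Open Scope complex_scope.

(** * Power series *)

Section Modulus.
Context {R : realType}.
Local Notation C := R[i].
Implicit Types (z w : C) (x : R).

Lemma modulus_ge0 z : 0 <= modulus z.
Proof. by case: z => a b; exact: sqrtr_ge0. Qed.

Lemma modulusM z w : modulus (z * w) = modulus z * modulus w.
Proof. exact: Normc.normcM. Qed.

Lemma modulusN z : modulus (- z) = modulus z.
Proof. exact: normcN. Qed.

Lemma modulus_le_add z w : modulus (z + w) <= modulus z + modulus w.
Proof. exact: le_normcD. Qed.

Lemma modulus0 : modulus (0 : C) = 0. Proof. exact: Normc.normc0. Qed.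
Lemma modulus1 : modulus (1 : C) = 1. Proof. exact: Normc.normc1. Qed.

Lemma modulusX z n : modulus (z ^+ n) = modulus z ^+ n.
Proof. by elim: n => [|n IH]; rewrite ?expr0 ?modulus1// !exprS modulusM IH. Qed.

Lemma modulusV z : modulus z^-1 = (modulus z)^-1.
Proof. exact: Normc.normcV. Qed.

Lemma modulus_distC z w : modulus (z - w) = modulus (w - z).
Proof. by rewrite -opprB modulusN. Qed.

Lemma modulus_eq0 z : (modulus z == 0) = (z == 0).
Proof.
by apply/eqP/eqP => [/Normc.eq0_normc//|->]; rewrite modulus0.
Qed.

Lemma modulus_gt0 z : (0 < modulus z) = (z != 0).
Proof. by rewrite lt_neqAle modulus_ge0 andbT eq_sym modulus_eq0. Qed.

Lemma modulusR x : modulus (x%:C : C) = `|x|.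
Proof. by rewrite /= expr0n addr0 sqrtr_sqr. Qed.

Lemma modulus_nat n : modulus (n%:R : C) = n%:R.
Proof.
have -> : (n%:R : C) = (n%:R : R)%:C by rewrite rmorph_nat.
by rewrite modulusR ger0_norm.
Qed.

Lemma sqr_modulus z : modulus z ^+ 2 = complex.Re z ^+ 2 + complex.Im z ^+ 2.
Proof. by case: z => a b /=; rewrite sqr_sqrtr// addr_ge0// sqr_ge0. Qed.

Lemma modulusJ z : modulus z^* = modulus z.
Proof. by case: z => a b /=; rewrite sqrrN. Qed.

Lemma mulJ_modulus z : z * z^* = (modulus z ^+ 2)%:C.
Proof.
rewrite sqr_modulus; case: z => a b /=; apply/eqP.
by rewrite eq_complex/=; apply/andP; split; apply/eqP; ring.
Qed.

Lemma Re_le_modulus z : `|complex.Re z| <= modulus z.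
Proof.
rewrite -(ler_pXn2r (n := 2))// ?nnegrE ?normr_ge0 ?modulus_ge0//.
by rewrite sqr_modulus -normrX ger0_norm ?sqr_ge0// lerDl sqr_ge0.
Qed.

Lemma Im_le_modulus z : `|complex.Im z| <= modulus z.
Proof.
rewrite -(ler_pXn2r (n := 2))// ?nnegrE ?normr_ge0 ?modulus_ge0//.
by rewrite sqr_modulus -normrX ger0_norm ?sqr_ge0// lerDr sqr_ge0.
Qed.

Lemma modulus_le_ReIm z : modulus z <= `|complex.Re z| + `|complex.Im z|.
Proof.
rewrite -(ler_pXn2r (n := 2))// ?nnegrE ?addr_ge0 ?normr_ge0 ?modulus_ge0//.
rewrite sqr_modulus sqrrD !real_normK ?num_real// -addrA lerD2l lerDr.
by rewrite pmulrn_lge0// mulr_ge0.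
Qed.

Lemma modulus_sum I (r : seq I) (P : pred I) (F : I -> C) :
  modulus (\sum_(i <- r | P i) F i) <= \sum_(i <- r | P i) modulus (F i).
Proof.
elim/big_ind2 : _ => [|x1 x2 y1 y2 h1 h2|//]; first by rewrite modulus0.
by rewrite (le_trans (modulus_le_add _ _))// lerD.
Qed.

Lemma modulus_sub_le z w : modulus z <= modulus w + modulus (z - w).
Proof. by rewrite (le_trans _ (modulus_le_add _ _))// addrC subrK. Qed.

Lemma modulus_distD z w y :
  modulus (z - w) <= modulus (z - y) + modulus (y - w).
Proof. by rewrite (le_trans _ (modulus_le_add _ _))// addrA subrK. Qed.

(** Convergence in [R[i]] as a limit of real numbers, so that the order lemmas over [R] apply;
    [cvcP] relates it to the topology. *)
Definition cvc (u : nat -> C) (l : C) :=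
  (fun n => modulus (l - u n)) @ \oo --> (0 : R).

Lemma cvcP (u : nat -> C) (l : C) : u @ \oo --> l <-> cvc u l.
Proof.
rewrite /cvc.
split=> [/cvgrPdist_lt h|/cvgrPdist_lt h].
  apply/cvgrPdist_lt => e e0.
  have := h e%:C; rewrite ltcR => /(_ e0).
  apply: filterS => n; rewrite normc_def ltcR sub0r normrN.
  by rewrite ger0_norm ?modulus_ge0//; case: (l - u n).
(* The radius is an element of [R[i]]; its positivity forces the imaginary part to vanish. *)
apply/cvgrPdist_lt => -[e e'].
rewrite ltcE/= => /andP[/eqP-> e0].
have := h e e0; apply: filterS => n.
rewrite sub0r normrN ger0_norm ?modulus_ge0// normc_def.
by rewrite (_ : e +i* 0 = e%:C)// ltcR; case: (l - u n).
Qed.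

Lemma cvg_geometric_bound (u : nat -> R) (l M t : R) :
  0 <= t < 1 -> (forall n, `|l - u n| <= M * t ^+ n) ->
  u @ \oo --> l.
Proof.
move=> /andP[t0 t1] h.
have hz : (fun n => M * t ^+ n) @ \oo --> (0 : R).
  rewrite -[X in _ --> X](mulr0 M); apply: cvgMr.
  by apply: cvg_expr; rewrite ger0_norm.
apply/cvgrPdist_lt => e e0.
move/cvgrPdist_lt : hz => /(_ _ e0); apply: filterS => n.
rewrite sub0r normrN => /(le_lt_trans (ler_norm _)).
exact: le_lt_trans (h n).
Qed.

End Modulus.

Section GeometricSeries.
Context {R : realType}.
Local Notation C := R[i].

Lemma sum_geo_le (t : R) m n : 0 <= t < 1 ->
  \sum_(m <= k < n) t ^+ k <= t ^+ m / (1 - t).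
Proof.
move=> /andP[t0 t1]; have d0 : 0 < 1 - t by rewrite subr_gt0.
case: (leqP n m) => [nm|mn].
  by rewrite big_geq// divr_ge0 ?exprn_ge0// ltW.
rewrite ler_pdivlMr// -{1}(add0n m) big_addn mulr_suml.
rewrite (_ : \sum_(0 <= i < n - m) _ =
   t ^+ m * \sum_(0 <= i < n - m) (t ^+ i - t ^+ i.+1)); last first.
  rewrite mulr_sumr; apply: eq_bigr => i _.
  by rewrite exprD exprS; ring.
rewrite -{2}(mulr1 (t ^+ m)) ler_wpM2l ?exprn_ge0//.
rewrite (eq_bigr (fun i => (- t ^+ i.+1) - (- t ^+ i))) => [|i _]; last first.
  by rewrite opprK addrC.
by rewrite telescope_sumr// expr0 opprK addrC gerBl exprn_ge0.
Qed.

Lemma geometric_tail_le (u : nat -> C) (M t : R) m n : 0 <= t < 1 ->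
  (forall n, modulus (u n) <= M * t ^+ n) ->
  modulus (\sum_(m <= k < n) u k) <= M * t ^+ m / (1 - t).
Proof.
move=> t01 h; rewrite (le_trans (modulus_sum _ _ _))//.
rewrite (le_trans (ler_sum _ (fun k _ => h k)))// -mulr_sumr -mulrA.
rewrite ler_wpM2l ?sum_geo_le//.
by have := h 0%N; rewrite expr0 mulr1; exact: le_trans (modulus_ge0 _).
Qed.

Lemma geometric_series_cvg (u : nat -> C) (M t : R) : 0 <= t < 1 ->
  (forall n, modulus (u n) <= M * t ^+ n) ->
  exists l, cvc (fun n => \sum_(k < n) u k) l.
Proof.
move=> t01 h; have [t0 t1] := andP t01.
have M0 : 0 <= M.
  by have := h 0%N; rewrite expr0 mulr1; exact: le_trans (modulus_ge0 _).
have cv (v : nat -> R) : (forall n, `|v n| <= M * t ^+ n) -> cvgn (series v).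
  move=> hv; apply: normed_cvg; apply: (@series_le_cvg _ _ (geometric M t)) => //.
  - by move=> n /=.
  - by move=> n /=; rewrite mulr_ge0// exprn_ge0.
  - by apply: is_cvg_geometric_series; rewrite ger0_norm.
have /cv cRe : forall n, `|complex.Re (u n)| <= M * t ^+ n.
  by move=> n; exact: le_trans (Re_le_modulus _) (h n).
have /cv cIm : forall n, `|complex.Im (u n)| <= M * t ^+ n.
  by move=> n; exact: le_trans (Im_le_modulus _) (h n).
set a := series _ in cRe; set b := series _ in cIm.
exists (limn a +i* limn b); rewrite /cvc.
apply: (@squeeze_cvgr _ _ _ _ (fun=> 0)
  (fun n => `|limn a - a n| + `|limn b - b n|)).
- near=> n; rewrite modulus_ge0/= (le_trans (modulus_le_ReIm _))//.
  rewrite !raddfB/= !raddf_sum/= /a /b /series/= !big_mkord.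
  exact: lexx.
- exact: cvg_cst.
- rewrite -[X in _ --> X](addr0 0); apply: cvgD; apply/norm_cvg0P.
    by rewrite -(subrr (limn a)); apply: cvgB => //; exact: cvg_cst.
  by rewrite -(subrr (limn b)); apply: cvgB => //; exact: cvg_cst.
Unshelve. all: by end_near. Qed.

End GeometricSeries.

Section ComplexLimits.
Context {R : realType}.
Local Notation C := R[i].
Implicit Types (u v : nat -> C) (l k : C).

Lemma cvc_le_lim u l (B : R) N : cvc u l ->
  (forall n, (N <= n)%N -> modulus (u n) <= B) -> modulus l <= B.
Proof.
move=> /cvgrPdist_lt h hB; apply/ler_addgt0Pr => e e0.
have [n _ hn] := h e e0.
have {hn} : modulus (l - u (maxn N n)) < e.
  have := hn (maxn N n) (leq_maxr N n) => /=.
  by rewrite sub0r normrN ger0_norm ?modulus_ge0.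
have := hB _ (leq_maxl N n); have := modulus_sub_le l (u (maxn N n)); lra.
Qed.

Lemma cvc_squeeze u l (b : nat -> R) :
  (forall n, modulus (l - u n) <= b n) -> b @ \oo --> (0 : R) -> cvc u l.
Proof.
move=> h hb; apply: (@squeeze_cvgr _ _ _ _ (fun=> 0) b) => //.
- by near=> n; rewrite modulus_ge0/=.
- exact: cvg_cst.
Unshelve. all: by end_near. Qed.

Lemma cvc_geometric u l (M t : R) : 0 <= t < 1 ->
  (forall n, modulus (l - u n) <= M * t ^+ n) -> cvc u l.
Proof.
move=> t01 h; apply: cvc_squeeze h _.
apply: (cvg_geometric_bound t01 (M := `|M|)) => n.
by rewrite sub0r normrN normrM ler_wpM2l// ger0_norm// exprn_ge0//; case/andP: t01.
Qed.

Lemma cvcD u v l k : cvc u l -> cvc v k -> cvc (fun n => u n + v n) (l + k).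
Proof.
move=> hu hv; apply: (@cvc_squeeze _ _
   (fun n => modulus (l - u n) + modulus (k - v n))) => [n|].
  rewrite (_ : l + k - _ = (l - u n) + (k - v n)) ?modulus_le_add//; ring.
by rewrite -[X in _ --> X](addr0 0); exact: cvgD.
Qed.

Lemma cvcZ (a : C) u l : cvc u l -> cvc (fun n => a * u n) (a * l).
Proof.
move=> hu; apply: (@cvc_squeeze _ _ (fun n => modulus a * modulus (l - u n))).
  by move=> n; rewrite -mulrBr modulusM.
by rewrite -[X in _ --> X](mulr0 (modulus a)); exact: cvgMr.
Qed.

Lemma cvcB u v l k : cvc u l -> cvc v k -> cvc (fun n => u n - v n) (l - k).
Proof.
move=> hu /(cvcZ (-1)) /(cvcD hu); rewrite mulN1r.
by under [fun n => _]eq_fun do rewrite mulN1r.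
Qed.

Lemma cvc_uniq u l k : cvc u l -> cvc u k -> l = k.
Proof.
move=> hl hk; apply/eqP; rewrite -subr_eq0 -modulus_eq0 eq_le modulus_ge0 andbT.
apply: (@cvc_le_lim _ _ _ 0%N (cvcB hl hk)) => n _.
by rewrite subrr modulus0.
Qed.

Lemma cvc_sum I (r : seq I) (U : I -> nat -> C) (L : I -> C) :
  (forall i, cvc (U i) (L i)) ->
  cvc (fun n => \sum_(i <- r) U i n) (\sum_(i <- r) L i).
Proof.
move=> h; elim: r => [|i r IH].
  rewrite big_nil /cvc; under [fun n => _]eq_fun do rewrite big_nil subrr modulus0.
  exact: cvg_cst.
rewrite big_cons; under [fun n => _]eq_fun do rewrite big_cons.
exact: cvcD.
Qed.

Lemma eq_cvc u v l : u =1 v -> cvc u l -> cvc v l.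
Proof. by move=> /funext->. Qed.

End ComplexLimits.

Section PowerSeries.
Context {R : realType}.
Local Notation C := R[i].
Implicit Types (f g : C -> C) (a b z : C) (c d : nat -> C) (r s : R).

Definition psum c n z : C := \sum_(k < n) c k * z ^+ k.

Definition has_pseries f a r c :=
  (forall s, 0 <= s < r -> exists M, forall k, modulus (c k) * s ^+ k <= M) /\
  (forall z, modulus (z - a) < r -> cvc (fun n => psum c n (z - a)) (f z)).

(** Abel's lemma. At [a + s] the partial sums eventually stay within [1] of the limit, so each later
    term, a difference of two of them, has modulus at most [2]; [M0] collects the earlier terms. *)
Lemma has_pseriesP f a r c :
  (forall z, modulus (z - a) < r -> cvc (fun n => psum c n (z - a)) (f z)) ->
  has_pseries f a r c.
Proof.
move=> h; split=> // s /andP[s0 sr].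
have /h/cvgrPdist_lt/(_ 1 ltr01) [N _ hN] : modulus (a + s%:C - a) < r.
  by rewrite addrC addKr modulusR ger0_norm.
pose M0 := \sum_(k < N) modulus (c k) * s ^+ k.
have M00 : 0 <= M0.
  by apply: sumr_ge0 => k _; rewrite mulr_ge0 ?modulus_ge0 ?exprn_ge0.
exists (M0 + 2) => k; have [kN|kN] := ltnP k N.
  rewrite /M0 (bigD1 (Ordinal kN))//= -!addrA lerDl addr_ge0//.
  by apply: sumr_ge0 => i _; rewrite mulr_ge0 ?modulus_ge0 ?exprn_ge0.
have := hN k kN; have /= := hN k.+1 (leqW kN).
rewrite !sub0r !normrN !ger0_norm ?modulus_ge0// (addrC a) addrK /psum big_ord_recr/=.
set S := \sum_(i < k) _; set T := c k * _ => h1 h2.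
have -> : modulus (c k) * s ^+ k = modulus T.
  by rewrite /T modulusM modulusX modulusR ger0_norm.
have -> : T = (f (a + s%:C) - S) - (f (a + s%:C) - (S + T)) by ring.
have := modulus_le_add (f (s%:C + a) - S) (- (f (s%:C + a) - (S + T))).
rewrite modulusN; rewrite (addrC a) in h1 h2 *; lra.
Qed.

Lemma psum_tail_le c (M s : R) z m n : 0 < s -> modulus z < s ->
  (forall k, modulus (c k) * s ^+ k <= M) -> (m <= n)%N ->
  modulus (psum c n z - psum c m z) <=
  M * (modulus z / s) ^+ m / (1 - modulus z / s).
Proof.
move=> s0 zs hM mn.
have -> : psum c n z - psum c m z = \sum_(m <= k < n) c k * z ^+ k.
  rewrite /psum -!(big_mkord xpredT (fun k => c k * z ^+ k)).
  by rewrite (@big_cat_nat _ _ _ m 0 n)//= [LHS]addrC addKr.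
apply: geometric_tail_le.
  by rewrite divr_ge0 ?modulus_ge0 ?(ltW s0)//= ltr_pdivrMr// mul1r.
move=> k; rewrite modulusM modulusX expr_div_n mulrA ler_pdivlMr ?exprn_gt0//.
by rewrite mulrAC ler_wpM2r ?exprn_ge0 ?modulus_ge0.
Qed.

Lemma pseries_tail f a r c (M s : R) z m : has_pseries f a r c ->
  0 < s -> modulus (z - a) < s -> modulus (z - a) < r ->
  (forall k, modulus (c k) * s ^+ k <= M) ->
  modulus (f z - psum c m (z - a)) <=
  M * (modulus (z - a) / s) ^+ m / (1 - modulus (z - a) / s).
Proof.
move=> [_ h] s0 zs /h hz hM.
have hm : cvc (fun=> psum c m (z - a)) (psum c m (z - a)).
  rewrite /cvc; under [fun n => _]eq_fun do rewrite subrr modulus0.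
  exact: cvg_cst.
apply: (cvc_le_lim (N := m) (cvcB hz hm)) => n mn.
exact: psum_tail_le.
Qed.

Lemma has_pseriesW f a r r' c : r' <= r -> has_pseries f a r c ->
  has_pseries f a r' c.
Proof.
move=> rr [h1 h2]; split=> [s /andP[s0 sr]|z zr].
  by apply: h1; rewrite s0 (lt_le_trans sr).
by apply: h2; exact: lt_le_trans zr rr.
Qed.

Lemma eq_has_pseries f g a r c :
  (forall z, modulus (z - a) < r -> f z = g z) ->
  has_pseries f a r c -> has_pseries g a r c.
Proof.
by move=> fg [h1 h2]; split=> // z zr; rewrite -fg//; exact: h2.
Qed.

Lemma has_pseriesB f g a r c d : has_pseries f a r c -> has_pseries g a r d ->
  has_pseries (fun z => f z - g z) a r (fun k => c k - d k).
Proof.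
move=> [_ hf] [_ hg]; apply: has_pseriesP => z zr.
apply: eq_cvc (cvcB (hf z zr) (hg z zr)) => n.
by rewrite /psum -sumrB; apply: eq_bigr => k _; rewrite mulrBl.
Qed.

Lemma has_pseriesZD f g a r c d (x : C) :
  has_pseries f a r c -> has_pseries g a r d ->
  has_pseries (fun z => x * f z + g z) a r (fun k => x * c k + d k).
Proof.
move=> [_ hf] [_ hg]; apply: has_pseriesP => z zr.
apply: eq_cvc (cvcD (cvcZ x (hf z zr)) (hg z zr)) => n.
by rewrite /psum mulr_sumr -big_split; apply: eq_bigr => k _ /=; rewrite mulrDl mulrA.
Qed.

Lemma pseries_at_center f a r c : 0 < r -> has_pseries f a r c -> f a = c 0%N.
Proof.
move=> r0 [_ h]; have := h a; rewrite subrr modulus0 => /(_ r0) ha.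
apply: (cvc_uniq ha); rewrite /cvc.
apply: (cvg_near_cst 0); near=> n.
have n0 : (0 < n)%N by near: n; exact: nbhs_infty_gt.
rewrite /psum -(prednK n0) big_ord_recl big1 => [|i _].
  by rewrite expr0 mulr1 addr0 subrr modulus0.
by rewrite /= exprS mul0r mulr0.
Unshelve. all: by end_near. Qed.

(** When the coefficients below [m] vanish, the tail estimate at a small real [t] reads
    [|c m| t^m <= B t^(m+1)]; letting [t] tend to [0] gives [c m = 0]. *)
Lemma pseries0_coef r c : 0 < r -> has_pseries (fun=> 0) 0 r c ->
  forall k, c k = 0.
Proof.
move=> r0 h; elim/ltn_ind => m IH.
pose s := r / 2; have s0 : 0 < s by rewrite /s; lra.
have sr : s < r by rewrite /s; lra.
have [M hM] := h.1 s (introT andP (conj (ltW s0) sr)).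
have M0 : 0 <= M by rewrite (le_trans _ (hM 0%N))// mulr_ge0 ?modulus_ge0 ?exprn_ge0 ?ltW.
apply/eqP; rewrite -modulus_eq0 eq_le modulus_ge0 andbT.
apply/ler_addgt0Pr => e e0; rewrite add0r.
pose B := 2 * M / s ^+ m.+1.
have B0 : 0 <= B by rewrite !mulr_ge0// invr_ge0 exprn_ge0// ltW.
(* The bound [B] may be [0], hence the denominator [B + 1]. *)
pose t := Num.min (s / 2) (e / (B + 1)).
have t0 : 0 < t by rewrite lt_min !divr_gt0//; lra.
have ts : t <= s / 2 by rewrite ge_min lexx.
have te : t <= e / (B + 1) by rewrite ge_min lexx orbT.
have mt : modulus (t%:C - 0 : C) = t by rewrite subr0 modulusR ger0_norm// ltW.
have := @pseries_tail _ _ _ _ M s t%:C m.+1 h s0.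
rewrite mt => /(_ _ _ hM); rewrite sub0r modulusN subr0.
rewrite /psum big_ord_recr/= big1 ?add0r => [|i _]; last first.
  by rewrite IH ?mul0r// ltn_ord.
rewrite modulusM modulusX modulusR (ger0_norm (ltW t0)) => H.
have {H} := H ltac:(lra) ltac:(lra) => H.
have : modulus (c m) * t ^+ m <= B * t * t ^+ m.
  apply: (le_trans H).
  have -> : B * t * t ^+ m = M * (t / s) ^+ m.+1 * 2.
    by rewrite /B (expr_div_n t s) [t ^+ m.+1]exprS; move: (s ^+ m.+1)^-1 => v; ring.
  apply: ler_wpM2l.
    by rewrite mulr_ge0// exprn_ge0// divr_ge0// ltW.
  have h2 : t / s <= 1 / 2 by rewrite ler_pdivrMr//; lra.
  by rewrite -[leRHS]invrK lef_pV2 ?posrE; lra.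
rewrite ler_pM2r ?exprn_gt0// => /le_trans; apply.
rewrite (le_trans (ler_wpM2l B0 te))// mulrCA ler_piMr ?(ltW e0)//.
by rewrite ler_pdivrMr ?mul1r; lra.
Qed.

Lemma pseries_uniq f g a r r' c d : 0 < r -> 0 < r' ->
  (forall z, modulus (z - a) < r -> modulus (z - a) < r' -> f z = g z) ->
  has_pseries f a r c -> has_pseries g a r' d -> c = d.
Proof.
move=> r0 r'0 fg hf hg; apply/funext => k; apply/eqP; rewrite -subr_eq0.
pose m := Num.min r r'.
have m0 : 0 < m by rewrite lt_min r0.
have mr : m <= r by rewrite ge_min lexx.
have mr' : m <= r' by rewrite ge_min lexx orbT.
have {hf hg}hh := has_pseriesB (has_pseriesW mr hf) (has_pseriesW mr' hg).
apply/eqP; apply: (@pseries0_coef m (fun k => c k - d k)) => //.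
split; first exact: hh.1.
move=> z; rewrite subr0 => zm; have := hh.2 (z + a).
rewrite addrK => /(_ zm); rewrite fg ?subrr// addrK.
  exact: lt_le_trans zm mr.
exact: lt_le_trans zm mr'.
Qed.

End PowerSeries.

Section Recentering.
Context {R : realType}.
Local Notation C := R[i].
Implicit Types (f g : C -> C) (a b z : C) (c d : nat -> C) (r s : R).

Lemma binomial_term_le (x y : R) n k : 0 <= x -> 0 <= y ->
  'C(n, k)%:R * x ^+ (n - k) * y ^+ k <= (x + y) ^+ n.
Proof.
move=> x0 y0; have [kn|nk] := leqP k n; last first.
  by rewrite bin_small// mul0r mul0r exprn_ge0// addr_ge0.
rewrite exprDn (bigD1 (Ordinal (kn : (k < n.+1)%N)))//= -mulrA mulr_natl lerDl.
by apply: sumr_ge0 => i _; rewrite mulrn_wge0// mulr_ge0// exprn_ge0.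
Qed.

Definition recenter_coef c (h : C) k n : C := c n * 'C(n, k)%:R * h ^+ (n - k).

Lemma recenter_coef_le c h (M s rho : R) k n : 0 < s -> 0 <= rho ->
  (forall k, modulus (c k) * s ^+ k <= M) ->
  modulus (recenter_coef c h k n) * rho ^+ k <=
  M * ((modulus h + rho) / s) ^+ n.
Proof.
move=> s0 rho0 hM.
rewrite /recenter_coef !modulusM modulusX modulus_nat -!mulrA.
rewrite [X in _ * X]mulrA.
rewrite (le_trans (ler_wpM2l (modulus_ge0 _)
  (binomial_term_le n k (modulus_ge0 h) rho0)))//.
rewrite expr_div_n mulrA ler_pdivlMr ?exprn_gt0// mulrAC.
by rewrite ler_wpM2r// exprn_ge0// addr_ge0 ?modulus_ge0.
Qed.

Lemma psum_recenter c (h w : C) n :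
  psum c n (h + w) = \sum_(k < n) (\sum_(i < n) recenter_coef c h k i) * w ^+ k.
Proof.
under [RHS]eq_bigr do rewrite mulr_suml.
rewrite exchange_big/=; apply: eq_bigr => i _.
rewrite exprDn mulr_sumr /recenter_coef.
rewrite (big_ord_widen n (fun j => c i * (h ^+ (i - j) * w ^+ j *+ 'C(i, j)))) ?ltn_ord//.
rewrite big_mkcond/=; apply: eq_bigr => j _; case: ifPn => [_|].
  by rewrite -mulr_natl; ring.
by rewrite ltnS -ltnNge => ij; rewrite bin_small// mulr0 !mul0r.
Qed.

(** By the binomial formula the double series is dominated by a geometric one as soon as
    [|h| + rho < s < r]. No infinite sums are exchanged: cutting both indices at [n] reproduces
    [psum c n (h + w)] exactly, and the part with [k >= K] is small uniformly in [n]. *)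
Lemma pseries_recenter f a r c b : has_pseries f a r c -> modulus (b - a) < r ->
  exists d, has_pseries f b (r - modulus (b - a)) d /\
    forall k, cvc (fun n => \sum_(i < n) recenter_coef c (b - a) k i) (d k).
Proof.
move=> hf; set h := b - a => hr.
have par rho : 0 <= rho < r - modulus h -> exists s M t : R,
    [/\ 0 < s, s < r, 0 <= t < 1, t = (modulus h + rho) / s &
        forall k, modulus (c k) * s ^+ k <= M].
  move=> /andP[rho0 rhor]; pose s := (r + (modulus h + rho)) / 2.
  have h0 := modulus_ge0 h.
  have s0 : 0 < s by rewrite /s; lra.
  have sr : s < r by rewrite /s; lra.
  have [M hM] := hf.1 s (introT andP (conj (ltW s0) sr)).
  exists s, M, ((modulus h + rho) / s); split=> //.
  rewrite divr_ge0 ?addr_ge0 ?(ltW s0)//= ltr_pdivrMr// mul1r /s; lra.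
have /choice[d hd] : forall k, exists l : C,
    cvc (fun n => \sum_(i < n) recenter_coef c h k i) l.
  move=> k; pose rho := (r - modulus h) / 2.
  have rho0 : 0 < rho by rewrite /rho; lra.
  have [|s [M [t [s0 sr t01 tE hM]]]] := par rho.
    by rewrite (ltW rho0)/= /rho; lra.
  apply: (geometric_series_cvg (M := M / rho ^+ k) t01) => n.
  rewrite mulrAC ler_pdivlMr ?exprn_gt0// tE.
  exact: recenter_coef_le (ltW rho0) hM.
exists d; split=> //; apply: has_pseriesP => z zb.
set w := z - b in zb *.
have w0 := modulus_ge0 w.
pose rho := (r - modulus h + modulus w) / 2.
have rho0 : 0 < rho by rewrite /rho; lra.
have wrho : modulus w < rho by rewrite /rho; lra.
have [|s [M [t [s0 sr t01 tE hM]]]] := par rho.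
  by rewrite (ltW rho0)/= /rho; lra.
pose B := M / (1 - t).
have B0 : 0 <= B.
  rewrite divr_ge0//; first by rewrite (le_trans _ (hM 0%N))// mulr_ge0 ?modulus_ge0 ?exprn_ge0 ?ltW.
  by case/andP: t01 => _ t1; rewrite subr_ge0 ltW.
have hB k n : modulus (\sum_(i < n) recenter_coef c h k i) * rho ^+ k <= B.
  rewrite -ler_pdivlMr ?exprn_gt0//.
  rewrite -(big_mkord xpredT (recenter_coef c h k)).
  apply: (le_trans (geometric_tail_le (M := M / rho ^+ k) 0 n t01 _)).
    move=> j; rewrite mulrAC ler_pdivlMr ?exprn_gt0// tE.
    exact: recenter_coef_le (ltW rho0) hM.
  by rewrite expr0 mulr1 /B mulrAC.
pose tau := modulus w / rho.
have tau01 : 0 <= tau < 1.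
  by rewrite divr_ge0 ?(ltW rho0)//= ltr_pdivrMr// mul1r.
have zr : modulus (z - a) < r.
  have := modulus_distD z a b; rewrite -/h -/w; lra.
apply: (@cvc_geometric _ _ _ (B / (1 - tau)) tau tau01) => K.
rewrite mulrAC.
have hK : cvc (fun n => \sum_(k < K) (\sum_(i < n) recenter_coef c h k i) * w ^+ k)
    (psum d K w).
  apply: cvc_sum => k; rewrite mulrC.
  by apply: eq_cvc (cvcZ (w ^+ k) (hd k)) => n; rewrite mulrC.
apply: (cvc_le_lim (N := K) (cvcB (hf.2 z zr) hK)) => n Kn.
have -> : z - a = h + w by rewrite /h /w; ring.
rewrite psum_recenter.
have := @psum_tail_le _ (fun k => \sum_(i < n) recenter_coef c h k i)
  B rho w K n rho0 wrho (fun k => hB k n) Kn.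
by rewrite /psum.
Qed.

(** The remainder after two terms is at most [B |x|^2] for [|x| <= s / 2], so the difference
    quotient is within [B |x|] of [c 1]. As [x] ranges over [R[i]], this is the complex
    derivative. *)
Lemma pseries_is_derive f a r c : 0 < r -> has_pseries f a r c ->
  derive1 f a = c 1%N.
Proof.
move=> r0 hf.
pose s := r / 2; have s0 : 0 < s by rewrite /s; lra.
have sr : s < r by rewrite /s; lra.
have [M hM] := hf.1 s (introT andP (conj (ltW s0) sr)).
have M0 : 0 <= M by rewrite (le_trans _ (hM 0%N))// mulr_ge0 ?modulus_ge0 ?exprn_ge0 ?ltW.
rewrite /derive1; apply: cvg_lim => //.
apply/cvgrPdist_lt => -[e e']; rewrite ltcE/= => /andP[/eqP-> e0].
pose B := 2 * M / s ^+ 2.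
have B0 : 0 <= B by rewrite !mulr_ge0// invr_ge0 exprn_ge0// ltW.
pose t := Num.min (s / 2) (e / (B + 1)).
have t0 : 0 < t by rewrite lt_min !divr_gt0//; lra.
have ts : t <= s / 2 by rewrite ge_min lexx.
have te : t <= e / (B + 1) by rewrite ge_min lexx orbT.
clearbody t.
exists t%:C; first by rewrite /= ltcR.
move=> x /=; rewrite sub0r normrN !normc_def !ltcR => xt x0.
have {}xt : modulus x < t by case: x xt {x0}.
set X := c 1%N - _; have -> : Num.sqrt (complex.Re X ^+ 2 + complex.Im X ^+ 2) = modulus X by case: X.
have xs : modulus x < s by lra.
have := pseries_tail 2 hf s0 (z := x + a); rewrite addrK => /(_ M xs (lt_trans xs sr) hM).
rewrite /psum !big_ord_recl big_ord0/= expr0 expr1 mulr1 addr0.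
rewrite -(pseries_at_center r0 hf) => H.
have -> : X = - (x^-1 * (f (x + a) - (f a + c 1%N * x))).
  by rewrite /X -[GRing.scale _ _]/(x^-1 * (f (x + a) - f a)); field.
rewrite modulusN modulusM modulusV.
have x0' : 0 < modulus x by rewrite modulus_gt0.
rewrite mulrC ltr_pdivrMr//; apply: (le_lt_trans H).
have h2 : modulus x / s <= 1 / 2 by rewrite ler_pdivrMr//; lra.
apply: (@le_lt_trans _ _ (M * (modulus x / s) ^+ 2 * 2)).
  apply: ler_wpM2l; first by rewrite mulr_ge0// exprn_ge0// divr_ge0// ltW.
  by rewrite -[leRHS]invrK lef_pV2 ?posrE; lra.
have -> : M * (modulus x / s) ^+ 2 * 2 = B * modulus x * modulus x.
  by rewrite /B; field; rewrite gt_eqF.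
rewrite ltr_pM2r//; apply: (@le_lt_trans _ _ (B * t)); first by rewrite ler_wpM2l// ltW.
apply: (@le_lt_trans _ _ (B * (e / (B + 1)))); first by rewrite ler_wpM2l.
by rewrite mulrA ltr_pdivrMr; nra.
Qed.

Definition deriv_coef c k : C := k.+1%:R * c k.+1.

(** The derivative at [z] is the first coefficient of the series recentred at [z], and the formula
    for that coefficient is itself the differentiated series. *)
Lemma has_pseries_derive f a r c : has_pseries f a r c ->
  has_pseries (derive1 f) a r (deriv_coef c).
Proof.
move=> hf; apply: has_pseriesP => z zr.
have [d [hd /(_ 1%N) d1]] := pseries_recenter hf zr.
rewrite (pseries_is_derive _ hd) ?subr_gt0//.
move: d1; rewrite /cvc -cvg_shiftS => d1.
apply: eq_cvc d1 => n; rewrite big_ord_recl/= /recenter_coef bin0n mulr0 mul0r add0r.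
by apply: eq_bigr => i _; rewrite /= bin1 /bump/= add1n subSS subn0 /deriv_coef; ring.
Qed.

End Recentering.

Section Product.
Context {R : realType}.
Local Notation C := R[i].
Implicit Types (f g : C -> C) (a b z : C) (c d : nat -> C) (r s : R).

Definition cauchy_product c d n : C := \sum_(i < n.+1) c i * d (n - i)%N.

Lemma psum_cauchy_product c d n z : psum (cauchy_product c d) n z =
  \sum_(0 <= i < n) \sum_(0 <= j < n - i) c i * z ^+ i * (d j * z ^+ j).
Proof.
rewrite /psum -(big_mkord xpredT (fun m => cauchy_product c d m * z ^+ m)).
transitivity (\sum_(0 <= m < n) \sum_(0 <= i < n | (i <= m)%N)
    c i * d (m - i)%N * z ^+ m).
  apply: eq_big_nat => m /andP[_ mn].
  rewrite mulr_suml -(big_mkord xpredT (fun i => c i * d (m - i)%N * z ^+ m)).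
  rewrite (@big_cat_nat _ _ _ m.+1 0 n)//= [X in _ + X]big1_seq ?addr0; last first.
    by move=> i; rewrite mem_index_iota => /andP[im /andP[mi _]]; lia.
  rewrite [RHS]big_mkcond/=; apply: eq_big_nat => i /andP[_ im].
  by rewrite -ltnS im.
under eq_bigr do rewrite big_mkcond/=.
rewrite exchange_big/=; apply: eq_big_nat => i /andP[_ iN].
rewrite (@big_cat_nat _ _ _ i 0 n) ?(ltnW iN)//= big1_seq ?add0r; last first.
  by move=> m; rewrite mem_index_iota => /andP[_ /andP[_ mi]]; rewrite leqNgt mi.
rewrite -{1}(add0n i) big_addn; apply: eq_bigr => j _.
by rewrite leq_addl addnK exprD; ring.
Qed.

(** The product of the partial sums differs from the partial sum of the Cauchy product by the terms
    with [i, j < n <= i + j]. With [|w| < s1 < s < r] and [|w| / s = sg * tau], such a term is at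
    most [M1 M2 sg^n tau^i tau^j]: one factor decays in [n], the others are summable. *)
Lemma has_pseriesM f g a r c d : has_pseries f a r c -> has_pseries g a r d ->
  has_pseries (fun z => f z * g z) a r (cauchy_product c d).
Proof.
move=> hf hg; apply: has_pseriesP => z zr; set w := z - a in zr *.
have w0 := modulus_ge0 w.
pose s := (2 * r + modulus w) / 3; pose s1 := (r + 2 * modulus w) / 3.
have s10 : 0 < s1 by rewrite /s1; lra.
have ws1 : modulus w < s1 by rewrite /s1; lra.
have s1s : s1 < s by rewrite /s1 /s; lra.
have sr : s < r by rewrite /s; lra.
have s0 : 0 < s by lra.
have [M1 hM1] := hf.1 s (introT andP (conj (ltW s0) sr)).
have [M2 hM2] := hg.1 s (introT andP (conj (ltW s0) sr)).
have M10 : 0 <= M1 by rewrite (le_trans _ (hM1 0%N))// mulr_ge0 ?modulus_ge0 ?exprn_ge0 ?ltW.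
have M20 : 0 <= M2 by rewrite (le_trans _ (hM2 0%N))// mulr_ge0 ?modulus_ge0 ?exprn_ge0 ?ltW.
clearbody s s1.
pose sg := modulus w / s1; pose tau := s1 / s.
have sg01 : 0 <= sg < 1 by rewrite divr_ge0 ?(ltW s10)//= ltr_pdivrMr// mul1r.
have tau01 : 0 <= tau < 1 by rewrite divr_ge0 ?ltW//= ltr_pdivrMr// mul1r.
have hfg : cvc (fun n => psum c n w * psum d n w) (f z * g z).
  have hz := hf.2 z zr; have hz' := hg.2 z zr.
  apply: (@cvc_squeeze _ _ _ (fun n => modulus (f z - psum c n w) * modulus (psum d n w) + modulus (f z) * modulus (g z - psum d n w))).
    move=> n; rewrite -!modulusM (le_trans _ (modulus_le_add _ _))//.
    by rewrite le_eqVlt; apply/orP; left; apply/eqP; congr modulus; ring.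
  have hd n : modulus (psum d n w) <= M2 / (1 - modulus w / s).
    have := @psum_tail_le _ d M2 s w 0 n s0 (lt_trans ws1 s1s) hM2 isT.
    by rewrite /psum big_ord0 subr0 expr0 mulr1.
  rewrite -[X in _ --> X](addr0 0) -[X in _ --> X + _](mul0r (M2 / (1 - modulus w / s))) -[X in _ --> _ + X](mulr0 (modulus (f z))).
  apply: cvgD; last exact: cvgMr.
  rewrite mul0r; apply: (@squeeze_cvgr _ _ _ _ (fun=> 0) (fun n => modulus (f z - psum c n w) * (M2 / (1 - modulus w / s)))).
  - by near=> n; rewrite mulr_ge0 ?modulus_ge0//= ler_wpM2l ?modulus_ge0.
  - exact: cvg_cst.
  - rewrite -[X in _ --> X](mul0r (M2 / (1 - modulus w / s))); exact: cvgMl.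
have hdiff : cvc (fun n => psum c n w * psum d n w - psum (cauchy_product c d) n w) 0.
  apply: (@cvc_geometric _ _ _ (M1 * M2 / (1 - tau) / (1 - tau)) sg sg01) => n.
  rewrite sub0r modulusN psum_cauchy_product /psum -!(big_mkord xpredT (fun i => _ i * w ^+ i)).
  rewrite mulr_suml -sumrB.
  rewrite (eq_big_nat _ _ (F2 := fun i =>
      \sum_(n - i <= j < n) c i * w ^+ i * (d j * w ^+ j))); last first.
    move=> i _; rewrite mulr_sumr (@big_cat_nat _ _ _ (n - i) 0 n) ?leq_subr//=.
    by rewrite [LHS]addrC addKr.
  rewrite (le_trans (modulus_sum _ _ _))//.
  apply: (@le_trans _ _ (\sum_(0 <= i < n) \sum_(0 <= j < n) M1 * M2 * sg ^+ n * (tau ^+ i * tau ^+ j))).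
    apply: ler_sum_nat => i /andP[_ hi].
    rewrite (le_trans (modulus_sum _ _ _))// [leRHS](@big_cat_nat _ _ _ (n - i) 0 n) ?leq_subr//= -[leLHS]add0r lerD//.
      apply: sumr_ge0 => j _; rewrite !mulr_ge0// exprn_ge0//.
      - by case/andP: sg01.
      - by case/andP: tau01.
      - by case/andP: tau01.
    apply: ler_sum_nat => j /andP[hj1 hj2].
    rewrite !modulusM !modulusX.
    have -> : modulus (c i) * modulus w ^+ i * (modulus (d j) * modulus w ^+ j) =
       (modulus (c i) * s ^+ i) * (modulus (d j) * s ^+ j) * (modulus w / s) ^+ (i + j).
      rewrite expr_div_n !exprD; field; rewrite !expf_eq0 (gt_eqF s0) !andbF//.
    have -> : modulus w / s = sg * tau by rewrite /sg /tau; field; rewrite !gt_eqF.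
    rewrite exprMn_comm; last exact: mulrC.
    rewrite -[leRHS]mulrA -exprD; apply: ler_pM.
    - by rewrite !mulr_ge0// ?modulus_ge0// exprn_ge0// ltW.
    - by case/andP: sg01 => ? _; case/andP: tau01 => ? _; rewrite mulr_ge0// exprn_ge0.
    - by apply: ler_pM; rewrite // mulr_ge0 ?modulus_ge0// exprn_ge0// ltW.
    - apply: ler_wpM2r; first by case/andP: tau01 => ? _; rewrite exprn_ge0.
      by case/andP: sg01 => ? /ltW ?; apply: ler_wiXn2l => //; rewrite -leq_subLR.
  under eq_bigr do rewrite -mulr_sumr -mulr_sumr mulrCA.
  rewrite -mulr_suml.
  set T := \sum_(0 <= i < n) tau ^+ i.
  have TT : 0 <= T <= (1 - tau)^-1.
    apply/andP; split.
      by apply: sumr_ge0 => j _; case/andP: tau01 => ? _; rewrite exprn_ge0.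
    by have := sum_geo_le 0 n tau01; rewrite expr0 mul1r.
  case/andP: TT => T0 T1; 
  have E0 : 0 <= M1 * (M2 * sg ^+ n).
    by case/andP: sg01 => ? _; rewrite !mulr_ge0// exprn_ge0.
  have -> : T * (M1 * M2 * sg ^+ n * T) = M1 * (M2 * sg ^+ n) * (T * T) by ring.
  have -> : M1 * M2 / (1 - tau) / (1 - tau) * sg ^+ n = M1 * (M2 * sg ^+ n) * ((1 - tau)^-1 * (1 - tau)^-1) by ring.
  by apply: ler_wpM2l => //; apply: ler_pM.
have := cvcB hfg hdiff; rewrite subr0; apply: eq_cvc => n.
by rewrite opprB addrC subrK.
Unshelve. all: by end_near. Qed.

End Product.

(** * Area integrals *)

Section AffineLebesgue.
Context {R : realType}.
Local Notation leb := (@lebesgue_measure R).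
Local Notation M := (measurableTypeR R).

Definition affine (a b : R) : M -> M := fun x => a * x + b.

Lemma measurable_affine (a b : R) :
  measurable_fun [set: M] (affine a b).
Proof.
apply: measurable_funD; last exact: measurable_cst.
by apply: measurable_funM; [exact: measurable_cst|exact: measurable_id].
Qed.

(** Uniqueness of Lebesgue measure reduces this to intervals []u, v]]. For [a < 0] the preimage is
    closed at the other end, which leaves its length unchanged. *)
Lemma pushforward_affine (a b : R) (A : set M) : a != 0 -> measurable A ->
  (`|a|%:E * pushforward leb (affine a b) A)%E = leb A.
Proof.
move=> a0 mA.
pose nu0 : {measure set M -> \bar R} :=
  mscale (NngNum (normr_ge0 a)) (pushforward leb (affine a b)).
pose nu := nu0 (measurable_affine a b).
apply/esym; apply: (@lebesgue_measure_unique _ nu) => // _ [[u v]] _ <- /=.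
rewrite /nu /nu0 /mscale/= /pushforward.
move: (a0); rewrite neq_lt => /orP[a_lt0|a_gt0]; last first.
  rewrite (_ : _ @^-1` _ = `](u - b) / a, (v - b) / a]%classic); last first.
    apply/seteqP; split=> x /=; rewrite !in_itv/= ltr_pdivrMr// ler_pdivlMr//;
      by rewrite ltrBlDr lerBrDr mulrC.
  rewrite !lebesgue_measure_itv/= !lte_fin ltr_pM2r ?invr_gt0// ltrD2r.
  case: ifPn => _; last by rewrite mule0.
  by rewrite -!EFinD -EFinM gtr0_norm//; congr EFin; field; rewrite gt_eqF.
rewrite (_ : _ @^-1` _ = `[(v - b) / a, (u - b) / a[%classic); last first.
  apply/seteqP; split=> x /=; rewrite !in_itv/= ler_ndivrMr// ltr_ndivlMr//;
    rewrite lerBrDr ltrBlDr mulrC; rewrite andbC//.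
rewrite !lebesgue_measure_itv/= !lte_fin ltr_nM2r ?invr_lt0// ltrD2r.
case: ifPn => _; last by rewrite mule0.
by rewrite -!EFinD -EFinM ltr0_norm//; congr EFin; field; rewrite lt_eqF.
Qed.

Lemma lebesgue_affine (a b : R) (h : R -> \bar R) : a != 0 ->
  measurable_fun [set: M] h -> (forall x, 0 <= h x)%E ->
  (\int[leb]_x h (a * x + b)%R = `|a|^-1%:E * \int[leb]_x h x)%E.
Proof.
move=> a0 mh h0.
have := @ge0_integral_pushforward _ _ M M R (affine a b) (measurable_affine a b) leb setT h
  measurableT mh (fun y _ => h0 y).
rewrite preimage_setT => <-.
pose nu0 : {measure set M -> \bar R} :=
  mscale (NngNum (normr_ge0 a)) (pushforward leb (affine a b)).
pose nu := nu0 (measurable_affine a b).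
rewrite [X in _ = (_ * X)%E](_ : _ = (\int[nu]_x h x)%E); last first.
  apply: eq_measure_integral => A mA _ /=.
  by rewrite /mscale/= pushforward_affine.
rewrite ge0_integral_mscale// muleA -EFinM mulVf ?mul1e//.
by rewrite normr_eq0.
Qed.

Lemma lebesgue_shift (b : R) (h : R -> \bar R) :
  measurable_fun [set: M] h -> (forall x, 0 <= h x)%E ->
  (\int[leb]_x h (x + b)%R = \int[leb]_x h x)%E.
Proof.
move=> mh h0; have := lebesgue_affine b (oner_neq0 _) mh h0.
rewrite normr1 invr1 mul1e => <-.
by apply: eq_integral => x _; rewrite mul1r.
Qed.

End AffineLebesgue.

Section PlaneIntegral.
Context {R : realType}.
Local Notation C := R[i].
Local Notation leb := (@lebesgue_measure R).
Local Notation M := (measurableTypeR R).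
Implicit Types (F G : C -> \bar R).

Definition cmeas F := measurable_fun [set: M * M] (fun p => F (to_complex p)).

Definition cint F : \bar R := (\int[plane_measure]_p F (to_complex p))%E.

Lemma measurable_Re : measurable_fun [set: M * M] (fun p : M * M => (p.1 : M)).
Proof. exact: measurable_fst. Qed.

Lemma measurable_Im : measurable_fun [set: M * M] (fun p : M * M => (p.2 : M)).
Proof. exact: measurable_snd. Qed.

Lemma cmeas_comp F d (T : measurableType d) (u v : T -> M) : cmeas F ->
  measurable_fun [set: T] u -> measurable_fun [set: T] v ->
  measurable_fun [set: T] (fun p => F (u p +i* v p)).
Proof.
move=> mF mu mv.
exact: (measurableT_comp mF (measurable_fun_pair mu mv)).
Qed.

Lemma cmeas_affine F (a b : C) : cmeas F -> cmeas (fun z => F (a * z + b)).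
Proof.
move=> mF; rewrite /cmeas.
have mx := measurable_Re; have my := measurable_Im.
have := @cmeas_comp F _ _
  (fun p : M * M => complex.Re a * p.1 - complex.Im a * p.2 + complex.Re b)
  (fun p : M * M => complex.Re a * p.2 + complex.Im a * p.1 + complex.Im b) mF.
case: a b => a a' [b b'] /= H.
apply: H.
- apply: measurable_funD; last exact: measurable_cst.
  by apply: measurable_funB; apply: measurable_funM => //; exact: measurable_cst.
- apply: measurable_funD; last exact: measurable_cst.
  by apply: measurable_funD; apply: measurable_funM => //; exact: measurable_cst.
Qed.

Lemma cint_iter F : cmeas F -> (forall z, 0 <= F z)%E ->
  cint F = (pi^-1%:E * \int[leb]_x \int[leb]_y F (x +i* y))%E.
Proof.
move=> mF F0; rewrite /cint /plane_measure ge0_integral_mscale//=.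
by rewrite (fubini_tonelli1 _ mF).
Qed.

Lemma cint_iter' F : cmeas F -> (forall z, 0 <= F z)%E ->
  cint F = (pi^-1%:E * \int[leb]_y \int[leb]_x F (x +i* y))%E.
Proof.
move=> mF F0; rewrite /cint /plane_measure ge0_integral_mscale//=.
congr (_ * _)%E.
rewrite (@fubini_tonelli1 _ _ M M R leb leb (fun p => F (to_complex p)) mF (fun p => F0 _)).
exact: (@fubini_tonelli _ _ M M R leb leb (fun p => F (to_complex p)) mF (fun p => F0 _)).
Qed.

Lemma cint_add F (b : C) : cmeas F -> (forall z, 0 <= F z)%E ->
  cint (fun z => F (z + b)) = cint F.
Proof.
move=> mF F0.
have mFb : cmeas (fun z => F (z + b)).
  by have := cmeas_affine 1 b mF; under [fun z => _]eq_fun do rewrite mul1r.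
rewrite (cint_iter mFb (fun z => F0 _)) (cint_iter mF F0); congr (_ * _)%E.
case: b mFb => b b' mFb.
have mFx (x : M) : measurable_fun [set: M] (fun y => F (x +i* y)).
  by apply: (@cmeas_comp F _ M (fun=> x) id mF); [exact: measurable_cst|exact: measurable_id].
pose H x := (\int[leb]_y F (x +i* y))%E.
have mH : measurable_fun [set: M] H by exact: (@measurable_fun_fubini_tonelli_F _ _ M M R leb (fun p => F (to_complex p)) mF (fun p => F0 _)).
have H0 x : (0 <= H x)%E by apply: integral_ge0 => y _; exact: F0.
rewrite -[RHS](lebesgue_shift b mH H0).
apply: eq_integral => x _; rewrite /H.
by rewrite -[RHS](lebesgue_shift b' (mFx (x + b)) (fun y => F0 _)).
Qed.

(** Multiplication by [x + i y] as two one-dimensional substitutions. With [v] fixed,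
    [X = x u - y v] replaces [u]; with [X] fixed, the imaginary part is affine in [v] with slope
    [x + y^2 / x]. The two factors multiply to [x^2 + y^2]. *)
Lemma cint_mul_Re F (a : C) : complex.Re a != 0 -> cmeas F ->
  (forall z, 0 <= F z)%E ->
  cint (fun z => F (a * z)) = ((modulus a ^- 2)%:E * cint F)%E.
Proof.
move=> a0 mF F0.
have mFa : cmeas (fun z => F (a * z)).
  by have := cmeas_affine a 0 mF; under [fun z => _]eq_fun do rewrite addr0.
rewrite (cint_iter' mFa (fun z => F0 _)) (cint_iter mF F0).
case: a a0 mFa => x y /= x0 mFa.
pose H v X := F (X +i* ((x + y ^+ 2 / x) * v + y / x * X)).
have mH : measurable_fun [set: M * M] (fun p : M * M => H p.1 p.2).
  apply: (@cmeas_comp F _ _ snd (fun p => (x + y ^+ 2 / x) * p.1 + y / x * p.2)) => //.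
  by apply: measurable_funD; apply: measurable_funM => //; exact: measurable_cst.
have H0 v X : (0 <= H v X)%E by exact: F0.
have d0 : 0 < x ^+ 2 + y ^+ 2.
  by rewrite ltr_pwDl ?sqr_ge0// lt_neqAle sqr_ge0 eq_sym sqrf_eq0 x0.
have e0 : x + y ^+ 2 / x != 0.
  have -> : x + y ^+ 2 / x = (x ^+ 2 + y ^+ 2) / x by field.
  by rewrite mulf_eq0 invr_eq0 negb_or x0 andbT gt_eqF.
pose K v := (\int[leb]_X H v X)%E.
have mK : measurable_fun [set: M] K.
  exact: (@measurable_fun_fubini_tonelli_F _ _ M M R leb (fun p => H p.1 p.2) mH (fun p => H0 _ _)).
have K0 v : (0 <= K v)%E by apply: integral_ge0 => y' _; exact: H0.
pose L x := (\int[leb]_y F (x +i* y))%E.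
have mL : measurable_fun [set: M] L.
  exact: (@measurable_fun_fubini_tonelli_F _ _ M M R leb (fun p => F (to_complex p)) mF (fun p => F0 _)).
have L0 v : (0 <= L v)%E by apply: integral_ge0 => y' _; exact: F0.
transitivity (pi^-1%:E * \int[leb]_v (`|x|^-1%:E * K v))%E.
  congr (_ * _)%E; apply: eq_integral => v _.
  rewrite -(lebesgue_affine (- (y * v)) x0 (measurable_fun_pair2 v mH) (fun X => H0 v X)).
  apply: eq_integral => u _; rewrite /H; congr F; apply/eqP.
  by rewrite eq_complex/=; apply/andP; split; apply/eqP; field.
have Ze (k : R) (h : M -> \bar R) : 0 <= k -> measurable_fun [set: M] h ->
    (forall x, 0 <= h x)%E -> (\int[leb]_x (k%:E * h x) = k%:E * \int[leb]_x h x)%E.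
  by move=> k0 mh h0; rewrite ge0_integralZl.
have x'0 : 0 <= `|x|^-1 by rewrite invr_ge0.
rewrite (Ze _ _ x'0 mK K0).
have := @fubini_tonelli _ _ M M R leb leb (fun p => H p.1 p.2) mH (fun p => H0 _ _).
rewrite /fubini_F /fubini_G/= -/K => ->.
rewrite (_ : (\int[leb]_X \int[leb]_v H v X =
   \int[leb]_X (`|x + y ^+ 2 / x|^-1%:E * L X))%E); last first.
  apply: eq_integral => X _; rewrite /H.
  apply: (@lebesgue_affine _ (x + y ^+ 2 / x) (y / x * X) (fun v => F (X +i* v)) e0) => //.
  apply: (@cmeas_comp F _ M (fun=> X) id mF); [exact: measurable_cst|exact: measurable_id].
rewrite (Ze _ _ _ mL L0) ?invr_ge0 ?normr_ge0//.
rewrite !muleA -!EFinM; congr (_%:E * _)%E.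
rewrite sqr_sqrtr ?(ltW d0)// -mulrA mulrC; congr (_ * _).
rewrite -invfM -normrM; congr (_^-1).
rewrite (_ : x * (x + y ^+ 2 / x) = x ^+ 2 + y ^+ 2) ?gtr0_norm//; by field.
Qed.

(** A purely imaginary [a] is the product of [1 + i] and [a / (1 + i)], both with nonzero real
    part. *)
Lemma cint_mul F (a : C) : a != 0 -> cmeas F -> (forall z, 0 <= F z)%E ->
  cint (fun z => F (a * z)) = ((modulus a ^- 2)%:E * cint F)%E.
Proof.
move=> a0 mF F0; have [ra|ra] := eqVneq (complex.Re a) 0; last exact: cint_mul_Re.
pose w : C := 1 +i* 1; pose b := a / w.
have w0 : w != 0 by rewrite eq_complex/= negb_and oner_eq0.
have bE : a = b * w by rewrite /b divfK.
have rb : complex.Re b != 0.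
  rewrite /b /w; case: a a0 ra {bE b} => u v /= + u0; rewrite u0 eq_complex/= eqxx/= => v0.
  rewrite mul0r add0r -mulrN opprK mulf_neq0// mulr1 mul1r.
have mFb : cmeas (fun z => F (b * z)).
  by have := cmeas_affine b 0 mF; under [fun z => _]eq_fun do rewrite addr0.
transitivity (cint (fun z => (fun z => F (b * z)) (w * z))).
  by congr cint; apply/funext => z; rewrite bE mulrA.
rewrite (@cint_mul_Re (fun z => F (b * z)))//= ?oner_eq0//.
rewrite cint_mul_Re// muleA -EFinM; congr (_%:E * _)%E.
by rewrite bE modulusM exprMn [RHS]invfM [RHS]mulrC.
Qed.

End PlaneIntegral.

(** * Roots of unity and discrete orthogonality *)

Section UnitCircle.
Context {R : realType}.
Local Notation C := R[i].
Implicit Types (t s : R).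

Definition expi t : C := cos t +i* sin t.

Lemma expi0 : expi 0 = 1. Proof. by rewrite /expi cos0 sin0. Qed.

Lemma expiD t s : expi (t + s) = expi t * expi s.
Proof.
rewrite /expi cosD sinD; apply/eqP; rewrite eq_complex/=.
by apply/andP; split; apply/eqP; ring.
Qed.

Lemma expiJ t : (expi t)^* = expi (- t).
Proof. by rewrite /expi cosN sinN. Qed.

Lemma modulus_expi t : modulus (expi t) = 1.
Proof. by rewrite /= cos2Dsin2 sqrtr1. Qed.

Lemma expiX t n : expi t ^+ n = expi (t *+ n).
Proof. by elim: n => [|n IH]; rewrite ?expr0 ?mulr0n ?expi0// exprS IH mulrS expiD. Qed.

Lemma expi_2pi : expi (pi *+ 2) = 1.
Proof. by rewrite /expi cos2pi sin2pi. Qed.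

Lemma expi_neq1 t : 0 < t < 2 * pi -> expi t != 1.
Proof.
move=> /andP[t0 t2]; apply/eqP => -[] h _.
have s0 : 0 < sin (t / 2).
  apply: sin_gt0_pi; rewrite divr_gt0//= ltr_pdivrMr// mulrC//.
have tE : t = (t / 2) *+ 2 by rewrite -[RHS]mulr_natr divfK.
have : cos ((t / 2) *+ 2) = 1 by rewrite -tE.
rewrite cos_mulr2n; have := cos2Dsin2 (t / 2).
have : 0 < sin (t / 2) ^+ 2 by rewrite exprn_gt0.
by move: (sin _ ^+ 2) (cos _ ^+ 2) => x y; lra.
Qed.

Lemma expi_inj t s a : a <= t < a + 2 * pi -> a <= s < a + 2 * pi ->
  expi t = expi s -> t = s.
Proof.
wlog ts : t s / t <= s.
  move=> H ht hs e; have [l|l] := leP t s; first exact: H.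
  by apply/esym; apply: H => //; exact: ltW.
move=> /andP[t1 t2] /andP[s1 s2] e; apply/eqP; apply/contraT => nts.
have lt : t < s by rewrite lt_neqAle nts ts.
have /expi_neq1/eqP[] : 0 < s - t < 2 * pi by rewrite subr_gt0 lt/=; lra.
by rewrite expiD -e -expiD subrr expi0.
Qed.

Definition unity_root N : C := expi (2 * pi / N%:R).

Lemma modulus_unity_root N : modulus (unity_root N) = 1.
Proof. exact: modulus_expi. Qed.

Lemma unity_rootX N m : unity_root N ^+ m = expi (2 * pi * m%:R / N%:R).
Proof. by rewrite expiX -[X in expi X]mulr_natr mulrAC. Qed.

Lemma unity_rootN N : (0 < N)%N -> unity_root N ^+ N = 1.
Proof.
move=> N0; rewrite unity_rootX mulfK ?pnatr_eq0 -?lt0n//.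
by rewrite -[RHS]expi_2pi -(mulr_natr pi 2) mulrC.
Qed.

Lemma unity_root_neq1 N m : (0 < m < N)%N -> unity_root N ^+ m != 1.
Proof.
move=> /andP[m0 mN]; rewrite unity_rootX; apply: expi_neq1.
have N0 : (0 < N%:R :> R) by rewrite ltr0n (ltn_trans m0).
have N0' : (0 < N)%N by exact: ltn_trans mN.
have pi0 := @pi_gt0 R.
rewrite !mulr_gt0 ?invr_gt0 ?ltr0n//=.
by rewrite ltr_pdivrMr// ltr_pM2l ?ltr_nat// mulr_gt0.
Qed.

Lemma sum_unity_root N i j : (i < N)%N -> (j < N)%N ->
  \sum_(k < N) (unity_root N ^+ k) ^+ i * ((unity_root N ^+ k) ^+ j)^* =
  (if i == j then N%:R else 0).
Proof.
wlog ij : i j / (j <= i)%N.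
  move=> H iN jN; have [l|l] := leqP j i; first exact: H.
  rewrite -[LHS]conjcK rmorph_sum/=.
  under eq_bigr do rewrite rmorphM/= conjcK mulrC.
  by rewrite H ?(ltnW l)// eq_sym; case: ifP; rewrite ?rmorph_nat ?rmorph0.
move=> iN jN; have N0 : (0 < N)%N by exact: leq_ltn_trans iN.
have wJ k : unity_root N ^+ k * (unity_root N ^+ k)^* = 1.
  by rewrite mulJ_modulus modulusX modulus_unity_root expr1n expr1n.
rewrite (eq_bigr (fun k : 'I_N => (unity_root N ^+ (i - j)) ^+ k)); last first.
  move=> k _; rewrite -{1}(subnK ij) exprD rmorphXn -mulrA -exprMn wJ expr1n mulr1.
  by rewrite -!exprM mulnC.
case: eqVneq => [->|nij].
  by rewrite subnn expr0; under eq_bigr do rewrite expr1n; rewrite sumr_const card_ord.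
have q1 : unity_root N ^+ (i - j) - 1 != 0.
  by rewrite subr_eq0 unity_root_neq1// subn_gt0 ltn_neqAle eq_sym nij ij (leq_ltn_trans (leq_subr _ _)).
apply: (mulfI q1); rewrite mulr0 -subrX1.
by rewrite -exprM mulnC exprM unity_rootN// expr1n subrr.
Qed.

(** Discrete Parseval: only the powers below [N] occur, so the [N]-th roots of unity separate them
    and every cross term cancels exactly. *)
Lemma sum_psum_unity_root (c : nat -> C) (z : C) N :
  \sum_(k < N) modulus (psum c N (unity_root N ^+ k * z)) ^+ 2 =
  N%:R * \sum_(n < N) modulus (c n) ^+ 2 * modulus z ^+ (2 * n).
Proof.
apply: complexI; rewrite rmorph_sum/=.
rewrite (eq_bigr (fun k : 'I_N => \sum_(i < N) \sum_(j < N)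
   (c i * (c j)^* * z ^+ i * (z ^+ j)^*) *
   ((unity_root N ^+ k) ^+ i * ((unity_root N ^+ k) ^+ j)^*))); last first.
  move=> k _; rewrite -mulJ_modulus /psum rmorph_sum/= big_distrlr/=.
  apply: eq_bigr => i _; apply: eq_bigr => j _.
  rewrite !exprMn !rmorphM/=; ring.
rewrite exchange_big/=.
rewrite (eq_bigr (fun i : 'I_N => N%:R * ((modulus (c i) ^+ 2 * modulus z ^+ (2 * i))%:C))); last first.
  move=> i _; rewrite exchange_big/= (bigD1 i)//= -mulr_sumr sum_unity_root// eqxx.
  rewrite big1 ?addr0 => [|j ji].
    rewrite mulrC; congr (_ * _).
    rewrite mulJ_modulus -mulrA mulJ_modulus modulusX -exprM (mulnC i).
    by rewrite [RHS]rmorphM.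
  rewrite -mulr_sumr sum_unity_root//.
  by rewrite (_ : (i == j :> nat) = false) ?mulr0// eq_sym; apply/negbTE.
by rewrite -mulr_sumr !rmorphM/= rmorph_nat rmorph_sum.
Qed.

End UnitCircle.

Section Measurability.
Context {R : realType}.
Local Notation C := R[i].
Local Notation M := (measurableTypeR R).
Implicit Types (F G : C -> R) (f g : C -> C).

Definition cmeasR F := measurable_fun [set: M * M] (fun p => F (to_complex p)).

Definition cmeasC f :=
  cmeasR (fun z => complex.Re (f z)) /\ cmeasR (fun z => complex.Im (f z)).

Lemma cmeas_EFin F : cmeasR F -> cmeas (fun z => (F z)%:E).
Proof. by move=> mF; apply/measurable_EFinP. Qed.

Lemma eq_cmeasR F G : F =1 G -> cmeasR F -> cmeasR G.
Proof. by move=> /funext->. Qed.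

Lemma eq_cmeasC f g : f =1 g -> cmeasC f -> cmeasC g.
Proof. by move=> /funext->. Qed.

Lemma cmeasR_cst (k : R) : cmeasR (fun=> k).
Proof. exact: measurable_cst. Qed.

Lemma cmeasRD F G : cmeasR F -> cmeasR G -> cmeasR (fun z => F z + G z).
Proof. exact: measurable_funD. Qed.

Lemma cmeasRB F G : cmeasR F -> cmeasR G -> cmeasR (fun z => F z - G z).
Proof. exact: measurable_funB. Qed.

Lemma cmeasRM F G : cmeasR F -> cmeasR G -> cmeasR (fun z => F z * G z).
Proof. exact: measurable_funM. Qed.

Lemma cmeasRX F n : cmeasR F -> cmeasR (fun z => F z ^+ n).
Proof. exact: measurable_funX. Qed.

Lemma cmeasR_sum I (r : seq I) (F : I -> C -> R) :
  (forall i, cmeasR (F i)) -> cmeasR (fun z => \sum_(i <- r) F i z).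
Proof.
move=> mF; elim: r => [|i r IH].
  by apply: eq_cmeasR (cmeasR_cst 0) => z; rewrite big_nil.
by apply: eq_cmeasR (cmeasRD (mF i) IH) => z; rewrite big_cons.
Qed.

Lemma cmeasR_cvg (F : nat -> C -> R) G : (forall n, cmeasR (F n)) ->
  (forall z, F ^~ z @ \oo --> G z) -> cmeasR G.
Proof. by move=> mF h; apply: (measurable_fun_cvg mF) => p _; exact: h. Qed.

Lemma cmeasR_mul (a : C) F : cmeasR F -> cmeasR (fun z => F (a * z)).
Proof.
move=> /cmeas_EFin /(cmeas_affine a 0) => h; apply/measurable_EFinP.
by move: h; rewrite /cmeas; under eq_fun do rewrite addr0.
Qed.

Lemma cmeasR_add (b : C) F : cmeasR F -> cmeasR (fun z => F (z + b)).
Proof.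
move=> /cmeas_EFin /(cmeas_affine 1 b) => h; apply/measurable_EFinP.
by move: h; rewrite /cmeas; under eq_fun do rewrite mul1r.
Qed.

Lemma cmeasC_id : cmeasC id.
Proof. by split; [exact: measurable_Re|exact: measurable_Im]. Qed.

Lemma cmeasC_cst (k : C) : cmeasC (fun=> k).
Proof. by split; exact: cmeasR_cst. Qed.

Lemma cmeasCD f g : cmeasC f -> cmeasC g -> cmeasC (fun z => f z + g z).
Proof.
move=> [f1 f2] [g1 g2]; split.
  by apply: eq_cmeasR (cmeasRD f1 g1) => z; rewrite raddfD.
by apply: eq_cmeasR (cmeasRD f2 g2) => z; rewrite raddfD.
Qed.

Lemma ReM (x y : C) : complex.Re (x * y) =
  complex.Re x * complex.Re y - complex.Im x * complex.Im y.
Proof. by case: x; case: y. Qed.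

Lemma ImM (x y : C) : complex.Im (x * y) =
  complex.Re x * complex.Im y + complex.Im x * complex.Re y.
Proof. by case: x => a b; case: y => c d /=. Qed.

Lemma cmeasCM f g : cmeasC f -> cmeasC g -> cmeasC (fun z => f z * g z).
Proof.
move=> [f1 f2] [g1 g2]; split.
  by apply: eq_cmeasR (cmeasRB (cmeasRM f1 g1) (cmeasRM f2 g2)) => z; rewrite ReM.
by apply: eq_cmeasR (cmeasRD (cmeasRM f1 g2) (cmeasRM f2 g1)) => z; rewrite ImM.
Qed.

Lemma cmeasCX f n : cmeasC f -> cmeasC (fun z => f z ^+ n).
Proof.
move=> mf; elim: n => [|n IH].
  by apply: eq_cmeasC (cmeasC_cst 1) => z; rewrite expr0.
by apply: eq_cmeasC (cmeasCM mf IH) => z; rewrite exprS.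
Qed.

Lemma cmeasC_sum I (r : seq I) (f : I -> C -> C) :
  (forall i, cmeasC (f i)) -> cmeasC (fun z => \sum_(i <- r) f i z).
Proof.
move=> mf; elim: r => [|i r IH].
  by apply: eq_cmeasC (cmeasC_cst 0) => z; rewrite big_nil.
by apply: eq_cmeasC (cmeasCD (mf i) IH) => z; rewrite big_cons.
Qed.

Lemma cmeasC_psum (c : nat -> C) n : cmeasC (psum c n).
Proof.
apply: cmeasC_sum => k; apply: cmeasCM; first exact: cmeasC_cst.
exact: cmeasCX cmeasC_id.
Qed.

Lemma cmeasR_modulus f : cmeasC f -> cmeasR (fun z => modulus (f z)).
Proof.
move=> [f1 f2].
have -> : (fun z => modulus (f z)) =
    (fun z => Num.sqrt (complex.Re (f z) ^+ 2 + complex.Im (f z) ^+ 2)).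
  by apply/funext => z; case: (f z).
apply: (measurableT_comp (f := @Num.sqrt R)).
  by apply: continuous_measurable_fun => x; exact: sqrt_continuous.
exact: (cmeasRD (cmeasRX 2 f1) (cmeasRX 2 f2)).
Qed.

Lemma cmeasR_modulus_id : cmeasR (fun z : C => modulus z).
Proof. exact: cmeasR_modulus cmeasC_id. Qed.

End Measurability.

Section RealPlaneIntegral.
Context {R : realType}.
Local Notation C := R[i].
Local Notation M := (measurableTypeR R).
Implicit Types (F G : C -> R).

Definition Rcint F : \bar R := cint (fun z => (F z)%:E).

Lemma Rcint_ge0 F : (forall z, 0 <= F z) -> (0 <= Rcint F)%E.
Proof. by move=> F0; apply: integral_ge0 => p _; rewrite lee_fin. Qed.

Lemma Rcint_le F G : cmeasR F -> cmeasR G -> (forall z, 0 <= F z) ->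
  (forall z, F z <= G z) -> (Rcint F <= Rcint G)%E.
Proof.
move=> mF mG F0 FG; apply: ge0_le_integral => //.
- by move=> p _; rewrite lee_fin.
- exact: cmeas_EFin.
- exact: cmeas_EFin.
- by move=> p _; rewrite lee_fin.
Qed.

Lemma RcintZ (k : R) F : 0 <= k -> cmeasR F -> (forall z, 0 <= F z) ->
  Rcint (fun z => k * F z) = (k%:E * Rcint F)%E.
Proof.
move=> k0 mF F0; rewrite /Rcint /cint.
under eq_integral do rewrite EFinM.
apply: ge0_integralZl_EFin => //; first by move=> p _; rewrite lee_fin.
exact: cmeas_EFin.
Qed.

Lemma RcintD F G : cmeasR F -> cmeasR G -> (forall z, 0 <= F z) ->
  (forall z, 0 <= G z) -> Rcint (fun z => F z + G z) = (Rcint F + Rcint G)%E.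
Proof.
move=> mF mG F0 G0; rewrite /Rcint /cint.
under eq_integral do rewrite EFinD.
apply: ge0_integralD => //.
- by move=> p _; rewrite lee_fin.
- exact: cmeas_EFin.
- by move=> p _; rewrite lee_fin.
- exact: cmeas_EFin.
Qed.

Lemma Rcint_sum I (r : seq I) (F : I -> C -> R) : (forall i, cmeasR (F i)) ->
  (forall i z, 0 <= F i z) ->
  Rcint (fun z => \sum_(i <- r) F i z) = (\sum_(i <- r) Rcint (F i))%E.
Proof.
move=> mF F0; rewrite /Rcint /cint.
under eq_integral do rewrite -sumEFin.
rewrite ge0_integral_sum// => i; first exact: cmeas_EFin.
by move=> p _; rewrite lee_fin.
Qed.

Lemma eq_Rcint F G : F =1 G -> Rcint F = Rcint G.
Proof. by move=> /funext->. Qed.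

Lemma Rcint_mul F (a : C) : a != 0 -> cmeasR F -> (forall z, 0 <= F z) ->
  Rcint (fun z => F (a * z)) = ((modulus a ^- 2)%:E * Rcint F)%E.
Proof.
move=> a0 mF F0; by rewrite /Rcint -cint_mul//; exact: cmeas_EFin.
Qed.

Lemma Rcint_rotate F (a : C) : modulus a = 1 -> cmeasR F ->
  (forall z, 0 <= F z) -> Rcint (fun z => F (a * z)) = Rcint F.
Proof.
move=> a1 mF F0; rewrite Rcint_mul// ?a1 ?expr1n ?invr1 ?mul1e//.
by rewrite -modulus_eq0 a1 oner_eq0.
Qed.

Lemma Rcint_add F (b : C) : cmeasR F -> (forall z, 0 <= F z) ->
  Rcint (fun z => F (z + b)) = Rcint F.
Proof.
move=> mF F0; rewrite /Rcint; apply: (cint_add b (F := fun z => (F z)%:E)).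
  exact: cmeas_EFin.
by move=> z; rewrite lee_fin.
Qed.

Lemma area_integralE (A : set C) F :
  area_integral A F = Rcint (fun z => F z * \1_A z).
Proof.
rewrite /area_integral integral_mkcond; apply: eq_integral => p _ /=.
rewrite patchE indicE.
have -> : (p \in to_complex @^-1` A) = (to_complex p \in A).
  by apply/idP/idP => /set_mem h; exact/mem_set.
by case: (_ \in A); rewrite ?mulr1 ?mulr0.
Qed.

(** Takes the part of integration in the angle: a radial weight comes out of the average, and
    [sum_psum_unity_root] evaluates what is left. *)
Lemma Rcint_average F N : (0 < N)%N -> cmeasR F -> (forall z, 0 <= F z) ->
  Rcint (fun z => N%:R^-1 * \sum_(k < N) F (unity_root N ^+ k * z)) = Rcint F.
Proof.
move=> N0 mF F0; have mFk (k : 'I_N) : cmeasR (fun z => F (unity_root N ^+ k * z)).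
  exact: cmeasR_mul.
rewrite RcintZ ?invr_ge0//; [|exact: cmeasR_sum|by move=> z; apply: sumr_ge0].
rewrite Rcint_sum//.
rewrite (eq_bigr (fun=> Rcint F)) => [|k _]; last first.
  by rewrite Rcint_rotate// modulusX modulus_unity_root expr1n.
have -> : (\sum_(k < N) Rcint F = N%:R%:E * Rcint F)%E.
  by rewrite mule_natl sumr_const card_ord.
rewrite muleA -EFinM mulVf ?mul1e//.
by rewrite pnatr_eq0 -lt0n.
Qed.

End RealPlaneIntegral.

(** * Parseval formula and Taylor expansions on the disc *)

Section Parseval.
Context {R : realType}.
Local Notation C := R[i].

Lemma limn_einf_le (u : nat -> \bar R) (l : \bar R) :
  (forall n, u n <= l)%E -> (limn_einf u <= l)%E.
Proof.
move=> ul; rewrite limn_einf_lim; apply: lime_le; first exact: is_cvg_einfs.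
by apply: nearW => n; apply: le_trans (ul n); apply: ereal_inf_lbound; exists n => /=.
Qed.

(** The limit [G] is extended-valued because in [parseval] one of the limits is a series summed in
    [\bar R]. *)
Lemma Rcint_fatou (F : nat -> C -> R) (G : C -> \bar R) (l : \bar R) :
  (forall n, cmeasR (F n)) -> (forall n z, 0 <= F n z) ->
  (forall z, (fun n => (F n z)%:E) @ \oo --> G z) ->
  (forall n, Rcint (F n) <= l)%E -> (cint G <= l)%E.
Proof.
move=> mF F0 FG Fl.
have := fatou (@plane_measure R) measurableT (f := fun n p => (F n (to_complex p))%:E)
  (fun n => cmeas_EFin (mF n)) (fun n p _ => F0 n _).
have -> : (\int[plane_measure]_(p in setT) limn_einf (fun n => (F n (to_complex p))%:E) = cint G)%E.
  by apply: eq_integral => p _; rewrite (cvg_limn_einf_sup (FG _)).1.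
by move=> /le_trans; apply; exact: limn_einf_le.
Qed.

(** Vanishing for [|z| >= r] removes the values of a series outside its disc of convergence, where
    [has_pseries] says nothing. *)
Definition radial (r : R) (w : C -> R) :=
  [/\ cmeasR w, forall z, 0 <= w z,
      forall a z, modulus a = 1 -> w (a * z) = w z
    & forall z, r <= modulus z -> w z = 0].

Definition moment (w : C -> R) n : \bar R :=
  Rcint (fun z => modulus z ^+ (2 * n) * w z).

Lemma cmeasR_pseries f (r : R) c w : has_pseries f 0 r c -> radial r w ->
  cmeasR (fun z => modulus (f z) ^+ 2 * w z).
Proof.
move=> hf [mw w0 wr wz].
apply: (@cmeasR_cvg _ (fun n z => modulus (psum c n z) ^+ 2 * w z)) => [n|z].
  by apply: cmeasRM => //; apply: cmeasRX; exact: cmeasR_modulus (cmeasC_psum _ _).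
have [zr|zr] := ltP (modulus z) r; last first.
  by rewrite wz// mulr0; under [fun n => _]eq_fun do rewrite mulr0; exact: cvg_cst.
apply: cvgMl.
have h : (fun n => modulus (psum c n z)) @ \oo --> modulus (f z).
  have := hf.2 z; rewrite subr0 => /(_ zr) hz.
  apply/cvgrPdist_le => e e0; move/cvgrPdist_le : hz => /(_ e e0).
  apply: filterS => n; rewrite sub0r normrN ger0_norm ?modulus_ge0// => /(le_trans _); apply.
  rewrite ler_norml; have := modulus_sub_le (f z) (psum c n z).
  have := modulus_sub_le (psum c n z) (f z); rewrite (modulus_distC (psum c n z)); lra.
under [fun n => _]eq_fun do rewrite expr2.
by rewrite expr2; exact: cvgM.
Qed.

Lemma Rcint_psum (r : R) c w N : radial r w ->
  Rcint (fun z => modulus (psum c N z) ^+ 2 * w z) =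
  (\sum_(0 <= n < N) (modulus (c n) ^+ 2)%:E * moment w n)%E.
Proof.
move=> [mw w0 wr wz].
have mm (n : nat) : cmeasR (fun z : C => modulus z ^+ (2 * n) * w z).
  by apply: cmeasRM => //; apply: cmeasRX; exact: cmeasR_modulus_id.
have mp : cmeasR (fun z => modulus (psum c N z) ^+ 2 * w z).
  by apply: cmeasRM => //; apply: cmeasRX; exact: cmeasR_modulus (cmeasC_psum _ _).
case: N mp => [|N] mp.
  rewrite big_geq//; transitivity (Rcint (fun z : C => 0 * 0)); last first.
    by rewrite RcintZ ?mul0e//; exact: cmeasR_cst.
  by apply: eq_Rcint => z; rewrite /psum big_ord0 modulus0 expr0n/= !mul0r.
rewrite -(Rcint_average (ltn0Sn N) mp); last by move=> z; rewrite mulr_ge0// exprn_ge0// modulus_ge0.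
transitivity (Rcint (fun z => \sum_(n < N.+1) modulus (c n) ^+ 2 * (modulus z ^+ (2 * n) * w z))).
  apply: eq_Rcint => z.
  rewrite (eq_bigr (fun k : 'I_N.+1 => modulus (psum c N.+1 (unity_root N.+1 ^+ k * z)) ^+ 2 * w z)).
    rewrite -mulr_suml sum_psum_unity_root !mulrA mulVf ?pnatr_eq0// mul1r mulr_suml.
    by apply: eq_bigr => n _; rewrite mulrA.
  by move=> k _; rewrite wr// modulusX modulus_unity_root expr1n.
rewrite Rcint_sum.
- rewrite big_mkord; apply: eq_bigr => n _; rewrite RcintZ ?sqr_ge0//.
  by move=> z; rewrite mulr_ge0// exprn_ge0// modulus_ge0.
- by move=> n; apply: cmeasRM => //; exact: cmeasR_cst.
- move=> n z; apply: mulr_ge0; first exact: sqr_ge0.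
  by apply: mulr_ge0 => //; apply: exprn_ge0; exact: modulus_ge0.
Qed.

Lemma sqr_dist_le (x y E B : R) : 0 <= x -> 0 <= y -> x <= B -> y <= B ->
  `|x - y| <= E -> `|x ^+ 2 - y ^+ 2| <= E * (2 * B).
Proof.
move=> x0 y0 xB yB h; rewrite subr_sqr normrM ler_pM ?normr_ge0//.
by rewrite ger0_norm ?addr_ge0//; lra.
Qed.

(** Both inequalities come from Fatou's lemma. The partial sums tend to [f] and their integrals are
    partial sums of the right side; conversely the averages of [|f|^2 w] over roots of unity tend to
    the full series, and each has the integral of [|f|^2 w]. *)
Theorem parseval f (r : R) c w : has_pseries f 0 r c -> radial r w ->
  Rcint (fun z => modulus (f z) ^+ 2 * w z) =
  (\sum_(0 <= n <oo) (modulus (c n) ^+ 2)%:E * moment w n)%E.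
Proof.
move=> hf rw; have [mw w0 wr wz] := rw.
have mm (n : nat) : cmeasR (fun z : C => modulus z ^+ (2 * n) * w z).
  by apply: cmeasRM => //; apply: cmeasRX; exact: cmeasR_modulus_id.
have mm0 (n : nat) z : 0 <= modulus (z : C) ^+ (2 * n) * w z.
  by rewrite mulr_ge0// exprn_ge0// modulus_ge0.
have mf := cmeasR_pseries hf rw.
have f0 z : 0 <= modulus (f z) ^+ 2 * w z by rewrite mulr_ge0// sqr_ge0.
have S0 n : (0 <= (modulus (c n) ^+ 2)%:E * moment w n)%E.
  by rewrite mule_ge0 ?lee_fin ?sqr_ge0 ?Rcint_ge0.
apply/eqP; rewrite eq_le; apply/andP; split.
  apply: (Rcint_fatou (F := fun n z => modulus (psum c n z) ^+ 2 * w z)) => [n|n z|z|n].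
  - by apply: cmeasRM => //; apply: cmeasRX; exact: cmeasR_modulus (cmeasC_psum _ _).
  - by rewrite mulr_ge0// sqr_ge0.
  - apply/fine_cvgP; split; first exact: nearW.
    have [zr|zr] := ltP (modulus z) r; last first.
      by rewrite wz// mulr0; under [fun n => _]eq_fun do rewrite /= mulr0; exact: cvg_cst.
    apply: cvgMl; under [fun n => _]eq_fun do rewrite expr2.
    rewrite expr2.
    have h : (fun n => modulus (psum c n z)) @ \oo --> modulus (f z); last exact: cvgM.
    have := hf.2 z; rewrite subr0 => /(_ zr) hz.
    apply/cvgrPdist_le => e e0; move/cvgrPdist_le : hz => /(_ e e0).
    apply: filterS => n; rewrite sub0r normrN ger0_norm ?modulus_ge0// => /(le_trans _); apply.
    rewrite ler_norml; have := modulus_sub_le (f z) (psum c n z).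
    have := modulus_sub_le (psum c n z) (f z); rewrite (modulus_distC (psum c n z)); lra.
  - by rewrite (Rcint_psum c n rw); exact: nneseries_lim_ge.
rewrite (_ : limn _ = cint (fun z => \sum_(0 <= n <oo)
    (modulus (c n) ^+ 2 * (modulus z ^+ (2 * n) * w z))%:E)%E); last first.
  have mc n : cmeasR (fun z => modulus (c n) ^+ 2 * (modulus z ^+ (2 * n) * w z)).
    by apply: cmeasRM => //; exact: cmeasR_cst.
  rewrite /cint integral_nneseries//.
  - apply: eq_eseriesr => n _; rewrite -RcintZ ?sqr_ge0//.
  - by move=> n; exact: (cmeas_EFin (mc n)).
  - by move=> n p _; rewrite lee_fin mulr_ge0 ?sqr_ge0.
apply: (Rcint_fatou (F := fun n z => n.+1%:R^-1 *
  \sum_(k < n.+1) (modulus (f (unity_root n.+1 ^+ k * z)) ^+ 2 * w (unity_root n.+1 ^+ k * z)))).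
- move=> n; apply: cmeasRM; first exact: cmeasR_cst.
  apply: cmeasR_sum => k.
  exact: (cmeasR_mul (unity_root n.+1 ^+ k) mf).
- by move=> n z; rewrite mulr_ge0 ?invr_ge0// sumr_ge0.
- move=> z.
  pose A n := n.+1%:R^-1 * \sum_(k < n.+1)
    (modulus (f (unity_root n.+1 ^+ k * z)) ^+ 2 * w (unity_root n.+1 ^+ k * z)).
  rewrite -[X in X @ \oo]/(fun n => (A n)%:E).
  pose S n := \sum_(k < n.+1) modulus (c k) ^+ 2 * (modulus z ^+ (2 * k) * w z).
  have hS : (fun n => (S n)%:E) @ \oo --> (\sum_(0 <= n <oo) (modulus (c n) ^+ 2 * (modulus z ^+ (2 * n) * w z))%:E)%E.
    rewrite (_ : (fun n => (S n)%:E) = fun n => (\sum_(0 <= k < n.+1) (modulus (c k) ^+ 2 * (modulus z ^+ (2 * k) * w z))%:E)%E); last first.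
      by apply/funext => n; rewrite sumEFin big_mkord.
    have := @is_cvg_nneseries R (fun n => (modulus (c n) ^+ 2 * (modulus z ^+ (2 * n) * w z))%:E) xpredT 0.
    move=> /(_ _)/cvg_ex[|l hl]; first by move=> n _ _; rewrite lee_fin mulr_ge0 ?sqr_ge0.
    rewrite (cvg_lim _ hl)//.
    by move: hl; rewrite -(cvg_shiftS (fun n => (\sum_(0 <= k < n) (modulus (c k) ^+ 2 * (modulus z ^+ (2 * k) * w z))%:E)%E)).
  (* By discrete Parseval [S n] is the same average with [f] replaced by its partial sum, so the
     geometric tail on the circle of radius [|z|] bounds the difference. *)
  have hd : (fun n => A n - S n) @ \oo --> (0 : R).
    have [zr|zr] := ltP (modulus z) r; last first.
      apply: (cvg_near_cst 0); apply: nearW => n.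
      rewrite /A /S (eq_bigr (fun=> 0)) => [|k _]; last first.
        by rewrite wr ?wz ?mulr0// modulusX modulus_unity_root expr1n.
      rewrite big1_eq mulr0 sub0r big1 ?oppr0// => k _.
      by rewrite wz ?mulr0.
    pose s := (modulus z + r) / 2.
    have z0 := modulus_ge0 z.
    have zs : modulus z < s by rewrite /s; lra.
    have sr : s < r by rewrite /s; lra.
    have s0 : 0 < s by lra.
    have [M hM] := hf.1 s (introT andP (conj (ltW s0) sr)).
    have M0 : 0 <= M by rewrite (le_trans _ (hM 0%N))// mulr_ge0 ?modulus_ge0 ?exprn_ge0 ?ltW.
    pose t := modulus z / s.
    have t01 : 0 <= t < 1 by rewrite divr_ge0 ?(ltW s0)//= ltr_pdivrMr// mul1r.
    have t1 : 0 < 1 - t by case/andP: t01 => _; rewrite subr_gt0.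
    pose B := M / (1 - t).
    have B0 : 0 <= B by rewrite divr_ge0// ltW.
    have tail u n : modulus u = 1 -> modulus (f (u * z) - psum c n (u * z)) <= B * t ^+ n.
      move=> u1; have uz : modulus (u * z - 0) = modulus z by rewrite subr0 modulusM u1 mul1r.
      have := @pseries_tail _ _ _ _ _ M s (u * z) n hf s0.
      rewrite uz => /(_ zs zr hM); rewrite subr0 => /le_trans; apply.
      by rewrite /B mulrAC.
    have fB u : modulus u = 1 -> modulus (f (u * z)) <= B.
      by move=> u1; have := tail u 0%N u1; rewrite /psum big_ord0 subr0 expr0 mulr1.
    have pB u n : modulus u = 1 -> modulus (psum c n (u * z)) <= B.
      move=> u1; have uz : modulus (u * z) = modulus z by rewrite modulusM u1 mul1r.
      have := @psum_tail_le _ c M s (u * z) 0 n s0; rewrite uz => /(_ zs hM isT).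
      by rewrite /psum big_ord0 subr0 expr0 mulr1.
    apply: (@cvg_geometric_bound _ _ _ (B * (2 * B) * w z) t t01) => n.
    rewrite sub0r normrN.
    have -> : S n = n.+1%:R^-1 * \sum_(k < n.+1) modulus (psum c n.+1 (unity_root n.+1 ^+ k * z)) ^+ 2 * w z.
      rewrite -mulr_suml sum_psum_unity_root !mulrA mulVf ?pnatr_eq0// mul1r mulr_suml.
      by apply: eq_bigr => k _; rewrite mulrA.
    rewrite /A -mulrBr -sumrB normrM ger0_norm ?invr_ge0//.
    rewrite ler_pdivrMl ?ltr0n//.
    rewrite (le_trans (ler_norm_sum _ _ _))//.
    rewrite (le_trans (ler_sum _ (G := fun=> B * (2 * B) * w z * t ^+ n) _))//; last first.
      by rewrite sumr_const card_ord [leRHS]mulr_natl.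
    move=> k _; have u1 : modulus (unity_root n.+1 ^+ k : C) = 1.
      by rewrite modulusX modulus_unity_root expr1n.
    rewrite wr// -mulrBl normrM (ger0_norm (w0 _)) mulrAC ler_wpM2r//.
    apply: (@le_trans _ _ (B * t ^+ n.+1 * (2 * B))).
      apply: sqr_dist_le; rewrite ?modulus_ge0 ?fB ?pB//.
      apply: le_trans (tail _ n.+1 u1).
      rewrite ler_norml; have := modulus_sub_le (f (unity_root n.+1 ^+ k * z)) (psum c n.+1 (unity_root n.+1 ^+ k * z)).
      have := modulus_sub_le (psum c n.+1 (unity_root n.+1 ^+ k * z)) (f (unity_root n.+1 ^+ k * z)).
      rewrite (modulus_distC (psum c n.+1 _)); lra.
    have BB : 0 <= B * (2 * B) by apply: mulr_ge0 => //; exact: mulr_ge0.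
    rewrite mulrAC ler_wpM2l//.
    by rewrite exprS ler_piMl ?exprn_ge0//; case/andP: t01 => // _ /ltW.
  have -> : (fun n => (A n)%:E) = (fun n => ((S n)%:E + (A n - S n)%:E)%E).
    by apply/funext => n; rewrite -EFinD addrC subrK.
  rewrite -[X in _ --> X]adde0; apply: cvgeD => //.
    by rewrite fin_num_adde_defl.
  by apply: cvg_EFin => //; exact: nearW.
- by move=> n; rewrite (Rcint_average (ltn0Sn n) mf f0).
Qed.

End Parseval.

Section Polar.
Context {R : realType}.
Local Notation C := R[i].

Lemma polar_expi (z : C) : modulus z = 1 -> exists2 t, 0 <= t < 2 * pi & z = expi t.
Proof.
case: z => x y z1.
have xy : x ^+ 2 + y ^+ 2 = 1 by have := sqr_modulus (x +i* y); rewrite z1 expr1n/=.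
have x1 : -1 <= x <= 1.
  by rewrite -ler_norml -(ler_pXn2r (n := 2))// ?nnegrE// expr1n real_normK ?num_real//; nra.
have pi0 := @pi_gt0 R.
have cx := acosK x1; have sx := sin_acos x1.
have a0 := acos_ge0 x1; have api := acos_lepi x1.
have yE : Num.sqrt (1 - x ^+ 2) = `|y| by rewrite -xy addrC addKr sqrtr_sqr.
have [y0|y0] := leP 0 y.
  exists (acos x); first by rewrite a0/=; lra.
  by rewrite /expi cx sx yE ger0_norm.
exists (2 * pi - acos x).
  have : acos x != 0.
    apply/eqP => h; move: sx; rewrite h sin0 yE => /esym/eqP.
    by rewrite normr_eq0 => /eqP h'; move: y0; rewrite h' ltxx.
  by move: a0; rewrite le_eqVlt eq_sym => /orP[/eqP->|]; rewrite ?eqxx//; lra.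
have e2 : expi (2 * pi) = 1 :> C by rewrite -[RHS]expi_2pi -(mulr_natr pi 2) mulrC.
by rewrite expiD e2 mul1r -expiJ /expi cx sx yE ltr0_norm//= opprK.
Qed.

Lemma polarP (z : C) : exists2 t, 0 <= t < 2 * pi & z = (modulus z)%:C * expi t.
Proof.
have [->|z0] := eqVneq z 0.
  exists 0; first by rewrite lexx mulr_gt0// pi_gt0.
  by rewrite modulus0 mul0r.
have mz : (modulus z)%:C != 0 :> C.
  by rewrite eq_complex/= negb_and modulus_eq0 z0.
have [t ht E] : exists2 t, 0 <= t < 2 * pi & z / (modulus z)%:C = expi t.
  apply: polar_expi; rewrite modulusM modulusV modulusR ger0_norm ?modulus_ge0//.
  by rewrite divff// modulus_eq0.
by exists t => //; rewrite -E mulrC divfK.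
Qed.

Lemma expi_dist_le (t s : R) :
  modulus (expi t - expi s) <= `|cos t - cos s| + `|sin t - sin s|.
Proof. exact: modulus_le_ReIm. Qed.

Lemma near_expi (t e : R) : 0 < e ->
  \forall x \near t, modulus (expi x - expi t) < e.
Proof.
move=> e0; have e2 : 0 < e / 2 by rewrite divr_gt0.
have := @continuous_cos R t; move/cvgrPdist_lt/(_ _ e2) => hc.
have := @continuous_sin R t; move/cvgrPdist_lt/(_ _ e2) => hs.
near=> x; apply: (le_lt_trans (expi_dist_le _ _)).
have : `|cos t - cos x| < e / 2 by near: x.
have : `|sin t - sin x| < e / 2 by near: x.
by rewrite (distrC (cos t)) (distrC (sin t)); lra.
Unshelve. all: by end_near. Qed.

End Polar.

(** * From local expansions to one Taylor series on the disc *)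

Section GlobalTaylor.
Context {R : realType}.
Local Notation C := R[i].
Implicit Types (f : C -> C) (c e : nat -> C) (r s : R).

Lemma pseries_cvg c r : (forall s, 0 <= s < r -> exists M, forall k, modulus (c k) * s ^+ k <= M) ->
  exists f, has_pseries f 0 r c.
Proof.
move=> h; have /choice[f hf] : forall z : C, exists l : C,
    modulus z < r -> cvc (fun n => psum c n z) l.
  move=> z; have [zr|_] := ltP (modulus z) r; last by exists 0.
  have z0 := modulus_ge0 z; pose s := (modulus z + r) / 2.
  have zs : modulus z < s by rewrite /s; lra.
  have sr : s < r by rewrite /s; lra.
  have s0 : 0 < s by lra.
  have [M hM] := h s (introT andP (conj (ltW s0) sr)).
  have t01 : 0 <= modulus z / s < 1 by rewrite divr_ge0 ?(ltW s0)//= ltr_pdivrMr// mul1r.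
  have [|l hl] := @geometric_series_cvg _ (fun k => c k * z ^+ k) M _ t01; last by exists l.
  move=> k; rewrite modulusM modulusX expr_div_n mulrA ler_pdivlMr ?exprn_gt0//.
  by rewrite mulrAC ler_wpM2r// exprn_ge0.
by exists f; split=> // z; rewrite subr0 => zr; exact: hf.
Qed.

(* Averaging over the N-th roots of unity as N grows gives the Cauchy estimate
   without contour integration. *)
Lemma cauchy_estimate f c r s (M : R) n : has_pseries f 0 r c -> 0 <= s < r ->
  (forall z, modulus z = s -> modulus (f z) <= M) -> modulus (c n) * s ^+ n <= M.
Proof.
move=> hf /andP[s0 sr] fM.
have ms : modulus (s%:C : C) = s by rewrite modulusR ger0_norm.
have M0 : 0 <= M by rewrite (le_trans _ (fM s%:C ms))// modulus_ge0.
pose s' := (s + r) / 2.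
have ss' : s < s' by rewrite /s'; lra.
have s'r : s' < r by rewrite /s'; lra.
have s'0 : 0 < s' by lra.
have [B hB] := hf.1 s' (introT andP (conj (ltW s'0) s'r)).
pose t := s / s'.
have t01 : 0 <= t < 1 by rewrite divr_ge0 ?(ltW s'0)//= ltr_pdivrMr// mul1r.
pose E N := B * t ^+ N / (1 - t).
have hE z N : modulus z = s -> modulus (psum c N z) <= M + E N.
  move=> zs; have := @pseries_tail _ _ _ _ _ B s' z N hf s'0.
  rewrite subr0 zs => /(_ ss' sr hB); rewrite -/t -/(E N) modulus_distC => h.
  by apply: le_trans (modulus_sub_le _ (f z)) _; rewrite lerD// fM.
apply/ler_addgt0Pr => e e0.
have [N nN EN] : exists2 N, (n < N)%N & E N <= e.
  have hz : (fun N => B / (1 - t) * t ^+ N) @ \oo --> (0 : R).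
    rewrite -[X in _ --> X](mulr0 (B / (1 - t))); apply: cvgMr.
    by apply: cvg_expr; case/andP: t01 => ? ?; rewrite ger0_norm.
  move/cvgrPdist_le/(_ _ e0) : hz => [N0 _ hN0].
  exists (maxn N0 n.+1); first by rewrite leq_maxr.
  have := hN0 (maxn N0 n.+1) (leq_maxl _ _); rewrite sub0r normrN => /(le_trans (ler_norm _)).
  by rewrite /E mulrAC.
apply: le_trans (_ : M + E N <= _); last by rewrite lerD2l.
have EN0 : 0 <= M + E N by rewrite (le_trans _ (hE s%:C N ms))// modulus_ge0.
rewrite -(ler_pXn2r (n := 2))// ?nnegrE ?mulr_ge0 ?modulus_ge0 ?exprn_ge0//.
have N0 : 0 < (N%:R : R) by rewrite ltr0n (leq_ltn_trans _ nN).
rewrite -(ler_pM2l N0).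
apply: (@le_trans _ _ (\sum_(k < N) modulus (psum c N (unity_root N ^+ k * s%:C)) ^+ 2)).
  rewrite sum_psum_unity_root ler_wpM2l// (bigD1 (Ordinal nN))//= expr0n/= addr0 sqrtr_sqr.
  rewrite ger0_norm// exprMn -exprM mulnC lerDl; apply: sumr_ge0 => i _.
  by rewrite mulr_ge0// ?sqr_ge0// exprn_ge0.
rewrite (le_trans (ler_sum _ (G := fun=> (M + E N) ^+ 2) _))//.
  move=> k _; rewrite ler_pXn2r// ?nnegrE ?modulus_ge0//; apply: hE.
  by rewrite modulusM modulusX modulus_unity_root expr1n mul1r.
by rewrite sumr_const card_ord [leRHS]mulr_natl.
Qed.

(** Each of the powers [t^k] with [k <= m] is at least [t^m], so the left side is at most a partial
    geometric sum. *)
Lemma succ_expn_bounded (t : R) : 0 <= t < 1 -> exists K, forall m, m.+1%:R * t ^+ m <= K.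
Proof.
move=> /andP[t0 t1]; exists (1 - t)^-1 => m.
have d0 : 0 < 1 - t by rewrite subr_gt0.
have t01 : 0 <= t < 1 by rewrite t0.
apply: le_trans (_ : \sum_(0 <= k < m.+1) t ^+ k <= _).
  rewrite big_mkord (_ : _ * _ = \sum_(k < m.+1) t ^+ m); last by rewrite sumr_const card_ord mulr_natl.
  apply: ler_sum => k _; apply: ler_wiXn2l => //; first exact: ltW.
  by rewrite -ltnS ltn_ord.
by have := sum_geo_le 0 m.+1 t01; rewrite expr0 mul1r.
Qed.

Lemma recenter_coef_lim_le c (h : C) (M s rho t : R) (dk : C) k : 0 < s -> 0 <= rho ->
  0 <= t < 1 -> (modulus h + rho) / s <= t ->
  (forall k, modulus (c k) * s ^+ k <= M) ->
  cvc (fun n => \sum_(i < n) recenter_coef c h k i) dk ->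
  modulus dk * rho ^+ k <= M / (1 - t).
Proof.
move=> s0 rho0 t01 ht hM hd.
have M0 : 0 <= M by rewrite (le_trans _ (hM 0%N))// mulr_ge0 ?modulus_ge0 ?exprn_ge0 ?ltW.
have -> : modulus dk * rho ^+ k = modulus ((rho ^+ k)%:C * dk).
  by rewrite modulusM modulusR ger0_norm ?exprn_ge0// mulrC.
apply: (cvc_le_lim (N := 0) (cvcZ ((rho ^+ k)%:C) hd)) => n _.
rewrite mulr_sumr -(big_mkord xpredT (fun i => _ * recenter_coef c h k i)).
have := @geometric_tail_le _ (fun i => (rho ^+ k)%:C * recenter_coef c h k i) M t 0 n t01.
rewrite expr0 mulr1; apply => i.
rewrite modulusM modulusR ger0_norm ?exprn_ge0// mulrC.
rewrite (le_trans (recenter_coef_le h k i s0 rho0 hM))// ler_wpM2l//.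
rewrite lerXn2r// ?nnegrE; last by case/andP: t01.
by rewrite divr_ge0 ?(ltW s0)// addr_ge0 ?modulus_ge0.
Qed.

(** The constant [7]: with [|a - b| <= r / 4], new radius [r / 2] and comparison radius [7 r / 8],
    the geometric ratio is [(1/4 + 1/2) / (7/8) = 6/7]. *)
Lemma pseries_recenter_uniform f b a r e (M : R) : 0 < r -> has_pseries f b r e ->
  (forall k, modulus (e k) * r ^+ k <= M) -> modulus (a - b) <= r / 4 ->
  exists d, has_pseries f a (r / 2) d /\ forall k, modulus (d k) * (r / 2) ^+ k <= M * 7.
Proof.
move=> r0 hf hM ab.
have s0 : 0 < r * 7 / 8 by lra.
have hM' k : modulus (e k) * (r * 7 / 8) ^+ k <= M.
  rewrite (le_trans _ (hM k))// ler_wpM2l ?modulus_ge0// lerXn2r// ?nnegrE; lra.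
have abr : modulus (a - b) < r by lra.
have [d [hd dE]] := pseries_recenter hf abr.
exists d; split; first by apply: has_pseriesW hd; lra.
move=> k; have -> : M * 7 = M / (1 - 6 / 7) by field.
apply: (recenter_coef_lim_le s0 _ _ _ hM' (dE k)); first by lra.
  by apply/andP; split; lra.
by rewrite ler_pdivrMr//; lra.
Qed.

(* Weierstrass: if every recentring of the series on the circle of radius [s]
   has coefficients at most [M / d ^ k], then the Cauchy estimate applied to the
   [k]-th derivative, summed against the binomial formula, bounds
   [|c m| (s + d) ^ m] by [M (m + 1)]. *)
Lemma pseries_extend f c r s d (M : R) : has_pseries f 0 r c -> 0 < s < r -> 0 < d ->
  (forall a, modulus a = s -> exists e, has_pseries f a d e /\
     forall k, modulus (e k) * d ^+ k <= M) ->
  has_pseries f 0 (s + d) c.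
Proof.
move=> hf /andP[s0 sr] d0 H.
have hc k m : 'C(m + k, k)%:R * modulus (c (m + k)%N) * s ^+ m * d ^+ k <= M.
  pose ck m := c (m + k)%N * 'C(m + k, k)%:R : C.
  have rc (z : C) : modulus z < r -> exists l, cvc (fun n => psum ck n z) l /\
     (modulus z = s -> modulus l * d ^+ k <= M).
    move=> zr; have zr' : modulus (z - 0) < r by rewrite subr0.
    have [e' [he' /(_ k)]] := pseries_recenter hf zr'.
    rewrite subr0 in he' * => hk; exists (e' k); split.
      move: hk; rewrite /cvc -(cvg_shiftn k) => hk.
      apply: eq_cvc hk => n; rewrite /psum.
      rewrite -(big_mkord xpredT (recenter_coef c z k)) (@big_cat_nat _ _ _ k 0 (n + k)) ?leq_addl//=.
      rewrite big1_seq ?add0r; last first.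
        move=> i; rewrite mem_index_iota => /andP[_ /andP[_ ik]].
        by rewrite /recenter_coef bin_small// mulr0 mul0r.
      rewrite -{1}(add0n k) big_addn addnK big_mkord; apply: eq_bigr => i _.
      by rewrite /recenter_coef /ck addnK.
    move=> zs; have [e [he eM]] := H z zs.
    have rs0 : 0 < r - modulus z by rewrite subr_gt0.
    by rewrite (pseries_uniq rs0 d0 (fun _ _ _ => erefl) he' he).
  have /choice[g hg] : forall z : C, exists l, modulus z < r -> cvc (fun n => psum ck n z) l /\
     (modulus z = s -> modulus l * d ^+ k <= M).
    move=> z; have [zr|_] := ltP (modulus z) r; last by exists 0.
    by have [l hl] := rc z zr; exists l.
  have hg' : has_pseries g 0 r ck.
    by apply: has_pseriesP => z; rewrite subr0 => zr; exact: (hg z zr).1.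
  have s0r : 0 <= s < r by rewrite ltW.
  have -> : 'C(m + k, k)%:R * modulus (c (m + k)%N) = modulus (ck m).
    by rewrite /ck modulusM modulus_nat mulrC.
  rewrite -ler_pdivlMr ?exprn_gt0//.
  apply: (@cauchy_estimate g ck r s (M / d ^+ k) m hg' s0r).
  move=> z zs; rewrite ler_pdivlMr ?exprn_gt0//; apply: (hg z _).2 => //.
  by rewrite zs.
have hb m : modulus (c m) * (s + d) ^+ m <= M * m.+1%:R.
  rewrite exprDn mulr_sumr.
  rewrite (le_trans (ler_sum _ (G := fun=> M) _))//.
    move=> i _; have im : (i <= m)%N by rewrite -ltnS ltn_ord.
    have := hc i (m - i)%N; rewrite subnK//.
    by rewrite -[_ *+ _]mulr_natl; lra.
  by rewrite sumr_const card_ord -[leLHS]mulr_natr.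
have M0 : 0 <= M by rewrite (le_trans _ (hc 0%N 0%N))// !mulr_ge0 ?modulus_ge0 ?exprn_ge0 ?ltW.
have [F hF] : exists F, has_pseries F 0 (s + d) c.
  apply: pseries_cvg => t /andP[t0 ts].
  have sd : 0 < s + d by lra.
  have tt : 0 <= t / (s + d) < 1 by rewrite divr_ge0 ?(ltW sd)//= ltr_pdivrMr// mul1r.
  have [K hK] := succ_expn_bounded tt; exists (M * K) => m.
  have -> : modulus (c m) * t ^+ m = (modulus (c m) * (s + d) ^+ m) * (t / (s + d)) ^+ m.
    rewrite expr_div_n; field; by rewrite expf_neq0// gt_eqF.
  rewrite (le_trans (ler_wpM2r _ (hb m)))// ?exprn_ge0//; first by case/andP: tt.
  by rewrite -mulrA ler_wpM2l.
have Ff z : modulus z < r -> modulus z < s + d -> F z = f z.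
  move=> z1 z2; have := hF.2 z; have := hf.2 z; rewrite subr0 => /(_ z1) h1 /(_ z2) h2.
  exact: cvc_uniq h2 h1.
apply: (eq_has_pseries _ hF) => z; rewrite subr0 => zsd.
have [zr|rz] := ltP (modulus z) r; first exact: Ff.
(* Beyond radius [r], the point [z] lies within [d] of the point [a] of modulus [s] on its ray. Near
   [a] the sum [F] equals [f], so both have the same expansion at [a], and this expansion reaches
   [z]. *)
have [t _ zE] := polarP z.
pose a : C := s%:C * expi t.
have as_ : modulus a = s by rewrite modulusM modulus_expi mulr1 modulusR ger0_norm// ltW.
have [e [he eM]] := H a as_.
have asd : modulus (a - 0) < s + d by rewrite subr0 as_ ltrDl.
have [e' [he' _]] := pseries_recenter hF asd.
rewrite subr0 as_ addrC addKr in he'.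
have rs0 : 0 < Num.min d (r - s) by rewrite lt_min d0 subr_gt0.
have ee' : e = e'.
  apply: (@pseries_uniq _ f F a (Num.min d (r - s)) d _ _ rs0 d0 _ _ he').
    move=> y ya _; apply/esym; apply: Ff.
      have := modulus_distD y 0 a; rewrite !subr0 as_.
      by move: ya; rewrite lt_min => /andP[_]; lra.
    have := modulus_distD y 0 a; rewrite !subr0 as_.
    by move: ya; rewrite lt_min => /andP[+ _]; lra.
  by apply: has_pseriesW he; rewrite ge_min lexx.
have za : modulus (z - a) < d.
  rewrite zE /a -mulrBl -raddfB modulusM modulus_expi mulr1 modulusR ger0_norm; lra.
have h1 := he'.2 z za; have h2 := he.2 z za; rewrite ee' in h2.
exact: cvc_uniq h1 h2.
Qed.

(** Let [rho] be the supremum of the radii up to which the series at [0] represents [f]. If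
    [rho < 1], compactness of the circle of radius [rho] gives local expansions with a common radius
    and bound, and [pseries_extend] then passes [rho]. *)
Theorem analytic_taylor f : analytic_on_disc f -> exists c, has_pseries f 0 1 c.
Proof.
move=> hf.
have loc z0 : disc z0 -> exists r c, 0 < r /\ has_pseries f z0 r c.
  move=> /hf[r [c [r0 hc]]]; exists r, c; split=> //; apply: has_pseriesP => z zr.
  have /cvcP := hc z zr; apply: eq_cvc => n.
  by rewrite /series/= /psum big_mkord.
have [r0 [c [r00 hc]]] : exists r c, 0 < r /\ has_pseries f 0 r c.
  by apply: loc; rewrite /disc/= expr0n/= addr0 sqrtr0.
exists c.
pose A := [set r : R | 0 < r <= 1 /\ has_pseries f 0 r c].
have A0 : A (Num.min r0 1).
  split; first by rewrite lt_min r00 ltr01 ge_min lexx orbT.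
  by apply: has_pseriesW hc; rewrite ge_min lexx.
have supA : has_sup A.
  by split; [exists (Num.min r0 1)|exists 1 => x [/andP[]]].
pose rho := sup A.
have rho0 : 0 < rho.
  by apply: lt_le_trans (ub_le_sup supA.2 A0); rewrite lt_min r00 ltr01.
have rho1 : rho <= 1 by apply: ge_sup => //; [exact: supA.1|move=> x [/andP[]]].
have hrho : has_pseries f 0 rho c.
  apply: has_pseriesP => z; rewrite subr0 => zr.
  have e0 : 0 < rho - modulus z by rewrite subr_gt0.
  have [r [_ hr] zr'] := sup_adherent e0 supA.
  have := hr.2 z; rewrite subr0; apply; rewrite -/rho in zr'; lra.
have [->//|rho1'] := eqVneq 1 rho.
have {rho1'}rho1' : rho < 1 by rewrite lt_neqAle eq_sym rho1' rho1.
have [i hi] : exists i : nat, forall t, 0 <= t <= 2 * pi -> exists e,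
    has_pseries f (rho%:C * expi t) i.+1%:R^-1 e /\
    forall k, modulus (e k) * i.+1%:R^-1 ^+ k <= i%:R.
  (* One integer [i] gives both the radius [1 / (i + 1)] and the bound [i], so that compactness can
     be applied along [\oo]. *)
  pose P (i : nat) t := exists e, has_pseries f (rho%:C * expi t) i.+1%:R^-1 e /\
    forall k, modulus (e k) * i.+1%:R^-1 ^+ k <= i%:R.
  have /compact_near_coveringP/(_ nat \oo P) := @segment_compact R 0 (2 * pi).
  case=> [t|N _ hN]; last by exists N => t ht; apply: (hN N) => //=; rewrite in_itv.
  move=> _; have db : disc (rho%:C * expi t).
    by rewrite /disc /mkset modulusM modulus_expi mulr1 modulusR ger0_norm// ltW.
  have [r [e [r_gt0 he]]] := loc _ db.
  have [r2 rr2] : 0 < r / 2 /\ r / 2 < r by lra.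
  have [M hM] := he.1 _ (introT andP (conj (ltW r2) rr2)).
  have r16 : 0 < r / 8 by lra.
  exists ([set u | modulus (expi u - expi t : C) < r / 8],
    [set i : nat | i.+1%:R^-1 <= r / 4 /\ M * 7 <= i%:R]).
    split=> /=; first exact: near_expi.
    near=> n; split.
      near: n; have r4 : 0 < r / 4 by lra.
      by apply: filterS (near_infty_natSinv_lt (PosNum r4)) => n /= /ltW.
    by near: n; exact: nbhs_infty_ger.
  move=> [u n]/= [hu [hn1 hn2]].
  have ub : modulus (rho%:C * expi u - rho%:C * expi t : C) <= r / 2 / 4.
    rewrite -mulrBr modulusM modulusR ger0_norm ?(ltW rho0)//.
    rewrite (le_trans (ler_wpM2l (ltW rho0) (ltW hu)))//; nra.
  have [d [hd hdM]] := pseries_recenter_uniform r2 (has_pseriesW (ltW rr2) he) hM ub.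
  have hn : n.+1%:R^-1 <= r / 2 / 2 by apply: (le_trans hn1); lra.
  exists d; split; first exact: has_pseriesW hd.
  move=> k; apply: le_trans hn2; apply: le_trans (hdM k).
  by rewrite ler_wpM2l ?modulus_ge0// lerXn2r// nnegrE ?invr_ge0//; lra.
pose r : R := i.+1%:R^-1; have r_gt0 : 0 < r by rewrite invr_gt0.
(* The circle of radius [rho - q] stays within [r / 4] of the circle of radius [rho], while
   [rho - q + r / 2] exceeds [rho]. *)
pose q := Num.min (r / 8) (rho / 2).
have q0 : 0 < q by rewrite lt_min !divr_gt0.
have q1 : q <= r / 8 by rewrite ge_min lexx.
have q2 : q <= rho / 2 by rewrite ge_min lexx orbT.
clearbody q.
have ext : has_pseries f 0 ((rho - q) + r / 2) c.
  apply: (@pseries_extend f c rho (rho - q) (r / 2) (i%:R * 7) hrho); [lra|lra|].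
  move=> a aE; have [t /andP[t0 t1] atE] := polarP a.
  have [|e [he hM]] := hi t; first by rewrite t0 ltW.
  apply: (pseries_recenter_uniform r_gt0 he hM).
  rewrite atE aE -mulrBl -raddfB modulusM modulus_expi mulr1 modulusR.
  by rewrite (_ : rho - q - rho = - q) ?normrN ?gtr0_norm//; [lra|ring].
have : Num.min (rho - q + r / 2) 1 <= rho.
  apply: (ub_le_sup supA.2); split.
    by rewrite lt_min ltr01 ge_min lexx orbT andbT; lra.
  by apply: has_pseriesW ext; rewrite ge_min lexx.
by rewrite ge_min => /orP[|]; lra.
Unshelve. all: by end_near. Qed.
End GlobalTaylor.

(** * Radial integrals and moments *)

Section DiscArea.
Context {R : realType}.
Local Notation C := R[i].
Local Notation M := (measurableTypeR R).
Local Notation leb := (@lebesgue_measure R).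

Definition cmeasS (A : set C) := measurable (to_complex @^-1` A : set (M * M)).

Lemma cmeasR_indic (A : set C) : cmeasS A -> cmeasR (\1_A : C -> R).
Proof.
move=> mA; rewrite /cmeasR.
rewrite (_ : (fun p => _) = (\1_(to_complex @^-1` A) : M * M -> R)); first exact: measurable_indic.
by apply/funext => p; rewrite !indicE.
Qed.

Lemma Rcint_indic (A : set C) : cmeasS A -> Rcint (\1_A : C -> R) = area A.
Proof.
move=> mA; have := area_integralE A (fun=> 1 : R).
rewrite (eq_Rcint (G := \1_A)) => [<-|z]; last by rewrite mul1r.
by rewrite /area_integral integral_cst// mul1e.
Qed.

Lemma cmeasS_preimage (F : C -> R) (B : set M) : cmeasR F -> measurable B ->
  cmeasS (F @^-1` B).
Proof. by move=> mF mB; rewrite /cmeasS; have := mF measurableT B mB; rewrite setTI. Qed.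

Definition sqmod (z : C) : R := modulus z ^+ 2.

Lemma cmeasR_sqmod : cmeasR sqmod.
Proof. by apply: cmeasRX; exact: cmeasR_modulus_id. Qed.

Lemma sqmodE (z : C) : sqmod z = complex.Re z ^+ 2 + complex.Im z ^+ 2.
Proof. exact: sqr_modulus. Qed.

(** The parameter is the squared radius, in which area is linear. *)
Definition cdisc (s : R) : set C := sqmod @^-1` `]-oo, s].

Lemma cmeasS_cdisc s : cmeasS (cdisc s).
Proof. exact: cmeasS_preimage cmeasR_sqmod _. Qed.

Lemma cdiscE s z : (z \in cdisc s) = (sqmod z <= s).
Proof. by apply/idP/idP => [/set_mem|h]; [|apply/mem_set]; rewrite /cdisc/= in_itv. Qed.

Lemma area_rectangle (a b : R) : a < b ->
  (@plane_measure R (`[a, b] `*` `[a, b])%classic = (pi^-1 * (b - a) ^+ 2)%:E)%E.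
Proof.
move=> ab; rewrite /plane_measure /= /mscale/= product_measure1E//=.
rewrite !lebesgue_measure_itv/= lte_fin ab -EFinB -!EFinM.
by congr EFin; rewrite expr2.
Qed.

Lemma area_cdisc1_gt0 : (0 < area (cdisc 1))%E.
Proof.
apply: (@lt_le_trans _ _ (@plane_measure R (`[0%R, 2^-1] `*` `[0%R, 2^-1])%classic)).
  by rewrite area_rectangle// lte_fin mulr_gt0 ?invr_gt0 ?pi_gt0// exprn_gt0//; lra.
apply: le_measure; rewrite ?inE//.
- exact: measurableX.
- exact: cmeasS_cdisc.
- move=> [x y]/= []/=; rewrite !in_itv/= /cdisc/= in_itv/= sqmodE/= => /andP[x0 x1] /andP[y0 y1].
  nra.
Qed.

Lemma area_cdisc1_lty : (area (cdisc 1) < +oo)%E.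
Proof.
apply: (@le_lt_trans _ _ (@plane_measure R (`[-1, 1] `*` `[-1, 1])%classic)).
  apply: le_measure; rewrite ?inE//.
  - exact: cmeasS_cdisc.
  - exact: measurableX.
  - move=> [x y]/=; rewrite /cdisc/= in_itv/= sqmodE/= => h; split=> /=; rewrite in_itv/=; apply/andP; split; nra.
by rewrite area_rectangle ?ltry//; lra.
Qed.

(** Kept as an unevaluated positive constant; comparison of the unit disc with two squares shows
    that it is positive and finite. *)
Definition kappa : R := fine (area (cdisc 1 : set C)).

Lemma kappaE : area (cdisc 1) = kappa%:E.
Proof. by rewrite fineK// ge0_fin_numE ?area_cdisc1_lty// ltW// area_cdisc1_gt0. Qed.

Lemma kappa_gt0 : 0 < kappa.
Proof. by rewrite -lte_fin -kappaE area_cdisc1_gt0. Qed.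

Lemma area_cdisc s : 0 < s -> area (cdisc s) = (s * kappa)%:E.
Proof.
move=> s0; rewrite -Rcint_indic; last exact: cmeasS_cdisc.
have sq0 : 0 < (Num.sqrt s)^-1 by rewrite invr_gt0 sqrtr_gt0.
rewrite (eq_Rcint (G := fun z => (\1_(cdisc 1) : C -> R) ((Num.sqrt s)^-1%:C * z))); last first.
  move=> z; rewrite !indicE !cdiscE; congr (_%:R); congr nat_of_bool.
  rewrite /sqmod modulusM modulusR exprMn gtr0_norm// exprVn sqr_sqrtr ?(ltW s0)//.
  by rewrite ler_pdivrMl// mulr1.
rewrite Rcint_mul//; last 2 first.
- by rewrite eq_complex/= negb_and gt_eqF.
- by apply: cmeasR_indic; exact: cmeasS_cdisc.
rewrite Rcint_indic ?kappaE; last exact: cmeasS_cdisc.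
rewrite modulusR gtr0_norm// -EFinM; congr EFin; congr (_ * _).
by rewrite exprVn invrK sqr_sqrtr// ltW.
Qed.

Lemma area_cdisc0 : area (cdisc 0) = 0%E.
Proof.
apply/eqP; rewrite eq_le measure_ge0 andbT; apply/lee_addgt0Pr => e e0; rewrite add0e.
have k0 := kappa_gt0.
have d0 : 0 < e / kappa by rewrite divr_gt0.
have <- : area (cdisc (e / kappa)) = e%:E by rewrite area_cdisc// divfK// gt_eqF.
apply: le_measure; rewrite ?inE; [exact: cmeasS_cdisc|exact: cmeasS_cdisc|].
by move=> p /=; rewrite /cdisc/= !in_itv/= => /le_trans; apply; exact: ltW.
Qed.

Lemma area_cdisc_max s : area (cdisc s) = (Num.max s 0 * kappa)%:E.
Proof.
have [s0|s0|->] := ltgtP s 0.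
- rewrite mul0r (_ : cdisc s = set0) ?/area ?preimage_set0 ?measure0//.
  apply/seteqP; split=> // z; rewrite /cdisc/= in_itv/= => h.
  by have := sqr_ge0 (modulus z); rewrite -/(sqmod z); lra.
- exact: area_cdisc.
- by rewrite mul0r area_cdisc0.
Qed.

Lemma area_sqmod_itv (u v : R) : u < v ->
  area (sqmod @^-1` `]u, v]) = ((Num.max v 0 - Num.max u 0) * kappa)%:E.
Proof.
move=> uv; have -> : (sqmod @^-1` `]u, v] = cdisc v `\` cdisc u)%classic.
  apply/seteqP; split=> z; rewrite /cdisc/= !in_itv/=.
    by move=> /andP[h1 h2]; split=> //; apply/negP; rewrite -ltNge.
  by move=> [h1 /negP]; rewrite -ltNge => h2; rewrite h1 h2.
rewrite /area -[to_complex @^-1` _]/(to_complex @^-1` cdisc v `\` to_complex @^-1` cdisc u) measureD.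
- rewrite (_ : _ `&` _ = to_complex @^-1` cdisc u).
    by rewrite -[LHS]/(area (cdisc v) - area (cdisc u))%E !area_cdisc_max mulrBl EFinB.
  rewrite -preimage_setI; congr (_ @^-1` _); apply/seteqP; split=> z; first by case.
  by rewrite /cdisc/= !in_itv/= => h; split=> //; apply: le_trans h _; exact: ltW.
- exact: cmeasS_cdisc.
- exact: cmeasS_cdisc.
- by rewrite -[X in (X < _)%E]/(area (cdisc v)) area_cdisc_max ltry.
Qed.

Lemma mfun_sqmod : measurable_fun [set: M * M] ((fun p => sqmod (to_complex p)) : M * M -> M).
Proof. exact: cmeasR_sqmod. Qed.

(* [sqmod] transports the area of the plane to a multiple of Lebesgue measure
   on the half-line; on the negative half-line Lebesgue measure is added by
   hand, so that the uniqueness theorem applies on the whole line. *)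
Lemma pushforward_sqmod (A : set M) : measurable A -> A `<=` `[0, +oo[%classic ->
  (leb A = kappa^-1%:E * area (sqmod @^-1` A))%E.
Proof.
move=> mA A0; have k0 := kappa_gt0; have ki : 0 <= kappa^-1 by rewrite invr_ge0 ltW.
have mneg : measurable (`]-oo, 0%R[%classic : set M) by exact: measurable_itv.
pose nu0 : {measure set M -> \bar R} := measure_add
  (mscale (NngNum ki) (pushforward (@plane_measure R) ((fun p => sqmod (to_complex p)) : M * M -> M)))
  (mrestr leb mneg).
pose nu := nu0 mfun_sqmod.
have nuE B : nu B = (kappa^-1%:E * area (sqmod @^-1` B) + leb (B `&` `]-oo, 0%R[%classic))%E.
  exact: measure_addE.
transitivity (nu A).
  apply: (@lebesgue_measure_unique _ nu) => // _ [[u v]] _ <-.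
  rewrite nuE.
  have [uv|vu] := ltP u v; last first.
    by rewrite set_itv_ge ?bnd_simp -?leNgt// preimage_set0 set0I /area preimage_set0 !measure0 mule0 adde0.
  rewrite area_sqmod_itv// -EFinM mulrC mulfK ?gt_eqF//.
  have [v0|v0] := ltP v 0.
    have u0 := lt_trans uv v0.
    rewrite (_ : `]u, v] `&` `]-oo, 0%R[ = `]u, v])%classic; last first.
      apply/seteqP; split=> x /=; first by case.
      by rewrite !in_itv/= => /andP[x1 x2]; rewrite x1 x2 (le_lt_trans x2).
    rewrite !lebesgue_measure_itv/= lte_fin uv.
    by rewrite !max_r ?(ltW v0) ?(ltW u0)// subrr add0e.
  rewrite (_ : `]u, v] `&` `]-oo, 0%R[ = `]u, 0%R[)%classic; last first.
    apply/seteqP; split=> x /=; rewrite !in_itv/=; first by move=> [/andP[-> _] ->].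
    by move=> /andP[x1 x2]; rewrite x1 x2 (le_trans (ltW x2) v0).
  rewrite !lebesgue_measure_itv/= !lte_fin uv.
  have [u0|u0] := ltP u 0; last by rewrite adde0.
  by rewrite -!EFinD; congr EFin; rewrite add0r subr0.
rewrite nuE (_ : A `&` _ = set0) ?measure0 ?adde0//.
apply/seteqP; split=> // x [/A0]/=; rewrite !in_itv/= andbT => h1 h2; lra.
Qed.

(** Polar coordinates for radial integrands: in the variable [t = |z|^2] the area becomes [kappa dt]
    on the half-line. *)
Lemma Rcint_sqmod (h : M -> R) : measurable_fun [set: M] h -> (forall x, 0 <= h x) ->
  (Rcint (fun z => h (sqmod z)) = kappa%:E * \int[leb]_(t in `[0%R, +oo[) (h t)%:E)%E.
Proof.
move=> mh h0; have k0 := kappa_gt0; have ki : 0 <= kappa^-1 by rewrite invr_ge0 ltW.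
have mh' : measurable_fun [set: M] (fun t => (h t)%:E) by exact/measurable_EFinP.
pose pf0 : {measure set M -> \bar R} :=
  pushforward (@plane_measure R) ((fun p => sqmod (to_complex p)) : M * M -> M).
pose pf := pf0 mfun_sqmod.
pose nu : {measure set M -> \bar R} := mscale (NngNum ki) pf.
have -> : (\int[leb]_(t in `[0%R, +oo[) (h t)%:E = \int[nu]_(t in `[0%R, +oo[) (h t)%:E)%E.
  by apply: eq_measure_integral => A mA A0; exact: (pushforward_sqmod mA A0).
have mI : measurable (`[0%R, +oo[%classic : set M) by exact: measurable_itv.
have mhI : measurable_fun (`[0%R, +oo[%classic : set M) (fun t => (h t)%:E).
  exact: measurable_funTS.
have E1 : (\int[nu]_(t in `[0%R, +oo[) (h t)%:E =
    kappa^-1%:E * \int[pf]_(t in `[0%R, +oo[) (h t)%:E)%E.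
  by apply: (@ge0_integral_mscale _ _ _ pf _ mI (NngNum ki) _ mhI) => t _; rewrite lee_fin.
have E2 : (\int[pf]_(t in `[0%R, +oo[) (h t)%:E = Rcint (fun z => h (sqmod z)))%E.
  rewrite /pf /pf0 (@ge0_integral_pushforward _ _ _ _ _ _ mfun_sqmod)//.
    rewrite (_ : _ @^-1` _ = setT)//.
    by apply/seteqP; split=> // p _ /=; rewrite in_itv/= andbT /sqmod sqr_ge0.
  by move=> t _; rewrite lee_fin.
by rewrite E1 E2 muleA -EFinM divff ?gt_eqF// mul1e.
Qed.

End DiscArea.

Section PowerIntegral.
Context {R : realType}.
Local Notation M := (measurableTypeR R).
Local Notation leb := (@lebesgue_measure R).

Lemma is_derive_powR_primitive (b u : R) : b + 1 != 0 -> 0 < u ->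
  is_derive u 1 (fun v => (b + 1)^-1 * v `^ (b + 1)) (u `^ b).
Proof.
move=> b0 u0.
have h : is_derive u 1 (@powR R ^~ (b + 1)) ((b + 1) * u `^ (b + 1 - 1)).
  exact: is_derive1_powR.
have := is_deriveZ (b + 1)^-1 h.
rewrite [_ *: (_ * _)]mulrA mulVf// mul1r addrK.
exact.
Qed.

Lemma powR_integral_compact (b e x : R) : b + 1 != 0 -> 0 < e < x ->
  (\int[leb]_(u in `[e, x]) (u `^ b)%:E =
   ((b + 1)^-1 * x `^ (b + 1) - (b + 1)^-1 * e `^ (b + 1))%:E)%E.
Proof.
move=> b0 /andP[e0 ex]; have x0 := lt_trans e0 ex.
have cF (v : R) : 0 < v -> {for v, continuous (fun v => (b + 1)^-1 * v `^ (b + 1))}.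
  move=> v0; apply/differentiable_continuous/derivable1_diffP.
  by have [] := is_derive_powR_primitive b0 v0.
rewrite (@continuous_FTC2 _ (fun u => u `^ b) (fun v => (b + 1)^-1 * v `^ (b + 1)) e x ex)//.
- apply: derivable_within_continuous => v; rewrite in_itv/= => /andP[ev _].
  by apply: derivable_powR; rewrite in_itv/= andbT (lt_le_trans e0).
- split=> [v|  |].
  + rewrite in_itv/= => /andP[ev _].
    by have [] := is_derive_powR_primitive b0 (lt_trans e0 ev).
  + by apply: cvg_at_right_filter; exact: cF.
  + by apply: cvg_at_left_filter; exact: cF.
- move=> v; rewrite in_itv/= => /andP[ev _]; rewrite derive1E.
  by have [_ ->] := is_derive_powR_primitive b0 (lt_trans e0 ev).
Qed.

Lemma powR_integral (b x : R) : -1 < b -> 0 < x ->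
  (\int[leb]_(u in `]0%R, x[) (u `^ b)%:E = (x `^ (b + 1) / (b + 1))%:E)%E.
Proof.
move=> b1 x0; have bp : 0 < b + 1 by lra.
have b0 : b + 1 != 0 by rewrite gt_eqF.
have mp (A : set M) : measurable_fun A (fun u : M => (u `^ b)%:E).
  by apply/measurable_EFinP/measurable_funTS; exact: measurable_powR.
rewrite (integral_itv_bndo_bndc (a := BRight 0))//; last exact: mp.
(* The integrand may be unbounded at [0], so the interval is exhausted from the left; [k.+2] keeps
   the left end strictly below [x]. *)
pose F (k : nat) : set M := `[x / k.+2%:R, x]%classic.
have UF : \bigcup_k F k = `]0, x]%classic.
  apply/seteqP; split=> u /=.
    move=> [k _]; rewrite /F/= !in_itv/= => /andP[h1 ->]; rewrite andbT.
    by apply: lt_le_trans h1; rewrite divr_gt0.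
  rewrite in_itv/= => /andP[u0 ux].
  have ux0 : 0 < u / x by rewrite divr_gt0.
  have [N _ /(_ N (leqnn N))/ltW hN] := near_infty_natSinv_lt (PosNum ux0).
  exists N => //; rewrite /F/= in_itv/= ux andbT.
  rewrite ler_pdivrMr// -ler_pdivrMl// mulrC.
  apply: le_trans (_ : N.+1%:R <= _); last by rewrite ler_nat.
  by rewrite -[leRHS]invrK -[leLHS]invrK lef_pV2 ?posrE ?invr_gt0 ?divr_gt0// invf_div.
rewrite -UF.
have := @ge0_nondecreasing_set_cvg_integral _ M R F (fun u => (u `^ b)%:E) leb.
move=> /(_ _ _ _ _)/cvg_lim <-//; last 3 first.
- apply/nondecreasing_seqP => k; rewrite subsetEset => u; rewrite /F/= !in_itv/= => /andP[h ->].
  rewrite andbT (le_trans _ h)// ler_pM2l// lef_pV2 ?posrE// ler_nat//.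
- by move=> k; exact: measurable_itv.
- by move=> k u _; rewrite lee_fin powR_ge0.
apply/cvg_lim => //.
rewrite (_ : (fun i => _) = (fun k : nat => ((b + 1)^-1 * x `^ (b + 1) -
    (b + 1)^-1 * (x / k.+2%:R) `^ (b + 1))%:E)); last first.
  apply/funext => k; rewrite powR_integral_compact// divr_gt0//= ltr_pdivrMr// ltr_pMr//.
  by rewrite ltr1n.
apply: cvg_EFin; first exact: nearW.
rewrite mulrC -[X in _ --> X]subr0; apply: cvgB; first exact: cvg_cst.
rewrite -[X in _ --> X](mulr0 (b + 1)^-1); apply: cvgMr.
have -> : (fun k : nat => (x / k.+2%:R) `^ (b + 1)) =
   (@powR R ^~ (b + 1)) \o (fun k : nat => x / k.+2%:R) by [].
apply: cvg_comp (powR_cvg0 bp).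
move=> A [e /= e0 he].
have ex0 : 0 < e / x by rewrite divr_gt0.
have := near_infty_natSinv_lt (PosNum ex0); apply: filterS => k /=.
rewrite ltr_pdivlMr// mulrC => h; apply: he => /=; last by rewrite divr_gt0.
rewrite sub0r normrN gtr0_norm ?divr_gt0//; apply: le_lt_trans h.
by rewrite ler_pM2l// lef_pV2 ?posrE// ler_nat.
Qed.

End PowerIntegral.

Section Moments.
Context {R : realType}.
Local Notation C := R[i].
Local Notation M := (measurableTypeR R).
Local Notation leb := (@lebesgue_measure R).
Implicit Types (b : R).

Lemma indic_itvE (i : interval R) (t : R) : (\1_[set` i] t : R) = (t \in i)%:R.
Proof. by rewrite indicE; congr (_%:R); congr nat_of_bool; apply/idP/idP => [/set_mem|h]; [|apply/mem_set]. Qed.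

Lemma measurable_indic_itv (i : interval R) : measurable_fun [set: M] (\1_[set` i] : M -> R).
Proof. by apply: measurable_indic; exact: measurable_itv. Qed.

Lemma integral_indic_itv (i : interval R) (h : M -> R) :
  (\int[leb]_t (h t * \1_[set` i] t)%:E = \int[leb]_(t in [set` i]) (h t)%:E)%E.
Proof.
rewrite [RHS]integral_mkcond; apply: eq_integral => t _.
by rewrite patchE indicE; case: (t \in _); rewrite ?mulr1 ?mulr0.
Qed.

(** The integrand of Euler's [B(n + 1, b + 1)], extended by [0] to the whole line. *)
Definition beta_fun n b (t : M) : R := t ^+ n * (1 - t) `^ b * \1_`]0, 1[%classic t.

Definition beta_int n b : \bar R := (\int[leb]_t (beta_fun n b t)%:E)%E.

Lemma measurable_powR1B b : measurable_fun [set: M] (fun t : M => (1 - t) `^ b).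
Proof.
apply: (measurableT_comp (f := @powR R ^~ b)); first exact: measurable_powR.
by apply: measurable_funB; [exact: measurable_cst|exact: measurable_id].
Qed.

Lemma measurable_beta_fun n b : measurable_fun [set: M] (beta_fun n b).
Proof.
apply: measurable_funM; last exact: measurable_indic_itv.
apply: measurable_funM; last exact: measurable_powR1B.
exact: measurable_funX.
Qed.

Lemma beta_fun_ge0 n b t : 0 <= beta_fun n b t.
Proof.
rewrite /beta_fun indic_itvE in_itv/=; case: ltP => t0; rewrite ?mulr0//.
by rewrite !mulr_ge0 ?exprn_ge0 ?powR_ge0// ltW.
Qed.

(** Integration by parts in the form of Tonelli: [s^n (1 - t)^b] is integrated over [0 < s < t < 1]
    in both orders. *)
Lemma beta_int_rec n b : -1 < b ->
  ((b + 1)%:E * beta_int n.+1 b = n.+1%:R%:E * beta_int n (b + 1))%E.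
Proof.
move=> b1; have bp : 0 < b + 1 by lra.
pose S (s : M) : R := s ^+ n * \1_`]0, 1[%classic s.
pose T (t : M) : R := (1 - t) `^ b * \1_`]0, 1[%classic t.
have mS : measurable_fun [set: M] S.
  by apply: measurable_funM; [exact: measurable_funX|exact: measurable_indic_itv].
have mT : measurable_fun [set: M] T.
  by apply: measurable_funM; [exact: measurable_powR1B|exact: measurable_indic_itv].
have S0 s : 0 <= S s.
  rewrite /S indic_itvE in_itv/=; case: ltP => s0; rewrite ?mulr0// mulr_ge0// exprn_ge0//; exact: ltW.
have T0 t : 0 <= T t.
  by rewrite /T mulr_ge0 ?powR_ge0// indicE.
pose K (p : M * M) : R := S p.1 * T p.2 * \1_[set q : M * M | q.1 < q.2] p.
have mK : measurable_fun [set: M * M] (fun p => (K p)%:E).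
  apply/measurable_EFinP; apply: measurable_funM.
    by apply: measurable_funM; [exact: (measurableT_comp mS measurable_fst)|exact: (measurableT_comp mT measurable_snd)].
  apply: measurable_indic.
  have := @measurable_fun_ltr _ (M * M)%type R setT fst snd measurable_fst measurable_snd measurableT [set true].
  by rewrite setTI; apply.
have K0 p : (0 <= (K p)%:E)%E by rewrite lee_fin mulr_ge0 ?indicE// mulr_ge0.
have := @fubini_tonelli _ _ M M R leb leb (fun p => (K p)%:E) mK K0.
rewrite /fubini_F /fubini_G.
have -> : (\int[leb]_s \int[leb]_t (K (s, t))%:E = (b + 1)^-1%:E * beta_int n (b + 1))%E.
  have Ze (k : R) (h : M -> R) : 0 <= k -> measurable_fun [set: M] h ->
      (forall x, 0 <= h x) -> (\int[leb]_x (k * h x)%:E = k%:E * \int[leb]_x (h x)%:E)%E.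
    move=> k0 mh h0; under eq_integral do rewrite EFinM.
    by rewrite ge0_integralZl//; [exact/measurable_EFinP|move=> x _; rewrite lee_fin].
  rewrite -Ze ?invr_ge0 ?(ltW bp)//; [|exact: measurable_beta_fun|exact: beta_fun_ge0].
  apply: eq_integral => s _.
  have mh : measurable_fun [set: M] (fun t : M => (T t * \1_`]s, +oo[%classic t : R)).
    by apply: measurable_funM => //; exact: measurable_indic_itv.
  have h0 t : 0 <= T t * \1_`]s, +oo[%classic t by rewrite mulr_ge0 ?indicE.
  rewrite (_ : (\int[leb]_t (K (s, t))%:E = \int[leb]_t (S s * (T t * \1_`]s, +oo[%classic t))%:E)%E); last first.
    apply: eq_integral => t _; congr EFin; rewrite /K/= -mulrA; congr (_ * (_ * _)).
    rewrite indic_itvE in_itv/= andbT indicE; congr (_%:R); congr nat_of_bool.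
    by apply/idP/idP => [/set_mem|h]; [|apply/mem_set].
  rewrite Ze//.
  rewrite /S /beta_fun indic_itvE in_itv/=.
  have [s0|s0] := ltP 0 s; last by rewrite !mulr0 mul0e.
  have [s1|s1] := ltP s 1; last by rewrite !mulr0 mul0e.
  rewrite !mulr1.
  have mh' : measurable_fun [set: M] (fun t : M => (T t * \1_`]s, +oo[%classic t : R)%:E).
    exact/measurable_EFinP.
  have := @lebesgue_affine R (-1) 1 (fun t => (T t * \1_`]s, +oo[%classic t)%:E).
  rewrite oppr_eq0 oner_eq0 normrN normr1 invr1 mul1e => /(_ isT mh') <-; last by move=> t; rewrite lee_fin.
  rewrite (_ : (\int[leb]_x _ = \int[leb]_(u in `]0%R, (1 - s)%R[) (u `^ b)%:E)%E); last first.
    rewrite -integral_indic_itv; apply: eq_integral => u _; congr EFin.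
    rewrite /T !indic_itvE !in_itv/= andbT -mulrA; congr (_ `^ _ * _); first by ring.
    rewrite -natrM mulnb; congr (_%:R); congr nat_of_bool.
    by apply/idP/idP => [/andP[/andP[h1 h2] h3]|/andP[h1 h2]]; [apply/andP; split; lra|apply/andP; split; [apply/andP; split; lra|lra]].
  rewrite powR_integral ?subr_gt0// -EFinM; congr EFin; by rewrite [RHS]mulrC mulrA.
have -> : (\int[leb]_t \int[leb]_s (K (s, t))%:E = n.+1%:R^-1%:E * beta_int n.+1 b)%E.
  have Ze (k : R) (h : M -> R) : 0 <= k -> measurable_fun [set: M] h ->
      (forall x, 0 <= h x) -> (\int[leb]_x (k * h x)%:E = k%:E * \int[leb]_x (h x)%:E)%E.
    move=> k0 mh h0; under eq_integral do rewrite EFinM.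
    by rewrite ge0_integralZl//; [exact/measurable_EFinP|move=> x _; rewrite lee_fin].
  rewrite -Ze ?invr_ge0//; [|exact: measurable_beta_fun|exact: beta_fun_ge0].
  apply: eq_integral => t _.
  have mh : measurable_fun [set: M] (fun s : M => (S s * \1_`]-oo, t[%classic s : R)).
    by apply: measurable_funM => //; exact: measurable_indic_itv.
  have h0 s : 0 <= S s * \1_`]-oo, t[%classic s by rewrite mulr_ge0 ?indicE.
  rewrite (_ : (\int[leb]_s (K (s, t))%:E = \int[leb]_s (T t * (S s * \1_`]-oo, t[%classic s))%:E)%E); last first.
    apply: eq_integral => s _; congr EFin; rewrite /K/= mulrAC [RHS]mulrC; congr (_ * _ * _).
  rewrite Ze//.
  rewrite /T /beta_fun indic_itvE in_itv/=.
  have [t0|t0] := ltP 0 t; last by rewrite !mulr0 mul0e.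
  have [t1|t1] := ltP t 1; last by rewrite !mulr0 mul0e.
  rewrite !mulr1.
  rewrite (_ : (\int[leb]_x _ = \int[leb]_(u in `]0%R, t[) (u `^ n%:R)%:E)%E); last first.
    rewrite -integral_indic_itv; apply: eq_integral => u _; congr EFin.
    rewrite /S !indic_itvE !in_itv/=; have [u0|u0] := ltP 0 u; last by rewrite !mulr0 mul0r.
    rewrite powR_mulrn ?(ltW u0)// -mulrA -natrM mulnb/=; congr (_ * _%:R); congr nat_of_bool.
    by apply/idP/idP => [/andP[]//|h]; rewrite h andbT; lra.
  rewrite powR_integral//; last by rewrite (lt_le_trans _ (ler0n _ n))//; lra.
  rewrite natr1 powR_mulrn ?(ltW t0)// -EFinM; congr EFin; by rewrite [RHS]mulrC mulrA (mulrC (t ^+ n.+1)).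
move=> E.
have n0 : (n.+1%:R : R) != 0 by rewrite pnatr_eq0.
have -> : beta_int n.+1 b = (n.+1%:R%:E * (n.+1%:R^-1%:E * beta_int n.+1 b))%E.
  by rewrite muleA -EFinM divff// mul1e.
rewrite -E !muleA -!EFinM; congr (_%:E * _)%E.
by field; rewrite gt_eqF.
Qed.

Lemma beta_int0 b : -1 < b -> beta_int 0 b = (b + 1)^-1%:E.
Proof.
move=> b1; have mh : measurable_fun [set: M] (fun t : M => (beta_fun 0 b t)%:E).
  by apply/measurable_EFinP; exact: measurable_beta_fun.
have := @lebesgue_affine R (-1) 1 (fun t => (beta_fun 0 b t)%:E).
rewrite oppr_eq0 oner_eq0 normrN normr1 invr1 mul1e => /(_ isT mh).
rewrite /beta_int => <-; last by move=> t; rewrite lee_fin beta_fun_ge0.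
rewrite (_ : (\int[leb]_x _ = \int[leb]_(u in `]0%R, 1%R[) (u `^ b)%:E)%E); last first.
  rewrite -integral_indic_itv; apply: eq_integral => u _; congr EFin.
  rewrite /beta_fun expr0 mul1r !indic_itvE !in_itv/=; congr (_ `^ _ * _); first by ring.
  congr (_%:R); congr nat_of_bool.
  by apply/idP/idP => /andP[h1 h2]; apply/andP; split; lra.
by rewrite powR_integral// powR1 div1r.
Qed.

Lemma beta_int_add n b : -1 < b ->
  (beta_int n (b + 1) + beta_int n.+1 b = beta_int n b)%E.
Proof.
move=> b1; rewrite /beta_int -ge0_integralD//; last 4 first.
- by move=> t _; rewrite lee_fin beta_fun_ge0.
- by apply/measurable_EFinP; exact: measurable_beta_fun.
- by move=> t _; rewrite lee_fin beta_fun_ge0.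
- by apply/measurable_EFinP; exact: measurable_beta_fun.
apply: eq_integral => t _; rewrite -EFinD; congr EFin; rewrite /beta_fun -mulrDl.
rewrite indic_itvE in_itv/=; case: ltP => t0; rewrite ?mulr0//; case: ltP => t1; rewrite ?mulr0// !mulr1.
rewrite powRD; last by apply/implyP => _; rewrite gt_eqF// subr_gt0.
rewrite powRr1; last by rewrite subr_ge0 ltW.
by rewrite exprS; ring.
Qed.

Definition wt b (z : C) : R := (1 - modulus z ^+ 2) `^ b * \1_disc z.

Lemma discE (z : C) : (\1_disc z : R) = (modulus z < 1)%R%:R.
Proof. by rewrite indicE; congr (_%:R); congr nat_of_bool; apply/idP/idP => [/set_mem|h]; [|apply/mem_set]. Qed.

Lemma cmeasS_disc : cmeasS (disc : set C).
Proof.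
rewrite (_ : disc = (fun z : C => modulus z) @^-1` `]-oo, 1[%classic).
  by apply: cmeasS_preimage => //; exact: cmeasR_modulus_id.
by apply/seteqP; split=> z; rewrite /disc/= in_itv.
Qed.

Lemma sqmod_lt1 (z : C) : (sqmod z < 1) = (modulus z < 1).
Proof.
by rewrite /sqmod -{1}(expr1n R 2) ltr_pXn2r// ?nnegrE ?modulus_ge0.
Qed.

Lemma radial_wt b : radial 1 (wt b).
Proof.
split.
- apply: cmeasRM; last by apply: cmeasR_indic; exact: cmeasS_disc.
  apply: (measurableT_comp (f := @powR R ^~ b)); first exact: measurable_powR.
  exact: (cmeasRB (cmeasR_cst 1) (cmeasR_sqmod (R := R))).
- by move=> z; rewrite mulr_ge0 ?powR_ge0// indicE.
- by move=> a z a1; rewrite /wt !discE modulusM a1 mul1r.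
- by move=> z z1; rewrite /wt discE ltNge z1 mulr0.
Qed.

Lemma moment_wtE b n : moment (wt b) n = (kappa%:E * beta_int n b)%E.
Proof.
pose h (t : M) : R := t ^+ n * (1 - t) `^ b * \1_`[0, 1[%classic t.
have mh : measurable_fun [set: M] h.
  apply: measurable_funM; last exact: measurable_indic_itv.
  by apply: measurable_funM; [exact: measurable_funX|exact: measurable_powR1B].
have h0 t : 0 <= h t.
  rewrite /h indic_itvE in_itv/=; have [t0|t0] := leP 0 t; last by rewrite mulr0.
  by rewrite !mulr_ge0 ?exprn_ge0 ?powR_ge0.
rewrite /moment (eq_Rcint (G := fun z => h (sqmod z))); last first.
  move=> z; rewrite /h /wt discE indic_itvE in_itv/= {3}/sqmod sqr_ge0/= sqmod_lt1 mulrA.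
  by rewrite /sqmod exprM.
rewrite (Rcint_sqmod mh h0); congr (_ * _)%E.
have -> : (\int[leb]_(t in `[0%R, +oo[) (h t)%:E = \int[leb]_(t in `[0%R, 1%R[) (t ^+ n * (1 - t) `^ b)%:E)%E.
  rewrite -!integral_indic_itv; apply: eq_integral => t _; congr EFin.
  rewrite /h !indic_itvE !in_itv/= andbT; have [t0|t0] := leP 0 t; by rewrite ?mulr1 ?mulr0.
rewrite /beta_int /beta_fun integral_indic_itv -integral_itv_obnd_cbnd//.
apply: measurable_funTS; apply/measurable_EFinP.
by apply: measurable_funM; [exact: measurable_funX|exact: measurable_powR1B].
Qed.

(** The squared norm of [z^n] for the weight [wt b]. It is determined by the recurrences [mom_rec]
    and [mom_add] and by its value at [n = 0], from which all estimates on it are derived. *)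
Definition mom b n : R := fine (moment (wt b : C -> R) n).

Lemma moment_wt_fin b n : -1 < b -> moment (wt b : C -> R) n = (mom b n)%:E.
Proof.
move=> b1; rewrite /mom fineK// moment_wtE fin_numM//.
elim: n => [|n IH]; first by rewrite beta_int0.
have := beta_int_add n b1; rewrite -(fineK IH).
have : (0 <= beta_int n (b + 1))%E by apply: integral_ge0 => t _; rewrite lee_fin beta_fun_ge0.
have : (0 <= beta_int n.+1 b)%E by apply: integral_ge0 => t _; rewrite lee_fin beta_fun_ge0.
by case: (beta_int n.+1 b) => [//| |]; case: (beta_int n (b + 1)).
Qed.

Lemma beta_int_mom b n : -1 < b -> beta_int n b = (mom b n / kappa)%:E.
Proof.
move=> b1; have k0 := @kappa_gt0 R.
have : (kappa%:E * beta_int n b = (mom b n)%:E)%E by rewrite -moment_wtE moment_wt_fin.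
move=> /(congr1 (fun x => kappa^-1%:E * x)%E); rewrite muleA -!EFinM mulVf ?gt_eqF// mul1e => ->.
by rewrite mulrC.
Qed.

Lemma mom_rec b n : -1 < b -> (b + 1) * mom b n.+1 = n.+1%:R * mom (b + 1) n.
Proof.
move=> b1; have b2 : -1 < b + 1 by lra.
have k0 := @kappa_gt0 R.
have := beta_int_rec n b1; rewrite (beta_int_mom _ b1) (beta_int_mom _ b2) -!EFinM => E; move: (EFin_inj E).
by rewrite !mulrA => /(mulIf _); apply; rewrite invr_eq0 gt_eqF.
Qed.

Lemma mom_add b n : -1 < b -> mom (b + 1) n + mom b n.+1 = mom b n.
Proof.
move=> b1; have b2 : -1 < b + 1 by lra.
have k0 := @kappa_gt0 R.
have := beta_int_add n b1; rewrite !(beta_int_mom _ b1) (beta_int_mom _ b2) -!EFinD => E; move: (EFin_inj E).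
by rewrite -mulrDl => /(mulIf _); apply; rewrite invr_eq0 gt_eqF.
Qed.

Lemma mom0 b : -1 < b -> mom b 0 = kappa / (b + 1).
Proof.
move=> b1; have k0 := @kappa_gt0 R.
have := beta_int0 b1; rewrite (beta_int_mom _ b1) => E; rewrite -(EFin_inj E).
by rewrite mulrC divfK// gt_eqF.
Qed.

Lemma mom_ratio b n : -1 < b ->
  mom b n.+1 * (n.+1%:R + b + 1) = n.+1%:R * mom b n.
Proof.
by move=> b1; rewrite -(mom_add n b1) [RHS]mulrDr -mom_rec//; ring.
Qed.

Lemma mom_gt0 b n : -1 < b -> 0 < mom b n.
Proof.
move=> b1; elim: n => [|n IH].
  by rewrite mom0// divr_gt0 ?kappa_gt0//; lra.
have n0 : 0 < (n.+1%:R : R) by [].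
have h : 0 < n.+1%:R + b + 1 by lra.
by rewrite -(pmulr_lgt0 _ h) mom_ratio// mulr_gt0.
Qed.

(* The Littlewood-Paley identity, coefficient by coefficient. *)
Lemma mom_derive b n : -1 < b ->
  n.+1%:R ^+ 2 * mom (b + 2) n * (n.+1%:R + b + 2) =
  (b + 1) * (b + 2) * n.+1%:R * mom b n.+1.
Proof.
move=> b1; have b2 : -1 < b + 1 by lra.
have n0 : 0 < (n.+1%:R : R) by [].
have := mom_rec n b2; rewrite (_ : b + 1 + 1 = b + 2); last by ring.
have := mom_rec n.+1 b1; have := mom_ratio n.+1 b1.
rewrite -(natr1 n.+1); move: (mom b n.+2) (mom b n.+1) (mom (b + 1) n.+1) (mom (b + 2) n) (n.+1%:R : R) n0 => x y z w N N0 e1 e2 e3.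
have N1 : N + 1 != 0 by rewrite gt_eqF//; lra.
have e2' : z = (b + 1) * x / (N + 1) by rewrite e2; field.
have e1' : x = (N + 1) * y / (N + 1 + b + 1).
  by rewrite -e1; field; rewrite gt_eqF//; lra.
have e3' : w = (b + 2) * z / N by rewrite e3; field; rewrite gt_eqF.
rewrite e3' e2' e1'; field.
by rewrite N1 !gt_eqF//; lra.
Qed.

End Moments.

(** * The Littlewood-Paley identity *)

Section BergmanCoefficients.
Context {R : realType}.
Local Notation C := R[i].
Implicit Types (b : R) (f F : C -> C) (c : nat -> C).

(** The squared Bergman norm without its factor [b + 1], which [bergman_normE] restores; after
    differentiation the weight index becomes [b + 2]. *)
Definition sqnorm b f : \bar R := Rcint (fun z => modulus (f z) ^+ 2 * wt b z).

Lemma wt_ge0 b (z : C) : 0 <= wt b z.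
Proof. by case: (radial_wt (R := R) b). Qed.

Lemma cmeasR_wt b : cmeasR (wt b : C -> R).
Proof. by case: (radial_wt (R := R) b). Qed.

Lemma sqnorm_ge0 b f : (0 <= sqnorm b f)%E.
Proof. by apply: Rcint_ge0 => z; rewrite mulr_ge0 ?sqr_ge0 ?wt_ge0. Qed.

Lemma bergman_normE b f : bergman_norm b f = sqrte ((b + 1)%:E * sqnorm b f).
Proof.
rewrite /bergman_norm area_integralE; congr (sqrte (_ * _)).
by apply: eq_Rcint => z; rewrite /wt mulrA.
Qed.

Lemma eq_sqnorm b f F : (forall z, modulus z < 1 -> f z = F z) -> sqnorm b f = sqnorm b F.
Proof.
move=> fF; apply: eq_Rcint => z; rewrite /wt discE.
by have [z1|z1] := ltP (modulus z) 1; [rewrite fF|rewrite !mulr0].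
Qed.

Definition coef_term b c n : \bar R := (modulus (c n) ^+ 2 * mom b n)%:E.

Lemma sqnorm_pseries b f c : -1 < b -> has_pseries f 0 1 c ->
  (sqnorm b f = \sum_(0 <= n <oo) coef_term b c n)%E.
Proof.
move=> b1 hf; rewrite /sqnorm (parseval hf (radial_wt b)).
by apply: eq_eseriesr => n _; rewrite (moment_wt_fin n b1) -EFinM.
Qed.

Lemma coef_term_ge0 b c n : -1 < b -> (0 <= coef_term b c n)%E.
Proof. by move=> b1; rewrite lee_fin mulr_ge0 ?sqr_ge0// ltW// mom_gt0. Qed.

Definition int_coef c n : C := if n is k.+1 then c k / k.+1%:R else 0.

(** With [N = n + 1], [mom_derive] makes the two quantities differ by the factor [(N + b + 2) / N],
    which lies between [1] and [b + 3] because [N >= 1]. *)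
Lemma mom_derive_bounds b n : -1 < b ->
  (b + 1) * (b + 2) * mom b n.+1 <= (b + 3) * (n.+1%:R ^+ 2 * mom (b + 2) n) /\
  n.+1%:R ^+ 2 * mom (b + 2) n <= (b + 1) * (b + 2) * mom b n.+1.
Proof.
move=> b1; have b3 : -1 < b + 2 by lra.
have n1 : 1 <= (n.+1%:R : R) by rewrite ler1n.
have n0 : 0 < (n.+1%:R : R) by [].
have Q0 : 0 <= n.+1%:R ^+ 2 * mom (b + 2) n.
  by apply: mulr_ge0; [exact: sqr_ge0|exact/ltW/mom_gt0].
have P0 : 0 <= (b + 1) * (b + 2) * mom b n.+1.
  by apply: mulr_ge0; [apply: mulr_ge0; lra|exact/ltW/mom_gt0].
have e : n.+1%:R ^+ 2 * mom (b + 2) n * (n.+1%:R + b + 2) =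
    (b + 1) * (b + 2) * mom b n.+1 * n.+1%:R.
  rewrite (mom_derive n b1); exact: mulrAC.
move: (n.+1%:R ^+ 2 * mom (b + 2) n) ((b + 1) * (b + 2) * mom b n.+1) Q0 P0 e => Q P Q0 P0 e.
split.
  rewrite -(ler_pM2r n0) -e [(b + 3) * Q]mulrC -mulrA ler_wpM2l//; nra.
have d0 : 0 < n.+1%:R + b + 2 by lra.
rewrite -(ler_pM2r d0) e ler_wpM2l//; lra.
Qed.

Lemma nneseries_shift (u : nat -> \bar R) : (forall n, 0 <= u n)%E ->
  (\sum_(0 <= n <oo) u n = u 0%N + \sum_(0 <= n <oo) u n.+1)%E.
Proof.
move=> u0; rewrite (nneseries_recl (fun n _ => u0 n) isT); congr (_ + _)%E.
by rewrite -(nneseries_addn 1 u0); apply: eq_eseriesr => n _; rewrite addn1.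
Qed.

Lemma coef_term_int0 b c : coef_term b (int_coef c) 0 = 0%E.
Proof. by rewrite /coef_term (_ : int_coef c 0 = 0)// modulus0 expr0n mul0r. Qed.

Lemma sqr_modulus_int_coef c n :
  modulus (int_coef c n.+1) ^+ 2 = modulus (c n) ^+ 2 / n.+1%:R ^+ 2.
Proof. by rewrite /= modulusM modulusV modulus_nat exprMn exprVn. Qed.

Lemma coef_term_int_le b c n : -1 < b ->
  (coef_term b (int_coef c) n.+1 <=
   ((b + 3) / ((b + 1) * (b + 2)))%:E * coef_term (b + 2) c n)%E.
Proof.
move=> b1; have [h _] := mom_derive_bounds n b1.
rewrite /coef_term -EFinM lee_fin sqr_modulus_int_coef.
move: h (sqr_ge0 (modulus (c n))); move: (mom b n.+1) (mom (b + 2) n) (modulus (c n) ^+ 2) => p q X.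
have d0 : 0 < (b + 1) * (b + 2) by apply: mulr_gt0; lra.
move: (n.+1%:R ^+ 2) (exprn_gt0 2 (ltr0Sn R n)) d0 => N N0.
move: ((b + 1) * (b + 2)) (b + 3) => D E D0 h X0.
have -> : X / N * p = X * (D * p) / (N * D).
  by field; rewrite !gt_eqF.
have -> : E / D * (X * q) = X * (E * (N * q)) / (N * D).
  by field; rewrite !gt_eqF.
by rewrite ler_wpM2r ?invr_ge0 ?mulr_ge0 ?(ltW D0) ?(ltW N0)// ler_wpM2l.
Qed.

Lemma coef_term_int_ge b c n : -1 < b ->
  (coef_term (b + 2) c n <=
   ((b + 1) * (b + 2))%:E * coef_term b (int_coef c) n.+1)%E.
Proof.
move=> b1; have [_ h] := mom_derive_bounds n b1.
rewrite /coef_term -EFinM lee_fin sqr_modulus_int_coef.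
move: h (sqr_ge0 (modulus (c n))); move: (mom b n.+1) (mom (b + 2) n) (modulus (c n) ^+ 2) => p q X.
move: (n.+1%:R ^+ 2) (exprn_gt0 2 (ltr0Sn R n)) => N N0.
move: ((b + 1) * (b + 2)) => D h X0.
have -> : D * (X / N * p) = X * (D * p) / N by field; rewrite gt_eqF.
by rewrite ler_pdivlMr// -mulrA ler_wpM2l// mulrC.
Qed.

Lemma sqnorm_int b F c : -1 < b -> has_pseries F 0 1 (int_coef c) ->
  (sqnorm b F = \sum_(0 <= n <oo) coef_term b (int_coef c) n.+1)%E.
Proof.
move=> b1 hF; rewrite (sqnorm_pseries b1 hF).
rewrite (@nneseries_shift (coef_term b (int_coef c)) (fun n => coef_term_ge0 (int_coef c) n b1)).
by rewrite coef_term_int0 add0e.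
Qed.

Lemma littlewood_paley_le b f F c : -1 < b ->
  has_pseries f 0 1 c -> has_pseries F 0 1 (int_coef c) ->
  (sqnorm b F <= ((b + 3) / ((b + 1) * (b + 2)))%:E * sqnorm (b + 2) f)%E.
Proof.
move=> b1 hf hF; have b3 : -1 < b + 2 by lra.
rewrite (sqnorm_int b1 hF) (sqnorm_pseries b3 hf) -(nneseriesZl _ _ (fun n _ => coef_term_ge0 c n b3)).
apply: lee_nneseries => [n _ _|n _]; first exact: coef_term_ge0.
exact: coef_term_int_le.
Qed.

Lemma littlewood_paley_ge b f F c : -1 < b ->
  has_pseries f 0 1 c -> has_pseries F 0 1 (int_coef c) ->
  (sqnorm (b + 2) f <= ((b + 1) * (b + 2))%:E * sqnorm b F)%E.
Proof.
move=> b1 hf hF; have b3 : -1 < b + 2 by lra.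
rewrite (sqnorm_int b1 hF) (sqnorm_pseries b3 hf) -(nneseriesZl _ _ (fun n _ => coef_term_ge0 (int_coef c) n.+1 b1)).
apply: lee_nneseries => [n _ _|n _]; first exact: coef_term_ge0.
exact: coef_term_int_ge.
Qed.

End BergmanCoefficients.

Section SegmentIntegral.
Context {R : realType}.
Local Notation C := R[i].
Local Notation M := (measurableTypeR R).
Local Notation leb := (@lebesgue_measure R).

Lemma Rintegral_monomial (n : nat) :
  (\int[leb]_(t in `[0%R, 1%R]) (t ^+ n))%R = n.+1%:R^-1 :> R.
Proof.
have mf (A : set M) : measurable_fun A (fun t : M => (t ^+ n)%:E).
  by apply/measurable_EFinP/measurable_funTS; exact: measurable_funX.
rewrite /Rintegral -(@integral_itv_obnd_cbnd R 0 (BRight 1) (fun t => (t ^+ n)%:E) (mf _)).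
rewrite -(@integral_itv_bndo_bndc R (BRight 0) 1 (fun t => (t ^+ n)%:E) (mf _)).
rewrite (_ : (\int[leb]_(t in _) _ = \int[leb]_(u in `]0%R, 1%R[) (u `^ n%:R)%:E)%E); last first.
  apply: eq_integral => t /set_mem/=; rewrite in_itv/= => /andP[t0 _].
  by rewrite powR_mulrn// ltW.
rewrite powR_integral ?powR1//= ?natr1 ?div1r//.
by rewrite (lt_le_trans _ (ler0n _ n))//; lra.
Qed.

Lemma integrable01 (f : M -> R) (B : R) : measurable_fun (`[0, 1]%classic : set M) f ->
  (forall t, 0 <= t <= 1 -> `|f t| <= B) ->
  leb.-integrable `[0, 1]%classic (EFin \o f).
Proof.
move=> mf fB; apply: measurable_bounded_integrable => //.
  by rewrite /= lebesgue_measure_itv/= lte_fin ltr01 oppr0 adde0 ltry.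
exists B; split; first exact: num_real.
by move=> x Bx t /=; rewrite in_itv/= => /fB h; apply: le_trans h (ltW Bx).
Qed.

(** The geometric domination is uniform in [t] on [[0, 1]], so the error of the integrals has an
    explicit bound tending to [0]. *)
Lemma Rintegral_power_series (k : M -> R) (be : nat -> R) (K th : R) :
  0 <= th < 1 -> (forall n, `|be n| <= K * th ^+ n) ->
  (forall t, 0 <= t <= 1 -> (fun n => \sum_(i < n) be i * t ^+ i) @ \oo --> k t) ->
  (fun n => \sum_(i < n) be i / i.+1%:R) @ \oo -->
    ((\int[leb]_(t in `[0%R, 1%R]) k t)%R : R).
Proof.
move=> th01 hbe hk; have [th0 th1] := andP th01.
have d0 : 0 < 1 - th by rewrite subr_gt0.
have K0 : 0 <= K by have := hbe 0%N; rewrite expr0 mulr1; exact: le_trans.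
pose S n (t : M) : R := \sum_(i < n) be i * t ^+ i.
have mS n (A : set M) : measurable_fun A (S n).
  apply: measurable_funTS.
  rewrite /S; elim: n => [|n IH].
    by under [fun t => _]eq_fun do rewrite big_ord0; exact: measurable_cst.
  under [fun t => _]eq_fun do rewrite big_ord_recr/=.
  apply: measurable_funD => //; apply: measurable_funM; first exact: measurable_cst.
  exact: measurable_funX.
have tail t m n : 0 <= t <= 1 -> (m <= n)%N -> `|S n t - S m t| <= K * th ^+ m / (1 - th).
  move=> /andP[t0 t1] mn.
  have -> : S n t - S m t = \sum_(m <= i < n) be i * t ^+ i.
    rewrite /S -!(big_mkord xpredT (fun i => be i * t ^+ i)).
    by rewrite (@big_cat_nat _ _ _ m 0 n)//= [LHS]addrC addKr.
  rewrite (le_trans (ler_norm_sum _ _ _))//.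
  apply: (@le_trans _ _ (\sum_(m <= i < n) K * th ^+ i)).
    apply: ler_sum => i _; rewrite normrM (ger0_norm (exprn_ge0 _ t0)).
    by rewrite (le_trans _ (hbe i))// ler_piMr// exprn_ile1.
  by rewrite -mulr_sumr -mulrA ler_wpM2l// sum_geo_le.
have SB n t : 0 <= t <= 1 -> `|S n t| <= K / (1 - th).
  by move=> t01; have := tail t 0%N n t01 isT; rewrite {2}/S big_ord0 subr0 expr0 mulr1.
have iS n : leb.-integrable `[0, 1]%classic (EFin \o S n).
  by apply: integrable01 (SB n); exact: mS.
have kS t m : 0 <= t <= 1 -> `|k t - S m t| <= K * th ^+ m / (1 - th).
  move=> t01; have h : (fun n => `|S n t - S m t|) @ \oo --> `|k t - S m t|.
    by apply: cvg_norm; apply: cvgB; [exact: hk|exact: cvg_cst].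
  rewrite -(cvg_lim _ h)//; apply: limr_le; first by apply/cvg_ex; eexists; exact: h.
  by near=> n; apply: tail => //; near: n; exact: nbhs_infty_ge.
have mk : measurable_fun (`[0, 1]%classic : set M) k.
  apply: (@measurable_fun_cvg _ _ _ _ S) => [n|t]; first exact: mS.
  by rewrite /= in_itv/=; exact: hk.
have ik : leb.-integrable `[0, 1]%classic (EFin \o k).
  apply: (integrable01 (B := K / (1 - th))) => // t t01.
  by have := kS t 0%N t01; rewrite /S big_ord0 subr0 expr0 mulr1.
have mI : measurable (`[0, 1]%classic : set M) by exact: measurable_itv.
have iSE n : (\int[leb]_(t in `[0%R, 1%R]) S n t)%R = \sum_(i < n) be i / i.+1%:R.
  elim: n => [|n IH].
    rewrite big_ord0 /S; under eq_Rintegral do rewrite big_ord0.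
    by rewrite Rintegral_cst// mul0r.
  rewrite big_ord_recr/= -IH.
  have im : leb.-integrable `[0, 1]%classic (EFin \o (fun t : M => t ^+ n)).
    apply: (integrable01 (B := 1)) => [|t /andP[t0 t1]].
      by apply: measurable_funTS; exact: measurable_funX.
    by rewrite ger0_norm ?exprn_ge0// exprn_ile1.
  rewrite -Rintegral_monomial -RintegralZl// -RintegralD//.
    by apply: eq_Rintegral => t _; rewrite /S big_ord_recr.
  apply: (eq_integrable mI _ _ _ (integrableZl mI (be n) im)) => t _.
  by rewrite /= EFinM.
apply: (@cvg_geometric_bound _ _ _ (K / (1 - th)) th th01) => n.
rewrite -iSE -RintegralB//.
apply: (le_trans (le_normr_Rintegral _ _)) => //.
  by apply: (eq_integrable mI _ _ _ (integrableB mI ik (iS n))) => t _.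
have -> : K / (1 - th) * th ^+ n = (\int[leb]_(t in `[0%R, 1%R]) (K / (1 - th) * th ^+ n))%R.
  rewrite (Rintegral_cst _ mI) [fine _](_ : _ = 1) ?mulr1//.
  by rewrite [X in fine X]lebesgue_measure_itv/= lte_fin ltr01 oppr0 adde0.
apply: le_Rintegral => //.
- apply: (integrable01 (B := K / (1 - th) * th ^+ n)).
    apply: measurableT_comp => //; apply: measurable_funB => //; exact: mS.
  by move=> t t01; rewrite ger0_norm// mulrAC; exact: kS.
- apply: (integrable01 (B := `|K / (1 - th) * th ^+ n|)) => //.
- by move=> t /=; rewrite in_itv/= mulrAC; exact: kS.
Unshelve. all: by end_near. Qed.

Lemma Re_cvg (ga : nat -> C) (be : nat -> R) (l : C) :
  cvc (fun n => \sum_(i < n) ga i) l ->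
  (forall i, complex.Re (ga i) = be i) ->
  (fun n => \sum_(i < n) be i) @ \oo --> complex.Re l.
Proof.
move=> h e; apply/cvgrPdist_le => d d0; move/cvgrPdist_le : h => /(_ d d0).
apply: filterS => n; rewrite sub0r normrN ger0_norm ?modulus_ge0// => /(le_trans _); apply.
rewrite (eq_bigr (fun i : 'I_n => complex.Re (ga i))) => [|i _]; last exact/esym/e.
by rewrite -(raddf_sum (@complex.Re R)) -raddfB; exact: Re_le_modulus.
Qed.

Lemma Im_cvg (ga : nat -> C) (be : nat -> R) (l : C) :
  cvc (fun n => \sum_(i < n) ga i) l ->
  (forall i, complex.Im (ga i) = be i) ->
  (fun n => \sum_(i < n) be i) @ \oo --> complex.Im l.
Proof.
move=> h e; apply/cvgrPdist_le => d d0; move/cvgrPdist_le : h => /(_ d d0).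
apply: filterS => n; rewrite sub0r normrN ger0_norm ?modulus_ge0// => /(le_trans _); apply.
rewrite (eq_bigr (fun i : 'I_n => complex.Im (ga i))) => [|i _]; last exact/esym/e.
by rewrite -(raddf_sum (@complex.Im R)) -raddfB; exact: Im_le_modulus.
Qed.

(** On the segment the integrand is the series of [c n z^(n+1) t^n], dominated geometrically for [t]
    in [[0, 1]]; integrating real and imaginary parts term by term divides by [n + 1]. *)
Lemma segment_integral_pseries h (c : nat -> C) : has_pseries h 0 1 c ->
  has_pseries (segment_integral h) 0 1 (int_coef c).
Proof.
move=> hh; apply: has_pseriesP => z; rewrite subr0 => z1.
have z0 := modulus_ge0 z.
pose s := (modulus z + 1) / 2.
have zs : modulus z < s by rewrite /s; lra.
have s1 : s < 1 by rewrite /s; lra.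
have s0 : 0 < s by lra.
have [K hK] := hh.1 s (introT andP (conj (ltW s0) s1)).
pose th := modulus z / s.
have th01 : 0 <= th < 1 by rewrite divr_ge0 ?(ltW s0)//= ltr_pdivrMr// mul1r.
pose ga n : C := c n * z ^+ n * z.
have hga n : modulus (ga n) <= K * modulus z * th ^+ n.
  rewrite /ga !modulusM modulusX [leRHS]mulrAC ler_wpM2r//.
  rewrite /th expr_div_n mulrA ler_pdivlMr ?exprn_gt0// mulrAC ler_wpM2r ?exprn_ge0//.
have hcv t : 0 <= t <= 1 -> cvc (fun n => \sum_(i < n) ga i * (t%:C) ^+ i) (h (t%:C * z) * z).
  move=> /andP[t0 t1].
  have tz : modulus (t%:C * z - 0) < 1.
    rewrite subr0 modulusM modulusR ger0_norm//; apply: le_lt_trans z1.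
    by rewrite ler_piMl.
  have := cvcZ z (hh.2 _ tz); rewrite subr0 [z * _]mulrC; apply: eq_cvc => n.
  rewrite /psum mulr_sumr; apply: eq_bigr => i _.
  by rewrite /ga exprMn; ring.
have ReX (t : R) (w : C) i : complex.Re (w * (t%:C) ^+ i) = complex.Re w * t ^+ i.
  by rewrite -rmorphXn; case: w => x y; rewrite /= mulr0 subr0.
have ImX (t : R) (w : C) i : complex.Im (w * (t%:C) ^+ i) = complex.Im w * t ^+ i.
  by rewrite -rmorphXn; case: w => x y; rewrite /= mulr0 add0r.
have cRe := @Rintegral_power_series (fun t => complex.Re (h (t%:C * z) * z))
  (fun n => complex.Re (ga n)) _ _ th01 (fun n => le_trans (Re_le_modulus _) (hga n)).
have cIm := @Rintegral_power_series (fun t => complex.Im (h (t%:C * z) * z))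
  (fun n => complex.Im (ga n)) _ _ th01 (fun n => le_trans (Im_le_modulus _) (hga n)).
have {}cRe := cRe (fun t t01 => @Re_cvg (fun i => ga i * t%:C ^+ i) (fun i => complex.Re (ga i) * t ^+ i) _ (hcv t t01) (fun i => ReX t (ga i) i)).
have {}cIm := cIm (fun t t01 => @Im_cvg (fun i => ga i * t%:C ^+ i) (fun i => complex.Im (ga i) * t ^+ i) _ (hcv t t01) (fun i => ImX t (ga i) i)).
rewrite /cvc -cvg_shiftS.
apply: (@cvc_squeeze _ (fun n => psum (int_coef c) n.+1 z) (segment_integral h z)
  (fun n => `|(\int[leb]_(t in `[0%R, 1%R]) complex.Re (h (t%:C * z) * z))%R - \sum_(i < n) complex.Re (ga i) / i.+1%:R|
   + `|(\int[leb]_(t in `[0%R, 1%R]) complex.Im (h (t%:C * z) * z))%R - \sum_(i < n) complex.Im (ga i) / i.+1%:R|)) => [n|].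
  apply: le_trans (modulus_le_ReIm _) _.
  have -> : psum (int_coef c) n.+1 z = \sum_(i < n) ga i * (i.+1%:R^-1)%:C.
    rewrite /psum big_ord_recl/= mul0r add0r; apply: eq_bigr => i _ /=.
    by rewrite /ga exprS fmorphV rmorph_nat; ring.
  rewrite !raddfB !raddf_sum/=.
  under eq_bigr do rewrite -[(_)%:C]expr1 ReX expr1.
  rewrite lerD2l; under eq_bigr do rewrite -[(_)%:C]expr1 ImX expr1.
  exact: lexx.
rewrite -[X in _ --> X](addr0 0); apply: cvgD; apply/norm_cvg0P.
  by rewrite -[X in _ --> X](subrr (\int[leb]_(t in `[0%R, 1%R]) complex.Re (h (t%:C * z) * z))%R); apply: cvgB => //; exact: cvg_cst.
by rewrite -[X in _ --> X](subrr (\int[leb]_(t in `[0%R, 1%R]) complex.Im (h (t%:C * z) * z))%R); apply: cvgB => //; exact: cvg_cst.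
Qed.

End SegmentIntegral.

(** * Growth of the Bergman kernel on the diagonal *)

Section KernelDiagonal.
Context {R : realType}.
Implicit Types (b x t : R).

Lemma bernoulli_ineq x n : 0 <= x <= 1 -> 1 - n%:R * x <= (1 - x) ^+ n.
Proof.
move=> /andP[x0 x1]; elim: n => [|n IH]; first by rewrite mul0r subr0 expr0.
rewrite exprS; apply: (@le_trans _ _ ((1 - x) * (1 - n%:R * x))); last first.
  by rewrite ler_wpM2l// subr_ge0.
have n0 : 0 <= (n%:R : R) by [].
by rewrite -natr1; nra.
Qed.

(** Both factors are compared with exponentials: [(1 + 1/m)^p <= e^(p/m)] and
    [1 - p/m <= e^(-p/m)]. *)
Lemma powR_step (p m : R) : 0 < p -> p < m ->
  (m - p) / m * (m + 1) `^ p <= m `^ p.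
Proof.
move=> p0 pm; have m0 : 0 < m by lra.
have m1 : m + 1 = m * (1 + m^-1) by field; rewrite gt_eqF.
have V0 : 0 < m^-1 by rewrite invr_gt0.
rewrite m1 powRM; [|lra|lra].
rewrite mulrCA ler_piMr ?powR_ge0//.
have h1 : (1 + m^-1) `^ p <= expR (p / m).
  rewrite mulrC expRM ge0_ler_powR ?nnegrE ?expR_ge0 ?expR_ge1Dx//; [exact: ltW|lra].
have h2 : (m - p) / m <= expR (- (p / m)).
  have -> : (m - p) / m = 1 + - (p / m) by field; rewrite gt_eqF.
  exact: expR_ge1Dx.
have mp0 : 0 <= (m - p) / m by rewrite divr_ge0//; lra.
apply: le_trans (ler_pM mp0 (powR_ge0 _ _) h2 h1) _.
by rewrite -expRD addNr expR0.
Qed.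

(** The moments decay at least like [n^-(b+1)]: by [mom_ratio] and [powR_step] the left side is
    nonincreasing in [n]. *)
Lemma mom_le_powR b n : -1 < b ->
  mom b n * (n.+1%:R + (b + 1)) `^ (b + 1) <= mom b 0 * (1 + (b + 1)) `^ (b + 1).
Proof.
move=> b1; elim: n => [|n IH]; first by [].
apply: le_trans IH; set m : R := n.+1%:R + (b + 1).
have n0 : 0 < (n.+1%:R : R) by [].
have m0 : 0 < m by rewrite /m; lra.
have -> : n.+2%:R + (b + 1) = m + 1 by rewrite /m -(natr1 n.+1); lra.
have -> : mom b n.+1 = mom b n * ((m - (b + 1)) / m).
  apply: (mulIf (lt0r_neq0 m0)); rewrite mulrA divfK ?gt_eqF//.
  have -> : m - (b + 1) = n.+1%:R by rewrite /m; lra.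
  by have := mom_ratio n b1; rewrite /m addrA => ->; rewrite mulrC.
rewrite -mulrA ler_wpM2l ?(ltW (mom_gt0 _ _))//.
by apply: powR_step; rewrite /m; lra.
Qed.

(** One dyadic block suffices: for [D = 2^(l-3)] and [D <= n < 2 D], Bernoulli gives
    [t^(2n) >= 1 - 2n 2^-l >= 1/2], and [1 / mom b n] is at least a multiple of [D^(b+1)]. The
    factor [8^-(b+2)] accounts for the shift by [3]; for [l < 3] the term [n = 0] is enough. *)
Lemma kernel_diag_lower b : -1 < b -> exists2 c0 : R, 0 < c0 &
  forall (l N : nat) t, (2 ^ l <= N)%N -> 1 - (2 ^+ l)^-1 <= t ->
    c0 * (2 ^+ l) `^ (b + 2) <= \sum_(n < N) t ^+ (2 * n) / mom b n.
Proof.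
move=> b1; pose K : R := mom b 0 * (1 + (b + 1)) `^ (b + 1).
have m00 : 0 < mom b 0 by exact: mom_gt0.
have one_le : 1 <= (1 + (b + 1)) `^ (b + 1).
  have e1 : 1 `^ (b + 1) = 1 :> R by rewrite powR1.
  rewrite -[leLHS]e1 ge0_ler_powR ?nnegrE//; lra.
have K0 : 0 < K by rewrite mulr_gt0// (lt_le_trans ltr01).
have m0K : mom b 0 <= K by rewrite ler_peMr// ltW.
exists (8^-1 `^ (b + 2) / (2 * K)); first by apply: divr_gt0; [apply: powR_gt0; lra|apply: mulr_gt0; lra].
move=> l N t lN tl.
have pl0 : 0 < 2 ^+ l :> R by rewrite exprn_gt0.
have -> : 8^-1 `^ (b + 2) / (2 * K) * (2 ^+ l) `^ (b + 2) = (8^-1 * 2 ^+ l) `^ (b + 2) / (2 * K).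
  by rewrite (powRM (b + 2))// ?invr_ge0// ?(ltW pl0)// mulrAC.
have V1 : (2 ^+ l)^-1 <= 1 :> R by rewrite invf_le1// exprn_ege1// ler1n.
have t0 : 0 <= t by apply: le_trans tl; rewrite subr_ge0.
have term0 n : 0 <= t ^+ (2 * n) / mom b n.
  by rewrite divr_ge0 ?exprn_ge0// ltW// mom_gt0.
have [l3|l3] := ltnP l 3.
  have N0 : (0 < N)%N by apply: leq_trans lN; rewrite expn_gt0.
  rewrite (bigD1 (Ordinal N0))//= muln0 expr0 ler_wpDr ?sumr_ge0//.
  have h1 : (8^-1 * 2 ^+ l) `^ (b + 2) <= 1.
    have e2 : 1 `^ (b + 2) = 1 :> R by rewrite powR1.
    rewrite -[leRHS]e2 ge0_ler_powR ?nnegrE//.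
    - lra.
    - rewrite mulrC ler_pdivrMr// mul1r; apply: (@le_trans _ _ (2 ^+ 3)); last by rewrite !exprS expr0; lra.
      by rewrite ler_weXn2l// ?ler1n// ltnW.
  rewrite ler_pdivrMr; last by apply: mulr_gt0.
  apply: le_trans h1 _.
  rewrite div1r ler_pdivlMl// mulr1; lra.
rewrite -(subnK l3) in lN tl pl0 V1 *; move: (l - 3)%N lN tl pl0 V1 => m lN tl pl0 V1.
have -> : 8^-1 * 2 ^+ (m + 3) = 2 ^+ m :> R by rewrite exprD !exprS expr0; field.
have Dm : (2 ^+ m : R) = (2 ^ m)%:R by rewrite natrX.
rewrite Dm; set D := (2 ^ m)%N in lN tl Dm *.
have D0 : (0 < D)%N by rewrite expn_gt0.
have lD : (2 ^ (m + 3) = 8 * D)%N by rewrite expnD mulnC.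
have tail : \sum_(D <= n < D + D) t ^+ (2 * n) / mom b n <= \sum_(n < N) t ^+ (2 * n) / mom b n.
  rewrite -(big_mkord xpredT (fun n => t ^+ (2 * n) / mom b n)).
  have DN : (D + D <= N)%N by rewrite (leq_trans _ lN)// lD addnn -mul2n leq_mul2r orbT.
  rewrite (@big_cat_nat _ _ _ (D + D) 0 N)//= ler_wpDr ?sumr_ge0//.
  by rewrite (@big_cat_nat _ _ _ D 0 (D + D)) ?leq_addr//= ler_wpDl// sumr_ge0.
apply: le_trans tail.
have -> : D%:R `^ (b + 2) / (2 * K) = \sum_(D <= n < D + D) D%:R `^ (b + 1) / (2 * K).
  rewrite sumr_const_nat addnK -[RHS]mulr_natl [RHS]mulrA; congr (_ / _).
  rewrite (_ : b + 2 = 1 + (b + 1)); last lra.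
  have Dn0 : (1 + (b + 1) == 0) ==> (D%:R != 0 :> R) by rewrite pnatr_eq0 -lt0n D0 implybT.
  by rewrite (powRD Dn0) powRr1.
apply: ler_sum_nat => n /andP[Dn nD].
have h1 : 2^-1 <= t ^+ (2 * n).
  apply: le_trans (@lerXn2r _ (2 * n) _ _ _ _ tl); rewrite ?nnegrE ?subr_ge0//.
  apply: le_trans (bernoulli_ineq (2 * n) _); last by rewrite V1 invr_ge0 ltW.
  have : ((2 * n)%:R : R) * (2 ^+ (m + 3))^-1 <= 2^-1.
    rewrite ler_pdivrMr// ler_pdivlMl// -natrX lD -!natrM ler_nat; lia.
  lra.
have h2 : D%:R `^ (b + 1) / K <= (mom b n)^-1.
  rewrite ler_pdivrMr// ler_pdivlMl ?mom_gt0//.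
  apply: le_trans (mom_le_powR n b1).
  rewrite ler_wpM2l ?(ltW (mom_gt0 _ _))// ge0_ler_powR ?nnegrE//; first lra.
  - by rewrite addr_ge0//; lra.
  - rewrite (@le_trans _ _ n.+1%:R) ?ler_nat 1?leqW// lerDl; lra.
rewrite invfM mulrCA; apply: ler_pM => //; rewrite ?invr_ge0//.
by rewrite divr_ge0 ?powR_ge0// ltW.
Qed.

End KernelDiagonal.

Section IntegrationOperator.
Context {R : realType}.
Local Notation C := R[i].
Implicit Types (b : R) (f g : C -> C) (c e : nat -> C).

Lemma has_pseries_analytic f c : has_pseries f 0 1 c -> analytic_on_disc f.
Proof.
move=> hf z0 z01; have h1 : modulus (z0 - 0) < 1 by rewrite subr0.
have [d [hd _]] := pseries_recenter hf h1.
exists (1 - modulus (z0 - 0)), d; split; first by rewrite subr_gt0.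
move=> z /(hd.2 z)/cvcP; apply: cvg_trans; apply: near_eq_cvg.
by near=> n; rewrite /psum /series/= big_mkord.
Unshelve. all: by end_near. Qed.

Lemma pseries_bounded f c r : has_pseries f 0 1 c -> r < 1 ->
  exists2 M, 0 <= M & forall z, modulus z <= r -> modulus (f z) <= M.
Proof.
move=> hf r1; have [r0|r0] := ltP r 0.
  exists 0 => // z zr; have := modulus_ge0 z; lra.
pose s := (r + 1) / 2.
have rs : r < s by rewrite /s; lra.
have s1 : s < 1 by rewrite /s; lra.
have s0 : 0 < s by lra.
have [M hM] := hf.1 s (introT andP (conj (ltW s0) s1)).
have M0 : 0 <= M by rewrite (le_trans _ (hM 0%N))// mulr_ge0 ?modulus_ge0 ?exprn_ge0 ?ltW.
have rs1 : r / s < 1 by rewrite ltr_pdivrMr// mul1r.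
exists (M / (1 - r / s)); first by rewrite divr_ge0// subr_ge0 ltW.
move=> z zr; have z0 := modulus_ge0 z.
have zs : modulus (z - 0) < s by rewrite subr0; lra.
have z1 : modulus (z - 0) < 1 by lra.
have := pseries_tail 0 hf s0 zs z1 hM; rewrite /psum big_ord0 !subr0 expr0 mulr1.
move=> /le_trans; apply; rewrite ler_wpM2l//.
have q : modulus z / s <= r / s by rewrite ler_pM2r ?invr_gt0.
by rewrite lef_pV2 ?posrE; lra.
Qed.

Lemma wtD2 b z : -1 < b -> wt (b + 2) z = (1 - modulus z ^+ 2) ^+ 2 * wt b z.
Proof.
move=> b1; rewrite /wt discE; case: ltP => z1; last by rewrite !mulr0.
have d0 : 0 < 1 - modulus z ^+ 2 by rewrite subr_gt0 expr_lt1 ?modulus_ge0.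
by rewrite powRD ?(gt_eqF d0) ?implybT// (powR_mulrn 2 (ltW d0)) !mulr1 mulrC.
Qed.

Lemma integration_operatorE g f z : modulus z < 1 ->
  integration_operator g f z = segment_integral (fun x => f x * derive1 g x) z.
Proof. by move=> z1; rewrite /integration_operator z1. Qed.

Lemma integration_operator_out g f z : ~ disc z -> integration_operator g f z = 0.
Proof. by move=> z1; rewrite /integration_operator ifN//; apply/negP. Qed.

Lemma integration_pseries g f c e : has_pseries g 0 1 e -> has_pseries f 0 1 c ->
  has_pseries (integration_operator g f) 0 1 (int_coef (cauchy_product c (deriv_coef e))).
Proof.
move=> hg hf; have h := segment_integral_pseries (has_pseriesM hf (has_pseries_derive hg)).
by apply: eq_has_pseries h => z; rewrite subr0 => z1; rewrite integration_operatorE.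
Qed.

Lemma integration_operator_le b g f c e : -1 < b ->
  has_pseries g 0 1 e -> has_pseries f 0 1 c ->
  (sqnorm b (integration_operator g f) <=
   ((b + 3) / ((b + 1) * (b + 2)))%:E * sqnorm (b + 2) (fun z => f z * derive1 g z)%R)%E.
Proof.
move=> b1 hg hf; apply: (littlewood_paley_le b1) (integration_pseries hg hf).
exact: has_pseriesM hf (has_pseries_derive hg).
Qed.

Lemma integration_operator_ge b g f c e : -1 < b ->
  has_pseries g 0 1 e -> has_pseries f 0 1 c ->
  (sqnorm (b + 2) (fun z => f z * derive1 g z)%R <=
   ((b + 1) * (b + 2))%:E * sqnorm b (integration_operator g f))%E.
Proof.
move=> b1 hg hf; apply: (littlewood_paley_ge b1) (integration_pseries hg hf).
exact: has_pseriesM hf (has_pseries_derive hg).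
Qed.

Definition bloch_sq g (z : C) : R := modulus (derive1 g z) ^+ 2 * (1 - modulus z ^+ 2) ^+ 2.

Lemma bloch_sq_ge0 g z : 0 <= bloch_sq g z.
Proof. by rewrite mulr_ge0 ?sqr_ge0. Qed.

Lemma sqnorm_mul_derive b g f : -1 < b ->
  sqnorm (b + 2) (fun z => f z * derive1 g z) =
  Rcint (fun z => modulus (f z) ^+ 2 * bloch_sq g z * wt b z).
Proof.
move=> b1; apply: eq_Rcint => z; rewrite wtD2// modulusM exprMn /bloch_sq; ring.
Qed.

Lemma little_bloch_near g eps : little_bloch g -> 0 < eps ->
  exists2 r, r < 1 & forall z, r < modulus z < 1 -> bloch_sq g z <= eps.
Proof.
move=> [_ hg] eps0; have s0 : 0 < Num.sqrt eps by rewrite sqrtr_gt0.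
have [d /= d0 hd] := hg _ s0.
exists (1 - d) => [|z /andP[rz z1]]; first lra.
have := hd (modulus z) _ z1 z erefl; rewrite /ball/= => /(_ ltac:(rewrite ger0_norm; lra)).
move=> h; rewrite /bloch_sq -exprMn mulrC -(sqr_sqrtr (ltW eps0)).
rewrite lerXn2r ?nnegrE ?sqrtr_ge0 ?(ltW h)// mulr_ge0 ?modulus_ge0//.
by rewrite subr_ge0 expr_le1 ?modulus_ge0// ltW.
Qed.

Lemma bloch_sq_bounded g : little_bloch g ->
  exists2 B, 0 < B & forall z, modulus z < 1 -> bloch_sq g z <= B.
Proof.
move=> hg; have [r r1 hr] := little_bloch_near hg ltr01.
have [e he] := analytic_taylor hg.1.
have [M M0 hM] := pseries_bounded (has_pseries_derive he) r1.
exists (1 + M ^+ 2) => [|z z1]; first by rewrite ltr_pwDl// sqr_ge0.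
have [zr|zr] := leP (modulus z) r; last first.
  by apply: le_trans (hr z _) _; rewrite ?zr// lerDl sqr_ge0.
have z0 := modulus_ge0 z.
have q1 : modulus z ^+ 2 <= 1 by rewrite expr_le1// ltW.
have q0 := sqr_ge0 (modulus z).
rewrite /bloch_sq; apply: (@le_trans _ _ (M ^+ 2)); last by rewrite lerDr.
rewrite -[leRHS]mulr1; apply: ler_pM; rewrite ?sqr_ge0//.
  by rewrite lerXn2r ?nnegrE ?modulus_ge0// hM.
by rewrite expr_le1// ?subr_ge0//; lra.
Qed.

Lemma cmeasR_bloch_sq_wt b g e : has_pseries g 0 1 e ->
  cmeasR (fun z => bloch_sq g z * wt b z).
Proof.
move=> hg; apply: eq_cmeasR (cmeasR_pseries (has_pseries_derive hg) (_ : radial 1 (fun z => (1 - modulus z ^+ 2) ^+ 2 * wt b z))) => [z|].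
  by rewrite /bloch_sq mulrA.
have [m1 m2 m3 m4] := radial_wt (R := R) b; split.
- apply: cmeasRM => //; apply: cmeasRX; apply: cmeasRB; first exact: cmeasR_cst.
  by apply: cmeasRX; exact: cmeasR_modulus_id.
- by move=> z; rewrite mulr_ge0 ?sqr_ge0.
- by move=> a z a1; rewrite m3// modulusM a1 mul1r.
- by move=> z z1; rewrite m4// mulr0.
Qed.

Lemma bergman_norm_leE b f (s : R) : -1 < b -> 0 <= s ->
  ((bergman_norm b f <= (Num.sqrt s)%:E) = ((b + 1)%:E * sqnorm b f <= s%:E))%E.
Proof.
move=> b1 s0; rewrite bergman_normE -[(Num.sqrt s)%:E]/(sqrte s%:E).
by rewrite lee_sqrt.
Qed.

Lemma bergman_norm_lty b f : -1 < b -> ((bergman_norm b f < +oo) = (sqnorm b f < +oo))%E.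
Proof.
move=> b1; rewrite bergman_normE; have := sqnorm_ge0 b f.
case: (sqnorm b f) => [r _|_|//]; first by rewrite -EFinM !ltry.
by rewrite gt0_muley// lte_fin; lra.
Qed.

End IntegrationOperator.

(** * Dyadic boxes *)

Section Sectors.
Context {R : realType}.
Local Notation C := R[i].
Implicit Types (a b t s : R) (z w : C).

Lemma pi_lt4 : (pi : R) < 4.
Proof. by have := @pihalf_lt2 R; lra. Qed.

Lemma cos_lipschitz t s : `|cos t - cos s| <= `|t - s|.
Proof.
wlog st : t s / s <= t.
  by move=> h; have [/h//|/ltW/h] := leP s t; rewrite distrC (distrC s).
have hd x : x \in `]s, t[ -> is_derive x 1 (cos : R -> R) (- sin x).
  by move=> _; exact: is_derive_cos.
have hc : {within `[s, t], continuous (cos : R -> R)}.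
  by apply: continuous_subspaceT => x; exact: continuous_cos.
have [c _ ->] := MVT_segment st hd hc.
rewrite normrM ler_piMl// normrN ler_norml sin_geN1 sin_le1//.
Qed.

Lemma sin_lipschitz t s : `|sin t - sin s| <= `|t - s|.
Proof.
rewrite -[X in `|X - _|]cosBpihalf -[X in `|_ - X|]cosBpihalf.
by apply: le_trans (cos_lipschitz _ _) _; rewrite opprB addrA subrK.
Qed.

Lemma expi_lipschitz t s : modulus (expi t - expi s) <= 2 * `|t - s|.
Proof.
apply: le_trans (expi_dist_le _ _) _.
by rewrite mulrDl mul1r lerD// ?cos_lipschitz ?sin_lipschitz.
Qed.

Definition sector a b : set C := [set z | Defs.arc a b (z / (modulus z)%:C)].

Lemma sectorP a b z : sector a b z <->
  exists t, [/\ a <= t < b, z != 0 & z = (modulus z)%:C * expi t].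
Proof.
split=> [[t /= tab e]|[t [tab z0 e]]]; last first.
  exists t => //; rewrite -/(expi t) {1}e mulrC mulrA mulVf ?mul1r//.
  by rewrite eq_complex/= negb_and modulus_eq0 z0.
exists t; have z0 : z != 0.
  apply/eqP => z0; move: e; rewrite z0 mul0r => e; have := modulus_expi t.
  by rewrite /expi e modulus0 => /eqP; rewrite eq_sym oner_eq0.
split=> //; rewrite /expi e mulrC divfK//.
by rewrite eq_complex/= negb_and modulus_eq0 z0.
Qed.

Lemma sector_split a m b : a <= m <= b -> sector a b = sector a m `|` sector m b.
Proof.
move=> /andP[am mb]; apply/seteqP; split=> z.
  move=> [t /= /andP[ta tb] e]; have [tm|tm] := ltP t m.
    by left; exists t => //=; rewrite ta.
  by right; exists t => //=; rewrite tm.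
by move=> [|] [t /= /andP[ta tb] e]; exists t => //=; apply/andP; split=> //;
  [exact: lt_le_trans tb mb|exact: le_trans am ta].
Qed.

Lemma cmeasR_Im_mul (u : C) : cmeasR (fun z => complex.Im (z * u)).
Proof.
have [_ mu] := cmeasCM (@cmeasC_id R) (cmeasC_cst u).
exact: mu.
Qed.

Lemma Im_mul_expi z t u : z = (modulus z)%:C * expi t ->
  complex.Im (z * expi u) = modulus z * sin (t + u).
Proof.
move=> e; rewrite {1}e -mulrA -expiD /expi /=; ring.
Qed.

(** Gives measurability: openings below [pi] are cut out by two half-planes, and larger sectors are
    halved twice in [cmeasS_sector]. *)
Lemma sector_halfplanes a b : 0 < b - a < pi -> sector a b =
  [set z | 0 <= complex.Im (z * expi (- a))] `&` [set z | complex.Im (z * expi (- b)) < 0].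
Proof.
move=> /andP[L0 L1]; apply/seteqP; split=> z.
  move=> /sectorP[t [/andP[ta tb] z0 e]] /=.
  rewrite (Im_mul_expi (- a) e) (Im_mul_expi (- b) e).
  have zp : 0 < modulus z by rewrite modulus_gt0.
  split; first by rewrite mulr_ge0 ?(ltW zp)// sin_ge0_pi//; apply/andP; split; lra.
  rewrite pmulr_rlt0// -oppr_gt0 -sinN sin_gt0_pi//; apply/andP; split; lra.
move=> [/= h1 h2]; have z0 : z != 0.
  by apply/eqP => z0; move: h2; rewrite z0 mul0r ltxx.
have zp : 0 < modulus z by rewrite modulus_gt0.
have [u /andP[u0 u2] e] := polarP (z * expi (- a)).
have {}e : z = (modulus z)%:C * expi (u + a).
  by move: e; rewrite modulusM modulus_expi mulr1 expiD mulrA => <-; rewrite -mulrA -expiD addNr expi0 mulr1.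
apply/sectorP; exists (u + a); split=> //.
move: h1 h2; rewrite (Im_mul_expi (- a) e) (Im_mul_expi (- b) e).
rewrite pmulr_rge0// pmulr_rlt0// addrK => h1 h2.
have upi : u <= pi.
  rewrite leNgt; apply/negP => upi; have : 0 < sin (u - pi).
    by apply: sin_gt0_pi; apply/andP; split; lra.
  by rewrite sinB cospi sinpi; lra.
apply/andP; split; first lra.
rewrite ltNge; apply/negP => bu; have : 0 <= sin (u + a - b).
  by apply: sin_ge0_pi; apply/andP; split; lra.
lra.
Qed.

Lemma cmeasS_sector_small a b : 0 < b - a < pi -> cmeasS (sector a b).
Proof.
move=> h; rewrite sector_halfplanes//; apply: measurableI.
  have := cmeasS_preimage (cmeasR_Im_mul (expi (- a))) (measurable_itv `[0, +oo[).
  by rewrite /cmeasS; congr (measurable _); apply/seteqP; split=> p /=; rewrite in_itv/= andbT.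
have := cmeasS_preimage (cmeasR_Im_mul (expi (- b))) (measurable_itv `]-oo, 0[).
by rewrite /cmeasS; congr (measurable _); apply/seteqP; split=> p /=; rewrite in_itv.
Qed.

Lemma cmeasS_sector a b : 0 < b - a <= 2 * pi -> cmeasS (sector a b).
Proof.
move=> /andP[L0 L1]; have p0 := @pi_gt0 R.
have half x y : 0 < y - x < 2 * pi -> cmeasS (sector x y).
  move=> /andP[h0 h1]; rewrite (@sector_split x ((x + y) / 2) y); last by apply/andP; split; lra.
  by apply: measurableU; apply: cmeasS_sector_small; apply/andP; split; lra.
rewrite (@sector_split a ((a + b) / 2) b); last by apply/andP; split; lra.
by apply: measurableU; apply: half; apply/andP; split; lra.
Qed.

End Sectors.

Section DyadicBoxes.
Context {R : realType}.
Local Notation C := R[i].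
Implicit Types (z w : C) (p q : nat * nat).

Definition side p : R := (2 ^+ p.1)^-1.

(* The scale [p.1 = 0] is allowed: its box is the punctured core
   [0 < |z| < 1/2]. *)
Definition box_index : set (nat * nat) := [set p | (1 <= p.2 <= 2 ^ p.1)%N].

Definition box_arg p : R := 2 * pi * p.2%:R / 2 ^+ p.1.

Lemma side_gt0 p : 0 < side p.
Proof. by rewrite invr_gt0 exprn_gt0. Qed.

Lemma side_le1 p : side p <= 1.
Proof. by rewrite invf_le1 ?exprn_gt0// exprn_ege1// ler1n. Qed.

Lemma box_argS p : 2 * pi * p.2.+1%:R / 2 ^+ p.1 = box_arg p + 2 * pi * side p.
Proof. by rewrite /box_arg /side -natr1; ring. Qed.

Lemma dyadic_boxE p z : dyadic_box p z <->
  [/\ side p / 2 < 1 - modulus z <= side p & sector (box_arg p) (box_arg p + 2 * pi * side p) z].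
Proof.
have p0 := @pi_gt0 R; have s0 := side_gt0 p.
rewrite /dyadic_box /arc_box /mkset box_argS addrAC subrr add0r.
have -> : 2 * pi * side p / (4 * pi) = side p / 2.
  by move: (pi : R) (side p) p0 => P s P0; field; rewrite gt_eqF.
have -> : 2 * pi * side p / (2 * pi) = side p.
  by move: (pi : R) (side p) p0 => P s P0; field; rewrite gt_eqF.
split=> [[_ h1 h2]|[h1 h2]]; first by split.
by split=> //; rewrite /disc /mkset; move: h1 => /andP[h1 _]; lra.
Qed.

Lemma dyadic_boxP p z : dyadic_box p z <-> exists t,
  [/\ side p / 2 < 1 - modulus z <= side p,
      box_arg p <= t < box_arg p + 2 * pi * side p, z != 0 & z = (modulus z)%:C * expi t].
Proof.
split=> [/dyadic_boxE[h1 /sectorP[t [h2 h3 h4]]]|[t [h1 h2 h3 h4]]]; first by exists t.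
by apply/dyadic_boxE; split=> //; apply/sectorP; exists t.
Qed.

Lemma side_scale_uniq (m n : nat) (x : R) : (2 ^+ m)^-1 / 2 < x <= (2 ^+ m)^-1 ->
  (2 ^+ n)^-1 / 2 < x <= (2 ^+ n)^-1 -> m = n.
Proof.
wlog mn : m n / (m <= n)%N.
  move=> h; have [/h//|/ltnW/h h'] := leqP m n.
  by move=> h1 h2; rewrite (h' h2 h1).
move=> /andP[h1 _] /andP[_ h2]; apply/eqP; rewrite eqn_leq mn/= leqNgt; apply/negP => mn'.
have : (2 ^+ n)^-1 <= (2 ^+ m)^-1 / 2 :> R.
  rewrite -invfM -exprSr lef_pV2 ?posrE ?exprn_gt0//.
  by rewrite ler_weXn2l// ler1n.
lra.
Qed.

Lemma dyadic_box_disjoint p q z : box_index p -> box_index q ->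
  dyadic_box p z -> dyadic_box q z -> p = q.
Proof.
case: p q => [n k] [m l]; rewrite /box_index/= => hk hl.
move=> /dyadic_boxP[t [h1 h2 z0 e]] /dyadic_boxP[s [h1' h2' _ e']].
have nm : n = m by apply: side_scale_uniq h1 h1'.
rewrite -{m}nm in hl h1' h2' *; congr (_, _).
have zn : (modulus z)%:C != 0 :> C by rewrite eq_complex/= negb_and modulus_eq0 z0.
have et : expi t = expi s by apply: (mulfI zn); rewrite -e -e'.
have p0 := @pi_gt0 R; have s0 := side_gt0 (n, 0%N).
have sn : side (n, 0%N) * (2 ^ n)%:R = 1 by rewrite /side natrX mulVf// expf_neq0.
pose a : R := 2 * pi * side (n, 0%N).
have a0 : 0 < a by rewrite !mulr_gt0.
have argE j : box_arg (n, j) = a * j%:R by rewrite /box_arg /a /side/=; ring.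
have aN : a * (2 ^ n)%:R = 2 * pi by rewrite /a -mulrA sn mulr1.
rewrite !argE -/a in h2 h2'.
(* Indices run from [1] to [2^n], so all arguments lie in [[a, a + 2 pi[], where [expi] is
   injective. *)
have in_range j u : (1 <= j <= 2 ^ n)%N -> a * j%:R <= u < a * j%:R + a -> a <= u < a + 2 * pi.
  move=> /andP[j1 jn] /andP[u1 u2].
  have : (1 : R) <= j%:R by rewrite ler1n.
  have : (j%:R : R) <= (2 ^ n)%:R by rewrite ler_nat.
  by rewrite -aN => *; apply/andP; split; nra.
have ts := expi_inj (in_range k t hk h2) (in_range l s hl h2') et.
rewrite -ts in h2'; move: h2 h2' => /andP[u1 u2] /andP[u3 u4].
have kl : (k%:R : R) < l%:R + 1 by rewrite -(ltr_pM2l a0) mulrDr mulr1; lra.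
have lk : (l%:R : R) < k%:R + 1 by rewrite -(ltr_pM2l a0) mulrDr mulr1; lra.
move: kl lk; rewrite !natr1 !ltr_nat !ltnS => kl lk.
by apply/eqP; rewrite eqn_leq kl lk.
Qed.

Lemma dyadic_box_cover z : 0 < modulus z < 1 -> exists2 p, box_index p & dyadic_box p z.
Proof.
move=> /andP[z0 z1]; have p0 := @pi_gt0 R.
have [n h1] : exists n, (2 ^+ n)^-1 / 2 < 1 - modulus z <= (2 ^+ n)^-1.
  have ex : exists n, (2 ^+ n)^-1 / 2 < 1 - modulus z :> R.
    have d0 : 0 < 1 - modulus z by lra.
    have := archimedean.Num.Theory.archi_boundP (ltW (divr_gt0 ltr01 d0)).
    set n := archimedean.Num.bound _ => hn; exists n; rewrite -invfM -exprSr invf_plt ?posrE ?exprn_gt0//.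
    rewrite -div1r (lt_trans hn)// -natrX ltr_nat.
    by rewrite (ltn_trans (ltn_expl n (isT : (1 < 2)%N)))// ltn_exp2l.
  have := ex_minnP ex; case=> n hn hmin; exists n; rewrite hn/=.
  case: n hn hmin => [|n] hn hmin; first by rewrite expr0 invr1; lra.
  rewrite leNgt; apply/negP => h; have := hmin n; rewrite -invfM -exprSr h => /(_ isT).
  by rewrite ltnn.
have [t /andP[t0 t2] e] := polarP z.
pose a : R := 2 * pi * (2 ^+ n)^-1.
have a0 : 0 < a by rewrite !mulr_gt0 ?invr_gt0 ?exprn_gt0.
have aN : a * (2 ^ n)%:R = 2 * pi by rewrite /a -mulrA natrX mulVf ?mulr1// expf_neq0.
have [j /andP[j1 j2]] : exists j : nat, a * j%:R <= t < a * j%:R + a.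
  exists (Num.truncn (t / a)); have := truncn_itv (divr_ge0 t0 (ltW a0)).
  move=> /andP[]; rewrite ler_pdivlMr// ltr_pdivrMr// => h2 h3.
  by rewrite mulrC h2/=; move: h3; rewrite -natr1 mulrDl mul1r.
have zn : z != 0 by rewrite -modulus_gt0.
have jn : (j < 2 ^ n)%N by rewrite -(ltr_nat R) -(ltr_pM2l a0) aN; lra.
case: j j1 j2 jn => [|j] j1 j2 jn.
  (* Arguments in [[0, a[] belong to the arc of index [2^n], after a full turn. *)
  exists (n, 2 ^ n)%N; first by rewrite /box_index/= leqnn expn_gt0.
  apply/dyadic_boxP; exists (t + 2 * pi); split=> //.
  - rewrite /box_arg /side/= -/a; have -> : 2 * pi * (2 ^ n)%:R / 2 ^+ n = a * (2 ^ n)%:R by rewrite /a; ring.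
    by rewrite aN; apply/andP; split; lra.
  - by rewrite expiD (mulr_natl pi 2) expi_2pi mulr1.
exists (n, j.+1); first by rewrite /box_index/= ltnW.
apply/dyadic_boxP; exists t; split=> //.
rewrite /box_arg /side/= -/a; have -> : 2 * pi * j.+1%:R / 2 ^+ n = a * j.+1%:R by rewrite /a; ring.
by rewrite j1.
Qed.

Lemma cmeasS_dyadic_box p : cmeasS (dyadic_box p : set C).
Proof.
have p0 := @pi_gt0 R; have s0 := side_gt0 p; have s1 := side_le1 p.
rewrite (_ : dyadic_box p = (fun z => 1 - modulus z) @^-1` `]side p / 2, side p]%classic
    `&` sector (box_arg p) (box_arg p + 2 * pi * side p)).
  apply: measurableI; last first.
    by apply: cmeasS_sector; rewrite addrAC subrr add0r; apply/andP; split; nra.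
  apply: cmeasS_preimage => //; apply: cmeasRB; first exact: cmeasR_cst.
  exact: cmeasR_modulus_id.
apply/seteqP; split=> z; first by move=> /dyadic_boxE[h1 h2]; split=> //=; rewrite in_itv.
by move=> [/= h1 h2]; apply/dyadic_boxE; split=> //; move: h1; rewrite in_itv.
Qed.

(** The constant [17 = 1 + 2 * 8]: moduli differ by at most [side p], arguments by at most
    [2 pi side p < 8 side p], and [expi] is Lipschitz with constant [2]. *)
Lemma dyadic_box_diam p z w : dyadic_box p z -> dyadic_box p w ->
  modulus (z - w) <= 17 * side p.
Proof.
move=> /dyadic_boxP[t [/andP[a1 a2] /andP[t1 t2] _ e]] /dyadic_boxP[s [/andP[b1 b2] /andP[s1 s2] _ e']].
have s0 := side_gt0 p; have pi4 := @pi_lt4 R; have w0 := modulus_ge0 w.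
have -> : z - w = (modulus z - modulus w)%:C * expi t + (modulus w)%:C * (expi t - expi s).
  by rewrite {1}e {1}e' rmorphB; ring.
apply: le_trans (modulus_le_add _ _) _.
rewrite !modulusM modulus_expi mulr1 !modulusR (ger0_norm w0).
have h1 : `|modulus z - modulus w| <= side p by rewrite ler_norml; apply/andP; split; lra.
have h2 := expi_lipschitz t s.
have h3 : `|t - s| <= 8 * side p by rewrite ler_norml; apply/andP; split; nra.
have h4 : modulus w <= 1 by lra.
have h5 := modulus_ge0 (expi t - expi s).
have : modulus w * modulus (expi t - expi s) <= modulus (expi t - expi s) by rewrite ler_piMl.
lra.
Qed.

End DyadicBoxes.

Section BoxAreas.
Context {R : realType}.
Local Notation C := R[i].
Implicit Types (z w c : C) (p q : nat * nat).

Lemma indic_setE (A : set C) z : A z -> \1_A z = 1 :> R.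
Proof. by move=> Az; rewrite indicE mem_set. Qed.

Lemma indic_setN (A : set C) z : ~ A z -> \1_A z = 0 :> R.
Proof. by move=> Az; rewrite indicE memNset. Qed.

Lemma indic_ge0 (A : set C) z : 0 <= \1_A z :> R.
Proof. by rewrite indicE; case: (_ \in _). Qed.

Lemma indic_le1 (A : set C) z : \1_A z <= 1 :> R.
Proof. by rewrite indicE; case: (_ \in _). Qed.

Lemma indic_sub (A B : set C) z w : (A z -> B w) -> \1_A z <= \1_B w :> R.
Proof.
move=> AB; have [/set_mem/AB Bz|nA] := boolP (z \in A); first by rewrite (indic_setE Bz) indic_le1.
by rewrite [leLHS]indicE (negbTE nA) indic_ge0.
Qed.

Definition ball_at c (r : R) : set C := [set z | modulus (z - c) <= r].

Lemma ball_atE c r z : 0 <= r -> \1_(ball_at c r) z = \1_(cdisc (r ^+ 2)) (z + - c) :> R.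
Proof.
move=> r0; rewrite !indicE cdiscE /sqmod ler_pXn2r ?nnegrE ?modulus_ge0//.
by congr (nat_of_bool _)%:R; apply/idP/idP => [/set_mem|h]; [|apply/mem_set].
Qed.

Lemma cmeasR_ball_at c r : 0 <= r -> cmeasR (\1_(ball_at c r) : C -> R).
Proof.
move=> r0; apply: eq_cmeasR (cmeasR_add (- c) (cmeasR_indic (cmeasS_cdisc (r ^+ 2)))) => z.
by rewrite ball_atE.
Qed.

Lemma Rcint_ball_at c r : 0 < r -> Rcint (\1_(ball_at c r) : C -> R) = (r ^+ 2 * kappa)%:E.
Proof.
move=> r0; have md := cmeasR_indic (cmeasS_cdisc (r ^+ 2)).
rewrite (eq_Rcint (G := fun z => \1_(cdisc (r ^+ 2)) (z + - c))); last by move=> z; rewrite ball_atE// ltW.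
rewrite (Rcint_add (- c) md (indic_ge0 _)) (Rcint_indic (cmeasS_cdisc (r ^+ 2))).
by rewrite area_cdisc// exprn_gt0.
Qed.

Definition box_point p : C := (1 - 3 / 4 * side p)%:C * expi (box_arg p).

Lemma modulus_box_point p : modulus (box_point p) = 1 - 3 / 4 * side p.
Proof.
have := @side_le1 R p; rewrite /box_point modulusM modulus_expi mulr1 modulusR => s1.
by rewrite ger0_norm//; lra.
Qed.

Lemma box_point_in p : dyadic_box p (box_point p).
Proof.
have s0 := @side_gt0 R p; have s1 := @side_le1 R p; have p0 := @pi_gt0 R.
apply/dyadic_boxP; exists (box_arg p); rewrite modulus_box_point; split=> //.
- by apply/andP; split; lra.
- by rewrite lexx ltrDl !mulr_gt0.
- by rewrite -modulus_gt0 modulus_box_point; lra.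
Qed.

Lemma dyadic_box_rotate p q z : p.1 = q.1 -> dyadic_box p z ->
  dyadic_box q (expi (box_arg q - box_arg p) * z).
Proof.
move=> pq /dyadic_boxP[t [h1 h2 z0 e]]; have spq : side q = side p :> R by rewrite /side pq.
have me : modulus (expi (box_arg q - box_arg p) * z) = modulus z.
  by rewrite modulusM modulus_expi mul1r.
apply/dyadic_boxP; exists (t + (box_arg q - box_arg p)); rewrite me spq; split=> //.
- by move: h2 => /andP[h2 h3]; apply/andP; split; lra.
- by rewrite -modulus_gt0 me modulus_gt0.
- by rewrite {1}e mulrCA -expiD [_ + t]addrC.
Qed.

Lemma area_dyadic_box_eq p q : p.1 = q.1 -> area (dyadic_box p : set C) = area (dyadic_box q).
Proof.
move=> pq; rewrite -(Rcint_indic (cmeasS_dyadic_box p)) -(Rcint_indic (cmeasS_dyadic_box q)).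
have mq := cmeasR_indic (@cmeasS_dyadic_box R q).
rewrite -(Rcint_rotate (modulus_expi (box_arg q - box_arg p)) mq (indic_ge0 _)).
apply: eq_Rcint => z; apply/eqP; rewrite eq_le; apply/andP; split; apply: indic_sub.
  exact: dyadic_box_rotate.
move=> /(dyadic_box_rotate (esym pq)); rewrite mulrA -expiD.
by rewrite [X in expi X](_ : _ = 0) ?expi0 ?mul1r//; ring.
Qed.

(** The [2^n] boxes of one scale are rotations of each other, so each has at least [2^-n] times the
    area of any annulus they cover. The annulus [5 d / 8 <= 1 - |z| < d] stays inside the half-open
    range of moduli of the boxes. *)
Lemma area_dyadic_box_ge p : (((kappa / 8) * side p ^+ 2)%:E <= area (dyadic_box p : set C))%E.
Proof.
set d : R := side p; have d0 : 0 < d by exact: side_gt0. have d1 : d <= 1 by exact: side_le1.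
pose A : set C := sqmod @^-1` `](1 - d) ^+ 2, (1 - 5 / 8 * d) ^+ 2]%classic.
have mA : cmeasS A by exact: cmeasS_preimage cmeasR_sqmod _.
have aA : area A = (((1 - 5 / 8 * d) ^+ 2 - (1 - d) ^+ 2) * kappa)%:E.
  have u0 : 0 <= (1 - d) ^+ 2 by exact: sqr_ge0.
  have v0 : 0 <= (1 - 5 / 8 * d) ^+ 2 by exact: sqr_ge0.
  by rewrite area_sqmod_itv ?(max_l u0) ?(max_l v0)//; nra.
have mb k := cmeasR_indic (@cmeasS_dyadic_box R (p.1, k)).
have : (area A <= Rcint (fun z => \sum_(k <- iota 1 (2 ^ p.1)) \1_(dyadic_box (p.1, k)) z)%R)%E.
  rewrite -(Rcint_indic mA); apply: Rcint_le.
  - exact: cmeasR_indic.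
  - exact: cmeasR_sum.
  - exact: indic_ge0.
  move=> z; have [/set_mem Az|nA] := boolP (z \in A); last first.
    by rewrite indicE (negbTE nA) sumr_ge0// => k _; exact: indic_ge0.
  rewrite (indic_setE Az); move: Az; rewrite /A/= in_itv/= /sqmod => /andP[h1 h2].
  have z0 : 0 < modulus z.
    rewrite lt0r modulus_ge0 andbT; apply: contraTneq h1 => ->.
    by rewrite expr0n/= -leNgt sqr_ge0.
  have h1' : 1 - d < modulus z by move: h1; rewrite ltr_pXn2r ?nnegrE//; lra.
  have h2' : modulus z <= 1 - 5 / 8 * d by move: h2; rewrite ler_pXn2r ?nnegrE//; lra.
  have z1 : modulus z < 1 by lra.
  have [[m l] ml hz] := dyadic_box_cover (introT andP (conj z0 z1)).
  have mE : m = p.1.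
    have /dyadic_boxP[t [h3 _ _ _]] := hz.
    by apply: (side_scale_uniq h3); rewrite -[(2 ^+ p.1)^-1]/d; apply/andP; split; lra.
  rewrite mE in ml hz.
  have lin : l \in iota 1 (2 ^ p.1) by rewrite mem_iota; move: ml; rewrite /box_index/= add1n ltnS.
  rewrite (bigD1_seq l lin (iota_uniq _ _))/= (indic_setE hz) lerDl.
  by apply: sumr_ge0 => k _; exact: indic_ge0.
rewrite (Rcint_sum _ mb (fun k => indic_ge0 _)).
rewrite (eq_bigr (fun=> area (dyadic_box p : set C))); last first.
  by move=> k _; rewrite (Rcint_indic (cmeasS_dyadic_box _)); exact: area_dyadic_box_eq.
have a0 : (0 <= area (dyadic_box p : set C))%E by exact: measure_ge0.
rewrite aA; case: (area _) a0 => [r| |]; last 2 first.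
- by move=> _ _; rewrite leey.
- by [].
move=> _; rewrite sumEFin !lee_fin big_const_seq count_predT iter_addr_0 size_iota -(mulr_natr r).
have k0 := @kappa_gt0 R.
have dN : d * (2 ^ p.1)%:R = 1 by rewrite natrX mulVf// expf_neq0.
move=> h; have {}h : d * (((1 - 5 / 8 * d) ^+ 2 - (1 - d) ^+ 2) * kappa) <= r.
  by have := ler_wpM2l (ltW d0) h; rewrite [leRHS]mulrCA dN mulr1.
apply: le_trans h; rewrite -subr_ge0.
have -> : d * (((1 - 5 / 8 * d) ^+ 2 - (1 - d) ^+ 2) * kappa) - kappa / 8 * d ^+ 2 =
    kappa * d ^+ 2 * (5 / 8 - 39 / 64 * d) by field.
rewrite !mulr_ge0 ?sqr_ge0 ?(ltW k0)//; lra.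
Qed.

Lemma dyadic_boxes_le1 s z : uniq s -> (forall p, p \in s -> box_index p) ->
  \sum_(p <- s) \1_(dyadic_box p) z <= 1 :> R.
Proof.
move=> us hs; have [/hasP[p ps /asboolP hp]|/hasPn hn] := boolP (has (fun p => `[< dyadic_box p z >]) s).
  rewrite (bigD1_seq p ps us)/= (indic_setE hp) big_seq_cond big1 ?addr0// => q /andP[qs qp].
  apply: indic_setN => hq; move/negP: qp; apply; apply/eqP.
  exact: dyadic_box_disjoint (hs _ qs) (hs _ ps) hq hp.
rewrite big_seq big1 ?ler01// => p /hn/asboolPn; exact: indic_setN.
Qed.

(** Large enough to contain the discs of radius [side p / 16] about grid points close to the box,
    small enough to keep [1 - |z|] comparable with [side p] and to overlap boundedly. *)
Definition box_nbhd p : set C :=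
  [set z | modulus (z - box_point p) <= 18 * side p /\ side p / 4 <= 1 - modulus z <= 2 * side p].

Lemma cmeasR_box_nbhd p : cmeasR (\1_(box_nbhd p) : C -> R).
Proof.
have s0 := @side_gt0 R p; apply: cmeasR_indic.
have -> : box_nbhd p = [set z | sqmod (z - box_point p) <= (18 * side p) ^+ 2] `&`
    ((fun z => 1 - modulus z) @^-1` `[side p / 4, 2 * side p]%classic).
  apply/seteqP; split=> z; rewrite /box_nbhd/= in_itv/= /sqmod ler_pXn2r ?nnegrE ?modulus_ge0//.
  - by rewrite mulr_ge0// ltW.
  - by rewrite mulr_ge0// ltW.
apply: measurableI.
  have := cmeasS_preimage (cmeasR_add (- box_point p) cmeasR_sqmod) (measurable_itv `]-oo, (18 * side p) ^+ 2]).
  by rewrite /cmeasS; congr (measurable _); apply/seteqP; split=> q /=; rewrite in_itv.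
apply: cmeasS_preimage => //; apply: cmeasRB; first exact: cmeasR_cst.
exact: cmeasR_modulus_id.
Qed.

(** Packing: with [d = 1 - |w|], each box whose neighbourhood contains [w] has side between [d / 2]
    and [4 d], hence area at least [kappa d^2 / 32], and lies in the disc of radius
    [(17 + 18) 4 d = 140 d] about [w]. As the boxes are disjoint, their number is bounded. *)
Lemma box_nbhd_overlap : exists2 K : R, 0 < K & forall s w, uniq s ->
  (forall p, p \in s -> box_index p) -> \sum_(p <- s) \1_(box_nbhd p) w <= K.
Proof.
have k0 := @kappa_gt0 R.
exists (32 * 140 ^+ 2) => [|s w us hs]; first by rewrite mulr_gt0// exprn_gt0.
pose s' := [seq p <- s | w \in box_nbhd p].
have -> : \sum_(p <- s) \1_(box_nbhd p) w = (size s')%:R :> R.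
  rewrite /s' size_filter -sum1_count natr_sum [RHS]big_mkcond/=.
  by apply: eq_bigr => p _; rewrite indicE; case: (_ \in _).
have us' : uniq s' by exact: filter_uniq.
have hs' p : p \in s' -> box_index p /\ box_nbhd p w.
  by rewrite mem_filter => /andP[/set_mem h /hs].
have [->|ns] := eqVneq (size s') 0%N; first by rewrite mulr_ge0// exprn_ge0.
pose d := 1 - modulus w.
have side_d p : p \in s' -> d / 2 <= side p <= 4 * d.
  by move=> /hs'[_ [_ /andP[h1 h2]]]; rewrite /d; apply/andP; split; lra.
have d0 : 0 < d.
  case: s' ns side_d {us' hs'} => // p s' _ /(_ p); rewrite mem_head => /(_ isT) /andP[_ h].
  by have := @side_gt0 R p; lra.
have mb p := cmeasR_indic (@cmeasS_dyadic_box R p).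
have : (Rcint (fun z => \sum_(p <- s') \1_(dyadic_box p) z)%R <= Rcint (\1_(ball_at w (140 * d)%R) : C -> R))%E.
  apply: Rcint_le.
  - exact: cmeasR_sum.
  - by apply: cmeasR_ball_at; rewrite mulr_ge0// ltW.
  - by move=> z; apply: sumr_ge0 => p _; exact: indic_ge0.
  move=> z; have [hz|hz] := pselect (ball_at w (140 * d) z).
    by rewrite (indic_setE hz) dyadic_boxes_le1// => p /hs'[].
  rewrite (indic_setN hz) big_seq big1// => p ps; apply: indic_setN => pz; apply: hz.
  have [_ [h _]] := hs' p ps; have /andP[_ h2] := side_d p ps.
  have h3 := dyadic_box_diam pz (box_point_in p).
  rewrite /ball_at/=; apply: le_trans (modulus_distD _ _ (box_point p)) _.
  by rewrite (modulus_distC _ w); lra.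
rewrite (Rcint_sum _ mb (fun k => indic_ge0 _)) Rcint_ball_at; last by rewrite mulr_gt0.
have : (\sum_(p <- s') (kappa / 8 * (d / 2) ^+ 2)%:E <= \sum_(p <- s') Rcint (\1_(dyadic_box p) : C -> R))%E.
  rewrite !big_seq; apply: lee_sum => p ps; rewrite (Rcint_indic (cmeasS_dyadic_box p)).
  apply: le_trans (area_dyadic_box_ge p); rewrite lee_fin ler_wpM2l ?divr_ge0 ?(ltW k0)//.
  have /andP[h _] := side_d p ps.
  by rewrite lerXn2r ?nnegrE ?divr_ge0 ?(ltW d0)// ltW ?side_gt0.
move=> /le_trans h /h; rewrite sumEFin lee_fin big_const_seq count_predT iter_addr_0 -[_ *+ size _]mulr_natr => h'.
have kd : 0 < kappa * d ^+ 2 by rewrite mulr_gt0// exprn_gt0.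
rewrite -(ler_pM2r kd).
have -> : (size s')%:R * (kappa * d ^+ 2) = 32 * (kappa / 8 * (d / 2) ^+ 2 * (size s')%:R) by field.
have -> : 32 * 140 ^+ 2 * (kappa * d ^+ 2) = 32 * ((140 * d) ^+ 2 * kappa) by ring.
by rewrite ler_wpM2l.
Qed.

End BoxAreas.

(** * Local estimates and the Carleson sum *)

Section LocalSup.
Context {R : realType}.
Local Notation C := R[i].
Implicit Types (z w a : C) (x d : nat -> C) (r : R).

Lemma cauchy_schwarz I (s : seq I) (P : pred I) (u v : I -> R) :
  (\sum_(i <- s | P i) u i * v i) ^+ 2 <=
  (\sum_(i <- s | P i) u i ^+ 2) * (\sum_(i <- s | P i) v i ^+ 2).
Proof.
elim: s => [|i s IH]; first by rewrite !big_nil expr2 mulr0.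
rewrite !big_cons; case: ifP => // _; move: IH.
have := sumr_ge0 s (fun i (_ : P i) => sqr_ge0 (u i)).
have := sumr_ge0 s (fun i (_ : P i) => sqr_ge0 (v i)).
move: (\sum_(j <- s | P j) u j ^+ 2) (\sum_(j <- s | P j) v j ^+ 2) (\sum_(j <- s | P j) u j * v j).
move: (u i) (v i) => a b A B S B0 A0 h.
have h1 : 2 * S * (a * b) <= A * b ^+ 2 + B * a ^+ 2.
  have y0 : 0 <= A * b ^+ 2 + B * a ^+ 2 by rewrite addr_ge0// mulr_ge0// sqr_ge0.
  rewrite (le_trans (ler_norm _))// -(ler_pXn2r (n := 2)) ?nnegrE// real_normK ?num_real//.
  have := sqr_ge0 (A * b ^+ 2 - B * a ^+ 2).
  have : S ^+ 2 * (a * b) ^+ 2 <= A * B * (a * b) ^+ 2 by rewrite ler_wpM2r// sqr_ge0.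
  nra.
nra.
Qed.

Definition taylor_at x N a k : C :=
  if (k < N)%N then \sum_(i < N) recenter_coef x a k i else 0.

Lemma psum_taylor x N a z : psum x N z = psum (taylor_at x N a) N (z - a).
Proof.
have -> : z = a + (z - a) by rewrite addrC subrK.
rewrite psum_recenter [in RHS](addrC a) addrK; apply: eq_bigr => k _.
by rewrite /taylor_at ltn_ord.
Qed.

Lemma radial_indic_cdisc r : 0 < r -> radial (r + 1) (\1_(cdisc (r ^+ 2)) : C -> R).
Proof.
move=> r0; split.
- exact: cmeasR_indic (cmeasS_cdisc _).
- exact: indic_ge0.
- by move=> a z a1; rewrite !indicE !cdiscE /sqmod modulusM a1 mul1r.
- move=> z rz; rewrite indicE cdiscE /sqmod ler_pXn2r ?nnegrE ?modulus_ge0 ?(ltW r0)//.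
  by rewrite leNgt (lt_le_trans _ rz)// ltrDl.
Qed.

Lemma moment_cdisc_ge r n : 0 < r ->
  ((kappa * r ^+ 2 / 2 * (r ^+ 2 / 2) ^+ n)%:E <= moment (\1_(cdisc (r ^+ 2)) : C -> R) n)%E.
Proof.
move=> r0; have q0 : 0 < r ^+ 2 by rewrite exprn_gt0.
pose A : set C := sqmod @^-1` `]r ^+ 2 / 2, r ^+ 2]%classic.
have mA : cmeasS A by exact: cmeasS_preimage cmeasR_sqmod _.
have aA : area A = (kappa * r ^+ 2 / 2)%:E.
  have q2 : 0 <= r ^+ 2 / 2 by lra.
  rewrite area_sqmod_itv ?(max_l q2) ?(max_l (ltW q0)); last lra.
  by congr EFin; field.
have cn : 0 <= (r ^+ 2 / 2) ^+ n by rewrite exprn_ge0// divr_ge0// ltW.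
rewrite mulrC EFinM -aA -(Rcint_indic mA) -(RcintZ cn (cmeasR_indic mA) (indic_ge0 _)).
apply: Rcint_le.
- by apply: cmeasRM; [exact: cmeasR_cst|exact: cmeasR_indic].
- apply: cmeasRM; last exact: cmeasR_indic (cmeasS_cdisc _).
  by apply: cmeasRX; exact: cmeasR_modulus_id.
- by move=> z; rewrite mulr_ge0// indic_ge0.
move=> z; have [/set_mem Az|nA] := boolP (z \in A); last first.
  by rewrite indicE (negbTE nA) mulr0 mulr_ge0 ?indic_ge0 ?exprn_ge0 ?modulus_ge0.
rewrite (indic_setE Az) mulr1; move: Az; rewrite /A/= in_itv/= => /andP[h1 h2].
rewrite indicE cdiscE h2 mulr1 exprM; apply: lerXn2r; rewrite ?nnegrE ?sqr_ge0//; last exact: ltW.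
by rewrite divr_ge0// ltW.
Qed.

Lemma geo_half_tail k N : \sum_(k <= n < N) (2^-1 : R) ^+ n <= 2 * 2^-1 ^+ k.
Proof.
have h : 0 <= (2^-1 : R) < 1 by apply/andP; split; lra.
by apply: le_trans (sum_geo_le _ _ h) _; rewrite mulrC; rewrite (_ : 1 - 2^-1 = 2^-1) ?invrK//; lra.
Qed.

Lemma psum_from d k N z : (k <= N)%N -> (forall j, (j < k)%N -> d j = 0) ->
  psum d N z = \sum_(k <= n < N) d n * z ^+ n.
Proof.
move=> kN d0; rewrite /psum -(big_mkord xpredT (fun n => d n * z ^+ n)).
rewrite (@big_cat_nat _ _ _ k 0 N)//= big1_seq ?add0r// => j.
by rewrite mem_index_iota => /andP[_ /d0->]; rewrite mul0r.
Qed.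

Lemma sqr_psum_le d k N z (m : nat -> R) : (forall n, 0 < m n) ->
  (forall j, (j < k)%N -> d j = 0) ->
  modulus (psum d N z) ^+ 2 <=
  (\sum_(0 <= n < N) modulus (d n) ^+ 2 * m n) * (\sum_(k <= n < N) modulus z ^+ (2 * n) / m n).
Proof.
move=> m0 d0.
have t0 n : 0 <= modulus (d n) ^+ 2 * m n by rewrite mulr_ge0 ?sqr_ge0 ?(ltW (m0 n)).
have v0 n : 0 <= modulus z ^+ (2 * n) / m n by rewrite divr_ge0 ?exprn_ge0 ?modulus_ge0 ?(ltW (m0 n)).
have [kN|Nk] := leqP k N; last first.
  rewrite /psum big1 => [|i _]; first by rewrite modulus0 expr0n/= mulr_ge0// sumr_ge0.
  by rewrite d0 ?mul0r// (leq_trans _ (ltnW Nk))// ltnW// ltnS.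
rewrite (psum_from _ kN d0).
apply: (@le_trans _ _ ((\sum_(k <= n < N) modulus (d n) * modulus z ^+ n) ^+ 2)).
  rewrite lerXn2r ?nnegrE ?modulus_ge0//.
    by apply: sumr_ge0 => n _; rewrite mulr_ge0 ?exprn_ge0 ?modulus_ge0.
  apply: le_trans (modulus_sum _ _ _) _.
  by apply: ler_sum => n _; rewrite modulusM modulusX.
apply: (@le_trans _ _ ((\sum_(k <= n < N) modulus (d n) ^+ 2 * m n) * (\sum_(k <= n < N) modulus z ^+ (2 * n) / m n))).
  have -> : \sum_(k <= n < N) modulus (d n) * modulus z ^+ n =
    \sum_(k <= n < N) (modulus (d n) * Num.sqrt (m n)) * (modulus z ^+ n / Num.sqrt (m n)).
    apply: eq_bigr => n _; have : 0 < Num.sqrt (m n) by rewrite sqrtr_gt0.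
    by move: (Num.sqrt (m n)) (modulus z ^+ n) => q y qp; field; rewrite gt_eqF.
  apply: le_trans (cauchy_schwarz _ _ _ _) _.
  under eq_bigr do rewrite exprMn sqr_sqrtr ?(ltW (m0 _))//.
  under [X in _ * X <= _]eq_bigr do rewrite expr_div_n sqr_sqrtr ?(ltW (m0 _))// -exprM mulnC.
  exact: lexx.
rewrite ler_wpM2r ?sumr_ge0//.
by rewrite [leRHS](@big_cat_nat _ _ _ k 0 N)//= lerDr sumr_ge0.
Qed.

(** A lower bound for the moment of order [n] of the disc of radius [r]: the outer half of its area
    is kept, where [|z|^2 > r^2 / 2]. *)
Definition ball_mom r n : R := kappa * r ^+ 2 / 2 * (r ^+ 2 / 2) ^+ n.

Lemma ball_mom_gt0 r n : 0 < r -> 0 < ball_mom r n.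
Proof.
move=> r0; have q0 : 0 < r ^+ 2 by rewrite exprn_gt0.
by rewrite mulr_gt0 ?exprn_gt0 ?divr_gt0// mulr_gt0// kappa_gt0.
Qed.

Lemma local_l2 x N a r : 0 < r ->
  ((\sum_(0 <= n < N) modulus (taylor_at x N a n) ^+ 2 * ball_mom r n)%:E <=
   Rcint (fun w => modulus (psum x N w) ^+ 2 * \1_(ball_at a r) w)%R)%E.
Proof.
move=> r0; set d := taylor_at x N a.
have md : cmeasR (\1_(cdisc (r ^+ 2)) : C -> R) by exact: cmeasR_indic (cmeasS_cdisc _).
have -> : Rcint (fun w => modulus (psum x N w) ^+ 2 * \1_(ball_at a r) w) =
    Rcint (fun w => modulus (psum d N w) ^+ 2 * \1_(cdisc (r ^+ 2)) w).
  rewrite -[RHS](Rcint_add (- a)).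
  - by apply: eq_Rcint => w; rewrite (ball_atE _ _ (ltW r0)) (psum_taylor _ _ a).
  - by apply: cmeasRM => //; apply: cmeasRX; apply: cmeasR_modulus; exact: cmeasC_psum.
  - by move=> w; rewrite mulr_ge0 ?sqr_ge0 ?indic_ge0.
rewrite (Rcint_psum _ _ (radial_indic_cdisc r0)) -sumEFin.
apply: lee_sum => n _; rewrite EFinM lee_wpmul2l ?lee_fin ?sqr_ge0//.
exact: moment_cdisc_ge.
Qed.

(** Cauchy-Schwarz for the expansion at [a] with the weights [ball_mom r n]. As
    [|z - a|^2 <= r^2 / 4], the second sum is at most [2 / (kappa r^2)] times the sum of [2^-n] over
    [n >= k]; the vanishing thus gains [2^-k]. *)
Lemma local_sup x N a k z r : 0 < r -> modulus (z - a) <= r / 2 ->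
  (forall j, (j < k)%N -> taylor_at x N a j = 0) ->
  ((modulus (psum x N z) ^+ 2)%:E <=
   (4 / (kappa * r ^+ 2) * 2^-1 ^+ k)%:E * Rcint (fun w => modulus (psum x N w) ^+ 2 * \1_(ball_at a r) w)%R)%E.
Proof.
move=> r0 zr hk; have := local_l2 x N a r0; set d := taylor_at x N a in hk *.
have k0 := @kappa_gt0 R; have q0 : 0 < r ^+ 2 by rewrite exprn_gt0.
have m0 n := ball_mom_gt0 n r0.
have c0 : 0 <= 4 / (kappa * r ^+ 2) * 2^-1 ^+ k.
  by rewrite mulr_ge0 ?exprn_ge0 ?invr_ge0// divr_ge0// mulr_ge0// ltW.
move=> /(lee_wpmul2l (x := (4 / (kappa * r ^+ 2) * 2^-1 ^+ k)%:E)).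
rewrite lee_fin => /(_ c0); apply: le_trans.
rewrite -EFinM lee_fin (psum_taylor _ _ a) -/d.
apply: le_trans (sqr_psum_le N (z - a) m0 hk) _.
rewrite [leRHS]mulrC ler_wpM2l//.
  by apply: sumr_ge0 => n _; rewrite mulr_ge0 ?sqr_ge0 ?(ltW (m0 n)).
apply: (@le_trans _ _ (\sum_(k <= n < N) 2 / (kappa * r ^+ 2) * 2^-1 ^+ n)).
  apply: ler_sum => n _; rewrite ler_pdivrMr//.
  have -> : 2 / (kappa * r ^+ 2) * 2^-1 ^+ n * ball_mom r n = (2^-1 * (r ^+ 2 / 2)) ^+ n.
    by rewrite /ball_mom (exprMn n 2^-1); move: (2^-1 ^+ n) ((r ^+ 2 / 2) ^+ n) => A B; field; rewrite !gt_eqF.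
  rewrite exprM lerXn2r ?nnegrE ?sqr_ge0//.
    by rewrite mulr_ge0 ?invr_ge0// divr_ge0// ltW.
  have := modulus_ge0 (z - a); rewrite expr2; nra.
rewrite -mulr_sumr; apply: le_trans (ler_wpM2l _ (geo_half_tail k N)) _.
  by rewrite divr_ge0// mulr_ge0// ltW.
rewrite mulrA (_ : 2 / (kappa * r ^+ 2) * 2 = 4 / (kappa * r ^+ 2))//.
by rewrite mulrAC -natrM.
Qed.

End LocalSup.

Section BoxEstimates.
Context {R : realType}.
Local Notation C := R[i].
Implicit Types (z w a : C) (x e : nat -> C) (b : R) (p : nat * nat) (f g : C -> C).

Lemma powR_quarter (t b : R) : 4^-1 <= t <= 4 -> t `^ b <= 4 `^ `|b| /\ (4 `^ `|b|)^-1 <= t `^ b.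
Proof.
move=> /andP[t1 t2]; have t0 : 0 < t by lra.
have l4 : `|ln t| <= ln 4.
  rewrite ler_norml; apply/andP; split; last by rewrite ler_ln ?posrE.
  by rewrite -lnV ?posrE// ler_ln ?posrE ?invr_gt0.
have h : `|b * ln t| <= `|b| * ln 4 by rewrite normrM ler_wpM2l.
move: h; rewrite ler_norml => /andP[h1 h2].
rewrite -powRN /powR !gt_eqF//; split; rewrite ler_expR//.
by rewrite mulNr.
Qed.

(** On [box_nbhd p] the quotient of [1 - |w|^2] by [side p] lies in [[1/4, 4]]; the absolute value
    of [b] covers both signs of the exponent. *)
Definition wt_ratio b : R := 4 `^ `|b|.

Lemma wt_ratio_gt0 b : 0 < wt_ratio b.
Proof. exact: powR_gt0. Qed.

Lemma wt_nbhd b p w : box_nbhd p w ->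
  wt b w <= wt_ratio b * side p `^ b /\ side p `^ b <= wt_ratio b * wt b w.
Proof.
move=> [_ /andP[h1 h2]]; have s0 := @side_gt0 R p; have w0 := modulus_ge0 w.
have w1 : modulus w < 1 by lra.
rewrite /wt discE w1 mulr1.
pose t := (1 - modulus w ^+ 2) / side p.
have tb : 4^-1 <= t <= 4.
  have q1 : modulus w ^+ 2 <= modulus w by rewrite expr2 ler_piMl// ltW.
  have q2 := sqr_ge0 (1 - modulus w).
  have {}q2 : 1 - modulus w ^+ 2 <= 2 * (1 - modulus w) by rewrite -subr_ge0; lra.
  by rewrite /t; apply/andP; split; [rewrite ler_pdivlMr//; lra|rewrite (ler_pdivrMr _ _ s0); lra].
have -> : 1 - modulus w ^+ 2 = side p * t by rewrite /t mulrC divfK// gt_eqF.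
have t0 : 0 <= t by case/andP: tb => + _; lra.
have [u1 u2] := powR_quarter b tb.
rewrite powRM ?(ltW s0)//; split.
  by rewrite mulrC ler_wpM2r ?powR_ge0.
rewrite mulrCA -[leLHS]mulr1 ler_wpM2l ?powR_ge0//.
by rewrite -(mulfV (lt0r_neq0 (wt_ratio_gt0 b))) ler_wpM2l ?powR_ge0.
Qed.

Lemma sqnorm_psum b x N : -1 < b ->
  sqnorm b (psum x N) = (\sum_(0 <= n < N) modulus (x n) ^+ 2 * mom b n)%:E.
Proof.
move=> b1; rewrite /sqnorm (Rcint_psum _ _ (radial_wt b)) -sumEFin.
by apply: eq_bigr => n _; rewrite (moment_wt_fin n b1) -EFinM.
Qed.

Lemma cmeasR_sqr_psum x N : cmeasR (fun z => modulus (psum x N z) ^+ 2 : R).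
Proof. by apply: cmeasRX; apply: cmeasR_modulus; exact: cmeasC_psum. Qed.

Lemma sqr_wt_ge0 b (u z : C) : 0 <= modulus u ^+ 2 * wt b z.
Proof. by rewrite mulr_ge0 ?sqr_ge0 ?wt_ge0. Qed.

Lemma sqr_wt_indic_ge0 b (u z : C) (A : set C) : 0 <= modulus u ^+ 2 * wt b z * \1_A z.
Proof. by rewrite mulr_ge0 ?sqr_wt_ge0 ?indic_ge0. Qed.

Definition nbhd_sq b f p : \bar R :=
  Rcint (fun z => modulus (f z) ^+ 2 * wt b z * \1_(box_nbhd p) z).

Lemma nbhd_sq_ge0 b f p : (0 <= nbhd_sq b f p)%E.
Proof. by apply: Rcint_ge0 => z; exact: sqr_wt_indic_ge0. Qed.

Lemma cmeasR_sqr_psum_wt b x N : cmeasR (fun z => modulus (psum x N z) ^+ 2 * wt b z).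
Proof. by apply: cmeasRM; [exact: cmeasR_sqr_psum|exact: cmeasR_wt]. Qed.

Lemma cmeasR_nbhd_sq b x N p :
  cmeasR (fun z => modulus (psum x N z) ^+ 2 * wt b z * \1_(box_nbhd p) z).
Proof. by apply: cmeasRM; [exact: cmeasR_sqr_psum_wt|exact: cmeasR_box_nbhd]. Qed.

Lemma nbhd_sq_fin b x N p : -1 < b -> exists2 i, 0 <= i & nbhd_sq b (psum x N) p = i%:E.
Proof.
move=> b1; have : (nbhd_sq b (psum x N) p <= sqnorm b (psum x N))%E.
  apply: Rcint_le.
  - exact: cmeasR_nbhd_sq.
  - exact: cmeasR_sqr_psum_wt.
  - by move=> z; exact: sqr_wt_indic_ge0.
  - by move=> z; rewrite ler_piMr ?indic_le1// sqr_wt_ge0.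
rewrite sqnorm_psum//; have := nbhd_sq_ge0 b (psum x N) p.
by case: (nbhd_sq _ _ _) => [i| |]//; rewrite lee_fin => i0 _; exists i.
Qed.

Lemma ball_nbhd_sq b x N a p i : nbhd_sq b (psum x N) p = i%:E ->
  (forall w, modulus (w - a) <= side p / 16 -> box_nbhd p w) ->
  (Rcint (fun w => modulus (psum x N w) ^+ 2 * \1_(ball_at a (side p / 16)) w)%R <=
   (wt_ratio b / side p `^ b * i)%:E)%E.
Proof.
move=> ei ha; have s0 := @side_gt0 R p; have sb0 : 0 < side p `^ b by exact: powR_gt0.
have r0 : 0 < side p / 16 :> R by rewrite divr_gt0.
have c0 : 0 <= wt_ratio b / side p `^ b by rewrite divr_ge0// ltW// wt_ratio_gt0.
rewrite EFinM -ei -(RcintZ c0 (cmeasR_nbhd_sq b x N p)); last first.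
  by move=> w; exact: sqr_wt_indic_ge0.
apply: Rcint_le.
- by apply: cmeasRM; [exact: cmeasR_sqr_psum|apply: cmeasR_ball_at; exact: ltW].
- by apply: cmeasRM; [exact: cmeasR_cst|exact: cmeasR_nbhd_sq].
- by move=> w; rewrite mulr_ge0 ?sqr_ge0 ?indic_ge0.
move=> w; have [hw|hw] := pselect (ball_at a (side p / 16) w); last first.
  by rewrite (indic_setN hw) mulr0 mulr_ge0// sqr_wt_indic_ge0.
have hn := ha w hw; rewrite (indic_setE hw) (indic_setE hn) !mulr1.
rewrite mulrCA -[leLHS]mulr1 ler_wpM2l ?sqr_ge0// mulrAC ler_pdivlMr// mul1r.
by have [] := wt_nbhd b hn.
Qed.

Lemma nbhd_sup b x N a k z p i : nbhd_sq b (psum x N) p = i%:E ->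
  (forall w, modulus (w - a) <= side p / 16 -> box_nbhd p w) ->
  modulus (z - a) <= side p / 32 ->
  (forall j, (j < k)%N -> taylor_at x N a j = 0) ->
  modulus (psum x N z) ^+ 2 * (side p ^+ 2 * side p `^ b) <=
  1024 / kappa * wt_ratio b * 2^-1 ^+ k * i.
Proof.
move=> ei ha hz hk; have s0 := @side_gt0 R p; have k0 := @kappa_gt0 R.
have r0 : 0 < side p / 16 :> R by rewrite divr_gt0.
have zr : modulus (z - a) <= side p / 16 / 2 by apply: le_trans hz _; lra.
have sb0 : 0 < side p `^ b by exact: powR_gt0.
have h1 := local_sup r0 zr hk.
set J := Rcint _ in h1.
have h2 : (J <= (wt_ratio b / side p `^ b * i)%:E)%E.
  exact: ball_nbhd_sq ei ha.
pose q : R := 4 / (kappa * (side p / 16) ^+ 2) * 2^-1 ^+ k.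
have c1 : (0 <= q%:E)%E.
  rewrite lee_fin; apply: mulr_ge0; last by rewrite exprn_ge0.
  by rewrite divr_ge0// mulr_ge0 ?sqr_ge0// ltW.
have := le_trans h1 (lee_wpmul2l c1 h2).
rewrite -EFinM lee_fin => h3.
have c2 : 0 <= side p ^+ 2 * side p `^ b by rewrite mulr_ge0 ?sqr_ge0// ltW.
apply: le_trans (ler_wpM2r c2 h3) _; rewrite {c1 h1 h2 h3}/q.
move: (side p `^ b) sb0 (2^-1 ^+ k) (wt_ratio b) => S S0 K W.
by rewrite le_eqVlt; apply/orP; left; apply/eqP; field; rewrite !gt_eqF.
Qed.

Lemma box_nbhd_near p z a w : dyadic_box p z -> modulus (z - a) <= side p / 16 ->
  modulus (w - a) <= side p / 16 -> box_nbhd p w.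
Proof.
move=> hz za wa; have s0 := @side_gt0 R p.
have h1 := dyadic_box_diam hz (box_point_in p).
have [/andP[h2 h3] _] := (dyadic_boxE p z).1 hz.
have zw : modulus (z - w) <= side p / 8.
  by have := modulus_distD z w a; rewrite (modulus_distC a w); lra.
have wz : modulus (w - z) <= side p / 8 by rewrite modulus_distC.
have h4 := modulus_sub_le w z; have h5 := modulus_sub_le z w.
split.
  by have := modulus_distD w (box_point p) z; lra.
by apply/andP; split; lra.
Qed.

(** A square lattice of step [th side p / 2] around [box_point p], reaching at least [17 side p] in
    each direction; rounding down both coordinates costs at most two steps. The number [G] of points
    does not depend on the box, which keeps the later constants uniform. *)
Lemma fine_grid_exists (th : R) : 0 < th ->
  exists G, exists grid : nat * nat -> 'I_G -> C,
  forall p z, dyadic_box p z -> exists i, modulus (z - grid p i) <= th * side p.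
Proof.
move=> th0; have := archimedean.Num.Theory.archi_boundP (divr_ge0 (ler0n R 34) (ltW th0)).
set L := archimedean.Num.bound _ => hL.
pose m := (L + L).+1; pose T := ('I_m * 'I_m)%type.
exists #|{: T}|; exists (fun p i => let q : T := enum_val i in
  box_point p + (th * side p / 2 * (q.1%:R - L%:R) +i* (th * side p / 2 * (q.2%:R - L%:R)))).
move=> p z hz; have s0 := @side_gt0 R p.
have h0 : 0 < th * side p / 2 :> R by rewrite divr_gt0// mulr_gt0.
have hd := dyadic_box_diam hz (box_point_in p).
have hth : 34 / th * (th * side p / 2) = 17 * side p by field; rewrite gt_eqF.
have near_ord (u : R) : `|u| <= 17 * side p ->
    exists j : 'I_m, 0 <= u - th * side p / 2 * (j%:R - L%:R) <= th * side p / 2.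
  move: (th * side p / 2) h0 hth => h h0 hth.
  rewrite -hth ler_norml => /andP[u1 u2]; pose y := u / h + L%:R.
  have uy : u = h * (y - L%:R) by rewrite /y addrK mulrC divfK// gt_eqF.
  have [b1 b2] : - (34 / th) <= u / h /\ u / h <= 34 / th.
    by rewrite (ler_pdivrMr _ _ h0) (ler_pdivlMr _ _ h0) mulNr.
  have [y0 y2] : 0 <= y /\ y <= L%:R + L%:R by rewrite /y; move: (34 / th) hL b1 b2 => ? ? ? ?; split; lra.
  have /andP[j1 j2] := truncn_itv y0.
  have jm : (Num.truncn y < m)%N by rewrite ltnS -(ler_nat R) natrD; lra.
  exists (Ordinal jm); rewrite uy -mulrBr/=; move: j2; rewrite -natr1 => j2.
  rewrite opprB addrA subrK; move: (Num.truncn y) j1 j2 {jm} => j j1 j2.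
  rewrite mulr_ge0 ?subr_ge0 ?(ltW h0)//=.
  rewrite -[leRHS]mulr1 ler_wpM2l ?(ltW h0)//; lra.
have [i hi] := near_ord (complex.Re (z - box_point p)) (le_trans (Re_le_modulus _) hd).
have [j hj] := near_ord (complex.Im (z - box_point p)) (le_trans (Im_le_modulus _) hd).
exists (enum_rank ((i, j) : T)); rewrite enum_rankK/= opprD addrA.
apply: le_trans (modulus_le_ReIm _) _; rewrite !raddfB/= -!raddfB.
move: hi hj; rewrite !raddfB/=; move=> /andP[i1 i2] /andP[j1 j2].
by rewrite !ger0_norm//; lra.
Qed.

Definition grid_dense G (grid : nat * nat -> 'I_G -> C) :=
  forall p z, dyadic_box p z -> exists i, modulus (z - grid p i) <= side p / 32.

Lemma grid_exists : exists G, exists grid : nat * nat -> 'I_G -> C, grid_dense grid.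
Proof.
have h : 0 < 32^-1 :> R by rewrite invr_gt0.
have [G [grid hg]] := fine_grid_exists h; exists G, grid => p z hz.
by have [i hi] := hg p z hz; exists i; rewrite mulrC.
Qed.

End BoxEstimates.

Section Carleson.
Context {R : realType}.
Local Notation C := R[i].
Implicit Types (z w a : C) (x e : nat -> C) (b : R) (p : nat * nat) (f g : C -> C).

Lemma box_sub_nbhd p z : dyadic_box p z -> box_nbhd p z.
Proof.
have s0 := @side_gt0 R p.
by move=> hz; apply: (box_nbhd_near hz (a := z)); rewrite subrr modulus0 divr_ge0 ?ltW.
Qed.

Lemma dyadic_box_lt1 p z : dyadic_box p z -> modulus z < 1.
Proof. by case/dyadic_boxE => /andP[h _] _; have := @side_gt0 R p; lra. Qed.

Lemma cmeasR_bloch_box g e p : has_pseries g 0 1 e ->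
  cmeasR (fun z => bloch_sq g z * \1_(dyadic_box p) z).
Proof.
move=> hg; apply: eq_cmeasR (cmeasRM (cmeasR_bloch_sq_wt 0 hg) (cmeasR_indic (cmeasS_dyadic_box p))) => z.
have [hz|hz] := pselect (dyadic_box p z); last by rewrite !(indic_setN hz) !mulr0.
by rewrite /wt discE (dyadic_box_lt1 hz) powRr0 !mulr1.
Qed.

Lemma bloch_measureE g p :
  bloch_measure g (dyadic_box p) = Rcint (fun z => bloch_sq g z * \1_(dyadic_box p) z).
Proof. exact: area_integralE. Qed.

Lemma area_dyadic_box_le p : (area (dyadic_box p : set C) <= (324 * kappa * side p ^+ 2)%:E)%E.
Proof.
have s0 := @side_gt0 R p; have r0 : 0 < 18 * side p :> R by rewrite mulr_gt0.
rewrite -(Rcint_indic (cmeasS_dyadic_box p)).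
have -> : (324 * kappa * side p ^+ 2)%:E = Rcint (\1_(ball_at (box_point p) (18 * side p)) : C -> R).
  by rewrite Rcint_ball_at//; congr EFin; ring.
apply: Rcint_le.
- exact: cmeasR_indic (cmeasS_dyadic_box p).
- by apply: cmeasR_ball_at; exact: ltW.
- exact: indic_ge0.
by move=> z; apply: indic_sub => /box_sub_nbhd[].
Qed.

Lemma area_dyadic_box_fin p : exists2 A : R, 0 < A & area (dyadic_box p : set C) = A%:E.
Proof.
have s0 := @side_gt0 R p; have k0 := @kappa_gt0 R.
have := area_dyadic_box_le p; have := @area_dyadic_box_ge R p.
case: (area _) => [A| |]//; rewrite !lee_fin => h _; exists A => //.
by apply: lt_le_trans h; rewrite mulr_gt0 ?exprn_gt0// divr_gt0.
Qed.

Lemma bloch_measure_le g p (B : R) : 0 <= B -> (dyadic_mean g p <= B%:E)%E ->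
  (bloch_measure g (dyadic_box p) <= (324 * kappa * B * side p ^+ 2)%:E)%E.
Proof.
move=> B0; have [A A0 eA] := area_dyadic_box_fin p.
have := area_dyadic_box_le p; rewrite /dyadic_mean eA inver (gt_eqF A0) lee_fin => hA.
rewrite lee_pdivrMr// -EFinM => /le_trans; apply; rewrite lee_fin.
by apply: le_trans (ler_wpM2l B0 hA) _; rewrite le_eqVlt; apply/orP; left; apply/eqP; ring.
Qed.

Lemma bloch_measure_ge g p (B : R) : 0 <= B -> (B%:E <= dyadic_mean g p)%E ->
  ((kappa / 8 * B * side p ^+ 2)%:E <= bloch_measure g (dyadic_box p))%E.
Proof.
move=> B0; have [A A0 eA] := area_dyadic_box_fin p.
have := @area_dyadic_box_ge R p; rewrite /dyadic_mean eA inver (gt_eqF A0) lee_fin => hA.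
rewrite lee_pdivlMr// -EFinM; apply: le_trans; rewrite lee_fin.
by rewrite mulrAC mulrC ler_wpM2l.
Qed.

Definition box_mass b g f p : \bar R :=
  Rcint (fun z => modulus (f z) ^+ 2 * (bloch_sq g z * wt b z) * \1_(dyadic_box p) z).

Lemma cmeasR_box_mass b g e x N p : has_pseries g 0 1 e ->
  cmeasR (fun z => modulus (psum x N z) ^+ 2 * (bloch_sq g z * wt b z) * \1_(dyadic_box p) z).
Proof.
move=> hg; apply: cmeasRM; last exact: cmeasR_indic (cmeasS_dyadic_box p).
by apply: cmeasRM; [exact: cmeasR_sqr_psum|exact: cmeasR_bloch_sq_wt hg].
Qed.

Lemma bloch_wt_ge0 b g z : 0 <= bloch_sq g z * wt b z.
Proof. by rewrite mulr_ge0 ?bloch_sq_ge0 ?wt_ge0. Qed.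

Lemma mass_ge0 b g f z : 0 <= modulus (f z) ^+ 2 * (bloch_sq g z * wt b z).
Proof. by rewrite mulr_ge0 ?sqr_ge0 ?bloch_wt_ge0. Qed.

Lemma box_mass_le b g e x N p (T A : R) : has_pseries g 0 1 e -> 0 <= T ->
  (forall z, dyadic_box p z -> modulus (psum x N z) ^+ 2 * (side p ^+ 2 * side p `^ b) <= T) ->
  (bloch_measure g (dyadic_box p) <= (A * side p ^+ 2)%:E)%E ->
  (box_mass b g (psum x N) p <= (T * wt_ratio b * A)%:E)%E.
Proof.
move=> hg T0 hT hA; have s0 := @side_gt0 R p; have W0 := wt_ratio_gt0 b.
have sb0 : 0 < side p `^ b by exact: powR_gt0.
pose q := T * wt_ratio b / side p ^+ 2.
have q0 : 0 <= q by rewrite divr_ge0 ?sqr_ge0// mulr_ge0// ltW.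
have bb0 z : 0 <= bloch_sq g z * \1_(dyadic_box p) z by rewrite mulr_ge0 ?bloch_sq_ge0 ?indic_ge0.
have -> : T * wt_ratio b * A = q * (A * side p ^+ 2).
  by rewrite /q; move: (side p) s0 => s s0; field; rewrite gt_eqF.
rewrite EFinM; apply: le_trans (lee_wpmul2l _ hA); last by rewrite lee_fin.
rewrite bloch_measureE -(RcintZ q0 (cmeasR_bloch_box p hg) bb0); apply: Rcint_le.
- exact: cmeasR_box_mass hg.
- by apply: cmeasRM; [exact: cmeasR_cst|exact: cmeasR_bloch_box hg].
- by move=> z; rewrite mulr_ge0 ?mass_ge0 ?indic_ge0.
move=> z; have [hz|hz] := pselect (dyadic_box p z); last by rewrite !(indic_setN hz) !mulr0.
rewrite (indic_setE hz) !mulr1 mulrCA [leRHS]mulrC ler_wpM2l ?bloch_sq_ge0//.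
have [h1 _] := wt_nbhd b (box_sub_nbhd hz).
apply: le_trans (ler_wpM2l (sqr_ge0 _) h1) _.
rewrite /q ler_pdivlMr ?exprn_gt0//.
have := ler_wpM2r (ltW W0) (hT z hz).
by congr (_ <= _); ring.
Qed.

Definition vanishing x N a k := forall j, (j < k)%N -> taylor_at x N a j = 0.

(** The weight is replaced by a power of [side p] once on the box and once on its neighbourhood,
    whence the square; [1024 = 4 * 16^2] comes from [local_sup] on discs of radius [side p / 16]. *)
Definition carleson_cst b : R := 1024 / kappa * wt_ratio b ^+ 2.

Lemma carleson_cst_gt0 b : 0 < carleson_cst b.
Proof.
apply: mulr_gt0; last exact/exprn_gt0/wt_ratio_gt0.
by apply: divr_gt0; [rewrite ltr0n|exact: kappa_gt0].
Qed.

Lemma box_mass_nbhd b g e x N p k (A : R) G (grid : nat * nat -> 'I_G -> C) : -1 < b ->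
  has_pseries g 0 1 e -> grid_dense grid ->
  (forall i, vanishing x N (grid p i) k) -> 0 <= A ->
  (bloch_measure g (dyadic_box p) <= (A * 2 ^+ k * side p ^+ 2)%:E)%E ->
  (box_mass b g (psum x N) p <= (carleson_cst b * A)%:E * nbhd_sq b (psum x N) p)%E.
Proof.
move=> b1 hg hgrid hv A0 hA; have s0 := @side_gt0 R p; have k0 := @kappa_gt0 R.
have [i i0 ei] := nbhd_sq_fin x N p b1.
have T0 : 0 <= 1024 / kappa * wt_ratio b * 2^-1 ^+ k * i.
  apply: mulr_ge0 i0; apply: mulr_ge0; last by rewrite exprn_ge0// invr_ge0.
  apply: mulr_ge0; last exact/ltW/wt_ratio_gt0.
  by apply: divr_ge0; [exact: ler0n|exact: ltW].
have hT z : dyadic_box p z ->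
    modulus (psum x N z) ^+ 2 * (side p ^+ 2 * side p `^ b) <= 1024 / kappa * wt_ratio b * 2^-1 ^+ k * i.
  move=> hz; have [l hl] := hgrid p z hz.
  apply: (nbhd_sup ei _ hl (hv l)) => w; apply: box_nbhd_near hz _.
  by apply: le_trans hl _; lra.
apply: le_trans (box_mass_le hg T0 hT hA) _.
rewrite ei -EFinM lee_fin /carleson_cst exprVn le_eqVlt; apply/orP; left; apply/eqP.
have : 2 ^+ k != 0 :> R by rewrite expf_neq0.
move: (2 ^+ k) (wt_ratio b) => K W K0; field; rewrite K0/= gt_eqF//.
Qed.

Lemma nbhd_sq_sum : exists2 K : R, 0 < K & forall b x N s, uniq s ->
  (forall p, p \in s -> box_index p) ->
  (\sum_(p <- s) nbhd_sq b (psum x N) p <= K%:E * sqnorm b (psum x N))%E.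
Proof.
have [K K0 hK] := @box_nbhd_overlap R; exists K => // b x N s us hs.
rewrite /nbhd_sq -(Rcint_sum _ (fun p => cmeasR_nbhd_sq b x N p)); last by move=> p z; exact: sqr_wt_indic_ge0.
rewrite -(RcintZ (ltW K0) (cmeasR_sqr_psum_wt b x N) (fun z => sqr_wt_ge0 b _ z)).
apply: Rcint_le.
- by apply: cmeasR_sum => p; exact: cmeasR_nbhd_sq.
- by apply: cmeasRM; [exact: cmeasR_cst|exact: cmeasR_sqr_psum_wt].
- by move=> z; apply: sumr_ge0 => p _; exact: sqr_wt_indic_ge0.
move=> z; rewrite -mulr_sumr mulrC ler_wpM2r ?sqr_wt_ge0//; exact: hK.
Qed.

Definition boxes_below L : seq (nat * nat) :=
  [seq p <- [seq (n, k) | n <- iota 0 L, k <- iota 0 (2 ^ L).+1] | (1 <= p.2 <= 2 ^ p.1)%N].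

Lemma boxes_below_uniq L : uniq (boxes_below L).
Proof.
apply: filter_uniq; apply: allpairs_uniq; rewrite ?iota_uniq// => -[a1 a2] [b1 b2] _ _ /= [-> ->] //.
Qed.

Lemma mem_boxes_below L p : (p \in boxes_below L) = (p.1 < L)%N && (1 <= p.2 <= 2 ^ p.1)%N.
Proof.
case: p => n k; rewrite mem_filter andbC; apply: andb_id2r => /andP[k1 k2].
apply/allpairsP/idP => [[[a1 a2] [/= + _ [-> _]]]|nL]; first by rewrite mem_iota.
exists (n, k); split; [by rewrite mem_iota|rewrite mem_iota|by []].
by rewrite add0n ltnS (leq_trans k2)// leq_exp2l// ltnW.
Qed.

(** There are infinitely many boxes, but a finite sum is enough: near the circle [bloch_sq g <= B]
    bounds the integrand directly, the boxes of scale below [L] cover the rest of the disc except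
    the origin, and the origin, which lies in no box, is a null set. *)
Lemma carleson_total : exists2 K : R, 0 < K & forall b g x N G (grid : nat * nat -> 'I_G -> C)
    (k : nat * nat -> nat) (B : R), -1 < b -> little_bloch g -> grid_dense grid -> 0 < B ->
  (forall p i, box_index p -> vanishing x N (grid p i) (k p)) ->
  (forall p, box_index p ->
    (bloch_measure g (dyadic_box p) <= (B * 2 ^+ k p * side p ^+ 2)%:E)%E) ->
  (Rcint (fun z => modulus (psum x N z) ^+ 2 * (bloch_sq g z * wt b z))%R <=
   ((carleson_cst b * K + 1) * B)%:E * sqnorm b (psum x N))%E.
Proof.
have [K K0 hK] := nbhd_sq_sum; exists K => // b g x N G grid k B b1 hg hgrid B0 hv hB.
have [e he] := analytic_taylor hg.1.
have [r r1 hr] := little_bloch_near hg B0.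
have d0 : 0 < 1 - r by lra.
have := archimedean.Num.Theory.archi_boundP (ltW (divr_gt0 ltr01 d0)).
set L := archimedean.Num.bound _ => hL.
pose F z := modulus (psum x N z) ^+ 2 * (bloch_sq g z * wt b z).
have F0 z : 0 <= F z by exact: mass_ge0.
have mF : cmeasR F by apply: cmeasRM; [exact: cmeasR_sqr_psum|exact: cmeasR_bloch_sq_wt he].
have mB p : cmeasR (fun z => F z * \1_(dyadic_box p) z) by exact: cmeasR_box_mass he.
have B0' p z : 0 <= F z * \1_(dyadic_box p) z by rewrite mulr_ge0 ?indic_ge0.
have m0 : cmeasR (\1_(cdisc 0) : C -> R) by exact: cmeasR_indic (cmeasS_cdisc _).
pose S z := \sum_(p <- boxes_below L) F z * \1_(dyadic_box p) z.
have mS : cmeasR S by exact: cmeasR_sum.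
have S0 z : 0 <= S z by apply: sumr_ge0.
have mO : cmeasR (fun z => B * (modulus (psum x N z) ^+ 2 * wt b z)).
  by apply: cmeasRM; [exact: cmeasR_cst|exact: cmeasR_sqr_psum_wt].
have O0 z : 0 <= B * (modulus (psum x N z) ^+ 2 * wt b z) by rewrite mulr_ge0 ?(ltW B0) ?sqr_wt_ge0.
have mZ : cmeasR (fun z => F 0 * \1_(cdisc 0) z) by apply: cmeasRM => //; exact: cmeasR_cst.
have Z0 z : 0 <= F 0 * \1_(cdisc 0) z by rewrite mulr_ge0 ?indic_ge0.
have cover z : F z <= S z + (B * (modulus (psum x N z) ^+ 2 * wt b z) + F 0 * \1_(cdisc 0) z).
  have [z1|z1] := ltP (modulus z) 1; last first.
    by rewrite {1}/F /wt discE ltNge z1 !mulr0 !addr_ge0// mulr_ge0// indic_ge0.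
  have [->|z0] := eqVneq z 0.
    have c0 : cdisc 0 (0 : C) by apply/set_mem; rewrite cdiscE /sqmod modulus0 expr0n.
    by rewrite (indic_setE c0) mulr1 addrA lerDr addr_ge0.
  have [zr|zr] := ltP r (modulus z).
    rewrite -[leLHS]addr0 -[leLHS]add0r lerD// lerD//.
    by rewrite /F mulrCA ler_wpM2r ?sqr_wt_ge0// hr// zr.
  have zp : 0 < modulus z by rewrite modulus_gt0.
  have [p pi hz] := dyadic_box_cover (introT andP (conj zp z1)).
  have pL : p \in boxes_below L.
    rewrite mem_boxes_below; move: pi; rewrite /box_index/= => ->; rewrite andbT.
    rewrite -(ltr_nat R); apply: le_lt_trans hL.
    have [/andP[_ h] _] := (dyadic_boxE p z).1 hz.
    rewrite div1r; apply: (@le_trans _ _ ((side p)^-1)).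
      by rewrite /side invrK -natrX ler_nat ltnW// ltn_expl.
    by rewrite lef_pV2 ?posrE ?side_gt0//; lra.
  rewrite -[leLHS]addr0 lerD ?addr_ge0// /S (bigD1_seq p pL (boxes_below_uniq L))/=.
  by rewrite (indic_setE hz) mulr1 lerDl sumr_ge0.
apply: (@le_trans _ _ (Rcint (fun z => S z + (B * (modulus (psum x N z) ^+ 2 * wt b z) + F 0 * \1_(cdisc 0) z))%R)).
  apply: Rcint_le => //; apply: cmeasRD => //; exact: cmeasRD.
rewrite (RcintD mS (cmeasRD mO mZ) S0); last by move=> z; rewrite addr_ge0.
rewrite (RcintD mO mZ O0 Z0) (RcintZ (F0 0) m0 (indic_ge0 _)) (Rcint_indic (cmeasS_cdisc _)).
rewrite area_cdisc0 mule0 adde0.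
rewrite (RcintZ (ltW B0) (cmeasR_sqr_psum_wt b x N) (fun z => sqr_wt_ge0 b _ z)).
have sE := sqnorm_psum x N b1; rewrite mulrDl mul1r sE -!EFinM mulrDl EFinD.
apply: leeD; last by rewrite -[Rcint _]/(sqnorm b (psum x N)) sE -EFinM.
rewrite /S (Rcint_sum _ mB B0').
have hidx p : p \in boxes_below L -> box_index p by rewrite mem_boxes_below => /andP[].
apply: (@le_trans _ _ (\sum_(p <- boxes_below L) (carleson_cst b * B)%:E * nbhd_sq b (psum x N) p)%E).
  rewrite !big_seq; apply: lee_sum => p /hidx hp.
  apply: (box_mass_nbhd b1 he hgrid (fun i => hv p i hp) (ltW B0)); exact: hB.
rewrite -ge0_sume_distrr; last by move=> p _; exact: nbhd_sq_ge0.
have cB0 : (0 <= (carleson_cst b * B)%:E)%E by rewrite lee_fin mulr_ge0 ?(ltW (carleson_cst_gt0 b)) ?ltW.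
apply: le_trans (lee_wpmul2l cB0 (hK b x N _ (boxes_below_uniq L) hidx)) _.
by rewrite sE -!EFinM lee_fin le_eqVlt; apply/orP; left; apply/eqP; ring.
Qed.

End Carleson.

(** * Finite-dimensional approximation *)

Section OrthogonalProjection.
Context {R : realType} (N : nat).
Local Notation C := R[i].
Implicit Types (x y u r : 'rV[C]_N) (T : 'M[C]_N).

Definition adj m n (A : 'M[C]_(m, n)) : 'M[C]_(n, m) := (map_mx (@conjc R) A)^T.

Lemma adjM m n p (A : 'M[C]_(m, n)) (B : 'M[C]_(n, p)) : adj (A *m B) = adj B *m adj A.
Proof. by rewrite /adj map_mxM trmx_mul. Qed.

Lemma adjK m n (A : 'M[C]_(m, n)) : adj (adj A) = A.
Proof. by apply/matrixP => i j; rewrite !mxE conjcK. Qed.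

Lemma adjB m n (A B : 'M[C]_(m, n)) : adj (A - B) = adj A - adj B.
Proof. by rewrite /adj map_mxB linearB. Qed.

Lemma adjD m n (A B : 'M[C]_(m, n)) : adj (A + B) = adj A + adj B.
Proof. by rewrite /adj map_mxD linearD. Qed.

Lemma adjZ m n (c : C) (A : 'M[C]_(m, n)) : adj (c *: A) = conjc c *: adj A.
Proof. by apply/matrixP => i j; rewrite !mxE; exact: rmorphM. Qed.

Definition sqn x : R := \sum_(j < N) modulus (x 0 j) ^+ 2.

Lemma sqn_ge0 x : 0 <= sqn x.
Proof. by apply: sumr_ge0 => j _; rewrite sqr_ge0. Qed.

Lemma mulmx_adj x : (x *m adj x) 0 0 = (sqn x)%:C.
Proof.
by rewrite mxE rmorph_sum; apply: eq_bigr => j _; rewrite !mxE mulJ_modulus.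
Qed.

Lemma sqn_eq0 x : sqn x = 0 -> x = 0.
Proof.
move=> h; apply/rowP => j; rewrite mxE; apply/eqP; rewrite -modulus_eq0 -sqrf_eq0.
by apply/eqP; move: j isT; apply/(psumr_eq0P _ h) => j _; exact: sqr_ge0.
Qed.

Definition proj_spec T := T *m T = T /\ adj T = T.

Lemma proj_pythagoras T x : proj_spec T -> sqn x = sqn (x *m T) + sqn (x - x *m T).
Proof.
move=> [TT aT]; apply: (@complexI R); rewrite rmorphD /= -!mulmx_adj.
suff -> : x *m adj x = x *m T *m adj (x *m T) + (x - x *m T) *m adj (x - x *m T) by rewrite mxE.
have xE : x - x *m T = x *m (1%:M - T) by rewrite mulmxBr mulmx1.
have a1 : adj (1%:M : 'M[C]_N) = 1%:M by rewrite /adj map_mx1 trmx1.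
have II : (1%:M - T) *m (1%:M - T) = 1%:M - T.
  by rewrite mulmxBl mul1mx mulmxBr mulmx1 TT subrr subr0.
rewrite xE !adjM adjB aT a1 !mulmxA -(mulmxA x T T) TT -(mulmxA x _ (1%:M - T)) II.
by rewrite -mulmxDl -mulmxDr addrC subrK mulmx1.
Qed.

Lemma proj_trace T : proj_spec T -> \sum_(j < N) (sqn (row j T))%:C = \tr T.
Proof.
move=> [TT aT]; have -> : \tr T = \tr (T *m adj T) by rewrite aT TT.
apply: eq_bigr => j _.
by rewrite -mulmx_adj !mxE; apply: eq_bigr => k _; rewrite !mxE.
Qed.

(* Gram-Schmidt; the convention [0^-1 = 0] absorbs a vector depending on the
   previous ones. *)
Lemma proj_exists (u : nat -> 'rV[C]_N) m : exists T (q : nat -> 'rV[C]_N), [/\ proj_spec T,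
  forall i, (i < m)%N -> u i *m T = u i,
  exists2 k, (k <= m)%N & \tr T = k%:R
  & forall x, exists c : nat -> C, x *m T = \sum_(i < m) c i *: q i].
Proof.
elim: m => [|m [T [q [[TT aT] hu [k km trT] hq]]]].
  exists 0, (fun=> 0); split=> //.
  - by split; [rewrite mul0mx|rewrite /adj map_mx0 trmx0].
  - by exists 0%N => //; rewrite mxtrace0.
  - by move=> x; exists (fun=> 0); rewrite mulmx0 big_ord0.
pose r := u m - u m *m T; pose s : C := (sqn r)%:C; pose c := s^-1.
have rT : r *m T = 0 by rewrite /r mulmxBl -mulmxA TT subrr.
have Tr : T *m adj r = 0.
  by rewrite -{1}aT -adjM rT; apply/matrixP => i j; rewrite !mxE conjc0.
have rr : r *m adj r = s%:M by rewrite [LHS]mx11_scalar mulmx_adj.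
have csr : (c * s) *: r = r.
  have [s0|s0] := eqVneq s 0; last by rewrite mulVf// scale1r.
  have -> : r = 0 by apply: sqn_eq0; apply: (@complexI R); rewrite -/s s0.
  by rewrite scaler0.
have csc : c * s * c = c.
  have [s0|s0] := eqVneq s 0; last by rewrite mulVf// mul1r.
  by rewrite /c s0 invr0 !mulr0.
pose P := adj r *m r.
have PP : P *m P = s *: P.
  by rewrite /P mulmxA -(mulmxA (adj r)) rr -mulmxA mul_scalar_mx -scalemxAr.
have aP : adj P = P by rewrite /P adjM adjK.
have cJ : conjc c = c.
  by rewrite /c fmorphV /s /= oppr0.
exists (T + c *: P), (fun i => if (i < m)%N then q i else r); split.
- split.
    rewrite mulmxDl !mulmxDr TT -!scalemxAl -!scalemxAr PP !scalerA.
    have -> : T *m P = 0 by rewrite /P mulmxA Tr mul0mx.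
    have -> : P *m T = 0 by rewrite /P -mulmxA rT mulmx0.
    rewrite !scaler0 addr0 add0r; congr (_ + _ *: _); rewrite -[RHS]csc; ring.
  by rewrite adjD adjZ aT aP cJ.
- move=> i; rewrite ltnS leq_eqVlt => /orP[/eqP->|im].
    rewrite mulmxDr -scalemxAr /P mulmxA.
    have -> : u m *m adj r = s%:M.
      have -> : u m = r + u m *m T by rewrite /r subrK.
      by rewrite mulmxDl -mulmxA Tr mulmx0 addr0.
    by rewrite mul_scalar_mx scalerA csr /r addrC subrK.
  rewrite mulmxDr hu// -scalemxAr /P mulmxA -{2}(hu i im) -(mulmxA _ T) Tr mulmx0 mul0mx.
  by rewrite scaler0 addr0.
- have trP : \tr P = s by rewrite /P mxtrace_mulC rr mxtrace_scalar.
  rewrite mxtraceD mxtraceZ trP trT; have [s0|s0] := eqVneq s 0.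
    by exists k; [exact: leqW|rewrite s0 mulr0 addr0].
  by exists k.+1; [rewrite ltnS|rewrite mulVf// natr1].
- move=> x; have [d hd] := hq x.
  exists (fun i => if (i < m)%N then d i else c * (x *m adj r) 0 0).
  rewrite big_ord_recr/= ltnn mulmxDr hd; congr (_ + _).
    by apply: eq_bigr => i _; rewrite !ltn_ord.
  rewrite -scalemxAr /P mulmxA -scalerA; congr (_ *: _).
  by rewrite {1}[x *m adj r]mx11_scalar mul_scalar_mx.
Qed.

Lemma proj_annihilates T u x : proj_spec T -> u *m T = u -> (x - x *m T) *m adj u = 0.
Proof.
by move=> [TT aT] uT; rewrite mulmxBl -mulmxA -{1}aT -adjM uT subrr.
Qed.

End OrthogonalProjection.

Section Rank.
Context {R : realType}.
Local Notation C := R[i].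

Lemma dependent_combinations m k (phi : 'I_m -> C -> C) (e : 'I_k -> C -> C) :
  (forall i, exists c : 'I_m -> C, forall z, e i z = \sum_(j < m) c j * phi j z) ->
  (m < k)%N -> exists2 v : 'I_k -> C, (exists i, v i != 0) & forall z, \sum_(i < k) v i * e i z = 0.
Proof.
move=> /choice[A hA] mk; pose M := \matrix_(i < k, j < m) A i j.
have : kermx M != 0.
  by rewrite -mxrank_eq0 mxrank_ker -lt0n subn_gt0 (leq_ltn_trans (rank_leq_col M)).
move=> /rowV0Pn[v /sub_kermxP vM v0]; exists (v 0).
  apply/existsP; apply: contraNT v0; rewrite negb_exists => /forallP h.
  by apply/eqP/rowP => i; rewrite mxE; apply/eqP; have := h i; rewrite negbK.
move=> z; under eq_bigr do rewrite hA mulr_sumr.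
rewrite exchange_big/= big1// => j _.
have /(congr1 (fun w : 'rV[C]_m => w 0 j)) := vM; rewrite !mxE => h.
transitivity ((\sum_(i < k) v 0 i * M i j) * phi j z); last by rewrite h mul0r.
rewrite mulr_suml; apply: eq_bigr => i _.
by rewrite mxE mulrA.
Qed.

(** [has_rank] asks for basis vectors in the range itself, whereas the [phi] only span a larger
    space. A linearly independent family of maximal size in the range has at most [m] members, and
    by maximality every further [S f] depends on it. *)
Lemma has_rank_exists b (S : (C -> C) -> C -> C) m (phi : 'I_m -> C -> C) :
  (forall f, bergman b f -> exists c : 'I_m -> C, forall z, S f z = \sum_(j < m) c j * phi j z) ->
  exists2 k, (k <= m)%N & has_rank b S k.
Proof.
move=> hS; pose indep k (e : 'I_k -> C -> C) :=
  (forall i, (S @` bergman b) (e i)) /\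
  (forall c : 'I_k -> C, (forall z, \sum_(i < k) c i * e i z = 0) -> forall i, c i = 0).
pose P k := `[< exists e : 'I_k -> C -> C, indep k e >].
have P0 : exists k, P k.
  by exists 0%N; apply/asboolP; exists (fun=> fun=> 0); split=> [[]|c _ []].
have Pm k : P k -> (k <= m)%N.
  move=> /asboolP[e [he hi]]; rewrite leqNgt; apply/negP => mk.
  have hphi i : exists c : 'I_m -> C, forall z, e i z = \sum_(j < m) c j * phi j z.
    by have [f hf <-] := he i; exact: hS.
  have [v [i vi] hv] := dependent_combinations hphi mk.
  by move/eqP: vi; apply; exact: hi hv i.
have := ex_maxnP P0 Pm; case=> k /asboolP[e [he hi]] hmax.
exists k; first by apply: Pm; apply/asboolP; exists e.
exists e; split=> // f hf.
pose e' (i : 'I_k.+1) := if unlift ord_max i is Some j then e j else S f.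
have sumE (c : 'I_k.+1 -> C) z : \sum_(i < k.+1) c i * e' i z =
    \sum_(i < k) c (lift ord_max i) * e i z + c ord_max * S f z.
  rewrite big_ord_recr/= /e' unlift_none; congr (_ + _); apply: eq_bigr => i _.
  have -> : widen_ord (leqnSn k) i = lift ord_max i by apply: val_inj; rewrite /= /bump leqNgt ltn_ord.
  by rewrite liftK.
have : ~ indep k.+1 e'.
  by move=> h; have := hmax k.+1; rewrite ltnn => /(_ _)/wrap[]//; apply/asboolP; exists e'.
move=> nind.
have [c hc [i ci]] : exists2 c : 'I_k.+1 -> C, (forall z, \sum_(i < k.+1) c i * e' i z = 0) & exists i, c i != 0.
  apply: contrapT => h; apply: nind; split.
    by move=> i; rewrite /e'; case: unliftP => [j _|_]; [exact: he|exists f].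
  move=> c hc i; apply: contrapT => ci; apply: h; exists c => //.
  by exists i; apply/eqP.
have cm : c ord_max != 0.
  apply: contraNneq ci => cm0; have := hi (fun j => c (lift ord_max j)).
  move=> /(_ _)/wrap[z|h]; first by have := hc z; rewrite sumE cm0 mul0r addr0.
  by case: (unliftP ord_max i) => [j ->|->]; rewrite ?cm0 ?h.
exists (fun j => - c (lift ord_max j) / c ord_max) => z.
have := hc z; rewrite sumE addrC => /eqP; rewrite addr_eq0 => /eqP h.
apply: (mulfI cm); rewrite h mulr_sumr -sumrN; apply: eq_bigr => j _.
by rewrite mulrA mulrCA mulfV// mulr1 mulNr.
Qed.

End Rank.

(** * The central disc [|z| < 1/2] *)

Section Core.
Context {R : realType}.
Local Notation C := R[i].
Implicit Types (z : C) (g : C -> C) (p : nat * nat).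

Definition bloch_wt z : R := (1 - modulus z ^+ 2) ^+ 2.

Lemma radial_bloch_wt (B : set R) : measurable (B : set (measurableTypeR R)) -> B `<=` `]-oo, 1[%classic ->
  radial 1 (fun z => bloch_wt z * \1_(sqmod @^-1` B) z).
Proof.
move=> mB B1; split.
- apply: cmeasRM; last by apply: cmeasR_indic; exact: cmeasS_preimage cmeasR_sqmod mB.
  by apply: cmeasRX; apply: cmeasRB; [exact: cmeasR_cst|exact: cmeasR_sqmod].
- by move=> z; rewrite mulr_ge0 ?sqr_ge0 ?indic_ge0.
- move=> a z a1; rewrite /bloch_wt modulusM a1 mul1r; congr (_ * _).
  by rewrite !indicE /sqmod /mkset; congr (nat_of_bool _)%:R; apply/idP/idP => /set_mem h;
    apply/mem_set; move: h; rewrite /preimage/= modulusM a1 mul1r.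
- move=> z z1; rewrite indic_setN ?mulr0// => /B1/=; rewrite in_itv/= sqmod_lt1; lra.
Qed.

(** The regions [|z|^2 <= 1/4] and [1/4 < |z|^2 <= 1/2] have equal area. On the first
    [|z|^(2n) <= 4^-n] and the weight is at most [1]; on the second [|z|^(2n) >= 4^-n] and the
    weight is at least [1/4]. *)
Lemma moment_core_le n :
  (moment (fun z : C => bloch_wt z * \1_(sqmod @^-1` `]-oo, 4^-1]%classic) z)%R n <=
   4%:E * moment (fun z : C => bloch_wt z * \1_(sqmod @^-1` `]4^-1, 2^-1]%classic) z)%R n)%E.
Proof.
have k0 := @kappa_gt0 R; pose t : R := 4^-1 ^+ n; have t0 : 0 < t by rewrite exprn_gt0.
pose A : set C := sqmod @^-1` `]4^-1, 2^-1]%classic.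
have mA : cmeasS A by exact: cmeasS_preimage cmeasR_sqmod _.
have aA : area A = (4^-1 * kappa)%:E.
  have q2 : 0 <= 2^-1 :> R by lra. have q4 : 0 <= 4^-1 :> R by lra.
  rewrite area_sqmod_itv ?(max_l q2) ?(max_l q4); last lra.
  by congr EFin; field.
have mc : cmeasS (cdisc 4^-1 : set C) by exact: cmeasS_cdisc.
have mod_meas m : cmeasR (fun z : C => modulus z ^+ m) by apply: cmeasRX; exact: cmeasR_modulus_id.
have mw (B : set R) : measurable (B : set (measurableTypeR R)) ->
    cmeasR (fun z : C => modulus z ^+ (2 * n) * (bloch_wt z * \1_(sqmod @^-1` B) z)).
  move=> mB; apply: cmeasRM => //.
  apply: cmeasRM; last by apply: cmeasR_indic; exact: cmeasS_preimage cmeasR_sqmod mB.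
  by apply: cmeasRX; apply: cmeasRB; [exact: cmeasR_cst|exact: cmeasR_sqmod].
have p0 (B : set R) z : 0 <= modulus z ^+ (2 * n) * (bloch_wt z * \1_(sqmod @^-1` B) z).
  by rewrite mulr_ge0 ?exprn_ge0 ?modulus_ge0// mulr_ge0 ?sqr_ge0 ?indic_ge0.
apply: (@le_trans _ _ (t * (4^-1 * kappa))%:E).
  rewrite EFinM -area_cdisc// -(Rcint_indic mc) -(RcintZ (ltW t0) (cmeasR_indic mc) (indic_ge0 _)).
  apply: Rcint_le => //; [exact: mw|by apply: cmeasRM; [exact: cmeasR_cst|exact: cmeasR_indic]|].
  move=> z; have [hz|hz] := pselect (cdisc 4^-1 z); last by rewrite !(indic_setN hz) !mulr0.
  rewrite !(indic_setE hz) !mulr1; move: hz => /mem_set; rewrite cdiscE /sqmod => hz.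
  have z0 := sqr_ge0 (modulus z).
  rewrite -[leRHS]mulr1 exprM; apply: ler_pM; [exact: exprn_ge0|exact: sqr_ge0| |].
    by apply: lerXn2r; rewrite ?nnegrE//; lra.
  by apply: exprn_ile1; lra.
apply: (@le_trans _ _ (4 * (t * 4^-1 * (4^-1 * kappa)))%:E).
  by rewrite lee_fin; lra.
rewrite EFinM lee_wpmul2l ?lee_fin// EFinM -aA -(Rcint_indic mA).
have t40 : 0 <= t * 4^-1 by lra.
rewrite -(RcintZ t40 (cmeasR_indic mA) (indic_ge0 _)).
apply: Rcint_le => //; [by apply: cmeasRM; [exact: cmeasR_cst|exact: cmeasR_indic]| exact: mw| |].
  by move=> z; rewrite mulr_ge0 ?indic_ge0.
move=> z; have [hz|hz] := pselect (A z); last by rewrite !(indic_setN hz) !mulr0.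
rewrite !(indic_setE hz) !mulr1; move: hz; rewrite /A/= in_itv/= /sqmod => /andP[h1 h2].
rewrite exprM; apply: ler_pM; [exact: ltW|by rewrite invr_ge0| |].
  by apply: lerXn2r; rewrite ?nnegrE ?sqr_ge0 ?(ltW h1).
by rewrite /bloch_wt; nra.
Qed.

(** By [parseval] for [g'] the comparison of moments becomes one of integrals, and the annulus
    [1/4 < |z|^2 <= 1/2] is covered by the two boxes of scale [1]. *)
Lemma bloch_measure_core g e : has_pseries g 0 1 e ->
  (bloch_measure g (dyadic_box (0, 1)%N) <=
   4%:E * (bloch_measure g (dyadic_box (1, 1)%N) + bloch_measure g (dyadic_box (1, 2)%N)))%E.
Proof.
move=> hg; have hd := has_pseries_derive hg.
pose w1 z := bloch_wt z * \1_(sqmod @^-1` `]-oo, 4^-1]%classic) z.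
pose w2 z := bloch_wt z * \1_(sqmod @^-1` `]4^-1, 2^-1]%classic) z.
have r1 : radial 1 w1.
  by apply: radial_bloch_wt => // x /=; rewrite !in_itv/=; lra.
have r2 : radial 1 w2.
  by apply: radial_bloch_wt => // x /=; rewrite !in_itv/= => /andP[]; lra.
have m1 := cmeasR_pseries hd r1; have m2 := cmeasR_pseries hd r2.
have p1 z : 0 <= w1 z by case: r1.
have p2 z : 0 <= w2 z by case: r2.
have mb p := cmeasR_bloch_box p hg.
have b0 p z : 0 <= bloch_sq g z * \1_(dyadic_box p) z by rewrite mulr_ge0 ?bloch_sq_ge0 ?indic_ge0.
apply: (@le_trans _ _ (Rcint (fun z => modulus (derive1 g z) ^+ 2 * w1 z)%R)).
  rewrite bloch_measureE; apply: Rcint_le => // z.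
  have [hz|hz] := pselect (dyadic_box (0, 1)%N z); last by rewrite (indic_setN hz) mulr0 mulr_ge0 ?sqr_ge0.
  have [/andP[h1 h2] _] := (dyadic_boxE _ z).1 hz; move: h1 h2; rewrite /side/= expr0 invr1 => h1 h2.
  have hc : (sqmod @^-1` `]-oo, 4^-1]%classic) z.
    by rewrite /= in_itv/= /sqmod expr2; have := modulus_ge0 z; nra.
  by rewrite (indic_setE hz) /w1 (indic_setE hc) !mulr1.
apply: (@le_trans _ _ (4%:E * Rcint (fun z => modulus (derive1 g z) ^+ 2 * w2 z)%R)%E).
  rewrite (parseval hd r1) (parseval hd r2) -nneseriesZl; last first.
    by move=> n _; rewrite mule_ge0 ?lee_fin ?sqr_ge0//; apply: Rcint_ge0 => z; rewrite mulr_ge0 ?exprn_ge0 ?modulus_ge0.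
  apply: lee_nneseries => [n _ _|n _].
    by rewrite mule_ge0 ?lee_fin ?sqr_ge0//; apply: Rcint_ge0 => z; rewrite mulr_ge0 ?exprn_ge0 ?modulus_ge0.
  by rewrite muleCA lee_wpmul2l ?lee_fin ?sqr_ge0//; exact: moment_core_le.
rewrite lee_wpmul2l ?lee_fin// !bloch_measureE -(RcintD (mb _) (mb _) (b0 _) (b0 _)).
apply: Rcint_le => //; [exact: cmeasRD|by move=> z; rewrite mulr_ge0 ?sqr_ge0|].
move=> z; rewrite -mulrDr.
have [hz|hz] := pselect ((sqmod @^-1` `]4^-1, 2^-1]%classic) z); last first.
  by rewrite /w2 (indic_setN hz) !mulr0 mulr_ge0 ?bloch_sq_ge0// addr_ge0 ?indic_ge0.
rewrite /w2 (indic_setE hz) mulr1 -[leLHS]mulr1 ler_wpM2l ?bloch_sq_ge0//.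
move: hz; rewrite /= in_itv/= /sqmod expr2 => /andP[h1 h2].
have z0 := modulus_ge0 z.
have z2 : 2^-1 < modulus z by nra.
have z34 : modulus z < 3 / 4 by nra.
have [p pi hp] := dyadic_box_cover (introT andP (conj (ltac:(lra) : 0 < modulus z) (ltac:(lra) : modulus z < 1))).
have p1E : p.1 = 1%N.
  have [h3 _] := (dyadic_boxE _ z).1 hp.
  by apply: (side_scale_uniq h3); rewrite expr1; apply/andP; split; lra.
move: pi hp; case: p p1E => n k /= ->; rewrite /box_index/=.
case: k => [|[|[|k]]]// _ hp; rewrite (indic_setE hp).
  by rewrite lerDl indic_ge0.
by rewrite lerDr indic_ge0.
Qed.

(* the vanishing order needed on the core is controlled by those of the two halves of
   the annulus [1/4 < 1 - |z| <= 1/2] *)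
Definition core_order (o : nat * nat -> nat) p : nat :=
  if p.1 == 0%N then (o (1, 1) + o (1, 2))%N else o p.

Lemma bloch_level_bound g (o : nat * nat -> nat) (B : R) p : little_bloch g -> 0 <= B ->
  (forall q, dyadic_indices q -> (dyadic_mean g q <= (B * 2 ^+ o q)%:E)%E) -> box_index p ->
  (bloch_measure g (dyadic_box p) <= (648 * kappa * B * 2 ^+ core_order o p * side p ^+ 2)%:E)%E.
Proof.
move=> hg B0 hB pi; have [e he] := analytic_taylor hg.1; have k0 := @kappa_gt0 R.
have pow0 n : 0 <= 2 ^+ n :> R by rewrite exprn_ge0.
have pow1 n : 1 <= 2 ^+ n :> R by rewrite exprn_ege1// ler1n.
have c0 : 0 <= 324 * kappa * B by apply: mulr_ge0 B0; apply: mulr_ge0 (ltW k0); exact: ler0n.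
have base q : dyadic_indices q -> (bloch_measure g (dyadic_box q) <= (324 * kappa * B * 2 ^+ o q * side q ^+ 2)%:E)%E.
  move=> hq; have h := bloch_measure_le (mulr_ge0 B0 (pow0 (o q))) (hB q hq).
  by rewrite -(mulrA (324 * kappa) B).
rewrite /core_order; case: eqP => p1; last first.
  apply: le_trans (base p _) _; first by split=> //; lia.
  rewrite lee_fin ler_wpM2r ?sqr_ge0// ler_wpM2r// -!mulrA ler_wpM2r ?ler_nat//.
  by rewrite mulr_ge0// ltW.
have -> : p = (0, 1)%N.
  case: p pi p1 => n k /= pi p1; rewrite p1 in pi *.
  by case: k pi => [|[|k]].
apply: le_trans (bloch_measure_core he) _.
have s1 k : side (1%N, k) = 2^-1 :> R by rewrite /side/= expr1.
have s0 : side (0, 1)%N = 1 :> R by rewrite /side/= expr0 invr1.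
have hs := leeD (base (1, 1)%N _) (base (1, 2)%N _).
apply: le_trans (lee_wpmul2l _ (hs _ _)) _ => //; rewrite ?lee_fin//.
rewrite !s1 s0 expr1n mulr1 exprD.
have := pow1 (o (1, 1)%N); have := pow1 (o (1, 2)%N).
move: (2 ^+ o (1, 1)%N) (2 ^+ o (1, 2)%N) => x y y1 x1.
have -> : 4 * (324 * kappa * B * x * 2^-1 ^+ 2 + 324 * kappa * B * y * 2^-1 ^+ 2) = 324 * kappa * B * (x + y) by field.
(* Both powers are at least [1], so [x + y <= 2 x y]: the orders of the two halves may be added on
   the core, at the price of [648 = 2 * 324]. *)
have -> : 648 * kappa * B * (x * y) = 324 * kappa * B * (2 * (x * y)) by ring.
by rewrite ler_wpM2l//; nra.
Qed.

End Core.

(** * Taylor polynomials and their remainders *)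

Section Taylor.
Context {R : realType}.
Local Notation C := R[i].
Implicit Types (z a : C) (f g h : C -> C) (c : nat -> C) (b : R).

Definition taylor f : nat -> C := xget (fun=> 0) [set c | has_pseries f 0 1 c].

Lemma taylorP f c : has_pseries f 0 1 c -> taylor f = c.
Proof.
move=> hf; have h : has_pseries f 0 1 (taylor f) by exact: (@xgetI _ (fun=> 0) [set d | has_pseries f 0 1 d] c hf).
by apply: (pseries_uniq ltr01 ltr01 (fun z _ _ => erefl) h hf).
Qed.

Lemma has_taylor f : analytic_on_disc f -> has_pseries f 0 1 (taylor f).
Proof. by move=> /analytic_taylor[c hc]; rewrite (taylorP hc). Qed.

Lemma psum_has_pseries c N (r : R) :
  has_pseries (psum c N) 0 r (fun n => if (n < N)%N then c n else 0).
Proof.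
apply: has_pseriesP => z _; rewrite subr0 /cvc; apply/cvgrPdist_le => d d0.
exists N => // n /= Nn; rewrite [X in modulus (_ - X)](_ : _ = psum c N z).
  by rewrite subrr modulus0 subrr normr0 ltW.
rewrite /psum -(subnK Nn) addnC big_split_ord/= [X in _ + X]big1 ?addr0.
  by apply: eq_bigr => i _; rewrite ltn_ord.
by move=> i _; rewrite ltnNge leq_addr mul0r.
Qed.

Lemma sqnorm_partial_le b f c N : -1 < b -> has_pseries f 0 1 c ->
  ((\sum_(n < N) modulus (c n) ^+ 2 * mom b n)%:E <= sqnorm b f)%E.
Proof.
move=> b1 hf; rewrite (sqnorm_pseries b1 hf) -(big_mkord xpredT (fun n => modulus (c n) ^+ 2 * mom b n)) -sumEFin.
by apply: nneseries_lim_ge => *; exact: coef_term_ge0.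
Qed.

(** The ratio [(n + 1) / (n + b + 2)] of consecutive moments is at least [t] once [n] exceeds
    [t (b + 1) / (1 - t)]. Up to [n0] monotonicity suffices, so [K = mom b n0] works throughout. *)
Lemma mom_lower b (t : R) : -1 < b -> 0 < t < 1 -> exists2 K, 0 < K & forall n, K * t ^+ n <= mom b n.
Proof.
move=> b1 /andP[t0 t1]; have d0 : 0 < 1 - t by lra.
have p0 : 0 < b + 1 by lra.
have tp0 : 0 <= t * (b + 1) / (1 - t) by rewrite divr_ge0 ?mulr_ge0 ?ltW.
have := archimedean.Num.Theory.archi_boundP tp0; set n0 := archimedean.Num.bound _ => hn0.
have mono n : mom b n.+1 <= mom b n.
  have h := mom_gt0 n.+1 (ltac:(lra) : -1 < b); have := mom_add n b1.
  have : 0 < mom (b + 1) n by apply: mom_gt0; lra.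
  lra.
exists (mom b n0) => [|n]; first exact: mom_gt0.
have [nn|nn] := leqP n n0.
  have : mom b n0 <= mom b n.
    rewrite -(subnK nn); elim: (n0 - n)%N => [|k IH]; first by rewrite add0n.
    by rewrite addSn; exact: le_trans (mono _) IH.
  move=> /(le_trans _); apply; rewrite ler_piMr ?exprn_ile1 ?ltW//; exact: mom_gt0.
rewrite -(subnK (ltnW nn)); elim: (n - n0)%N => [|k IH].
  by rewrite add0n ler_piMr ?exprn_ile1 ?ltW//; exact: mom_gt0.
rewrite addSn exprS mulrCA; apply: le_trans (ler_wpM2l (ltW t0) IH) _.
have hr := mom_ratio (k + n0) b1.
have m0 := mom_gt0 (k + n0) b1.
have q0 : 0 < (k + n0).+1%:R + b + 1 by rewrite -natr1; have : 0 <= (k + n0)%:R :> R by []; lra.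
rewrite -(ler_pM2r q0) hr mulrAC [leRHS]mulrC [leRHS]mulrC ler_wpM2r ?(ltW m0)//.
have : n0%:R <= (k + n0)%:R :> R by rewrite ler_nat leq_addl.
move: hn0; rewrite ltr_pdivrMr// -natr1; move: (k + n0)%:R n0%:R => x y; nra.
Qed.

(** Cauchy-Schwarz with the weights [mom b n], using [1 / mom b n <= K^-1 t^-n]; the condition
    [r^2 < t] makes the remaining sum a geometric tail. *)
Lemma taylor_tail_sup b f c N z (r t K : R) : -1 < b -> has_pseries f 0 1 c ->
  0 < K -> 0 < t -> (forall n, K * t ^+ n <= mom b n) -> 0 <= r -> r ^+ 2 < t -> modulus z <= r -> r < 1 ->
  ((modulus (f z - psum c N z) ^+ 2)%:E <=
   (K^-1 * (r ^+ 2 / t) ^+ N / (1 - r ^+ 2 / t))%:E * sqnorm b f)%E.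
Proof.
move=> b1 hf K0 t0 hK r0 rt zr r1.
have [q0 q1] : 0 <= r ^+ 2 / t /\ r ^+ 2 / t < 1.
  by rewrite divr_ge0 ?sqr_ge0 ?ltW// ltr_pdivrMr ?mul1r.
set q := r ^+ 2 / t in q0 q1 *.
have A0 : 0 < K^-1 / (1 - q) by rewrite divr_gt0 ?invr_gt0// subr_gt0.
have B0 : 0 <= K^-1 * q ^+ N / (1 - q).
  by rewrite mulrAC mulr_ge0 ?exprn_ge0// ltW.
have := sqnorm_ge0 b f; case E : (sqnorm b f) => [s| |]//; last first.
  (* For an infinite norm the right side is [+oo] unless its factor is [0]. In that case [r = 0] and
     [N > 0], so [z] is the centre, where the Taylor polynomial agrees with [f]. *)
  move=> _; have [B1|B1] := ltP 0 (K^-1 * q ^+ N / (1 - q)); first by rewrite gt0_muley ?leey// lte_fin.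
  have qN : q ^+ N = 0.
    apply/eqP; move: B1; rewrite mulrAC pmulr_rle0// => h.
    by rewrite eq_le h exprn_ge0.
  have r00 : r = 0.
    move/eqP: qN; rewrite expf_eq0 /q => /andP[_]; rewrite mulf_eq0 invr_eq0 (gt_eqF t0) orbF sqrf_eq0.
    by move/eqP.
  have N0 : (0 < N)%N by move/eqP: qN; rewrite expf_eq0 => /andP[].
  have z0 : z = 0.
    by apply/eqP; rewrite -modulus_eq0 eq_le modulus_ge0 andbT -r00.
  have f0 : f z = c 0%N by rewrite z0; exact: pseries_at_center ltr01 hf.
  have p0 : psum c N z = c 0%N.
    by case: N N0 {qN B0 B1} => // N _; rewrite /psum z0 big_ord_recl/= mulr1 big1 ?addr0// => i _; rewrite expr0n/= mulr0.
  by rewrite f0 p0 subrr modulus0 expr0n/= mule_ge0// lee_fin.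
rewrite lee_fin => s0; rewrite -EFinM lee_fin.
have z1 : modulus (z - 0) < 1 by rewrite subr0; lra.
have hlim := hf.2 z z1; rewrite subr0 in hlim.
have cst : cvc (fun=> psum c N z) (psum c N z).
  by rewrite /cvc; under [fun n => _]eq_fun do rewrite subrr modulus0; exact: cvg_cst.
have RHS0 : 0 <= K^-1 * q ^+ N / (1 - q) * s by rewrite mulr_ge0.
rewrite -(sqr_sqrtr RHS0) lerXn2r ?nnegrE ?modulus_ge0 ?sqrtr_ge0//.
apply: (cvc_le_lim (N := N) (cvcB hlim cst)) => M NM.
rewrite -(ler_pXn2r (n := 2)) ?nnegrE ?modulus_ge0 ?sqrtr_ge0// sqr_sqrtr//.
pose d n := if (n < N)%N then 0 else c n.
have -> : psum c M z - psum c N z = psum d M z.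
  rewrite /psum -!(big_mkord xpredT (fun k => _ k * z ^+ k)).
  rewrite !(@big_cat_nat _ _ _ N 0 M)//= [LHS]addrC addKr.
  rewrite [X in X + _]big1_seq ?add0r.
    by apply: eq_big_nat => i /andP[Ni _]; rewrite /d ltnNge Ni.
  by move=> i; rewrite mem_index_iota /d => /andP[_ /andP[_ ->]]; rewrite mul0r.
have d0 j : (j < N)%N -> d j = 0 by rewrite /d => ->.
apply: le_trans (sqr_psum_le M z (fun n => mom_gt0 n b1) d0) _.
rewrite [leRHS]mulrC; apply: ler_pM.
- by apply: sumr_ge0 => n _; rewrite mulr_ge0 ?sqr_ge0// ltW// mom_gt0.
- by apply: sumr_ge0 => n _; rewrite divr_ge0 ?exprn_ge0 ?modulus_ge0// ltW// mom_gt0.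
- rewrite -lee_fin -E; apply: le_trans (sqnorm_partial_le M b1 hf).
  rewrite lee_fin big_mkord; apply: ler_sum => n _; rewrite ler_wpM2r ?(ltW (mom_gt0 _ _))//.
  by rewrite /d; case: ifP => // _; rewrite modulus0 expr0n/= sqr_ge0.
have q01 : 0 <= q < 1 by rewrite q0.
rewrite -mulrA; apply: le_trans (ler_wpM2l _ (sum_geo_le N M q01)); last by rewrite invr_ge0 ltW.
rewrite mulr_sumr; apply: ler_sum => n _.
have Kt : 0 < K * t ^+ n by rewrite mulr_gt0 ?exprn_gt0.
apply: (@le_trans _ _ (r ^+ (2 * n) / (K * t ^+ n))).
  apply: ler_pM; rewrite ?exprn_ge0 ?modulus_ge0 ?invr_ge0 ?(ltW (mom_gt0 _ _))//.
    by rewrite lerXn2r ?nnegrE ?modulus_ge0.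
  by rewrite lef_pV2 ?posrE ?mom_gt0.
by rewrite /q expr_div_n -exprM invfM mulrCA.
Qed.

End Taylor.

Section OperatorLinearity.
Context {R : realType}.
Local Notation C := R[i].
Implicit Types (z a : C) (f g h : C -> C) (c d e : nat -> C) (b : R).

Lemma pseries_eval_uniq f h c z : has_pseries f 0 1 c -> has_pseries h 0 1 c ->
  modulus z < 1 -> f z = h z.
Proof.
move=> [_ hf] [_ hh] z1; have z1' : modulus (z - 0) < 1 by rewrite subr0.
exact: cvc_uniq (hf z z1') (hh z z1').
Qed.

Lemma int_coef_lin (x : C) c d e :
  int_coef (cauchy_product (fun n => x * c n + d n) e) =
  (fun n => x * int_coef (cauchy_product c e) n + int_coef (cauchy_product d e) n).
Proof.
apply/funext => -[|n] /=; first by rewrite mulr0 addr0.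
rewrite mulrA -mulrDl; congr (_ / _); rewrite /cauchy_product mulr_sumr -big_split/=.
by apply: eq_bigr => i _; ring.
Qed.

Lemma integration_lin g f h c d e (x : C) z : has_pseries g 0 1 e ->
  has_pseries f 0 1 c -> has_pseries h 0 1 d ->
  integration_operator g (fun w => x * f w + h w) z =
  x * integration_operator g f z + integration_operator g h z.
Proof.
move=> hg hf hh; have [z1|z1] := pselect (disc z); last first.
  by rewrite !integration_operator_out// mulr0 addr0.
apply: (pseries_eval_uniq
  (h := fun w => x * integration_operator g f w + integration_operator g h w)
  (integration_pseries hg (has_pseriesZD x hf hh)) _ z1).
by rewrite int_coef_lin; exact: has_pseriesZD (integration_pseries hg hf) (integration_pseries hg hh).
Qed.

Definition mass b g f : \bar R := Rcint (fun z => modulus (f z) ^+ 2 * (bloch_sq g z * wt b z)).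

Lemma cmeasR_mass b g f c e : -1 < b -> has_pseries g 0 1 e -> has_pseries f 0 1 c ->
  cmeasR (fun z => modulus (f z) ^+ 2 * (bloch_sq g z * wt b z)).
Proof.
move=> b1 hg hf; have hfg := has_pseriesM hf (has_pseries_derive hg).
apply: eq_cmeasR (cmeasR_pseries hfg (radial_wt (b + 2))) => z.
by rewrite wtD2// modulusM exprMn /bloch_sq; ring.
Qed.

Lemma mass_le b g f c (D : R) : -1 < b -> little_bloch g -> has_pseries f 0 1 c -> 0 < D ->
  (forall z, modulus z < 1 -> bloch_sq g z <= D) ->
  (mass b g f <= D%:E * sqnorm b f)%E.
Proof.
move=> b1 hg hf D0 hD; have [e he] := analytic_taylor hg.1.
have mf := cmeasR_pseries hf (radial_wt b).
rewrite /sqnorm -(RcintZ (ltW D0) mf (fun z => sqr_wt_ge0 b _ z)); apply: Rcint_le.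
- exact: cmeasR_mass b1 he hf.
- by apply: cmeasRM mf; exact: cmeasR_cst.
- by move=> z; exact: mass_ge0.
move=> z; have [z1|z1] := ltP (modulus z) 1; last first.
  by rewrite /wt discE ltNge z1 !mulr0.
by rewrite mulrCA ler_wpM2r ?sqr_wt_ge0// hD.
Qed.

Definition lp_cst b : R := (b + 3) / ((b + 1) * (b + 2)).

Lemma lp_cst_gt0 b : -1 < b -> 0 < lp_cst b.
Proof. by move=> b1; rewrite divr_gt0 ?mulr_gt0//; lra. Qed.

Lemma sqnorm_integration_le b g f c e : -1 < b -> has_pseries g 0 1 e -> has_pseries f 0 1 c ->
  (sqnorm b (integration_operator g f) <= (lp_cst b)%:E * mass b g f)%E.
Proof.
move=> b1 hg hf; have := integration_operator_le b1 hg hf; rewrite sqnorm_mul_derive//.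
have -> // : mass b g f = Rcint (fun z => modulus (f z) ^+ 2 * bloch_sq g z * wt b z).
by apply: eq_Rcint => z; rewrite mulrA.
Qed.

Lemma bergman_integration b g f c : -1 < b -> little_bloch g -> has_pseries f 0 1 c ->
  (sqnorm b f < +oo)%E -> bergman b (integration_operator g f).
Proof.
move=> b1 hg hf fin; have [e he] := analytic_taylor hg.1; split.
- exact: has_pseries_analytic (integration_pseries he hf).
- rewrite bergman_norm_lty//; apply: le_lt_trans (sqnorm_integration_le b1 he hf) _.
  have [D D0 hD] := bloch_sq_bounded hg.
  have L0 : (0 <= (lp_cst b)%:E)%E by rewrite lee_fin ltW// lp_cst_gt0.
  apply: le_lt_trans (lee_wpmul2l L0 (mass_le b1 hg hf D0 hD)) _.
  have := sqnorm_ge0 b f; case: (sqnorm b f) fin => [s| |]// _ _.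
  by rewrite -!EFinM ltry.
- by move=> z; exact: integration_operator_out.
Qed.

(** One [B] pays for [|z| > r], where [bloch_sq g <= B]; the other for [|z| <= r], where the squared
    remainder is at most a small multiple of the squared norm of [f]. That [N] does not depend on
    [f] expresses the compactness of [I_g]. *)
Lemma mass_tail b g (B : R) : -1 < b -> little_bloch g -> 0 < B ->
  exists N, forall f c, has_pseries f 0 1 c -> (sqnorm b f < +oo)%E ->
    (mass b g (fun z => f z - psum c N z)%R <= (2 * B)%:E * sqnorm b f)%E.
Proof.
move=> b1 hg B0; have [e he] := analytic_taylor hg.1.
have [D D0 hD] := bloch_sq_bounded hg; have [r0 r01 hr0] := little_bloch_near hg B0.
pose r := Num.max r0 0; have r00 : 0 <= r by rewrite le_max lexx orbT.
have r1 : r < 1 by rewrite gt_max r01 ltr01.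
have hr z : r < modulus z < 1 -> bloch_sq g z <= B.
  by move=> /andP[h1 h2]; apply: hr0; rewrite h2 andbT (le_lt_trans _ h1)// le_max lexx.
have rr1 : r ^+ 2 < 1 by rewrite expr2; nra.
pose t := (r ^+ 2 + 1) / 2; have t01 : 0 < t < 1.
  by rewrite /t; have := sqr_ge0 r => ?; apply/andP; split; lra.
have t0 : 0 < t by case/andP: t01.
have rt : r ^+ 2 < t by rewrite /t; lra.
have [K K0 hK] := mom_lower b1 t01.
pose q := r ^+ 2 / t; have q01 : 0 <= q < 1.
  by rewrite divr_ge0 ?sqr_ge0 ?(ltW t0)//= ltr_pdivrMr// mul1r.
have [Kq hKq] := succ_expn_bounded q01.
have q1 : 0 < 1 - q by case/andP: q01; lra.
have m0 : 0 < mom b 0 by exact: mom_gt0.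
pose A := K^-1 / (1 - q) * D * mom b 0.
have A0 : 0 < A by rewrite !mulr_gt0 ?invr_gt0.
have Kq0 : 0 <= Kq by apply: le_trans (hKq 0%N); rewrite expr0 mulr1.
(* Since [(N + 1) q^N <= Kq], any [N] above [A Kq / B] makes [A q^N <= B]. *)
have := archimedean.Num.Theory.archi_boundP (divr_ge0 (mulr_ge0 Kq0 (ltW A0)) (ltW B0)).
set N := archimedean.Num.bound _ => hN; exists N => f c hf fin.
have qN : A * q ^+ N <= B.
  have n0 : 0 < N.+1%:R :> R by [].
  rewrite -(ler_pM2r n0) mulrAC -mulrA.
  apply: le_trans (ler_wpM2l (ltW A0) (hKq N)) _.
  move: hN; rewrite ltr_pdivrMr// => hN; rewrite mulrC [leRHS]mulrC; apply: le_trans (ltW hN) _.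
  by rewrite ler_wpM2r ?(ltW B0)// ler_nat.
have hu := has_pseriesB hf (psum_has_pseries c N 1).
set u := fun z => f z - psum c N z in hu *.
have mu := cmeasR_pseries hu (radial_wt b).
case E : (sqnorm b f) fin (sqnorm_ge0 b f) => [s| |]// _; rewrite lee_fin => s0.
pose ep := K^-1 * q ^+ N / (1 - q) * s * D.
have ep0 : 0 <= ep.
  rewrite !mulr_ge0 ?(ltW D0) ?invr_ge0 ?(ltW q1) ?(ltW K0)//.
  by apply: exprn_ge0; case/andP: q01.
have sup z : modulus z <= r -> modulus (u z) ^+ 2 <= K^-1 * q ^+ N / (1 - q) * s.
  move=> zr; have := taylor_tail_sup N b1 hf K0 t0 hK r00 rt zr r1.
  by rewrite E -EFinM lee_fin.
have mw := cmeasR_wt (R := R) b.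
have mB : cmeasR (fun z => B * (modulus (u z) ^+ 2 * wt b z)) by apply: cmeasRM mu; exact: cmeasR_cst.
have mE : cmeasR (fun z => ep * wt b z) by apply: cmeasRM mw; exact: cmeasR_cst.
apply: (@le_trans _ _ (Rcint (fun z => B * (modulus (u z) ^+ 2 * wt b z) + ep * wt b z)%R)).
  apply: Rcint_le.
  - exact: cmeasR_mass b1 he hu.
  - exact: cmeasRD.
  - by move=> z; exact: mass_ge0.
  move=> z; have [z1|z1] := ltP (modulus z) 1; last first.
    by rewrite /wt discE ltNge z1 !mulr0 addr0.
  have [zr|zr] := ltP r (modulus z).
    rewrite mulrCA -[leLHS]addr0 lerD//; last by rewrite mulr_ge0 ?wt_ge0.
    by rewrite ler_wpM2r ?sqr_wt_ge0// hr// zr.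
  rewrite mulrA -[leLHS]add0r lerD//; first by rewrite mulr_ge0 ?sqr_wt_ge0// ltW.
  rewrite ler_wpM2r ?wt_ge0//; apply: ler_pM; rewrite ?sqr_ge0 ?bloch_sq_ge0//; first exact: sup.
  exact: hD.
rewrite (RcintD mB mE); [|by move=> z; rewrite mulr_ge0 ?sqr_wt_ge0// ltW|by move=> z; rewrite mulr_ge0 ?wt_ge0].
rewrite (RcintZ (ltW B0) mu (fun z => sqr_wt_ge0 b _ z)) (RcintZ ep0 mw (wt_ge0 b)).
have -> : Rcint (wt b : C -> R) = (mom b 0)%:E.
  rewrite -moment_wt_fin//; apply: eq_Rcint => z.
  by rewrite muln0 expr0 mul1r.
have : (Rcint (fun z => modulus (u z) ^+ 2 * wt b z)%R <= s%:E)%E.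
  rewrite -E -[Rcint _]/(sqnorm b u) (sqnorm_pseries b1 hu) (sqnorm_pseries b1 hf).
  apply: lee_nneseries => [n _ _|n _]; first exact: coef_term_ge0.
  rewrite lee_fin ler_wpM2r ?(ltW (mom_gt0 _ _))//.
  by case: ifP => _; rewrite ?subrr ?subr0 ?modulus0 ?expr0n ?sqr_ge0.
move=> h; have B0' : (0 <= B%:E)%E by rewrite lee_fin ltW.
apply: le_trans (leeD (lee_wpmul2l B0' h) (lexx _)) _.
rewrite -!EFinM -EFinD lee_fin (_ : ep * mom b 0 = A * q ^+ N * s); last first.
  rewrite /ep /A; move: (q ^+ N) (mom b 0) (1 - q)^-1 K^-1 => a1 a2 a3 a4.
  clear; ring.
by rewrite mulr_natl mulr2n mulrDl lerD2l ler_wpM2r.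
Qed.

End OperatorLinearity.

Section WeightedCoordinates.
Context {R : realType} (b : R) (N : nat).
Hypothesis b1 : -1 < b.
Local Notation C := R[i].
Implicit Types (x y : 'rV[C]_N) (f : C -> C).

(* coordinates with respect to the orthonormal monomials [z^n / sqrt (mom b n)] *)
Definition rcoef x n : C :=
  (if insub n is Some i then x 0 i else 0) / (Num.sqrt (mom b n))%:C.

Definition coords f : 'rV[C]_N := \row_i (taylor f i * (Num.sqrt (mom b i))%:C).

Lemma rcoef_ord x (i : 'I_N) : rcoef x i = x 0 i / (Num.sqrt (mom b i))%:C.
Proof. by rewrite /rcoef valK. Qed.

Lemma sqrt_mom_neq0 n : (Num.sqrt (mom b n))%:C != 0 :> C.
Proof.
by rewrite -modulus_gt0 modulusR ger0_norm ?sqrtr_ge0// sqrtr_gt0; exact: mom_gt0.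
Qed.

Lemma rcoef_lin (c : C) x y n : rcoef (c *: x + y) n = c * rcoef x n + rcoef y n.
Proof.
rewrite /rcoef; case: insubP => [i _ _|_]; first by rewrite !mxE mulrDl mulrA.
by rewrite !mul0r mulr0 addr0.
Qed.

Lemma psum_rcoef_lin (c : C) x y z :
  psum (rcoef (c *: x + y)) N z = c * psum (rcoef x) N z + psum (rcoef y) N z.
Proof.
rewrite /psum mulr_sumr -big_split/=; apply: eq_bigr => i _.
by rewrite rcoef_lin mulrDl mulrA.
Qed.

Lemma sqnorm_rcoef x : sqnorm b (psum (rcoef x) N) = (sqn x)%:E.
Proof.
rewrite sqnorm_psum// big_mkord; congr EFin; apply: eq_bigr => i _.
rewrite rcoef_ord modulusM modulusV modulusR (ger0_norm (sqrtr_ge0 _)) exprMn exprVn.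
by rewrite (sqr_sqrtr (ltW (mom_gt0 i b1))) divfK// gt_eqF// mom_gt0.
Qed.

Lemma psum_coords f : psum (rcoef (coords f)) N = psum (taylor f) N.
Proof.
apply/funext => z; apply: eq_bigr => i _.
by rewrite rcoef_ord mxE mulfK// sqrt_mom_neq0.
Qed.

Lemma sqn_coords f : analytic_on_disc f -> ((sqn (coords f))%:E <= sqnorm b f)%E.
Proof.
move=> hf; have := sqnorm_partial_le N b1 (has_taylor hf).
rewrite (_ : \sum_(n < N) _ = sqn (coords f))//; apply: eq_bigr => i _.
rewrite mxE modulusM modulusR (ger0_norm (sqrtr_ge0 _)) exprMn.
by rewrite (sqr_sqrtr (ltW (mom_gt0 i b1))).
Qed.

Lemma coords_lin (c : C) f h : analytic_on_disc f -> analytic_on_disc h ->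
  coords (fun z => c * f z + h z) = c *: coords f + coords h.
Proof.
move=> hf hh; apply/rowP => i; rewrite !mxE.
rewrite (taylorP (has_pseriesZD c (has_taylor hf) (has_taylor hh))).
by rewrite mulrDl mulrA.
Qed.

(** Represents the [j]-th Taylor coefficient at [a] for the pairing [x *m adj y], hence the
    conjugation. *)
Definition taylor_functional (a : C) (j : nat) : 'rV[C]_N :=
  \row_i conjc (if (j < N)%N then 'C(i, j)%:R * a ^+ (i - j) / (Num.sqrt (mom b i))%:C else 0).

Lemma taylor_at_rcoef x a j :
  taylor_at (rcoef x) N a j = (x *m adj (taylor_functional a j)) 0 0.
Proof.
rewrite mxE /taylor_at; case: ifP => jN; last first.
  by rewrite big1// => i _; rewrite !mxE jN conjcK mulr0.
apply: eq_bigr => i _; rewrite !mxE jN conjcK /recenter_coef rcoef_ord; ring.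
Qed.

Lemma psum_rcoef_pseries x : has_pseries (psum (rcoef x) N) 0 1
  (fun n => if (n < N)%N then rcoef x n else 0).
Proof. exact: psum_has_pseries. Qed.

End WeightedCoordinates.

Section UpperBound.
Context {R : realType}.
Local Notation C := R[i].

Section CompressedOperator.
Variables (b : R) (N : nat) (g : C -> C) (T : 'M[C]_N).
Hypotheses (b1 : -1 < b) (hg : little_bloch g) (hT : proj_spec T).

(** The finite-rank competitor: Taylor polynomial, projection by [T], then [I_g]. When [T] fixes the
    functionals of the vanishing conditions, the discarded part [x - x *m T] satisfies these
    conditions. *)
Definition compressed (f : C -> C) : C -> C :=
  integration_operator g (psum (rcoef b (coords b N f *m T)) N).

Lemma integration_rcoef_lin (c : C) (x y : 'rV[C]_N) z :
  integration_operator g (psum (rcoef b (c *: x + y)) N) z =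
  c * integration_operator g (psum (rcoef b x) N) z + integration_operator g (psum (rcoef b y) N) z.
Proof.
have [e he] := analytic_taylor hg.1.
rewrite -(integration_lin c z he (psum_rcoef_pseries b x) (psum_rcoef_pseries b y)).
by congr (integration_operator g _ z); apply/funext => w; exact: psum_rcoef_lin.
Qed.

Lemma integration_rcoef_sum m (c : nat -> C) (q : nat -> 'rV[C]_N) z :
  integration_operator g (psum (rcoef b (\sum_(i < m) c i *: q i)) N) z =
  \sum_(i < m) c i * integration_operator g (psum (rcoef b (q i)) N) z.
Proof.
elim: m => [|m IH].
  rewrite !big_ord0; have := integration_rcoef_lin (-1) 0 0 z.
  by rewrite scaler0 addr0 mulN1r addNr.
by rewrite !big_ord_recr/= addrC integration_rcoef_lin IH addrC.
Qed.

Lemma sqnorm_compressed_le f (D : R) : bergman b f -> 0 < D ->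
  (forall z, modulus z < 1 -> bloch_sq g z <= D) ->
  (sqnorm b (compressed f) <= (lp_cst b * D)%:E * sqnorm b f)%E.
Proof.
move=> [af _ _] D0 hD; have [e he] := analytic_taylor hg.1.
have hp := psum_rcoef_pseries b (coords b N f *m T).
apply: le_trans (sqnorm_integration_le b1 he hp) _.
have L0 : (0 <= (lp_cst b)%:E)%E by rewrite lee_fin ltW// lp_cst_gt0.
rewrite (EFinM (lp_cst b) D) -muleA lee_wpmul2l//; apply: le_trans (mass_le b1 hg hp D0 hD) _.
rewrite lee_wpmul2l ?lee_fin ?(ltW D0)// (sqnorm_rcoef b1).
apply: le_trans (sqn_coords N b1 af); rewrite lee_fin.
by rewrite [leRHS](proj_pythagoras _ hT) lerDl sqn_ge0.
Qed.

Lemma bergman_norm_le_of_sqnorm f (K : R) : 0 <= K -> (sqnorm b f <= (K / (b + 1))%:E)%E ->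
  (bergman_norm b f <= (Num.sqrt K)%:E)%E.
Proof.
move=> K0 h; have p0 : 0 < b + 1 by rewrite -ltrBlDr sub0r.
rewrite (bergman_norm_leE _ b1 K0); have p0' : (0 <= (b + 1)%:E)%E by rewrite lee_fin ltW.
apply: le_trans (lee_wpmul2l p0' h) _.
by rewrite -EFinM lee_fin mulrC divfK// gt_eqF.
Qed.

Lemma sqnorm_of_bergman_norm f (K : R) : 0 <= K -> (bergman_norm b f <= (Num.sqrt K)%:E)%E ->
  (sqnorm b f <= (K / (b + 1))%:E)%E.
Proof.
move=> K0; have p0 : 0 < b + 1 by rewrite -ltrBlDr sub0r.
rewrite (bergman_norm_leE _ b1 K0); have := sqnorm_ge0 b f; case: (sqnorm b f) => [s| |]//.
  by rewrite -EFinM !lee_fin ler_pdivlMr// mulrC.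
by rewrite gt0_muley ?lte_fin.
Qed.

Lemma compressed_bounded : bounded_operator b compressed.
Proof.
have [D D0 hD] := bloch_sq_bounded hg.
split.
- move=> f hf; apply: bergman_integration b1 hg (psum_rcoef_pseries b _) _.
  by rewrite (sqnorm_rcoef b1) ltry.
- move=> c f h [af _ _] [ah _ _]; apply/funext => z.
  rewrite /compressed (coords_lin b N c af ah) mulmxDl -scalemxAl.
  exact: integration_rcoef_lin.
have K0 : 0 <= lp_cst b * D by rewrite mulr_ge0 ?ltW// lp_cst_gt0.
apply: (@le_lt_trans _ _ (Num.sqrt (lp_cst b * D))%:E); last exact: ltry.
apply: ge_ereal_sup => _ [f [hf hf1] <-]; apply: bergman_norm_le_of_sqnorm => //.
apply: le_trans (sqnorm_compressed_le hf D0 hD) _.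
rewrite (EFinM (lp_cst b * D) (b + 1)^-1) lee_wpmul2l ?lee_fin//.
have := @sqnorm_of_bergman_norm f 1 ler01; rewrite sqrtr1 div1r; exact.
Qed.

End CompressedOperator.
End UpperBound.

(** * Upper bound for the singular values *)

Section SingularValueUpper.
Context {R : realType}.
Local Notation C := R[i].
Implicit Types (b : R) (f g h : C -> C) (p q : nat * nat).

Lemma bergman0 b : -1 < b -> bergman b (fun=> 0 : C).
Proof.
move=> b1; have h0 : has_pseries (fun=> 0 : C) 0 1 (fun=> 0).
  apply: has_pseriesP => z _; apply/cvgrPdist_le => d d0; exists 0%N => // n _.
  by rewrite /= /psum big1 ?subr0 ?modulus0 ?subrr ?normr0 ?ltW// => i _; rewrite mul0r.
split=> //; first exact: has_pseries_analytic h0.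
rewrite bergman_norm_lty// (sqnorm_pseries b1 h0) eseries0 ?ltry// => n _ _.
by rewrite /coef_term modulus0 expr0n/= mul0r.
Qed.

Lemma operator_norm_ge0 b (T : (C -> C) -> C -> C) : -1 < b -> (0 <= operator_norm b T)%E.
Proof.
move=> b1; apply: le_trans (ereal_sup_ubound _); last first.
  exists (fun=> 0) => //; split; first exact: bergman0.
  have h : sqnorm b (fun=> 0 : C) = 0%E.
    by rewrite /sqnorm /Rcint /cint integral0_eq// => x _; rewrite modulus0 expr0n/= mul0r.
  by rewrite bergman_normE h mule0 sqrte0.
by rewrite bergman_normE sqrte_ge0.
Qed.

Lemma singular_value_ge0 b (T : (C -> C) -> C -> C) n : -1 < b -> (0 <= singular_value b T n)%E.
Proof. by move=> b1; apply: le_ereal_inf_tmp => _ [S _ <-]; exact: operator_norm_ge0. Qed.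

Lemma singular_value_sqr_le b (T S : (C -> C) -> C -> C) n k (K : R) : -1 < b -> 0 <= K ->
  bounded_operator b S -> (k < n)%N -> has_rank b S k ->
  (forall f, bergman b f -> (sqnorm b f <= (b + 1)^-1%:E)%E ->
     (sqnorm b (fun z => T f z - S f z)%R <= (K / (b + 1))%:E)%E) ->
  (singular_value b T n ^+ 2 <= K%:E)%E.
Proof.
move=> b1 K0 hS kn hk h.
have -> : K%:E = ((Num.sqrt K)%:E ^+ 2)%E by rewrite -EFin_expe sqr_sqrtr.
rewrite lee_sqr ?singular_value_ge0// ?lee_fin ?sqrtr_ge0//.
apply: le_trans (ereal_inf_lbound _) _.
  by exists S => //; split=> //; exists k.
apply: ge_ereal_sup => _ [f [hf hf1] <-].
apply: (bergman_norm_le_of_sqnorm b1 K0); apply: h => //.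
by have := @sqnorm_of_bergman_norm R b b1 f 1 ler01; rewrite sqrtr1 div1r; exact.
Qed.

Lemma sqr_modulus_add (u v : C) : modulus (u + v) ^+ 2 <= 2 * modulus u ^+ 2 + 2 * modulus v ^+ 2.
Proof.
have h := modulus_le_add u v; have h0 := modulus_ge0 (u + v).
have : modulus (u + v) ^+ 2 <= (modulus u + modulus v) ^+ 2.
  by rewrite lerXn2r ?nnegrE// addr_ge0 ?modulus_ge0.
have := sqr_ge0 (modulus u - modulus v); lra.
Qed.

Lemma mass_add b g f h c d : -1 < b -> little_bloch g ->
  has_pseries f 0 1 c -> has_pseries h 0 1 d ->
  (mass b g (fun z => f z + h z)%R <= 2%:E * mass b g f + 2%:E * mass b g h)%E.
Proof.
move=> b1 hg hf hh; have [e he] := analytic_taylor hg.1.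
have mf := cmeasR_mass b1 he hf; have mh := cmeasR_mass b1 he hh.
have hs : has_pseries (fun z => 1 * f z + h z) 0 1 (fun k => 1 * c k + d k) by exact: has_pseriesZD.
have ms := cmeasR_mass b1 he hs.
have m2f : cmeasR (fun z => 2 * (modulus (f z) ^+ 2 * (bloch_sq g z * wt b z))) by apply: cmeasRM mf; exact: cmeasR_cst.
have m2h : cmeasR (fun z => 2 * (modulus (h z) ^+ 2 * (bloch_sq g z * wt b z))) by apply: cmeasRM mh; exact: cmeasR_cst.
have two : 0 <= 2 :> R by [].
rewrite /mass -(RcintZ two mf (fun z => mass_ge0 b g f z)) -(RcintZ two mh (fun z => mass_ge0 b g h z)).
rewrite -(RcintD m2f m2h); [|by move=> z; rewrite mulr_ge0 ?mass_ge0|by move=> z; rewrite mulr_ge0 ?mass_ge0].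
apply: Rcint_le.
- by apply: eq_cmeasR ms => z; rewrite mul1r.
- exact: cmeasRD.
- by move=> z; rewrite mulr_ge0 ?sqr_ge0 ?bloch_wt_ge0.
move=> z; move: (bloch_sq g z * wt b z) (bloch_wt_ge0 b g z) => w w0.
by have := ler_wpM2r w0 (sqr_modulus_add (f z) (h z)); congr (_ <= _); ring.
Qed.

Theorem singular_value_upper b : -1 < b -> exists C0 M, 0 < C0 /\
  forall g (s : seq (nat * nat)) (o : nat * nat -> nat) (B : R), little_bloch g ->
  uniq s -> (forall p, p \in s -> dyadic_indices p) -> 0 < B ->
  (forall q, dyadic_indices q -> (dyadic_mean g q <= (B * 2 ^+ o q)%:E)%E) ->
  (forall p, p \notin s -> o p = 0%N) ->
  (singular_value b (integration_operator g) (1 + M * \sum_(p <- s) o p)%N ^+ 2 <= (C0 * B)%:E)%E.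
Proof.
move=> b1; have [G [grid hgrid]] := @grid_exists R; have [K K0 hK] := @carleson_total R.
have k0 := @kappa_gt0 R; have L0 := lp_cst_gt0 b1.
pose CC := carleson_cst b * K + 1.
have CC0 : 0 < CC by rewrite addr_gt0// mulr_gt0// carleson_cst_gt0.
have [c6 c6E c648] : exists2 c6 : R, c6 = 648 * kappa & 0 < c6.
  exists (648 * kappa); first by [].
  by apply: mulr_gt0 k0; rewrite ltr0n.
(* A box costs [G] conditions per unit of order. The boxes of [s] contribute the sum of the orders
   once and the core at most twice more, hence [3 * G]. In [2 + CC] the [2] is the constant of
   [mass_tail] and [CC] that of [carleson_total]. *)
exists (lp_cst b * (2 * (2 + CC) * c6)), (3 * G)%N.
split; first by rewrite mulr_gt0// mulr_gt0// mulr_gt0// addr_gt0.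
move=> g s o B hg us hs B0 hB ho; pose B1 := c6 * B.
have B10 : 0 < B1 by rewrite mulr_gt0.
have [e he] := analytic_taylor hg.1.
have [N hN] := mass_tail b1 hg B10.
pose s' := (0, 1)%N :: s.
pose conds := flatten [seq [seq (grid p i, j) | i <- enum 'I_G, j <- iota 0 (core_order o p)] | p <- s'].
pose u (l : nat) : 'rV[C]_N := let aj := nth (0, 0%N) conds l in taylor_functional b N aj.1 aj.2.
have [T [q [hT hu _ hq]]] := proj_exists u (size conds).
have o_le p : (o p <= \sum_(p <- s) o p)%N.
  have [ps|ps] := boolP (p \in s); last by rewrite ho.
  by rewrite (bigD1_seq p ps us)/= leq_addr.
have size_conds : (size conds <= 3 * G * \sum_(p <- s) o p)%N.
  rewrite /conds size_flatten /shape -map_comp sumnE big_map.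
  rewrite (eq_bigr (fun p => G * core_order o p)%N); last first.
    by move=> p _; rewrite /= size_allpairs size_enum_ord size_iota.
  rewrite /s' big_cons -big_distrr/= -mulnDr (mulnC 3) -mulnA leq_mul2l; apply/orP; right.
  have -> : (\sum_(p <- s) core_order o p = \sum_(p <- s) o p)%N.
    rewrite !big_seq; apply: eq_bigr => p /hs[p1 _]; rewrite /core_order.
    by case: eqP p1 => // ->.
  rewrite {1}/core_order/= mulSn addnC leq_add2l mul2n -addnn.
  by apply: leq_add; exact: o_le.
have vanish y p i : box_index p -> vanishing (rcoef b (y - y *m T)) N (grid p i) (core_order o p).
  move=> pi j jk; have pc : p \in s' \/ core_order o p = 0%N.
    have [ps|ps] := boolP (p \in s); first by left; rewrite inE ps orbT.
    rewrite /core_order; case: eqP => p1; last by right; exact: ho.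
    left; case: p pi p1 {ps jk} => n k /= pi p1; rewrite p1 in pi *.
    by case: k pi => [|[|k]]//; rewrite inE eqxx.
  case: pc => [ps|k00]; last by rewrite k00 in jk.
  have hc : (grid p i, j) \in conds.
    apply/flattenP; eexists; first by apply/mapP; exists p.
    by apply/allpairsP; exists (i, j); rewrite mem_enum mem_iota.
  have lc : (index (grid p i, j) conds < size conds)%N by rewrite index_mem.
  have uT := hu _ lc; rewrite /u (nth_index _ hc)/= in uT.
  by rewrite (taylor_at_rcoef b) (proj_annihilates y hT uT) mxE.
have [k km hk] : exists2 k, (k <= size conds)%N & has_rank b (compressed b g T) k.
  apply: (has_rank_exists (phi := fun i : 'I_(size conds) => integration_operator g (psum (rcoef b (q i)) N))).
  move=> f _; have [c hc] := hq (coords b N f); exists (fun i : 'I_(size conds) => c i) => z.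
  by rewrite /compressed hc (integration_rcoef_sum b hg).
have K1 : 0 <= lp_cst b * (2 * (2 + CC) * c6) * B.
  by rewrite mulr_ge0 ?(ltW B0)// mulr_ge0 ?(ltW L0)// mulr_ge0 ?(ltW c648)// mulr_ge0// addr_ge0// ltW.
have kn : (k < 1 + 3 * G * \sum_(p <- s) o p)%N by rewrite add1n ltnS (leq_trans km).
apply: (singular_value_sqr_le b1 K1 (compressed_bounded b1 hg hT) kn hk) => f hf hf1.
have [af ffin _] := hf; have tf := has_taylor af.
have fin : (sqnorm b f < +oo)%E by rewrite -(bergman_norm_lty f b1).
pose x := coords b N f; pose y := x *m T.
have py := psum_rcoef_pseries b y; have pxy := psum_rcoef_pseries b (x - y).
pose h z := f z - psum (rcoef b y) N z.
have hh := has_pseriesB tf py.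
have hF : has_pseries (fun z => integration_operator g f z - compressed b g T f z) 0 1
    (int_coef (cauchy_product (fun n => taylor f n - (if (n < N)%N then rcoef b y n else 0)) (deriv_coef e))).
  have := has_pseriesZD (-1) (integration_pseries he py) (integration_pseries he tf).
  rewrite -int_coef_lin => H.
  rewrite (_ : (fun n => taylor f n - _) = (fun n => -1 * (if (n < N)%N then rcoef b y n else 0) + taylor f n)); last first.
    by apply/funext => n; rewrite mulN1r addrC.
  by apply: eq_has_pseries H => z _; rewrite mulN1r addrC.
have lp := littlewood_paley_le b1 (has_pseriesM hh (has_pseries_derive he)) hF.
apply: le_trans lp _; rewrite sqnorm_mul_derive//.
have -> : Rcint (fun z => modulus (f z - psum (rcoef b y) N z) ^+ 2 * bloch_sq g z * wt b z) = mass b g h.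
  by apply: eq_Rcint => z; exact/esym/mulrA.
(* What the competitor misses is the Taylor remainder, controlled by [mass_tail], plus a polynomial
   with the prescribed zeros, controlled by [carleson_total]. *)
have hsplit : h = (fun z => (f z - psum (taylor f) N z) + psum (rcoef b (x - y)) N z).
  apply/funext => z; rewrite -(psum_coords N b1 f) -/x.
  have -> : x - y = -1 *: y + x by rewrite scaleN1r addrC.
  by rewrite psum_rcoef_lin /h; ring.
have hlevel p : box_index p ->
    (bloch_measure g (dyadic_box p) <= (B1 * 2 ^+ core_order o p * side p ^+ 2)%:E)%E.
  by rewrite /B1 c6E; exact: bloch_level_bound hg (ltW B0) hB.
have m1 := hN f _ tf fin.
have m2 := hK b g (rcoef b (x - y)) N G grid (core_order o) B1 b1 hg hgrid B10 (fun p i => vanish x p i)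
   hlevel.
have m3 := mass_add b1 hg (has_pseriesB tf (psum_has_pseries (taylor f) N 1)) pxy.
rewrite -hsplit in m3.
have sx := sqn_coords N b1 af.
have E1 : ((sqn (x - y))%:E <= (b + 1)^-1%:E)%E.
  apply: le_trans hf1; apply: le_trans sx; rewrite lee_fin.
  by rewrite [leRHS](proj_pythagoras _ hT) lerDr sqn_ge0.
have E2 : (mass b g h <= (2 * (2 * B1 / (b + 1)) + 2 * (CC * B1 / (b + 1)))%:E)%E.
  apply: le_trans m3 _; rewrite [leRHS]EFinD; apply: leeD; rewrite [leRHS](EFinM 2) lee_wpmul2l ?lee_fin//.
    apply: le_trans m1 _; rewrite (EFinM (2 * B1)) lee_wpmul2l// lee_fin.
    by rewrite mulr_ge0// ltW.
  apply: le_trans m2 _; rewrite (sqnorm_rcoef b1) (EFinM (CC * B1)) lee_wpmul2l// lee_fin.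
  by rewrite mulr_ge0 ?ltW.
have Lp : (0 <= (lp_cst b)%:E)%E by rewrite lee_fin ltW.
apply: le_trans (lee_wpmul2l Lp E2) _; rewrite -EFinM lee_fin /B1.
clearbody CC; rewrite le_eqVlt; apply/orP; left; apply/eqP.
by move: (lp_cst b) (b + 1)^-1; clear => a1 a2; ring.
Qed.

End SingularValueUpper.

(** * Lower bound for the singular values *)

Section Kernels.
Context {R : realType} (b : R).
Hypothesis b1 : -1 < b.
Local Notation C := R[i].
Implicit Types (z w a : C) (p : nat * nat) (N n : nat).

(** Coefficients of the Bergman kernel at [w]: [psum (kcoef w) N] reproduces evaluation at [w] on
    polynomials of degree below [N]. *)
Definition kcoef w n : C := (conjc w) ^+ n / (mom b n)%:C.

Definition kdiag N z : R := \sum_(n < N) modulus z ^+ (2 * n) / mom b n.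

Lemma kernel_conj N w z : psum (kcoef z) N w = conjc (psum (kcoef w) N z).
Proof.
rewrite /psum rmorph_sum; apply: eq_bigr => n _.
by rewrite /kcoef !rmorphM rmorphXn fmorphV rmorphXn/= conjcK oppr0; ring.
Qed.

Lemma modulus_kernel_sym N w z : modulus (psum (kcoef z) N w) = modulus (psum (kcoef w) N z).
Proof. by rewrite kernel_conj modulusJ. Qed.

Lemma kernel_diag N z : psum (kcoef z) N z = (kdiag N z)%:C.
Proof.
rewrite /psum /kdiag rmorph_sum; apply: eq_bigr => n _.
rewrite /kcoef mulrAC -exprMn [z^* * z]mulrC mulJ_modulus -rmorphXn -exprM/=.
by rewrite rmorphM fmorphV.
Qed.

Lemma kdiag_ge0 N z : 0 <= kdiag N z.
Proof. by apply: sumr_ge0 => n _; rewrite divr_ge0 ?exprn_ge0 ?modulus_ge0 ?(ltW (mom_gt0 _ b1)). Qed.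

Lemma sqnorm_kernel N z : sqnorm b (psum (kcoef z) N) = (kdiag N z)%:E.
Proof.
rewrite sqnorm_psum// big_mkord; congr EFin; apply: eq_bigr => n _.
have m0 := mom_gt0 n b1.
rewrite /kcoef modulusM modulusV modulusX modulusJ modulusR (ger0_norm (ltW m0)) exprMn exprVn exprM.
by rewrite [in RHS]exprAC; move: (mom b n) m0 => m m0; field; rewrite gt_eqF.
Qed.

Lemma kdiag_lower : exists2 c0 : R, 0 < c0 & forall p N z, dyadic_box p z ->
  (2 ^ p.1 <= N)%N -> c0 <= side p ^+ 2 * side p `^ b * kdiag N z.
Proof.
have [c0 c00 hc0] := kernel_diag_lower b1; exists c0 => // p N z hz pN.
have s0 := @side_gt0 R p; have sb0 : 0 < side p `^ b by exact: powR_gt0.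
have [/andP[_ hz1] _] := (dyadic_boxE p z).1 hz.
have h := hc0 p.1 N (modulus z) pN (ltac:(rewrite -[(2 ^+ p.1)^-1]/(side p); lra) : 1 - (2 ^+ p.1)^-1 <= modulus z).
have e : side p ^+ 2 * side p `^ b * (2 ^+ p.1) `^ (b + 2) = 1.
  have -> : side p ^+ 2 * side p `^ b = side p `^ (b + 2).
    by rewrite powRD ?(gt_eqF s0) ?implybT// (powR_mulrn 2 (ltW s0)) mulrC.
  rewrite -powRM ?(ltW s0)// ?exprn_ge0// /side mulVf ?powR1// expf_neq0//.
have sp : 0 < side p ^+ 2 * side p `^ b by rewrite mulr_gt0// exprn_gt0.
by have := ler_wpM2l (ltW sp) h; rewrite mulrCA e mulr1.
Qed.

Lemma psum_sub0 (c : nat -> C) N u :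
  psum c N u - psum c N 0 = psum (fun n => if n == 0%N then 0 else c n) N u.
Proof.
case: N => [|N]; first by rewrite /psum !big_ord0 subr0.
rewrite /psum !big_ord_recl/= mul0r add0r expr0 mulr1.
rewrite [X in _ - (_ + X)]big1 ?addr0; last by move=> j _; rewrite expr0n/= mulr0.
by rewrite addrC addKr.
Qed.

(** The squared norm of the kernel at [z] is its diagonal value [D], and [D] is at least [c0] over
    [side p] to the power [b + 2]. Hence, over the distance [th side p], the expansion at [z]
    without its constant term varies by at most a multiple of [D] times the root of [tau]; [tau] is
    chosen to make this at most [D / 2]. *)
Lemma kernel_near : exists2 th : R, 0 < th <= 32^-1 & forall p N z a, dyadic_box p z ->
  (2 ^ p.1 <= N)%N -> modulus (z - a) <= th * side p ->
  kdiag N z ^+ 2 <= 4 * modulus (psum (kcoef a) N z) ^+ 2.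
Proof.
have [c0 c00 hc0] := kdiag_lower; have k0 := @kappa_gt0 R; have W0 := wt_ratio_gt0 b.
have [c1 c1E c10] : exists2 c1 : R, c1 = 1024 / kappa & 0 < c1.
  exists (1024 / kappa); first by [].
  by apply: divr_gt0; [rewrite ltr0n|exact: k0].
have A0 : 0 < 1 + 4 * (c1 * wt_ratio b / c0).
  by rewrite addr_gt0// mulr_gt0// divr_gt0// mulr_gt0.
pose tau := (2 * (1 + 4 * (c1 * wt_ratio b / c0)))^-1.
have tau0 : 0 < tau by rewrite invr_gt0 mulr_gt0.
have tau2 : tau <= 2^-1.
  rewrite lef_pV2 ?posrE ?mulr_gt0//.
  have : 0 < c1 * wt_ratio b / c0 by rewrite divr_gt0// mulr_gt0.
  lra.
have tau4 : c1 * wt_ratio b / c0 * tau <= 4^-1.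
  have e : 2 * (1 + 4 * (c1 * wt_ratio b / c0)) * tau = 1 by rewrite /tau mulfV// gt_eqF// mulr_gt0.
  clear tau2; clearbody tau; move: (c1 * wt_ratio b / c0) e tau0 => x e tau0; nra.
exists (tau / 32) => [|p N z a hz pN hza]; first by apply/andP; split; lra.
have s0 := @side_gt0 R p; have sb0 : 0 < side p `^ b by exact: powR_gt0.
have r0 : 0 < side p / 16 :> R by rewrite divr_gt0.
set x := kcoef z; set D := kdiag N z.
have D0 : 0 <= D := kdiag_ge0 N z.
have Dlow : c0 <= side p ^+ 2 * side p `^ b * D := hc0 p N z hz pN.
have [i i0 ei] := nbhd_sq_fin x N p b1.
have iD : i <= D.
  rewrite -lee_fin -ei -sqnorm_kernel; apply: Rcint_le.
  - exact: cmeasR_nbhd_sq.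
  - exact: cmeasR_sqr_psum_wt.
  - by move=> w; exact: sqr_wt_indic_ge0.
  - by move=> w; rewrite ler_piMr ?indic_le1// sqr_wt_ge0.
have nb w : modulus (w - z) <= side p / 16 -> box_nbhd p w.
  by apply: (box_nbhd_near hz); rewrite subrr modulus0 ltW.
have h1 := le_trans (local_l2 x N z r0) (ball_nbhd_sq ei nb).
rewrite lee_fin in h1.
pose d n := if n == 0%N then 0 else taylor_at x N z n.
have diff : psum x N a - psum x N z = psum d N (a - z).
  by rewrite [psum x N a](psum_taylor x N z a) [psum x N z](psum_taylor x N z z) subrr psum_sub0.
have d0 j : (j < 1)%N -> d j = 0 by case: j.
have h2 := sqr_psum_le N (a - z) (fun n => ball_mom_gt0 n r0) d0.
have q1 : \sum_(0 <= n < N) modulus (d n) ^+ 2 * ball_mom (side p / 16) n <= wt_ratio b / side p `^ b * D.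
  apply: (@le_trans _ _ (wt_ratio b / side p `^ b * i)); last first.
    by rewrite ler_wpM2l// divr_ge0// ltW.
  apply: le_trans h1; apply: ler_sum => n _; rewrite ler_wpM2r ?(ltW (ball_mom_gt0 _ r0))//.
  by rewrite /d; case: eqP => _; rewrite ?modulus0 ?expr0n ?sqr_ge0.
have q2 : \sum_(1 <= n < N) modulus (a - z) ^+ (2 * n) / ball_mom (side p / 16) n <= c1 * tau / side p ^+ 2.
  have ps : 0 < side p ^+ 2 :> R by rewrite exprn_gt0.
  have B0 : 0 <= c1 / 2 / side p ^+ 2 by rewrite !divr_ge0// ?(ltW c10)// ltW.
  have tau01 : 0 <= tau < 1 by rewrite (ltW tau0)/=; lra.
  apply: (@le_trans _ _ (\sum_(1 <= n < N) c1 / 2 / side p ^+ 2 * tau ^+ n)).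
    apply: ler_sum => n _; rewrite ler_pdivrMr ?ball_mom_gt0//.
    have -> : c1 / 2 / side p ^+ 2 * tau ^+ n * ball_mom (side p / 16) n = (tau * ((side p / 16) ^+ 2 / 2)) ^+ n.
      rewrite /ball_mom (exprMn n tau) c1E; move: (((side p / 16) ^+ 2 / 2) ^+ n) (tau ^+ n) => X Y.
      by move: (side p) s0 => s s0; field; rewrite !gt_eqF.
    rewrite exprM; apply: lerXn2r; rewrite ?nnegrE ?sqr_ge0//.
      by rewrite mulr_ge0 ?(ltW tau0)// divr_ge0 ?sqr_ge0.
    rewrite modulus_distC in hza; have m0 := modulus_ge0 (a - z).
    apply: (@le_trans _ _ ((tau / 32 * side p) ^+ 2)).
      by apply: lerXn2r; rewrite ?nnegrE// mulr_ge0 ?(ltW s0)// divr_ge0// ltW.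
    have -> : (tau / 32 * side p) ^+ 2 = tau * (tau / 2) * ((side p / 16) ^+ 2 / 2) by field.
    rewrite ler_wpM2r ?divr_ge0 ?sqr_ge0// ler_piMr ?(ltW tau0)//; lra.
  rewrite -mulr_sumr; apply: le_trans (ler_wpM2l B0 (sum_geo_le 1 N tau01)) _.
  rewrite expr1; have h3 : tau / (1 - tau) <= 2 * tau.
    rewrite ler_pdivrMr; last by lra.
    nra.
  apply: le_trans (ler_wpM2l B0 h3) _.
  by rewrite le_eqVlt; apply/orP; left; apply/eqP; move: (side p ^+ 2)^-1 => S; field.
have q10 : 0 <= \sum_(0 <= n < N) modulus (d n) ^+ 2 * ball_mom (side p / 16) n.
  by apply: sumr_ge0 => n _; rewrite mulr_ge0 ?sqr_ge0 ?(ltW (ball_mom_gt0 _ r0)).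
have q20 : 0 <= \sum_(1 <= n < N) modulus (a - z) ^+ (2 * n) / ball_mom (side p / 16) n.
  by apply: sumr_ge0 => n _; rewrite divr_ge0 ?exprn_ge0 ?modulus_ge0 ?(ltW (ball_mom_gt0 _ r0)).
have h3 := le_trans h2 (ler_pM q10 q20 q1 q2); rewrite -diff in h3.
have h4 : modulus (psum x N a - psum x N z) ^+ 2 <= (D / 2) ^+ 2.
  apply: le_trans h3 _.
  have sp : 0 < side p ^+ 2 * side p `^ b by rewrite mulr_gt0// exprn_gt0.
  have -> : wt_ratio b / side p `^ b * D * (c1 * tau / side p ^+ 2) =
     c1 * wt_ratio b / c0 * tau * D * (c0 / (side p ^+ 2 * side p `^ b)).
    move: (side p ^+ 2) (side p `^ b) sb0 (exprn_gt0 2 s0) => S T T0 S0.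
    by move: (wt_ratio b) => W; field; rewrite !gt_eqF.
  have h5 : c0 / (side p ^+ 2 * side p `^ b) <= D by rewrite ler_pdivrMr// mulrC.
  have h6 : 0 <= c1 * wt_ratio b / c0 * tau * D.
    by rewrite mulr_ge0// mulr_ge0 ?(ltW tau0)// divr_ge0 ?(ltW c00)// mulr_ge0 ?(ltW c10)// ltW.
  apply: le_trans (ler_wpM2l h6 h5) _.
  have -> : (D / 2) ^+ 2 = 4^-1 * D * D by field.
  by rewrite ler_wpM2r// ler_wpM2r.
have h7 : modulus (psum x N a - psum x N z) <= D / 2.
  by move: h4; rewrite ler_pXn2r ?nnegrE ?modulus_ge0// divr_ge0.
have h8 := modulus_sub_le (psum x N z) (psum x N a).
rewrite (modulus_distC (psum x N z)) in h8; rewrite {1}kernel_diag modulusR (ger0_norm D0) -/D in h8.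
rewrite -(modulus_kernel_sym N a z) -/x.
have : (D / 2) ^+ 2 <= modulus (psum x N a) ^+ 2.
  by apply: lerXn2r; rewrite ?nnegrE ?modulus_ge0 ?divr_ge0//; lra.
lra.
Qed.

End Kernels.

Section AbstractLowerBound.
Context {R : realType}.
Local Notation C := R[i].

(* Averaging a quadratic form over a basis: it cannot be small on the whole orthogonal
   complement of a subspace of small dimension. *)
Lemma large_on_complement n N k (M : 'M[C]_(n, N)) (q : 'rV[C]_N -> R) (u : nat -> 'rV[C]_n)
    (C2 C3 c2 : R) : (0 < n)%N -> 0 <= C3 -> 0 < c2 ->
  (forall x y, q (x + y) <= 2 * q x + 2 * q y) ->
  (forall y, q y <= C3 * sqn y) -> (forall v, sqn (v *m M) <= C2 * sqn v) ->
  (forall j, c2 <= q (row j M)) -> 8 * (C2 * C3) * k%:R <= c2 * n%:R ->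
  exists v, [/\ sqn v <= 1, forall l, (l < k)%N -> v *m adj (u l) = 0 & c2 / 4 <= q (v *m M)].
Proof.
move=> n0 C30 c20 hadd hq hM hc hk.
have [T [_ [hT hu [k' kk trT] _]]] := proj_exists u k.
have trR : \sum_(j < n) sqn (row j T) = k'%:R.
  by apply: (@complexI R); rewrite rmorph_sum rmorph_nat -trT; exact: proj_trace.
pose ep (j : 'I_n) : 'rV[C]_n := delta_mx 0 j.
have sq1 j : sqn (ep j) = 1.
  rewrite /sqn (bigD1 j)//= !mxE !eqxx modulus1 expr1n big1 ?addr0// => i ij.
  by rewrite !mxE eqxx (negbTE ij) modulus0 expr0n.
(* The projected parts [ep j *m T] have total squared norm [tr T <= k], small compared with the
   number [n] of rows, so for some [j] the form stays large after this part is removed. *)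
pose v j := ep j - ep j *m T.
have key j : c2 <= 2 * q (v j *m M) + 2 * (C3 * (C2 * sqn (row j T))).
  apply: le_trans (hc j) _.
  have -> : row j M = v j *m M + ep j *m T *m M by rewrite -mulmxDl subrK rowE.
  apply: le_trans (hadd _ _) _; rewrite lerD2l ler_wpM2l//.
  apply: le_trans (hq _) _; rewrite ler_wpM2l//.
  by rewrite rowE; exact: hM.
have [j hj] : exists j, c2 / 4 <= q (v j *m M).
  (* Were all these values below [c2 / 4], summation over [j] would give
     [c2 n / 2 <= 2 C2 C3 k <= c2 n / 4]. *)
  apply: contrapT => hn; have lt j : q (v j *m M) < c2 / 4.
    by rewrite ltNge; apply/negP => h; apply: hn; exists j.
  have : \sum_(j < n) c2 <= \sum_(j < n) (c2 / 2 + 2 * (C3 * (C2 * sqn (row j T)))).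
    by apply: ler_sum => j _; have := key j; have := lt j; lra.
  rewrite big_split/= !sumr_const -!mulr_sumr trR card_ord -(mulr_natr c2) -(mulr_natr (c2 / 2)).
  have C20 : 0 <= C2 by have := hM (ep (Ordinal n0)); rewrite sq1 mulr1; apply: le_trans; exact: sqn_ge0.
  have kR : k'%:R <= k%:R :> R by rewrite ler_nat.
  have := ler_wpM2l (mulr_ge0 C20 C30) kR; move: hk.
  have nR : 0 < n%:R :> R by rewrite ltr0n.
  have := mulr_gt0 c20 nR.
  rewrite (mulrA C3) (mulrC C3) [2 * (C2 * C3 * _)]mulrA -(mulrA 8) -(mulrA 2).
  move: (c2 * n%:R) (C2 * C3 * k%:R) (C2 * C3 * k'%:R) (mulrAC c2 2^-1 n%:R) => a1 a2 a3 ->; lra.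
exists (v j); split=> //.
  by rewrite -(sq1 j) [leRHS](proj_pythagoras _ hT) lerDr sqn_ge0.
by move=> l lk; apply: proj_annihilates => //; exact: hu.
Qed.

End AbstractLowerBound.

Section TestFunctions.
Context {R : realType} (b : R).
Hypothesis b1 : -1 < b.
Local Notation C := R[i].
Implicit Types (z w a : C) (p : nat * nat) (N n : nat) (g : C -> C).

Lemma dyadic_mean_fin g p : little_bloch g -> exists2 A : R, 0 <= A & dyadic_mean g p = A%:E.
Proof.
move=> hg; have [e he] := analytic_taylor hg.1; have [D D0 hD] := bloch_sq_bounded hg.
have [A A0 eA] := @area_dyadic_box_fin R p.
have bb0 z : 0 <= bloch_sq g z * \1_(dyadic_box p) z by rewrite mulr_ge0 ?bloch_sq_ge0 ?indic_ge0.
have h0 : (0 <= bloch_measure g (dyadic_box p))%E by rewrite bloch_measureE; exact: Rcint_ge0.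
have : (bloch_measure g (dyadic_box p) <= (D * A)%:E)%E.
  have mi := cmeasR_indic (@cmeasS_dyadic_box R p).
  rewrite bloch_measureE EFinM -eA -(Rcint_indic (@cmeasS_dyadic_box R p)) -(RcintZ (ltW D0) mi (indic_ge0 _)).
  apply: Rcint_le => //; [exact: cmeasR_bloch_box he|by apply: cmeasRM mi; exact: cmeasR_cst|].
  move=> z; have [hz|hz] := pselect (dyadic_box p z); last by rewrite !(indic_setN hz) !mulr0.
  by rewrite !(indic_setE hz) !mulr1 hD// (dyadic_box_lt1 hz).
rewrite /dyadic_mean eA inver (gt_eqF A0); move: h0; case: (bloch_measure _ _) => [m| |]//.
by rewrite lee_fin => m0 _; exists (m / A); rewrite ?divr_ge0 ?(ltW A0)// EFinM.
Qed.

(** Every [z] of the box is near a grid point whose kernel is large at [z], so the box masses of the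
    kernels at the nearby grid points add up to at least a multiple of the mean. There are at most
    [G] such points, so one of them carries its share; the divisor [G.+1] in [c1] makes the
    contradiction strict. *)
Lemma test_point_exists : exists2 c1 : R, 0 < c1 & forall g p N (A : R), little_bloch g ->
  (2 ^ p.1 <= N)%N -> 0 < A -> (A%:E <= dyadic_mean g p)%E ->
  exists2 w, (forall v, modulus (v - w) <= side p / 16 -> box_nbhd p v) &
    ((c1 * A / (side p ^+ 2 * side p `^ b))%:E <= box_mass b g (psum (kcoef b w) N) p)%E.
Proof.
have [th /andP[th0 th32] hth] := kernel_near b1; have [c0 c00 hc0] := kdiag_lower b1.
have [G [grid hgrid]] := @fine_grid_exists R th th0.
have k0 := @kappa_gt0 R; have W0 := wt_ratio_gt0 b.
pose c1 := c0 ^+ 2 * kappa / (32 * wt_ratio b * G.+1%:R).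
have c10 : 0 < c1 by rewrite divr_gt0 ?mulr_gt0 ?exprn_gt0.
exists c1 => // g p N A hg pN A0 hA; have [e he] := analytic_taylor hg.1.
have s0 := @side_gt0 R p; have sb0 : 0 < side p `^ b by exact: powR_gt0.
pose S := side p ^+ 2 * side p `^ b; have S0 : 0 < S by rewrite mulr_gt0// exprn_gt0.
pose V := c1 * A / S; have V0 : 0 < V by rewrite divr_gt0// mulr_gt0.
pose near i := `[< exists2 z, dyadic_box p z & modulus (z - grid p i) <= th * side p >].
have [[i ni hi]|hno] := pselect (exists2 i, near i & (V%:E <= box_mass b g (psum (kcoef b (grid p i)) N) p)%E).
  exists (grid p i) => // v hv; move/asboolP: ni => [z hz hzi].
  by apply: box_nbhd_near hz _ hv; apply: le_trans hzi _; nra.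
exfalso.
have mm i := cmeasR_box_mass b (kcoef b (grid p i)) N p he.
have ub : (\sum_(i < G | near i) box_mass b g (psum (kcoef b (grid p i)) N) p <= (G%:R * V)%:E)%E.
  apply: (@le_trans _ _ (\sum_(i < G | near i) V%:E)%E).
    apply: lee_sum => i ni; rewrite leNgt; apply/negP => h; apply: hno; exists i => //; exact: ltW.
  rewrite sumEFin lee_fin sumr_const -(mulr_natl V) ler_wpM2r ?(ltW V0)// ler_nat.
  by rewrite (leq_trans (max_card _))// card_ord.
pose c3 := 4^-1 * (c0 / S) ^+ 2 * (side p `^ b / wt_ratio b).
have c30 : 0 < c3.
  apply: mulr_gt0; last exact: divr_gt0.
  by apply: mulr_gt0; [rewrite invr_gt0|apply: exprn_gt0; exact: divr_gt0].
have bb0 z : 0 <= bloch_sq g z * \1_(dyadic_box p) z by rewrite mulr_ge0 ?bloch_sq_ge0 ?indic_ge0.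
have lb : (c3%:E * bloch_measure g (dyadic_box p) <= \sum_(i < G | near i) box_mass b g (psum (kcoef b (grid p i)) N) p)%E.
  rewrite bloch_measureE -(RcintZ (ltW c30) (cmeasR_bloch_box p he) bb0).
  rewrite [leRHS](_ : _ = \sum_(i <- [seq i <- enum 'I_G | near i]) box_mass b g (psum (kcoef b (grid p i)) N) p)%E; last first.
    by rewrite big_filter big_enum_cond.
  rewrite /box_mass -(Rcint_sum _ mm); last by move=> i z; rewrite mulr_ge0 ?mass_ge0 ?indic_ge0.
  apply: Rcint_le.
  - by apply: cmeasRM; [exact: cmeasR_cst|exact: cmeasR_bloch_box he].
  - exact: cmeasR_sum.
  - by move=> z; rewrite mulr_ge0 ?(ltW c30).
  move=> z; have [hz|hz] := pselect (dyadic_box p z); last first.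
    by rewrite !(indic_setN hz) !mulr0 sumr_ge0// => i _; rewrite mulr0.
  have [i hi] := hgrid p z hz.
  have ni : near i by apply/asboolP; exists z.
  have iin : i \in [seq i <- enum 'I_G | near i] by rewrite mem_filter ni mem_enum.
  rewrite (bigD1_seq i iin (filter_uniq _ (enum_uniq _)))/= (indic_setE hz) !mulr1.
  rewrite ler_wpDr ?sumr_ge0// => [j _|]; first by rewrite mulr1; exact: mass_ge0.
  have h1 := hth p N z (grid p i) hz pN hi; have h2 := hc0 p N z hz pN.
  have [_ h3] := wt_nbhd b (box_sub_nbhd hz).
  rewrite [leRHS]mulrCA [leRHS]mulrC ler_wpM2r ?bloch_sq_ge0//.
  apply: ler_pM.
  - by rewrite mulr_ge0 ?invr_ge0 ?sqr_ge0.
  - exact: divr_ge0 (ltW sb0) (ltW W0).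
  - have : (c0 / S) ^+ 2 <= kdiag b N z ^+ 2.
      apply: lerXn2r; rewrite ?nnegrE ?kdiag_ge0 ?divr_ge0 ?(ltW c00) ?(ltW S0)//.
      by rewrite ler_pdivrMr// mulrC.
    lra.
  - by rewrite ler_pdivrMr// mulrC.
have := le_trans (le_trans (lee_wpmul2l (ltac:(rewrite lee_fin; exact: ltW) : (0 <= c3%:E)%E) (bloch_measure_ge (ltW A0) hA)) lb) ub.
rewrite -EFinM lee_fin; apply/negP; rewrite -ltNge.
have -> : c3 * (kappa / 8 * A * side p ^+ 2) = G.+1%:R * V.
  rewrite /c3 /V /c1 /S; move: (side p ^+ 2) (exprn_gt0 2 s0) (side p `^ b) sb0 => x x0 y y0.
  have g0 : (G.+1%:R : R) != 0 by rewrite pnatr_eq0.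
  move: (G.+1%:R : R) g0 (wt_ratio b) W0 => x1 x10 x2 x20; field.
  by rewrite x10 !gt_eqF.
by rewrite ltr_pM2r// ltr_nat.
Qed.

End TestFunctions.

Section SingularValueLower.
Context {R : realType}.
Local Notation C := R[i].
Implicit Types (z w : C) (p : nat * nat) (N n : nat) (b : R) (g f : C -> C).

Definition kernel_row b N w : 'rV[C]_N := \row_i ((conjc w) ^+ i / (Num.sqrt (mom b i))%:C).

Lemma psum_kernel_row b N w : -1 < b -> psum (rcoef b (kernel_row b N w)) N = psum (kcoef b w) N.
Proof.
move=> b1; apply/funext => z; apply: eq_bigr => i _; congr (_ * _).
rewrite rcoef_ord mxE /kcoef -mulrA -invfM -rmorphM.
by rewrite -expr2 (sqr_sqrtr (ltW (mom_gt0 i b1))).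
Qed.

Lemma kernel_row_reproducing b N w (y : 'rV[C]_N) :
  (kernel_row b N w *m adj y) 0 0 = conjc (psum (rcoef b y) N w).
Proof.
rewrite mxE /psum rmorph_sum; apply: eq_bigr => i _.
by rewrite !mxE rcoef_ord !rmorphM rmorphXn fmorphV/= oppr0; ring.
Qed.

(** Up to constants, the weighted area of the box. *)
Definition box_scale b p : R := side p ^+ 2 * side p `^ b.

Lemma box_scale_gt0 b p : 0 < box_scale b p.
Proof. by rewrite mulr_gt0 ?exprn_gt0 ?powR_gt0 ?side_gt0. Qed.

(** Each value is bounded by the integral over the neighbourhood of its box, through [nbhd_sup] with
    vanishing order [0]; the bounded overlap of the neighbourhoods sums these integrals. *)
Lemma sampling b : -1 < b -> exists2 K : R, 0 < K & forall (s : seq (nat * nat)) (w : nat * nat -> C) N (y : 'rV[C]_N),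
  uniq s -> (forall p, p \in s -> box_index p) ->
  (forall p, p \in s -> forall v, modulus (v - w p) <= side p / 16 -> box_nbhd p v) ->
  \sum_(p <- s) box_scale b p * modulus (psum (rcoef b y) N (w p)) ^+ 2 <= K * sqn y.
Proof.
move=> b1; have [K K0 hK] := @nbhd_sq_sum R; have k0 := @kappa_gt0 R.
have [c1 c1E c10] : exists2 c1 : R, c1 = 1024 / kappa & 0 < c1.
  exists (1024 / kappa); first by [].
  by apply: divr_gt0; [rewrite ltr0n|exact: k0].
exists (c1 * wt_ratio b * K) => [|s w N y us hs hw].
  by apply: mulr_gt0 K0; apply: mulr_gt0 c10 (wt_ratio_gt0 b).
rewrite -lee_fin EFinM -(sqnorm_rcoef b1).
have W0 : 0 <= c1 * wt_ratio b by apply: mulr_ge0; [exact: ltW|exact/ltW/wt_ratio_gt0].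
rewrite (EFinM (c1 * wt_ratio b)) -muleA; apply: le_trans (lee_wpmul2l _ (hK b (rcoef b y) N s us hs)); last by rewrite lee_fin.
rewrite ge0_sume_distrr; last by move=> p _; exact: nbhd_sq_ge0.
rewrite -sumEFin !big_seq; apply: lee_sum => p ps.
have [i i0 ei] := nbhd_sq_fin (rcoef b y) N p b1; rewrite ei -EFinM lee_fin mulrC.
have s0 := @side_gt0 R p.
have h := @nbhd_sup R b (rcoef b y) N (w p) 0 (w p) p i ei (hw p ps).
rewrite c1E; have := h _ _; rewrite expr0 mulr1; apply=> //.
by rewrite subrr modulus0 divr_ge0// ltW.
Qed.

Lemma linear_sum N n (L : 'rV[C]_N -> C) (v : 'rV[C]_n) (M : 'M[C]_(n, N)) :
  (forall (c : C) x y, L (c *: x + y) = c * L x + L y) ->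
  L (v *m M) = \sum_(j < n) v 0 j * L (row j M).
Proof.
move=> hL; have L0 : L 0 = 0.
  by have := hL (-1) 0 0; rewrite scaler0 addr0 mulN1r addNr.
have LD x y : L (x + y) = L x + L y by have := hL 1 x y; rewrite scale1r mul1r.
have LZ c x : L (c *: x) = c * L x by have := hL c x 0; rewrite addr0 L0 addr0.
rewrite mulmx_sum_row (big_morph L LD L0); apply: eq_bigr => j _; exact: LZ.
Qed.

(** Membership in [bergman] requires the value [0] outside the disc, so the test polynomials are cut
    off there. *)
Definition truncated (f : C -> C) z : C := if modulus z < 1 then f z else 0.

Lemma truncated_pseries f c : has_pseries f 0 1 c -> has_pseries (truncated f) 0 1 c.
Proof. by apply: eq_has_pseries => z; rewrite subr0 /truncated => ->. Qed.

Theorem singular_value_lower b : -1 < b -> exists (C1 : R) (c0 : nat), [/\ 0 < C1, (0 < c0)%N &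
  forall g (s : seq (nat * nat)) m (A : R), little_bloch g -> uniq s ->
  (forall p, p \in s -> dyadic_indices p) -> 0 < A ->
  (forall p, p \in s -> (A%:E <= dyadic_mean g p)%E) -> (0 < m)%N -> (c0 * m <= size s)%N ->
  ((A / C1)%:E <= singular_value b (integration_operator g) m ^+ 2)%E].
Proof.
move=> b1; have p0 : 0 < b + 1 by lra. have p2 : 0 < b + 2 by lra.
have k0 := @kappa_gt0 R.
have [K K0 hK] := @nbhd_sq_sum R; have [Ks Ks0 hKs] := sampling b1.
have [c1 c10 hc1] := test_point_exists b1.
have [G [grid hgrid]] := @grid_exists R.
have [c4 c4E c40] : exists2 c4 : R, c4 = 324 * kappa & 0 < c4.
  exists (324 * kappa); first by [].
  by apply: mulr_gt0 k0; rewrite ltr0n.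
have [C3 C3E C30] : exists2 C3 : R, C3 = carleson_cst b * c4 * K & 0 < C3.
  exists (carleson_cst b * c4 * K); first by [].
  by apply: mulr_gt0 K0; apply: mulr_gt0 c40; exact: carleson_cst_gt0.
pose c2 := c1 / ((b + 1) * Ks); have c20 : 0 < c2 by rewrite divr_gt0// mulr_gt0.
pose C2 := (b + 1)^-1; have C20 : 0 < C2 by rewrite invr_gt0.
have ratio0 : 0 <= 8 * (C2 * C3) / c2.
  exact: divr_ge0 (mulr_ge0 (ler0n _ 8) (mulr_ge0 (ltW C20) (ltW C30))) (ltW c20).
have := archimedean.Num.Theory.archi_boundP ratio0; set c0 := archimedean.Num.bound _ => hc0.
exists (4 * (b + 2) / c2), c0.+1; split=> //; first by rewrite divr_gt0// mulr_gt0.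
move=> g s m A hg us hs A0 hA m0 hm.
have [e he] := analytic_taylor hg.1.
have hidx p : p \in s -> box_index p by move=> /hs[].
(* A common bound for all the [2 ^ p.1], as the kernel estimates demand; it does not enter the
   constants. *)
pose N := (2 ^ \sum_(p <- s) p.1)%N.
have pN p : p \in s -> (2 ^ p.1 <= N)%N.
  by move=> ps; rewrite leq_exp2l// (bigD1_seq p ps us)/= leq_addr.
have /choice[a ha] : forall p, exists x : R, dyadic_mean g p = x%:E.
  by move=> p; have [x _ hx] := dyadic_mean_fin p hg; exists x.
have Aa p : p \in s -> A <= a p by move=> ps; rewrite -lee_fin -ha; exact: hA.
have a0 p : p \in s -> 0 < a p by move=> /Aa; exact: lt_le_trans.
have /choice[w hw] : forall p, exists w, p \in s ->
    (forall v, modulus (v - w) <= side p / 16 -> box_nbhd p v) /\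
    ((c1 * a p / box_scale b p)%:E <= box_mass b g (psum (kcoef b w) N) p)%E.
  move=> p; have [ps|ps] := boolP (p \in s); last by exists 0.
  have hAp : ((a p)%:E <= dyadic_mean g p)%E by rewrite ha.
  by have [v h1 h2] := hc1 g p N (a p) hg (pN p ps) (a0 p ps) hAp; exists v.
have bm_ge0 p (y : 'rV[C]_N) : (0 <= box_mass b g (psum (rcoef b y) N) p)%E.
  by apply: Rcint_ge0 => z; rewrite mulr_ge0 ?mass_ge0 ?indic_ge0.
have bm_le p (y : 'rV[C]_N) : p \in s -> (box_mass b g (psum (rcoef b y) N) p <=
    (carleson_cst b * (c4 * a p))%:E * nbhd_sq b (psum (rcoef b y) N) p)%E.
  move=> ps; have ca0 : 0 <= c4 * a p by apply: mulr_ge0 (ltW c40) (ltW (a0 p ps)).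
  have hm' : (dyadic_mean g p <= (a p)%:E)%E by rewrite ha.
  have h := bloch_measure_le (ltW (a0 p ps)) hm'; rewrite -c4E in h.
  apply: (box_mass_nbhd b1 he hgrid (k := 0) _ ca0); first by move=> i j.
  by rewrite expr0 mulr1.
pose bm p (y : 'rV[C]_N) : R := fine (box_mass b g (psum (rcoef b y) N) p).
have bmE p y : p \in s -> box_mass b g (psum (rcoef b y) N) p = (bm p y)%:E.
  move=> ps; have [i i0 ei] := nbhd_sq_fin (rcoef b y) N p b1.
  have := bm_le p y ps; rewrite ei /bm -EFinM; have := bm_ge0 p y.
  by case: (box_mass _ _ _ _).
(* Each box is divided by its own mean [a p], so that [q] is bounded by a multiple of [sqn] although
   the means may far exceed [A]. Since [A <= a p], [A * q y] is still at most the full integral. *)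
pose q (y : 'rV[C]_N) := \sum_(p <- s) (a p)^-1 * bm p y.
have mm p (y : 'rV[C]_N) := cmeasR_box_mass b (rcoef b y) N p he.
have mp0 p (y : 'rV[C]_N) z : 0 <= modulus (psum (rcoef b y) N z) ^+ 2 * (bloch_sq g z * wt b z) * \1_(dyadic_box p) z.
  by rewrite mulr_ge0 ?mass_ge0 ?indic_ge0.
have q_add x y : q (x + y) <= 2 * q x + 2 * q y.
  rewrite /q !mulr_sumr -big_split/= !big_seq; apply: ler_sum => p ps.
  rewrite (mulrCA 2 _ (bm p x)) (mulrCA 2 _ (bm p y)) -mulrDr ler_wpM2l ?invr_ge0 ?(ltW (a0 p ps))//.
  rewrite -lee_fin EFinD (EFinM 2 (bm p x)) (EFinM 2 (bm p y)) -!bmE//.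
  have two : 0 <= 2 :> R by [].
  rewrite /box_mass -(RcintZ two (mm p x) (mp0 p x)) -(RcintZ two (mm p y) (mp0 p y)).
  rewrite -RcintD.
  - apply: Rcint_le => //; first by apply: cmeasRD; apply: cmeasRM => //; exact: cmeasR_cst.
    move=> z; move: (bloch_sq g z * wt b z) (bloch_wt_ge0 b g z) (\1_(dyadic_box p) z) (indic_ge0 (R := R) (dyadic_box p) z) => d d0 ii ii0.
    have -> : psum (rcoef b (x + y)) N z = psum (rcoef b x) N z + psum (rcoef b y) N z.
      by have := psum_rcoef_lin b 1 x y z; rewrite scale1r mul1r.
    have := ler_wpM2r (mulr_ge0 d0 ii0) (sqr_modulus_add (psum (rcoef b x) N z) (psum (rcoef b y) N z)).
    by congr (_ <= _); ring.
  - by apply: cmeasRM => //; exact: cmeasR_cst.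
  - by apply: cmeasRM => //; exact: cmeasR_cst.
  - by move=> z; rewrite mulr_ge0.
  - by move=> z; rewrite mulr_ge0.
have q_le y : q y <= C3 * sqn y.
  rewrite -lee_fin (EFinM C3) -(sqnorm_rcoef b1) C3E (EFinM _ K) -muleA.
  have cc0 : 0 <= carleson_cst b * c4 by apply: mulr_ge0 (ltW c40); exact/ltW/carleson_cst_gt0.
  apply: le_trans (lee_wpmul2l _ (hK b (rcoef b y) N s us hidx)); last by rewrite lee_fin.
  rewrite ge0_sume_distrr; last by move=> p _; exact: nbhd_sq_ge0.
  rewrite /q -sumEFin !big_seq; apply: lee_sum => p ps.
  have [i i0 ei] := nbhd_sq_fin (rcoef b y) N p b1.
  have := bm_le p y ps; rewrite bmE// ei -!EFinM !lee_fin => h.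
  by rewrite ler_pdivrMl ?a0//; apply: le_trans h _; rewrite le_eqVlt; apply/orP; left; apply/eqP; ring.
(* Normalizes the kernels so that combinations with [sqn v <= 1] satisfy [sqn y <= 1 / (b + 1)],
   that is, have Bergman norm at most [1]. *)
pose t : R := Num.sqrt (((b + 1) * Ks)^-1).
have t2 : t ^+ 2 = ((b + 1) * Ks)^-1 by rewrite sqr_sqrtr// invr_ge0 mulr_ge0 ?ltW.
pose tau p : R := t * Num.sqrt (box_scale b p).
have tau0 p : 0 <= tau p by rewrite mulr_ge0 ?sqrtr_ge0.
have tau2 p : tau p ^+ 2 = t ^+ 2 * box_scale b p.
  by rewrite exprMn (sqr_sqrtr (ltW (box_scale_gt0 b p))).
pose f p : 'rV[C]_N := (tau p)%:C *: kernel_row b N (w p).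
pose n := size s; pose pt (j : 'I_n) := nth (0, 0)%N s j.
have pts j : pt j \in s by exact: mem_nth.
pose M : 'M[C]_(n, N) := \matrix_(j, i) f (pt j) 0 i.
have rowM j : row j M = f (pt j) by apply/rowP => i; rewrite !mxE.
have sumpt (F : nat * nat -> R) : \sum_(j < n) F (pt j) = \sum_(p <- s) F p.
  by rewrite [RHS](big_nth (0, 0)%N) big_mkord.
have q_row j : c2 <= q (row j M).
  rewrite rowM; have ps := pts j; move: (pt j) ps => p ps.
  rewrite /q (bigD1_seq p ps us)/= ler_wpDr//.
    rewrite big_seq_cond; apply: sumr_ge0 => r /andP[rs _].
    by rewrite mulr_ge0 ?fine_ge0 ?bm_ge0// invr_ge0 ltW// a0.
  have bmf : bm p (f p) = tau p ^+ 2 * bm p (kernel_row b N (w p)).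
    apply: EFin_inj; rewrite EFinM -!bmE// /box_mass -(RcintZ (sqr_ge0 _) (mm p _) (mp0 p _)).
    apply: eq_Rcint => z; have := psum_rcoef_lin b (tau p)%:C (kernel_row b N (w p)) 0 z.
    rewrite addr0 -/(f p) => ->.
    have -> : psum (rcoef b (0 : 'rV[C]_N)) N z = 0.
      by rewrite /psum big1// => i _; rewrite rcoef_ord mxE mul0r mul0r.
    by rewrite addr0 modulusM modulusR (ger0_norm (tau0 p)) exprMn !mulrA.
  have [_ h] := hw p ps; rewrite -(psum_kernel_row N (w p) b1) bmE// lee_fin in h.
  have B0 := box_scale_gt0 b p.
  rewrite bmf tau2 t2 ler_pdivlMl ?a0// /c2.
  have := ler_wpM2l (ltac:(by rewrite mulr_ge0 ?(ltW B0)// invr_ge0 mulr_ge0 ?ltW) : 0 <= ((b + 1) * Ks)^-1 * box_scale b p) h.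
  apply: le_trans; rewrite le_eqVlt; apply/orP; left; apply/eqP.
  by move: (box_scale b p) B0 => B B0; field; rewrite !gt_eqF.
(* Duality: up to conjugation, [sqn y] is the sum of the [v 0 j] against the scaled values of [y] at
   the sample points. Cauchy-Schwarz and [sampling] bound its square by [C2 * sqn v * sqn y]. *)
have bessel v : sqn (v *m M) <= C2 * sqn v.
  set y := v *m M.
  have [y0|yn] := eqVneq (sqn y) 0; first by rewrite y0 mulr_ge0 ?sqn_ge0 ?(ltW C20).
  have yp : 0 < sqn y by rewrite lt0r yn sqn_ge0.
  have E j : modulus ((M *m adj y) j 0) = tau (pt j) * modulus (psum (rcoef b y) N (w (pt j))).
    have -> : (M *m adj y) j 0 = (row j M *m adj y) 0 0 by rewrite -row_mul [RHS]mxE.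
    rewrite rowM /f -scalemxAl mxE kernel_row_reproducing modulusM modulusR modulusJ.
    by rewrite ger0_norm.
  have h1 : sqn y <= \sum_(j < n) modulus (v 0 j) * (tau (pt j) * modulus (psum (rcoef b y) N (w (pt j)))).
    have -> : sqn y = modulus ((y *m adj y) 0 0) by rewrite mulmx_adj modulusR ger0_norm ?sqn_ge0.
    rewrite {1}/y -mulmxA mxE; apply: le_trans (modulus_sum _ _ _) _.
    by apply: ler_sum => j _; rewrite modulusM E.
  have h2 : \sum_(j < n) (tau (pt j) * modulus (psum (rcoef b y) N (w (pt j)))) ^+ 2 <= C2 * sqn y.
    rewrite (sumpt (fun p => (tau p * modulus (psum (rcoef b y) N (w p))) ^+ 2)).
    rewrite (eq_bigr (fun p => t ^+ 2 * (box_scale b p * modulus (psum (rcoef b y) N (w p)) ^+ 2))); last first.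
      by move=> p _; rewrite exprMn tau2 mulrA.
    rewrite -mulr_sumr t2; have t20 : 0 <= ((b + 1) * Ks)^-1 by rewrite invr_ge0 mulr_ge0 ?ltW.
    apply: le_trans (ler_wpM2l t20 (hKs s w N y us hidx (fun p ps => (hw p ps).1))) _.
    rewrite le_eqVlt; apply/orP; left; apply/eqP; rewrite /C2.
    by move: (sqn y) => Y; field; rewrite !gt_eqF.
  have h3 : sqn y ^+ 2 <= sqn v * (C2 * sqn y).
    apply: (@le_trans _ _ ((\sum_(j < n) modulus (v 0 j) * (tau (pt j) * modulus (psum (rcoef b y) N (w (pt j))))) ^+ 2)).
      by apply: lerXn2r; rewrite ?nnegrE ?sqn_ge0//; apply: le_trans h1; exact: sqn_ge0.
    apply: le_trans (cauchy_schwarz _ _ _ _) _.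
    by rewrite ler_wpM2l ?sqn_ge0.
  by rewrite -(ler_pM2r yp) -expr2 [C2 * sqn v]mulrC -mulrA.
have X0 : 0 <= A / (4 * (b + 2) / c2).
  by rewrite divr_ge0 ?(ltW A0)// divr_ge0 ?(ltW c20)// mulr_ge0// ltW.
have -> : (A / (4 * (b + 2) / c2))%:E = ((Num.sqrt (A / (4 * (b + 2) / c2)))%:E ^+ 2)%E.
  by rewrite -EFin_expe sqr_sqrtr.
rewrite lee_sqr ?singular_value_ge0// ?lee_fin ?sqrtr_ge0//.
apply: le_ereal_inf_tmp => _ [S [hS [k km [eS [_ _ heS]]]] <-].
pose F (y : 'rV[C]_N) := truncated (psum (rcoef b y) N).
have Fp (y : 'rV[C]_N) : has_pseries (F y) 0 1 (fun n => if (n < N)%N then rcoef b y n else 0).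
  exact: truncated_pseries (psum_rcoef_pseries b y).
have Fsq y : sqnorm b (F y) = (sqn y)%:E.
  by rewrite -(sqnorm_rcoef b1); apply: eq_sqnorm => z z1; rewrite /F /truncated z1.
have Fb y : bergman b (F y).
  split; first exact: has_pseries_analytic (Fp y).
  - by rewrite bergman_norm_lty// Fsq ltry.
  - by move=> z /negP z1; rewrite /F /truncated; case: ifP => // h; move: z1; rewrite /disc/= h.
have Flin (c : C) x y : F (c *: x + y) = (fun z => c * F x z + F y z).
  apply/funext => z; rewrite /F /truncated; case: ifP => _; first exact: psum_rcoef_lin.
  by rewrite mulr0 addr0.
have Slin z (c : C) x y : S (F (c *: x + y)) z = c * S (F x) z + S (F y) z.
  by case: hS => _ lin _; rewrite Flin lin.
have /choice[cc hcc] : forall j, exists c : 'I_k -> C, forall z, S (F (row j M)) z = \sum_(l < k) c l * eS l z.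
  by move=> j; exact: heS.
(* Orthogonality to these [k] vectors makes the coefficients of [S (F y)] with respect to [eS]
   vanish, so that [S] kills the test function. *)
pose u (l : nat) : 'rV[C]_n := \row_j conjc (if insub l is Some i then cc j i else 0).
have n_gt0 : (0 < n)%N by apply: leq_trans hm; rewrite muln_gt0.
have hk : 8 * (C2 * C3) * k%:R <= c2 * n%:R.
  have kn : (c0.+1 * k <= n)%N by apply: leq_trans hm; rewrite leq_mul2l (ltnW km) orbT.
  have kn' : c0%:R * k%:R <= n%:R :> R by rewrite -natrM ler_nat (leq_trans _ kn)// leq_mul2r leqnSn orbT.
  move: hc0; rewrite ltr_pdivrMr// => hc0.
  have h1 := ler_wpM2r (ler0n R k) (ltW hc0).
  have h2 := ler_wpM2l (ltW c20) kn'.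
  by apply: le_trans h1 _; move: h2; rewrite mulrA (mulrC c2).
have [v [v1 vu vq]] := @large_on_complement R n N k M q u C2 C3 c2 n_gt0 (ltW C30) c20 q_add q_le bessel q_row hk.
set y := v *m M in vq.
have SF0 z : S (F y) z = 0.
  rewrite /y (linear_sum v M (Slin z)).
  under eq_bigr do rewrite hcc mulr_sumr.
  rewrite exchange_big/= big1// => l _.
  have /(congr1 (fun B : 'M[C]_1 => B 0 0)) := vu l (ltn_ord l); rewrite !mxE => h.
  transitivity ((\sum_(j < n) v 0 j * cc j l) * eS l z).
    by rewrite mulr_suml; apply: eq_bigr => j _; rewrite mulrA.
  rewrite [X in X * _](_ : _ = 0) ?mul0r// -[RHS]h; apply: eq_bigr => j _.
  by rewrite !mxE valK conjcK.
have yC2 : sqn y <= C2.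
  by apply: le_trans (bessel v) _; rewrite ler_piMr// ltW.
apply: (@le_trans _ _ (bergman_norm b (fun z => integration_operator g (F y) z - S (F y) z))); last first.
  apply: ereal_sup_ubound; exists (F y) => //; split=> //.
  rewrite -[1%E]/(1%:E) -[X in (_ <= X%:E)%E]sqrtr1 (bergman_norm_leE _ b1 ler01) Fsq -EFinM lee_fin.
  by rewrite mulrC -(ler_pdivlMr _ _ p0) div1r.
rewrite bergman_normE -[(Num.sqrt _)%:E]/(sqrte (A / (4 * (b + 2) / c2))%:E) lee_sqrt; last first.
  by rewrite mule_ge0 ?sqnorm_ge0// lee_fin ltW.
have -> : sqnorm b (fun z => integration_operator g (F y) z - S (F y) z) = sqnorm b (integration_operator g (F y)).
  by apply: eq_sqnorm => z _; rewrite SF0 subr0.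
have := integration_operator_ge b1 he (Fp y); rewrite sqnorm_mul_derive//.
have mass_lower : ((A * q y)%:E <= Rcint (fun z => modulus (F y z) ^+ 2 * bloch_sq g z * wt b z)%R)%E.
  apply: (@le_trans _ _ (\sum_(p <- s) box_mass b g (psum (rcoef b y) N) p)%E).
    rewrite /q mulr_sumr -sumEFin !big_seq; apply: lee_sum => p ps.
    rewrite bmE// lee_fin mulrA ler_piMl//; first by rewrite fine_ge0.
    by rewrite ler_pdivrMr ?a0// mul1r Aa.
  rewrite /box_mass -(Rcint_sum _ (fun p => mm p y) (fun p => mp0 p y)).
  apply: Rcint_le.
  - by apply: cmeasR_sum => p; exact: mm.
  - by apply: eq_cmeasR (cmeasR_mass b1 he (Fp y)) => z; rewrite mulrA.
  - by move=> z; apply: sumr_ge0.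
  move=> z; rewrite -mulr_sumr.
  have [z1|z1] := ltP (modulus z) 1; last by rewrite /wt discE ltNge z1 !mulr0 mul0r.
  rewrite /F /truncated z1 -[modulus _ ^+ 2 * bloch_sq g z * wt b z]mulrA ler_piMr ?mass_ge0//.
  exact: dyadic_boxes_le1.
move=> /(le_trans mass_lower); have := sqnorm_ge0 b (integration_operator g (F y)).
case: (sqnorm b (integration_operator g (F y))) => [r| |]//; last first.
  by move=> _ _; rewrite gt0_muley ?leey// lte_fin.
rewrite -!EFinM !lee_fin => r0 hr.
have h5 := ler_wpM2l (ltW A0) vq.
have h6 := le_trans h5 hr.
rewrite invf_div mulrA ler_pdivrMr; last by rewrite mulr_gt0.
move: h6 p0 p2; clear; move=> h6 p0 p2; rewrite -(ler_pM2r (ltac:(lra) : 0 < 4^-1 :> R)).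
have -> : (b + 1) * r * (4 * (b + 2)) / 4 = (b + 1) * (b + 2) * r by field.
by apply: le_trans h6; rewrite -(mulrA A c2).
Qed.

End SingularValueLower.

(** * Comparison with a doubling sequence *)

Section Counting.

(** Halving: for [j <= N / 2] the logarithm drops by one when [N] is replaced by [N / 2], and each
    of the other [j] contributes [1]. So passing from [N / 2] to [N] adds at most [N]. Orders
    logarithmic in [N / j] thus have linear total cost. *)
Lemma sum_log_le N : (\sum_(1 <= j < N.+1) (trunc_log 2 (N %/ j)).+1 <= 2 * N)%N.
Proof.
elim/ltn_ind: N => N IH; have [->|N0] := posnP N; first by rewrite big_geq.
have hN : (N %/ 2 < N)%N by rewrite ltn_Pdiv.
have split_at : ((N %/ 2).+1 <= N.+1)%N by rewrite ltnS leq_div.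
rewrite (@big_cat_nat _ _ _ (N %/ 2).+1 1 N.+1)//=.
have h1 : (\sum_(1 <= j < (N %/ 2).+1) (trunc_log 2 (N %/ j)).+1 <= N %/ 2 + 2 * (N %/ 2))%N.
  apply: leq_trans (leq_add (leqnn (N %/ 2)) (IH _ hN)).
  have e : (N %/ 2 = \sum_(1 <= j < (N %/ 2).+1) 1)%N by rewrite sum_nat_const_nat subn1 muln1.
  rewrite {2}e -big_split/= !big_nat; apply: leq_sum => j /andP[j1 j2].
  have j0 : (0 < j)%N by [].
  have jN : (2 <= N %/ j)%N by rewrite leq_divRL// mulnC -leq_divRL.
  by rewrite trunc_log2S// add1n -divn2 -!divnMA [(j * 2)%N]mulnC.
have h2 : (\sum_((N %/ 2).+1 <= j < N.+1) (trunc_log 2 (N %/ j)).+1 <= N - N %/ 2)%N.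
  apply: (@leq_trans (\sum_((N %/ 2).+1 <= j < N.+1) 1)%N); last by rewrite sum_nat_const_nat muln1 subSS.
  rewrite !big_nat; apply: leq_sum => j /andP[j1 j2].
  have : (N %/ j < 2)%N by rewrite ltn_divLR ?(leq_trans _ j1)// mulnC -ltn_divLR.
  by case: (N %/ j)%N => [|[|x]].
apply: leq_trans (leq_add h1 h2) _.
have := leq_divM N 2; lia.
Qed.

(** Serves to let the orders grow linearly in [u] while the index of the singular value stays below
    [2^u N]. The witness rests on [2^(2w) >= (w + 1)^2]. *)
Lemma linear_lt_exp2 (a b : nat) : exists u, (a + b * u <= 2 ^ u)%N.
Proof.
exists (2 * (a + 2 * b))%N; set w := (a + 2 * b)%N.
rewrite [(2 * w)%N]mulnC expnM; apply: (@leq_trans (w.+1 ^ 2)%N); last first.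
  by rewrite leq_exp2r// ltn_expl.
rewrite /w; nia.
Qed.

End Counting.

Section Doubling.
Context {R : realType} (eta : nat -> R) (q : nat).
Hypotheses (eta_noninc : forall m n, (1 <= m <= n)%N -> eta n <= eta m)
  (eta_double : forall n, (1 <= n)%N -> eta n <= 2 ^+ q * eta (2 * n)%N).

Lemma eta_pow2 u n : (1 <= n)%N -> eta n <= 2 ^+ (q * u) * eta (2 ^ u * n)%N.
Proof.
move=> n1; elim: u => [|u IH]; first by rewrite muln0 expr0 !mul1r mul1n.
apply: le_trans IH _; rewrite mulnS exprD expnS -mulnA [2 ^+ q * _]mulrC -mulrA.
rewrite ler_wpM2l ?exprn_ge0//; apply: eta_double.
by rewrite muln_gt0 expn_gt0.
Qed.

Lemma eta_le_pow2 u n m : (1 <= n)%N -> (1 <= m)%N -> (m <= 2 ^ u * n)%N ->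
  eta n <= 2 ^+ (q * u) * eta m.
Proof.
move=> n1 m1 mn; apply: le_trans (eta_pow2 u n1) _.
by rewrite ler_wpM2l ?exprn_ge0// eta_noninc// m1.
Qed.

End Doubling.

Section Comparison.
Context {R : realType}.
Local Notation C := R[i].

Lemma singular_value_nonincreasing b (T : (C -> C) -> C -> C) m n : (m <= n)%N ->
  (singular_value b T n <= singular_value b T m)%E.
Proof.
move=> mn; apply: ereal_inf_le_tmp => _ [S [hS [k km hk]] <-].
by exists S => //; split=> //; exists k => //; exact: leq_trans km mn.
Qed.

Lemma singular_value_sqr_nonincreasing b (T : (C -> C) -> C -> C) m n : -1 < b -> (m <= n)%N ->
  (singular_value b T n ^+ 2 <= singular_value b T m ^+ 2)%E.
Proof. by move=> b1 mn; rewrite lee_sqr ?singular_value_ge0// singular_value_nonincreasing. Qed.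

Section Enumeration.
Variables (g : C -> C) (e : nat -> nat * nat).
Hypothesis e_bij : set_bij [set n | (1 <= n)%N] dyadic_indices e.

Definition first_boxes N := [seq e j | j <- iota 1 N].

Lemma first_boxes_uniq N : uniq (first_boxes N).
Proof.
rewrite map_inj_in_uniq ?iota_uniq// => i j; rewrite !mem_iota => /andP[i1 _] /andP[j1 _].
by case: e_bij => _ inj _; apply: inj; apply/mem_set.
Qed.

Lemma first_boxes_dyadic N p : p \in first_boxes N -> dyadic_indices p.
Proof.
move=> /mapP[j]; rewrite mem_iota => /andP[j1 _] ->.
by case: e_bij => im _ _; apply: im.
Qed.

Lemma dyadic_enum p : dyadic_indices p -> exists2 j, (1 <= j)%N & p = e j.
Proof. by case: e_bij => _ _ sur /sur[j j1 <-]; exists j. Qed.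

Lemma mem_first_boxes N j : (1 <= j)%N -> (e j \in first_boxes N) = (j <= N)%N.
Proof.
move=> j1; apply/mapP/idP => [[i ]|jN]; last by exists j => //; rewrite mem_iota j1 add1n ltnS.
rewrite mem_iota add1n ltnS => /andP[i1 iN] eij; suff -> : j = i by [].
by case: e_bij => _ inj _; apply: inj => //; apply/mem_set.
Qed.

(** Turns orders indexed by the rank in the enumeration into orders indexed by boxes; ranks start at
    [1], hence the successor of [index]. *)
Definition order_of N (k : nat -> nat) p :=
  if p \in first_boxes N then k (index p (first_boxes N)).+1 else 0%N.

Lemma order_ofE N k j : (1 <= j <= N)%N -> order_of N k (e j) = k j.
Proof.
move=> /andP[j1 jN]; rewrite /order_of mem_first_boxes// jN; congr (k _).
have h : e j = nth (0, 0)%N (first_boxes N) j.-1.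
  rewrite (nth_map 0%N) ?size_iota ?prednK// nth_iota ?prednK//.
  by rewrite add1n prednK.
by rewrite h index_uniq ?first_boxes_uniq// ?size_map ?size_iota ?prednK.
Qed.

Lemma order_of_out N k p : p \notin first_boxes N -> order_of N k p = 0%N.
Proof. by rewrite /order_of => /negbTE->. Qed.

Lemma order_of_sum N k : (\sum_(p <- first_boxes N) order_of N k p = \sum_(1 <= j < N.+1) k j)%N.
Proof.
rewrite big_map /index_iota subSS subn0 !big_seq; apply: eq_bigr => j.
by rewrite mem_iota add1n ltnS => h; exact: order_ofE.
Qed.

End Enumeration.
End Comparison.

Lemma le_double_of_half {R : realFieldType} (x y z : R) : z <= x + y -> 2 * x <= z -> z <= 2 * y.
Proof. lra. Qed.

(** * Comparison of abstract sequences linked by the upper and lower bounds *)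

Section Transfer.
Context {R : realType} (eta x : nat -> R) (S : nat -> \bar R) (q M c0 : nat) (C0 C1 : R).
Hypotheses (eta_gt0 : forall n, (1 <= n)%N -> 0 < eta n)
  (eta_noninc : forall m n, (1 <= m <= n)%N -> eta n <= eta m)
  (eta_double : forall n, (1 <= n)%N -> eta n <= 2 ^+ q * eta (2 * n)%N)
  (x_noninc : forall m n, (1 <= m <= n)%N -> x n <= x m)
  (x_ge0 : forall n, (1 <= n)%N -> 0 <= x n)
  (S_noninc : forall m n, (m <= n)%N -> (S n <= S m)%E)
  (C0_gt0 : 0 < C0) (C1_gt0 : 0 < C1) (c0_gt0 : (0 < c0)%N)
  (S_upper : forall N (k : nat -> nat) B, 0 < B ->
    (forall j, (1 <= j <= N)%N -> x j <= B * 2 ^+ k j) ->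
    (forall j, (N < j)%N -> x j <= B) ->
    (S (1 + M * \sum_(1 <= j < N.+1) k j)%N <= (C0 * B)%:E)%E)
  (S_lower : forall m, (1 <= m)%N -> 0 < x (c0 * m)%N -> ((x (c0 * m)%N / C1)%:E <= S m)%E).

Let pow2_gt0 k : 0 < 2 ^+ k :> R. Proof. by rewrite exprn_gt0. Qed.

(* The orders [q * (log2 (N / j) + 1) + t] reduce [x j] to the size of [eta N / 2 ^ t]
   for [j <= N], at a total cost linear in [N]. *)
Lemma upper_shift D t N : 0 < D -> (forall j, (1 <= j)%N -> x j <= D * eta j) -> (1 <= N)%N ->
  (S (1 + M * ((2 * q + t) * N))%N <= (C0 * (D / 2 ^+ t * eta N + x N))%:E)%E.
Proof.
move=> D0 hD N1; pose k j := (q * (trunc_log 2 (N %/ j)).+1 + t)%N.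
have hk : (1 + M * \sum_(1 <= j < N.+1) k j <= 1 + M * ((2 * q + t) * N))%N.
  rewrite leq_add2l leq_mul2l; apply/orP; right.
  rewrite big_split/= -big_distrr/= sum_nat_const_nat subn1/= mulnDl [(t * N)%N]mulnC leq_add2r.
  by rewrite [(2 * q)%N]mulnC -mulnA leq_mul2l sum_log_le orbT.
apply: le_trans (S_noninc hk) _.
have eN := eta_gt0 N1; have xN := x_ge0 N1.
have A0 : 0 < D / 2 ^+ t * eta N by rewrite mulr_gt0// divr_gt0.
apply: S_upper; first by rewrite ltr_wpDr.
- move=> j /andP[j1 jN]; rewrite mulrDl.
  have h : eta j <= 2 ^+ (q * (trunc_log 2 (N %/ j)).+1) * eta N.
    apply: (eta_le_pow2 eta_noninc eta_double) => //.
    by apply: ltnW; rewrite -ltn_divLR// trunc_log_ltn.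
  apply: le_trans (hD _ j1) _; rewrite ler_wpDr//.
    by apply: mulr_ge0 => //; exact: ltW.
  rewrite /k exprD; apply: (@le_trans _ _ (D * (2 ^+ (q * (trunc_log 2 (N %/ j)).+1) * eta N))).
    by rewrite ler_wpM2l// ltW.
  rewrite le_eqVlt; apply/orP; left; apply/eqP.
  have := lt0r_neq0 (pow2_gt0 t); move: (2 ^+ (q * _)) (2 ^+ t) => Q P P0.
  by field.
- move=> j jN; apply: (@le_trans _ _ (x N)); first by rewrite x_noninc// N1 ltnW.
  by rewrite ler_wpDl// ltW.
Qed.

Lemma asymp_of_means c d : 0 < c -> 0 < d ->
  (forall j, (1 <= j)%N -> c * eta j <= x j <= d * eta j) ->
  asymp S (fun n => (eta n)%:E).
Proof.
move=> c_gt0 d_gt0 hx; pose P := (1 + M * (2 * q + 0))%N.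
have hd j : (1 <= j)%N -> x j <= d * eta j by move=> /hx/andP[].
have P_gt0 : (0 < P)%N by [].
have PP : (P <= 2 ^ P)%N by rewrite ltnW// ltn_expl.
exists (c / (C1 * 2 ^+ (q * c0))), ((C0 * (d + d)) * 2 ^+ (q * P.+1)); split.
- by rewrite divr_gt0// mulr_gt0.
- by rewrite mulr_gt0// mulr_gt0// addr_gt0.
move=> n n1; split.
  have cn : (1 <= c0 * n)%N by rewrite muln_gt0 c0_gt0.
  have en : 0 < eta (c0 * n)%N := eta_gt0 cn.
  have /andP[xn _] := hx _ cn.
  have x_gt0 : 0 < x (c0 * n)%N by apply: lt_le_trans xn; rewrite mulr_gt0.
  apply: le_trans (S_lower n1 x_gt0); rewrite -EFinM lee_fin.
  have h : eta n <= 2 ^+ (q * c0) * eta (c0 * n)%N.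
    apply: (eta_le_pow2 eta_noninc eta_double) => //.
    by rewrite leq_mul2r ltnW ?orbT// ltn_expl.
  rewrite ler_pdivlMr// -mulrA mulrAC ler_pdivrMr ?mulr_gt0// mulrA.
  apply: (@le_trans _ _ (c * (2 ^+ (q * c0) * eta (c0 * n)%N) * C1)).
    by rewrite (ler_wpM2r (ltW C1_gt0))// (ler_wpM2l (ltW c_gt0)).
  rewrite [C1 * _]mulrC [x _ * _]mulrA ler_wpM2r ?(ltW C1_gt0)//.
  by rewrite mulrCA [leLHS]mulrC ler_wpM2r// ltW.
rewrite -EFinM; have [nP|Pn] := ltnP n P.
  (* For these finitely many [n] the quotient of [n] by [P] is [0]. They are compared with [S 1],
     which is bounded without any vanishing condition. *)
  apply: le_trans (S_noninc n1) _.
  have := @S_upper 0 (fun=> 0%N) (d * eta 1%N) (mulr_gt0 d_gt0 (eta_gt0 (leqnn 1))).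
  rewrite big_geq// muln0 addn0 => /(_ _ _)/le_trans; apply.
  - by move=> j /andP[j1 j0]; have := leq_trans j1 j0.
  - move=> j j1; apply: le_trans (hd _ j1) _.
    by rewrite ler_wpM2l ?(ltW d_gt0)// eta_noninc.
  rewrite lee_fin.
  have h : eta 1%N <= 2 ^+ (q * P.+1) * eta n.
    apply: (eta_le_pow2 eta_noninc eta_double) => //.
    by rewrite muln1 (leq_trans (ltnW nP))// (leq_trans PP)// leq_exp2l.
  apply: (@le_trans _ _ (C0 * (d * (2 ^+ (q * P.+1) * eta n)))).
    by rewrite (ler_wpM2l (ltW C0_gt0))// (ler_wpM2l (ltW d_gt0)).
  rewrite -!mulrA ler_wpM2l ?(ltW C0_gt0)// ler_wpM2r//.
    by rewrite mulr_ge0// ltW// eta_gt0.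
  by rewrite ler_wpDr// ltW.
(* Without extra order the index is [1 + 2 q M N <= P N <= n]. As [n < P (N + 1) <= 2^(P+1) N],
   passing from [eta N] to [eta n] costs only a constant. *)
pose N := (n %/ P)%N; have N1 : (1 <= N)%N by rewrite divn_gt0.
have Nn : (1 + M * ((2 * q + 0) * N) <= n)%N.
  by apply: leq_trans (leq_divM n P); rewrite -/N /P mulnDr muln1 leq_add// mulnA mulnC.
apply: le_trans (S_noninc Nn) _; apply: le_trans (upper_shift 0 d_gt0 hd N1) _.
rewrite lee_fin expr0 divr1.
have h : eta N <= 2 ^+ (q * P.+1) * eta n.
  apply: (eta_le_pow2 eta_noninc eta_double) => //.
  apply: ltnW; apply: (leq_trans (ltn_ceil n P_gt0)); rewrite -/N expnS.
  by have := leq_mul2r N.*2 P (2 ^ P); rewrite PP orbT => hh; nia.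
rewrite -!mulrA ler_wpM2l ?(ltW C0_gt0)//.
apply: (@le_trans _ _ ((d + d) * eta N)); first by rewrite mulrDl lerD2l hd.
by rewrite ler_wpM2l// addr_ge0// ltW.
Qed.

Lemma asymp_means c d : 0 < c -> 0 < d ->
  (forall n, (1 <= n)%N -> ((c * eta n)%:E <= S n)%E /\ (S n <= (d * eta n)%:E)%E) ->
  asymp (fun n => (x n)%:E) (fun n => (eta n)%:E).
Proof.
move=> c_gt0 d_gt0 hS.
(* The first summand bounds [x n] for [n >= c0], through [S_lower] at the quotient of [n] by [c0];
   the second takes care of [n < c0]. *)
pose D := C1 * d * 2 ^+ (q * c0.+1) + x 1 / eta c0.
have ec0 : 0 < eta c0 := eta_gt0 c0_gt0.
have E_gt0 : 0 < C1 * d * 2 ^+ (q * c0.+1) by rewrite !mulr_gt0.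
have F_ge0 : 0 <= x 1 / eta c0 by rewrite divr_ge0 ?x_ge0// ltW.
have D_gt0 : 0 < D by rewrite ltr_wpDr.
have hD n : (1 <= n)%N -> x n <= D * eta n.
  move=> n1; have en := eta_gt0 n1; rewrite mulrDl; have [nc|cn] := ltnP n c0.
    rewrite ler_wpDl//; first by rewrite mulr_ge0// ltW.
    apply: (@le_trans _ _ (x 1)); first exact: x_noninc.
    rewrite mulrAC ler_pdivlMr// ler_wpM2l ?x_ge0// eta_noninc//.
    by rewrite n1 ltnW.
  rewrite ler_wpDr//; first by rewrite mulr_ge0// ltW.
  pose m := (n %/ c0)%N; have m1 : (1 <= m)%N by rewrite divn_gt0.
  have cm : (c0 * m <= n)%N by rewrite mulnC leq_divM.
  apply: (@le_trans _ _ (x (c0 * m)%N)).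
    by apply: x_noninc; rewrite muln_gt0 c0_gt0 m1.
  have [x0|x0] := leP (x (c0 * m)%N) 0.
    by apply: le_trans x0 _; rewrite mulr_ge0// ltW.
  have := le_trans (S_lower m1 x0) (hS _ m1).2; rewrite lee_fin ler_pdivrMr// => h.
  apply: le_trans h _; rewrite mulrC -!mulrA ler_wpM2l ?(ltW C1_gt0)// ler_wpM2l ?(ltW d_gt0)//.
  apply: (eta_le_pow2 eta_noninc eta_double) => //.
  apply: ltnW; apply: (leq_trans (ltn_ceil n c0_gt0)); rewrite -/m expnS.
  by have := ltn_expl c0 (isT : (1 < 2)%N) => hh; nia.
have [t0 ht0] : exists t0, 2 * C0 * D / c <= 2 ^+ t0.
  exists (Num.truncn (2 * C0 * D / c)).+1; apply: ltW.
  apply: lt_le_trans (truncnS_gt _) _; rewrite -natrX ler_nat.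
  by rewrite ltnW// ltn_expl.
(* With [t = q u + t0] the index is at most [2^u N], where [eta] has lost at most the factor
   [G = 2^(q u)]. The same factor is gained in [2^t = G 2^t0], and [t0] is such that the [eta N]
   term then accounts for at most half of [c * eta N]; the other half must come from [x N]. *)
have [u hu] := linear_lt_exp2 (1 + M * (2 * q + t0))%N (M * q).
pose G : R := 2 ^+ (q * u); have G0 : 0 < G := pow2_gt0 _.
exists (c / (2 * C0 * G)), D; split=> //; first by rewrite divr_gt0// !mulr_gt0.
move=> N N1; split; rewrite -EFinM lee_fin; last exact: hD.
pose t := (q * u + t0)%N; have eN := eta_gt0 N1.
pose n := (1 + M * ((2 * q + t) * N))%N.
have n1 : (1 <= n)%N by [].
have hn : (n <= 2 ^ u * N)%N.
  by apply: (@leq_trans ((1 + M * (2 * q + t0) + M * q * u) * N)%N);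
    [rewrite /n /t; nia | rewrite leq_mul2r hu orbT].
have h1 : eta N <= G * eta n by apply: (eta_le_pow2 eta_noninc eta_double).
have := le_trans (hS _ n1).1 (upper_shift t D_gt0 hD N1); rewrite lee_fin /t exprD -/G => h2.
have h3 : D / (G * 2 ^+ t0) * (2 * C0 * G) <= c.
  have P0 := pow2_gt0 t0; rewrite mulrAC ler_pdivrMr ?mulr_gt0//.
  move: ht0; rewrite ler_pdivrMr// => h; have := ler_wpM2l (ltW G0) h.
  by congr (_ <= _); ring.
rewrite mulrAC ler_pdivrMr ?mulr_gt0//.
have h4 : c * eta N <= G * (C0 * (D / (G * 2 ^+ t0) * eta N + x N)).
  apply: (@le_trans _ _ (c * (G * eta n))); first by rewrite ler_wpM2l// ltW.
  by rewrite mulrCA ler_wpM2l// ltW.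
have := ler_wpM2r (ltW eN) h3; move: h4.
move: (D / _) => y; move: (eta N) (x N) => v w.
have -> : y * (2 * C0 * G) * v = 2 * (G * (C0 * (y * v))) by ring.
have -> : G * (C0 * (y * v + w)) = G * (C0 * (y * v)) + G * C0 * w by ring.
have -> : w * (2 * C0 * G) = 2 * (G * C0 * w) by ring.
exact: le_double_of_half.
Qed.

End Transfer.

Local Close Scope complex_scope.
Local Close Scope classical_set_scope.
Unset Implicit Arguments.
Set Strict Implicit.
Set Printing Implicit Defensive.

Theorem corollary1p1 (R : realType) (alpha : R) (g : R[i] -> R[i])
    (eta : nat -> R) (a : nat -> \bar R)
    (alpha_gt : -1 < alpha)
    (g_little_bloch : little_bloch g)
    (eta_gt0 : forall n, (1 <= n)%N -> 0 < eta n)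
    (eta_noninc : forall m n, (1 <= m <= n)%N -> eta n <= eta m)
    (eta_doubling : asymp (fun n => (eta (2 * n)%N)%:E) (fun n => (eta n)%:E))
    (a_rearrangement :
      nonincreasing_rearrangement dyadic_indices (dyadic_mean g) a) :
  asymp (fun n => (singular_value alpha (integration_operator g) n ^+ 2)%E)
        (fun n => (eta n)%:E)
  <-> asymp a (fun n => (eta n)%:E).
Proof.
have [e [e_bij ae a_noninc]] := a_rearrangement.
have [q eta_double] : exists q, forall n, (1 <= n)%N -> eta n <= 2 ^+ q * eta (2 * n)%N.
  have [c [d [c_gt0 _ hc]]] := eta_doubling.
  exists (Num.truncn c^-1).+1 => n n1; have [h _] := hc n n1.
  move: h; rewrite -EFinM lee_fin -ler_pdivlMl// => h; apply: le_trans h _.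
  have h2 : 0 < eta (2 * n)%N by apply: eta_gt0; rewrite muln_gt0.
  rewrite (ler_wpM2r (ltW h2))//; apply: ltW; apply: lt_le_trans (truncnS_gt _) _.
  by rewrite -natrX ler_nat ltnW// ltn_expl.
have hx n : exists A : R, 0 <= A /\ dyadic_mean g (e n) = A%:E.
  by have [A A0 eA] := dyadic_mean_fin (e n) g_little_bloch; exists A.
have [x hxx] := boolp.choice hx.
have xE n : dyadic_mean g (e n) = (x n)%:E by case: (hxx n).
have x_ge0 n : (1 <= n)%N -> 0 <= x n by case: (hxx n).
clear hx hxx.
have x_noninc m n : (1 <= m <= n)%N -> x n <= x m.
  move=> mn; have /andP[m1 mn'] := mn; have := a_noninc _ _ mn.
  by rewrite (ae m m1) (ae n (leq_trans m1 mn')) (xE m) (xE n) lee_fin.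
have [C0 [M [C0_gt0 hu]]] := singular_value_upper alpha_gt.
have [C1 [c0 [C1_gt0 c0_gt0 hl]]] := singular_value_lower alpha_gt.
pose S n := (singular_value alpha (integration_operator g) n ^+ 2)%E.
have S_noninc m n : (m <= n)%N -> (S n <= S m)%E by exact: singular_value_sqr_nonincreasing.
have S_upper N (k : nat -> nat) B : 0 < B ->
    (forall j, (1 <= j <= N)%N -> x j <= B * 2 ^+ k j) ->
    (forall j, (N < j)%N -> x j <= B) ->
    (S (1 + M * \sum_(1 <= j < N.+1) k j)%N <= (C0 * B)%:E)%E.
  move=> B0 h1 h2; rewrite -(order_of_sum e_bij N k).
  apply: hu => //; first exact: (first_boxes_uniq e_bij).
  - by move=> p; exact: (first_boxes_dyadic e_bij).
  - move=> p /(dyadic_enum e_bij)[j j1 ->]; rewrite xE lee_fin.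
    have [jN|Nj] := leqP j N; first by rewrite (order_ofE e_bij) ?j1// h1// j1.
    rewrite (order_of_out (e := e)); first by rewrite expr0 mulr1 h2.
    by rewrite (mem_first_boxes e_bij)// -ltnNge.
  - by move=> p; exact: order_of_out.
have S_lower m : (1 <= m)%N -> 0 < x (c0 * m)%N -> ((x (c0 * m)%N / C1)%:E <= S m)%E.
  move=> m1 x0; apply: (hl g (first_boxes e (c0 * m)%N)) => //.
  - exact: (first_boxes_uniq e_bij).
  - by move=> p; exact: (first_boxes_dyadic e_bij).
  - move=> p pin; have [j j1 ej] := dyadic_enum e_bij (first_boxes_dyadic e_bij pin).
    move: pin; rewrite ej (mem_first_boxes e_bij)// => jN.
    by rewrite xE lee_fin x_noninc// j1.
  - by rewrite size_map size_iota.
split=> -[c [d [c_gt0 d_gt0 h]]].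
- have [c' [d' [c'0 d'0 h']]] := asymp_means eta_gt0 eta_noninc eta_double x_noninc x_ge0
    S_noninc C0_gt0 C1_gt0 c0_gt0 S_upper S_lower c_gt0 d_gt0 h.
  by exists c', d'; split=> // n n1; rewrite ae// xE; exact: h'.
- apply: (asymp_of_means eta_gt0 eta_noninc eta_double x_noninc x_ge0
    S_noninc C0_gt0 C1_gt0 c0_gt0 S_upper S_lower c_gt0 d_gt0) => n n1.
  by have [] := h n n1; rewrite ae// xE -!EFinM !lee_fin => -> ->.
Qed.
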